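(* Let $\mathfrak g=\mathfrak l\oplus\mathfrak u_+\oplus\mathfrak u_-$ be a nondegenerate polarized Lie algebra, let $K=\sum_ia_i\otimes b_i\otimes\ell_i\in(U(\mathfrak u_+)\otimes U(\mathfrak u_-))\widehat\otimes\widehat U$ be its canonical element, and set $$J:=\sum_ia_i\otimes S(b_i)S(\ell_i^{(2)})\otimes S(\ell_i^{(1)}).$$ Then $J$ is a quantization of $r_{\mathfrak l}^{\mathfrak g}$; that is, $J$ is an $\mathfrak l$-invariant element of $U(\mathfrak g)^{\otimes2}\widehat\otimes\widehat U_{\le0}$ such that (i) $J^{12,3,4}J^{1,2,34}=J^{1,23,4}J^{2,3,4}$; (ii) $J-1\in U(\mathfrak g)^{\otimes2}\widehat\otimes\widehat U_{\le-1}$; (iii) the reduction $j\in U(\mathfrak g)^{\otimes2}\otimes S^\cdot(\mathfrak l)[1/D_0]_{-1}$ of $J-1$ modulo $U(\mathfrak g)^{\otimes2}\widehat\otimes\widehat U_{\le-2}$ satisfies $\mathrm{Alt}(j):=j-j^{2,1,3}=r_{\mathfrak l}^{\mathfrak g}$.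
   Context: All Lie algebras are finite dimensional over $\mathbb C$. A polarized Lie algebra is $\mathfrak g=\mathfrak l\oplus\mathfrak u_+\oplus\mathfrak u_-$ with $\mathfrak l,\mathfrak u_\pm$ Lie subalgebras and $[\mathfrak l,\mathfrak u_\pm]\subset\mathfrak u_\pm$; put $\mathfrak u=\mathfrak u_+\oplus\mathfrak u_-$. It is nondegenerate if for generic $\lambda\in\mathfrak l^*$ the form $\omega(\lambda):(x,y)\mapsto\lambda([x,y]_{\mathfrak l})$ on $\mathfrak u$ is nondegenerate ($[\cdot]_{\mathfrak l}$: projection to $\mathfrak l$ along $\mathfrak u$). Then $d'=\dim\mathfrak u_+=\dim\mathfrak u_-$; let $D_0'\in S^{d'}(\mathfrak l)$ be the determinant of the matrix $([x_i,y_j]_{\mathfrak l})$ for bases $(x_i)$ of $\mathfrak u_+$, $(y_j)$ of $\mathfrak u_-$, and $D_0=\det\omega$, which is $(D'_0)^2$ up to a nonzero scalar. $\widehat U$ is Springer's microlocalization of $U(\mathfrak l)$ at a lift $D'\in U(\mathfrak l)_{\le d'}$ of $D_0'$: the complete separated $\mathbb Z$-filtered algebra containing $U(\mathfrak l)$ as a filtered subalgebra, in which $D'$ is invertible, with $\mathrm{gr}\,\widehat U=S^\cdot(\mathfrak l)[1/D_0']$, universal among filtered morphisms from $U(\mathfrak l)$ to complete separated filtered algebras sending $D'$ to an invertible element; it is independent of the lift. For a vector space $V$, $V\widehat\otimes\widehat U=\varprojlim_k(V\otimes\widehat U)/(V\otimes\widehat U_{\le k})$. The coproduct of $U(\mathfrak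 l)$ extends to $\widehat U\to U(\mathfrak l)\widehat\otimes\widehat U$ (and to $\widehat U\to\widehat U\widehat\otimes U(\mathfrak l)$), and the antipode $S$ extends to $\widehat U$. Sweedler notation $\Delta(x)=\sum x^{(1)}\otimes x^{(2)}$. $J^{12,3,4}=(\Delta\otimes\mathrm{id}\otimes\mathrm{id})(J)$, $J^{1,23,4}=(\mathrm{id}\otimes\Delta\otimes\mathrm{id})(J)$, $J^{1,2,34}=(\mathrm{id}\otimes\mathrm{id}\otimes\Delta)(J)$ with $\Delta:\widehat U\to U(\mathfrak l)\widehat\otimes\widehat U$, $J^{2,3,4}=1\otimes J$; identity (i) is in $U(\mathfrak g)^{\otimes3}\widehat\otimes\widehat U$. Harish-Chandra map $H:U(\mathfrak g)\to U(\mathfrak l)$: $H(x_+x_0x_-)=\varepsilon(x_+)\varepsilon(x_-)x_0$ for $x_\pm\in U(\mathfrak u_\pm)$, $x_0\in U(\mathfrak l)$, $\varepsilon$ the counit. The canonical element $K=\sum_ia_i\otimes b_i\otimes\ell_i$ is the unique element of $(U(\mathfrak u_+)\otimes U(\mathfrak u_-))\widehat\otimes\widehat U$ with $\sum_iH(xa_i)\ell_iH(b_iy)=H(xy)$ for all $x\in U(\mathfrak l\oplus\mathfrak u_-)$, $y\in U(\mathfrak l\oplus\mathfrak u_+)$. $r_{\mathfrak l}^{\mathfrak g}=-\omega(\lambda)^{-1}\in\wedge^2(\mathfrak u)\otimes S^\cdot(\mathfrak l)[1/D_0]$, where $\omega^{-1}$ is the image of the tensor $\omega\in\wedge^2(\mathfrak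 u^* )$ under the tensor square of the inverse of the isomorphism $\mathfrak u\to\mathfrak u^*$ it induces; equivalently, writing $r_{\mathfrak l}^{\mathfrak g}=\sum_iu_i\otimes v_i\otimes\ell_i$, $\sum_i[x,u_i]_{\mathfrak l}\ell_i\otimes v_i=1\otimes x$ for all $x\in\mathfrak u$. *)

(* Defs.v *)
From HB Require Import structures.
From mathcomp Require Import all_boot all_order all_algebra.
From mathcomp Require Import zify mpoly complex boolp classical_sets reals.

Set Implicit Arguments.
Unset Strict Implicit.
Unset Printing Implicit Defensive.

Import Order.TTheory GRing.Theory Num.Theory.
Local Open Scope ring_scope.
Local Open Scope quotient_scope.

Section PropQuotient.
Variables (T : choiceType) (E : T -> T -> Prop).
Hypotheses (Erefl : forall x, E x x) (Esym : forall x y, E x y -> E y x)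
  (Etrans : forall x y z, E x y -> E y z -> E x z).

Definition propb : rel T := fun x y => `[< E x y >].

Lemma propb_refl : reflexive propb.
Proof. by move=> x; apply/asboolP. Qed.
Lemma propb_sym : ssrbool.symmetric propb.
Proof. by move=> x y; apply/asboolP/asboolP; exact: Esym. Qed.
Lemma propb_trans : transitive propb.
Proof. by move=> y x z /asboolP xy /asboolP yz; apply/asboolP; exact: Etrans yz. Qed.

Canonical propb_equiv := EquivRel propb propb_refl propb_sym propb_trans.

Lemma eq_pi x y :
  (\pi_({eq_quot propb_equiv}) x = \pi_({eq_quot propb_equiv}) y) <-> E x y.
Proof. by split=> [/eqmodP/asboolP|h]; last exact/eqmodP/asboolP. Qed.

Lemma repr_pi x : E (repr (\pi_({eq_quot propb_equiv}) x)) x.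
Proof. by apply/eq_pi; rewrite reprK. Qed.

End PropQuotient.

Section Separation.
Variables (F : fieldType) (V : lmodType F).

Definition subspace (N : set V) :=
  N 0 /\ forall (a : F) x y, N x -> N y -> N (a *: x + y).

Lemma separating_functional (N : set V) (v : V) : subspace N -> ~ N v ->
  exists f : {linear V -> F^o}, f v = 1 /\ forall x, N x -> f x = 0.
Proof.
move=> [N0 Nl] Nv.
pose P (X : set V) := subspace (fun x => X x \/ N x) /\ ~ (X v \/ N v).
have [A FP tot|M [[[M0 Ml] Mv] Mmax]] := @Zorn_bigcup V P.
  split; last first.
    by case=> [[X AX Xv]|//]; case: (FP _ AX) => _ []; left.
  split; first by right.
  have case1 a x y X : A X -> X x -> X y \/ N y ->
      (\bigcup_(X in A) X)%classic (a *: x + y) \/ N (a *: x + y).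
    move=> AX Xx Xy; have [[_ Xl] _] := FP _ AX.
    by have [?|?] := Xl a x y (or_introl Xx) Xy; [left; exists X|right].
  move=> a x y [[X AX Xx]|Nx] [[Y AY Yy]|Ny].
  - have [XY|YX] := tot _ _ AX AY.
      by apply: (case1 _ _ _ Y) => //; [exact: XY|left].
    by apply: (case1 _ _ _ X) => //; left; exact: YX.
  - by apply: (case1 _ _ _ X) => //; right.
  - have [[_ Yl] _] := FP _ AY.
    by have [?|?] := Yl a x y (or_intror Nx) (or_introl Yy); [left; exists Y|right].
  - by right; exact: Nl.
pose L x := M x \/ N x.
have Lv : ~ L v by [].
have LD x y : L x -> L y -> L (x + y).
  by move=> Lx Ly; have := Ml 1 x y Lx Ly; rewrite scale1r.
have LZ a x : L x -> L (a *: x).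
  by move=> Lx; have := Ml a x 0 Lx M0; rewrite addr0.
have dec x : exists a, L (x - a *: v).
  have [Lx|nLx] := pselect (L x); first by exists 0; rewrite scale0r subr0.
  apply: contrapT => nex.
  pose M' : set V := fun y => exists m a, L m /\ y = m + a *: x.
  have : P M'.
    have M'N y : (M' y \/ N y) -> M' y.
      by case=> // Ny; exists y, 0; split; [right|rewrite scale0r addr0].
    split.
      split; first by left; exists 0, 0; rewrite scale0r addr0.
      move=> a y z /M'N [m [b [Lm ->]]] /M'N [m' [b' [Lm' ->]]]; left.
      exists (a *: m + m'), (a * b + b'); split; first exact: Ml.
      by rewrite scalerDr scalerDl scalerA addrACA.
    move=> /M'N [m [a [Lm vE]]].
    have [a0|a0] := eqVneq a 0.
      by apply: Lv; rewrite vE a0 scale0r addr0.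
    apply: nex; exists a^-1.
    rewrite vE scalerDr scalerA mulVf // scale1r opprD addrCA subrr addr0.
    by rewrite -scalerN -scaleN1r; exact: LZ (LZ _ _ Lm).
  apply: Mmax; split.
    by move=> y My; exists y, 0; split; [left|rewrite scale0r addr0].
  move=> M'M; apply: nLx; left; apply: M'M.
  by exists 0, 1; rewrite scale1r add0r.
have uniq x a b : L (x - a *: v) -> L (x - b *: v) -> a = b.
  move=> La Lb; apply: contrapT => /eqP ab.
  have := LD _ _ Lb (LZ (- 1) _ La).
  rewrite scaleN1r opprB addrC addrA subrK -scalerBl => /(LZ (a - b)^-1).
  by rewrite scalerA mulVf ?subr_eq0 // scale1r.
pose f x : F^o := projT1 (cid (dec x)).
have fP x : L (x - f x *: v) by rewrite /f; case: cid.
have f_lin : linear f.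
  move=> a x y; apply: (uniq (a *: x + y)); first exact: fP.
  have := Ml a _ _ (fP x) (fP y).
  by rewrite scalerBr scalerA addrACA -opprD -scalerDl.
pose flin := GRing.isLinear.Build F V F^o *%R f f_lin.
exists (HB.pack_for {linear V -> F^o} f flin); split=> /= [|x Nx].
  by apply: (uniq v); [exact: fP|rewrite scale1r subrr].
by apply: (uniq x); [exact: fP|rewrite scale0r subr0; right].
Qed.

End Separation.

Record lieAlg (F : fieldType) := LieAlg {
  lie_sort :> vectType F;
  lie_br : lie_sort -> lie_sort -> lie_sort;
  lie_linl : forall z, linear (fun x => lie_br x z);
  lie_linr : forall z, linear (lie_br z);
  lie_alt : forall x, lie_br x x = 0;
  lie_jacobi : forall x y z,
    lie_br x (lie_br y z) + lie_br y (lie_br z x) + lie_br z (lie_br x y) = 0 }.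

Notation "⁅ x , y ⁆" := (lie_br x y) (at level 0, x, y at level 99, format "⁅ x ,  y ⁆") : ring_scope.

Definition lie_closed (F : fieldType) (g : lieAlg F) (V : {vspace g}) : Prop :=
  forall x y, x \in V -> y \in V -> ⁅x, y⁆ \in V.

Section SubLie.
Variables (F : fieldType) (g : lieAlg F) (V : {vspace g}) (hV : lie_closed V).

Definition sub_br (x y : subvs_of V) : subvs_of V := vsproj V ⁅vsval x, vsval y⁆.

Lemma sub_brE x y : vsval (sub_br x y) = ⁅vsval x, vsval y⁆.
Proof. by rewrite /sub_br vsprojK // hV ?subvsP. Qed.

Lemma sub_linl z : linear (fun x => sub_br x z).
Proof. by move=> a x y; apply: val_inj; rewrite /= !(sub_brE, linearP) /= lie_linl. Qed.
Lemma sub_linr z : linear (sub_br z).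
Proof. by move=> a x y; apply: val_inj; rewrite /= !(sub_brE, linearP) /= lie_linr. Qed.
Lemma sub_alt x : sub_br x x = 0.
Proof. by apply: val_inj; rewrite /= sub_brE lie_alt. Qed.
Lemma sub_jacobi x y z :
  sub_br x (sub_br y z) + sub_br y (sub_br z x) + sub_br z (sub_br x y) = 0.
Proof. by apply: val_inj; rewrite /= !sub_brE lie_jacobi. Qed.

Definition subLie : lieAlg F := LieAlg sub_linl sub_linr sub_alt sub_jacobi.

End SubLie.

Section Enveloping.
Variables (F : fieldType) (g : lieAlg F).

Inductive uterm : Type :=
| UVar of g | UZero | UOne | UOpp of uterm | UAdd of uterm & uterm
| UMul of uterm & uterm | UScale of F & uterm.

Inductive ucong : uterm -> uterm -> Prop :=
| uc_refl s : ucong s s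
| uc_sym s t : ucong s t -> ucong t s
| uc_trans s t u : ucong s t -> ucong t u -> ucong s u
| uc_opp s s' : ucong s s' -> ucong (UOpp s) (UOpp s')
| uc_add s s' t t' : ucong s s' -> ucong t t' -> ucong (UAdd s t) (UAdd s' t')
| uc_mul s s' t t' : ucong s s' -> ucong t t' -> ucong (UMul s t) (UMul s' t')
| uc_scale a s s' : ucong s s' -> ucong (UScale a s) (UScale a s')
| uc_addA s t u : ucong (UAdd s (UAdd t u)) (UAdd (UAdd s t) u)
| uc_addC s t : ucong (UAdd s t) (UAdd t s)
| uc_add0 s : ucong (UAdd UZero s) s
| uc_addN s : ucong (UAdd (UOpp s) s) UZero
| uc_mulA s t u : ucong (UMul s (UMul t u)) (UMul (UMul s t) u)
| uc_mul1l s : ucong (UMul UOne s) s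
| uc_mul1r s : ucong (UMul s UOne) s
| uc_mulDl s t u : ucong (UMul (UAdd s t) u) (UAdd (UMul s u) (UMul t u))
| uc_mulDr s t u : ucong (UMul s (UAdd t u)) (UAdd (UMul s t) (UMul s u))
| uc_scaleA a b s : ucong (UScale a (UScale b s)) (UScale (a * b) s)
| uc_scale1 s : ucong (UScale 1 s) s
| uc_scaleDr a s t : ucong (UScale a (UAdd s t)) (UAdd (UScale a s) (UScale a t))
| uc_scaleDl s a b : ucong (UScale (a + b) s) (UAdd (UScale a s) (UScale b s))
| uc_scaleAl a s t : ucong (UScale a (UMul s t)) (UMul (UScale a s) t)
| uc_scaleAr a s t : ucong (UScale a (UMul s t)) (UMul s (UScale a t))
| uc_lin a x y : ucong (UVar (a *: x + y)) (UAdd (UScale a (UVar x)) (UVar y))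
| uc_br x y : ucong (UVar ⁅x, y⁆)
    (UAdd (UMul (UVar x) (UVar y)) (UOpp (UMul (UVar y) (UVar x)))).

HB.instance Definition _ := gen_eqMixin uterm.
HB.instance Definition _ := gen_choiceMixin uterm.

Definition Uenv : Type := {eq_quot propb_equiv uc_refl uc_sym uc_trans}.
HB.instance Definition _ := Choice.on Uenv.
HB.instance Definition _ := Quotient.on Uenv.

Local Notation upi := (\pi_Uenv).

Lemma upiE s t : upi s = upi t <-> ucong s t.
Proof. exact: eq_pi. Qed.
Lemma ureprP s : ucong (repr (upi s)) s.
Proof. by apply/upiE; rewrite reprK. Qed.
Lemma uenvP (P : Uenv -> Prop) : (forall s, P (upi s)) -> forall x, P x.
Proof. by move=> h x; rewrite -[x]reprK. Qed.

Definition uopp (x : Uenv) : Uenv := upi (UOpp (repr x)).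
Definition uadd (x y : Uenv) : Uenv := upi (UAdd (repr x) (repr y)).
Definition umul (x y : Uenv) : Uenv := upi (UMul (repr x) (repr y)).
Definition uscale a (x : Uenv) : Uenv := upi (UScale a (repr x)).

Lemma uoppE s : uopp (upi s) = upi (UOpp s).
Proof. by apply/upiE; apply: uc_opp; exact: ureprP. Qed.
Lemma uaddE s t : uadd (upi s) (upi t) = upi (UAdd s t).
Proof. by apply/upiE; apply: uc_add; exact: ureprP. Qed.
Lemma umulE s t : umul (upi s) (upi t) = upi (UMul s t).
Proof. by apply/upiE; apply: uc_mul; exact: ureprP. Qed.
Lemma uscaleE a s : uscale a (upi s) = upi (UScale a s).
Proof. by apply/upiE; apply: uc_scale; exact: ureprP. Qed.

Let uE := (uoppE, uaddE, umulE, uscaleE).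

Lemma uaddA : associative uadd.
Proof. by do 3!elim/uenvP => ?; rewrite !uE; apply/upiE; constructor. Qed.
Lemma uaddC : commutative uadd.
Proof. by do 2!elim/uenvP => ?; rewrite !uE; apply/upiE; constructor. Qed.
Lemma uadd0 : left_id (upi UZero) uadd.
Proof. by elim/uenvP => ?; rewrite !uE; apply/upiE; constructor. Qed.
Lemma uaddN : left_inverse (upi UZero) uopp uadd.
Proof. by elim/uenvP => ?; rewrite !uE; apply/upiE; constructor. Qed.
HB.instance Definition _ := GRing.isZmodule.Build Uenv uaddA uaddC uadd0 uaddN.

Lemma uscaleA a b x : uscale a (uscale b x) = uscale (a * b) x.
Proof. by elim/uenvP: x => ?; rewrite !uE; apply/upiE; constructor. Qed.
Lemma uscale1 : left_id 1 uscale.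
Proof. by elim/uenvP => ?; rewrite !uE; apply/upiE; constructor. Qed.
Lemma uscaleDr : right_distributive uscale uadd.
Proof. by move=> a; do 2!elim/uenvP => ?; rewrite !uE; apply/upiE; constructor. Qed.
Lemma uscaleDl x : {morph uscale^~ x : a b / a + b >-> uadd a b}.
Proof. by elim/uenvP: x => ? a b; rewrite !uE; apply/upiE; constructor. Qed.
HB.instance Definition _ :=
  GRing.Zmodule_isLmodule.Build F Uenv uscaleA uscale1 uscaleDr uscaleDl.

Lemma upiN s : - upi s = upi (UOpp s). Proof. exact: uoppE. Qed.
Lemma upiD s t : upi s + upi t = upi (UAdd s t). Proof. exact: uaddE. Qed.
Lemma upiZ a s : a *: upi s = upi (UScale a s). Proof. exact: uscaleE. Qed.

Section Eval.
Variables (A : algType F) (f : g -> A).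

Fixpoint ueval (s : uterm) : A :=
  match s with
  | UVar x => f x | UZero => 0 | UOne => 1 | UOpp s => - ueval s
  | UAdd s t => ueval s + ueval t | UMul s t => ueval s * ueval t
  | UScale a s => a *: ueval s
  end.

(* The algebra morphism U(g) -> A extending f when f is a morphism of Lie
   algebras (see [ulift_spec]); otherwise the value depends on the choice of
   representatives. *)
Definition ulift (x : Uenv) : A := ueval (repr x).

Hypotheses (f_lin : linear f) (f_br : forall x y, f ⁅x, y⁆ = f x * f y - f y * f x).

Lemma ueval_cong s t : ucong s t -> ueval s = ueval t.
Proof.
elim=> /= {s t}; do ?by [move=> *; congruence].
- by move=> *; rewrite addrA.
- by move=> *; rewrite addrC.
- by move=> *; rewrite add0r.
- by move=> *; rewrite addNr.
- by move=> *; rewrite mulrA.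
- by move=> *; rewrite mul1r.
- by move=> *; rewrite mulr1.
- by move=> *; rewrite mulrDl.
- by move=> *; rewrite mulrDr.
- by move=> *; rewrite scalerA.
- by move=> *; rewrite scale1r.
- by move=> *; rewrite scalerDr.
- by move=> *; rewrite scalerDl.
- by move=> *; rewrite scalerAl.
- by move=> *; rewrite scalerAr.
- by move=> *; rewrite f_lin.
- by move=> *; rewrite f_br.
Qed.

Lemma ulift_pi s : ulift (upi s) = ueval s.
Proof. by apply: ueval_cong; exact: ureprP. Qed.

End Eval.

Lemma umulA : associative umul.
Proof. by do 3!elim/uenvP => ?; rewrite !uE; apply/upiE; constructor. Qed.
Lemma umul1l : left_id (upi UOne) umul.
Proof. by elim/uenvP => ?; rewrite !uE; apply/upiE; constructor. Qed.
Lemma umul1r : right_id (upi UOne) umul.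
Proof. by elim/uenvP => ?; rewrite !uE; apply/upiE; constructor. Qed.
Lemma umulDl : left_distributive umul uadd.
Proof. by do 3!elim/uenvP => ?; rewrite !uE; apply/upiE; constructor. Qed.
Lemma umulDr : right_distributive umul uadd.
Proof. by do 3!elim/uenvP => ?; rewrite !uE; apply/upiE; constructor. Qed.

Lemma u_nontrivial : upi UOne != upi UZero.
Proof.
apply/eqP => /upiE/(@ueval_cong F^o (fun=> 0)) /=.
have lin0 : linear (fun _ : g => 0 : F^o) by move=> a x y; rewrite scaler0 addr0.
have br0 (x y : g) : (0 : F^o) = 0 * 0 - 0 * 0 by rewrite mulr0 subr0.
by move=> /(_ lin0 (fun _ _ => br0 0 0))/eqP; rewrite oner_eq0.
Qed.

HB.instance Definition _ := GRing.Zmodule_isNzRing.Build Uenv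
  umulA umul1l umul1r umulDl umulDr u_nontrivial.

Lemma upiM s t : upi s * upi t = upi (UMul s t). Proof. exact: umulE. Qed.

Lemma uscaleAl a x y : uscale a (umul x y) = umul (uscale a x) y.
Proof. by elim/uenvP: x y => ?; elim/uenvP => ?; rewrite !uE; apply/upiE; constructor. Qed.
Lemma uscaleAr a x y : uscale a (umul x y) = umul x (uscale a y).
Proof. by elim/uenvP: x y => ?; elim/uenvP => ?; rewrite !uE; apply/upiE; constructor. Qed.
HB.instance Definition _ := GRing.Lmodule_isLalgebra.Build F Uenv uscaleAl.
HB.instance Definition _ := GRing.Lalgebra_isAlgebra.Build F Uenv uscaleAr.

Definition uinj (x : g) : Uenv := upi (UVar x).

Lemma uinj_lin : linear uinj.
Proof. by move=> a x y; rewrite /uinj upiZ upiD; apply/upiE; constructor. Qed.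

Lemma uinj_br x y : uinj ⁅x, y⁆ = uinj x * uinj y - uinj y * uinj x.
Proof. by rewrite /uinj !upiM upiN upiD; apply/upiE; constructor. Qed.

Lemma uenv_ind (P : Uenv -> Prop) :
  (forall x, P (uinj x)) -> P 1 -> (forall a x y, P x -> P y -> P (a *: x + y)) ->
  (forall x y, P x -> P y -> P (x * y)) -> forall x, P x.
Proof.
move=> Pi P1 Pl PM.
have P0 : P 0 by have := Pl (- 1) 1 1 P1 P1; rewrite scaleN1r addNr.
elim/uenvP; elim=> [x|||s Ps|s Ps t Pt|s Ps t Pt|a s Ps].
- exact: Pi.
- exact: P0.
- exact: P1.
- by have := Pl (- 1) _ _ Ps P0; rewrite addr0 scaleN1r upiN.
- by have := Pl 1 _ _ Ps Pt; rewrite scale1r upiD.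
- by have := PM _ _ Ps Pt; rewrite upiM.
- by have := Pl a _ _ Ps P0; rewrite addr0 upiZ.
Qed.

Lemma ulift_spec (A : algType F) (f : g -> A) :
  linear f -> (forall x y, f ⁅x, y⁆ = f x * f y - f y * f x) ->
  [/\ linear (ulift f), GRing.monoid_morphism (ulift f) & forall x, ulift f (uinj x) = f x].
Proof.
move=> fl fb; have E := ulift_pi fl fb; split=> [a x y||x].
- elim/uenvP: x y => s; elim/uenvP => t.
  by rewrite (upiZ a s) (upiD (UScale a s) t) !E.
- split; first exact: E.
  by elim/uenvP => s; elim/uenvP => t; rewrite (upiM s t) !E.
- exact: E.
Qed.

End Enveloping.

Arguments uinj {F g} x.

Definition bilinear_map (F : fieldType) (V W M : lmodType F) (b : V -> W -> M) : Prop :=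
  (forall w, linear (b^~ w)) /\ (forall v, linear (b v)).

Section Tensor.
Variables (F : fieldType) (V W : lmodType F).

Inductive tterm : Type :=
| TGen of V & W | TZero | TOpp of tterm | TAdd of tterm & tterm | TScale of F & tterm.

Inductive tcong : tterm -> tterm -> Prop :=
| tc_refl s : tcong s s
| tc_sym s t : tcong s t -> tcong t s
| tc_trans s t u : tcong s t -> tcong t u -> tcong s u
| tc_opp s s' : tcong s s' -> tcong (TOpp s) (TOpp s')
| tc_add s s' t t' : tcong s s' -> tcong t t' -> tcong (TAdd s t) (TAdd s' t')
| tc_scale a s s' : tcong s s' -> tcong (TScale a s) (TScale a s')
| tc_addA s t u : tcong (TAdd s (TAdd t u)) (TAdd (TAdd s t) u)
| tc_addC s t : tcong (TAdd s t) (TAdd t s)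
| tc_add0 s : tcong (TAdd TZero s) s
| tc_addN s : tcong (TAdd (TOpp s) s) TZero
| tc_scaleA a b s : tcong (TScale a (TScale b s)) (TScale (a * b) s)
| tc_scale1 s : tcong (TScale 1 s) s
| tc_scaleDr a s t : tcong (TScale a (TAdd s t)) (TAdd (TScale a s) (TScale a t))
| tc_scaleDl s a b : tcong (TScale (a + b) s) (TAdd (TScale a s) (TScale b s))
| tc_linl a v v' w :
    tcong (TGen (a *: v + v') w) (TAdd (TScale a (TGen v w)) (TGen v' w))
| tc_linr a v w w' :
    tcong (TGen v (a *: w + w')) (TAdd (TScale a (TGen v w)) (TGen v w')).

HB.instance Definition _ := gen_eqMixin tterm.
HB.instance Definition _ := gen_choiceMixin tterm.

Definition tens : Type := {eq_quot propb_equiv tc_refl tc_sym tc_trans}.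
HB.instance Definition _ := Choice.on tens.
HB.instance Definition _ := Quotient.on tens.

Local Notation tpi := (\pi_tens).

Lemma tpiE s t : tpi s = tpi t <-> tcong s t.
Proof. exact: eq_pi. Qed.
Lemma treprP s : tcong (repr (tpi s)) s.
Proof. by apply/tpiE; rewrite reprK. Qed.
Lemma tensP (P : tens -> Prop) : (forall s, P (tpi s)) -> forall x, P x.
Proof. by move=> h x; rewrite -[x]reprK. Qed.

Definition topp (x : tens) : tens := tpi (TOpp (repr x)).
Definition tadd (x y : tens) : tens := tpi (TAdd (repr x) (repr y)).
Definition tscale a (x : tens) : tens := tpi (TScale a (repr x)).

Lemma toppE s : topp (tpi s) = tpi (TOpp s).
Proof. by apply/tpiE; apply: tc_opp; exact: treprP. Qed.
Lemma taddE s t : tadd (tpi s) (tpi t) = tpi (TAdd s t).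
Proof. by apply/tpiE; apply: tc_add; exact: treprP. Qed.
Lemma tscaleE a s : tscale a (tpi s) = tpi (TScale a s).
Proof. by apply/tpiE; apply: tc_scale; exact: treprP. Qed.

Let tE := (toppE, taddE, tscaleE).

Lemma taddA : associative tadd.
Proof. by do 3!elim/tensP => ?; rewrite !tE; apply/tpiE; constructor. Qed.
Lemma taddC : commutative tadd.
Proof. by do 2!elim/tensP => ?; rewrite !tE; apply/tpiE; constructor. Qed.
Lemma tadd0 : left_id (tpi TZero) tadd.
Proof. by elim/tensP => ?; rewrite !tE; apply/tpiE; constructor. Qed.
Lemma taddN : left_inverse (tpi TZero) topp tadd.
Proof. by elim/tensP => ?; rewrite !tE; apply/tpiE; constructor. Qed.
HB.instance Definition _ := GRing.isZmodule.Build tens taddA taddC tadd0 taddN.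

Lemma tscaleA a b x : tscale a (tscale b x) = tscale (a * b) x.
Proof. by elim/tensP: x => ?; rewrite !tE; apply/tpiE; constructor. Qed.
Lemma tscale1 : left_id 1 tscale.
Proof. by elim/tensP => ?; rewrite !tE; apply/tpiE; constructor. Qed.
Lemma tscaleDr : right_distributive tscale tadd.
Proof. by move=> a; do 2!elim/tensP => ?; rewrite !tE; apply/tpiE; constructor. Qed.
Lemma tscaleDl x : {morph tscale^~ x : a b / a + b >-> tadd a b}.
Proof. by elim/tensP: x => ? a b; rewrite !tE; apply/tpiE; constructor. Qed.
HB.instance Definition _ :=
  GRing.Zmodule_isLmodule.Build F tens tscaleA tscale1 tscaleDr tscaleDl.

Lemma tpiN s : - tpi s = tpi (TOpp s). Proof. exact: toppE. Qed.
Lemma tpiD s t : tpi s + tpi t = tpi (TAdd s t). Proof. exact: taddE. Qed.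
Lemma tpiZ a s : a *: tpi s = tpi (TScale a s). Proof. exact: tscaleE. Qed.

Definition tmk (v : V) (w : W) : tens := tpi (TGen v w).

Lemma tmk_bilin : bilinear_map tmk.
Proof.
by split=> ? a x y; rewrite /tmk tpiZ tpiD; apply/tpiE; constructor.
Qed.

Lemma tens_ind (P : tens -> Prop) :
  (forall v w, P (tmk v w)) -> (forall a x y, P x -> P y -> P (a *: x + y)) ->
  forall x, P x.
Proof.
move=> Pg Pl.
have P0 : P 0.
  have h := Pg 0 0.
  by have := Pl (- 1) _ _ h h; rewrite scaleN1r addNr.
elim/tensP; elim=> [v w||s Ps|s Ps t Pt|a s Ps].
- exact: Pg.
- exact: P0.
- by have := Pl (- 1) _ _ Ps P0; rewrite addr0 scaleN1r tpiN.
- by have := Pl 1 _ _ Ps Pt; rewrite scale1r tpiD.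
- by have := Pl a _ _ Ps P0; rewrite addr0 tpiZ.
Qed.

Section Lift.
Variables (M : lmodType F) (b : V -> W -> M).

Fixpoint teval (s : tterm) : M :=
  match s with
  | TGen v w => b v w | TZero => 0 | TOpp s => - teval s
  | TAdd s t => teval s + teval t | TScale a s => a *: teval s
  end.

(* The linear map V (x) W -> M sending v (x) w to b v w, when b is bilinear
   (see [tlift_spec]); otherwise the value depends on the choice of
   representatives. *)
Definition tlift (x : tens) : M := teval (repr x).

Hypothesis b_bilin : bilinear_map b.

Lemma teval_cong s t : tcong s t -> teval s = teval t.
Proof.
case: b_bilin => bl br; elim=> /= {s t}; do ?by [move=> *; congruence].
- by move=> *; rewrite addrA.
- by move=> *; rewrite addrC.
- by move=> *; rewrite add0r.
- by move=> *; rewrite addNr.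
- by move=> *; rewrite scalerA.
- by move=> *; rewrite scale1r.
- by move=> *; rewrite scalerDr.
- by move=> *; rewrite scalerDl.
- by move=> a v v' w; rewrite (bl w).
- by move=> a v w w'; rewrite (br v).
Qed.

Lemma tlift_pi s : tlift (tpi s) = teval s.
Proof. by apply: teval_cong; exact: treprP. Qed.

Lemma tlift_spec : linear tlift /\ forall v w, tlift (tmk v w) = b v w.
Proof.
split=> [a|v w]; last exact: tlift_pi.
elim/tensP=> s; elim/tensP => t.
by rewrite (tpiZ a s) (tpiD (TScale a s) t) !tlift_pi.
Qed.

End Lift.

End Tensor.

Arguments tmk {F V W}.
Arguments tens {F} (V W)%_type.
Notation "V ⊗ W" := (tens V%type W%type) (at level 40, left associativity) : type_scope.
Notation "v ⊗ w" := (tmk v w) (at level 40, left associativity) : ring_scope.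

Section TensorTheory.
Variables (F : fieldType) (V W : lmodType F).

Lemma tensDl (x y : V) (w : W) : (x + y) ⊗ w = x ⊗ w + y ⊗ w.
Proof. by have := (tmk_bilin V W).1 w 1 x y; rewrite !scale1r. Qed.
Lemma tensDr (v : V) (x y : W) : v ⊗ (x + y) = v ⊗ x + v ⊗ y.
Proof. by have := (tmk_bilin V W).2 v 1 x y; rewrite !scale1r. Qed.
Lemma tens0l (w : W) : (0 : V) ⊗ w = 0.
Proof. by apply: (addIr (0 ⊗ w)); rewrite -tensDl !add0r. Qed.
Lemma tens0r (v : V) : v ⊗ (0 : W) = 0.
Proof. by apply: (addIr (v ⊗ 0)); rewrite -tensDr !add0r. Qed.
Lemma tensZl a (v : V) (w : W) : (a *: v) ⊗ w = a *: (v ⊗ w).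
Proof. by have := (tmk_bilin V W).1 w a v 0; rewrite !addr0 tens0l addr0. Qed.
Lemma tensZr a (v : V) (w : W) : v ⊗ (a *: w) = a *: (v ⊗ w).
Proof. by have := (tmk_bilin V W).2 v a w 0; rewrite !addr0 tens0r addr0. Qed.

Lemma eq_tens_lin (M : lmodType F) (f h : V ⊗ W -> M) : linear f -> linear h ->
  (forall v w, f (v ⊗ w) = h (v ⊗ w)) -> f =1 h.
Proof.
by move=> fl hl fh; elim/tens_ind => // a x y Ex Ey; rewrite fl hl Ex Ey.
Qed.

End TensorTheory.

Definition tmap (F : fieldType) (V V' W W' : lmodType F) (f : V -> V') (h : W -> W') :
  V ⊗ W -> V' ⊗ W' := tlift (fun v w => f v ⊗ h w).

Definition tswap (F : fieldType) (V W : lmodType F) : V ⊗ W -> W ⊗ V :=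
  tlift (fun v w => w ⊗ v).

Section TensorAlgebra.
Variables (F : fieldType) (A B : algType F).

Definition tmulg (a : A) (b : B) : A ⊗ B -> A ⊗ B :=
  tlift (fun a' b' => (a * a') ⊗ (b * b')).
Definition tmul (x y : A ⊗ B) : A ⊗ B := tlift (fun a b => tmulg a b y) x.

Lemma tmulg_spec a b : linear (tmulg a b) /\
  forall a' b', tmulg a b (a' ⊗ b') = (a * a') ⊗ (b * b').
Proof.
apply: tlift_spec; split=> [w|v] c x y; first by
  rewrite mulrDr -scalerAr tensDl tensZl.
by rewrite mulrDr -scalerAr tensDr tensZr.
Qed.

Lemma tmulg_bilin y : bilinear_map (fun a b => tmulg a b y).
Proof.
split=> [w|v] c x x'; elim/tens_ind: y => [a b|d s t Es Et];
  rewrite ?(tmulg_spec _ _).2 ?(tmulg_spec _ _).1.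
- by rewrite mulrDl -scalerAl tensDl tensZl.
- rewrite Es Et !scalerDr !scalerA (mulrC d) !addrA; congr (_ + _).
  by rewrite addrAC.
- by rewrite mulrDl -scalerAl tensDr tensZr.
- rewrite Es Et !scalerDr !scalerA (mulrC d) !addrA; congr (_ + _).
  by rewrite addrAC.
Qed.

Lemma tmul_linl y : linear (fun x => tmul x y).
Proof. exact: (tlift_spec (tmulg_bilin y)).1. Qed.
Lemma tmul_genl a b y : tmul (a ⊗ b) y = tmulg a b y.
Proof. exact: (tlift_spec (tmulg_bilin y)).2. Qed.
Lemma tmulE a b a' b' : tmul (a ⊗ b) (a' ⊗ b') = (a * a') ⊗ (b * b').
Proof. by rewrite tmul_genl (tmulg_spec _ _).2. Qed.
Lemma tmul_linr x : linear (tmul x).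
Proof.
elim/tens_ind: x => [a b|d s t Es Et] c y z.
  by rewrite !tmul_genl (tmulg_spec _ _).1.
rewrite !tmul_linl Es Et !scalerDr !scalerA (mulrC d) !addrA; congr (_ + _).
by rewrite addrAC.
Qed.

Lemma tmul1l : left_id (1 ⊗ 1) tmul.
Proof.
elim/tens_ind => [a b|d s t Es Et]; first by rewrite tmulE !mul1r.
by rewrite tmul_linr Es Et.
Qed.
Lemma tmul1r : right_id (1 ⊗ 1) tmul.
Proof.
elim/tens_ind => [a b|d s t Es Et]; first by rewrite tmulE !mulr1.
by rewrite tmul_linl Es Et.
Qed.
Lemma tmulDl : left_distributive tmul +%R.
Proof. by move=> x y z; have := tmul_linl z 1 x y; rewrite !scale1r. Qed.
Lemma tmulDr : right_distributive tmul +%R.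
Proof. by move=> x y z; have := tmul_linr x 1 y z; rewrite !scale1r. Qed.
Lemma tmulA : associative tmul.
Proof.
elim/tens_ind => [a b|d s t Es Et] y z; last by
  rewrite !tmul_linl Es Et.
elim/tens_ind: y => [a' b'|d s t Es Et]; last by
  rewrite tmul_linl !tmul_linr tmul_linl Es Et.
elim/tens_ind: z => [a'' b''|d s t Es Et]; last by
  rewrite !tmul_linr Es Et.
by rewrite !tmulE !mulrA.
Qed.

Lemma tens_sep (N : set B) (a : A) (b : B) : a != 0 -> subspace N -> ~ N b ->
  exists f : A ⊗ B -> F^o, [/\ linear f, f (a ⊗ b) = 1 &
    forall a' b', N b' -> f (a' ⊗ b') = 0].
Proof.
move=> a0 N_sub Nb.
have [||f [fa _]] := @separating_functional _ A [set 0]%classic a.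
- by split=> // c x y /= -> ->; rewrite scaler0 addr0.
- exact/eqP.
have [h [hb hN]] := separating_functional N_sub Nb.
have [l E] : linear (tlift (fun a b => f a * h b : F^o)) /\
    forall v w, tlift (fun a b => f a * h b : F^o) (v ⊗ w) = f v * h w.
  apply: tlift_spec; split=> w c x y; first by
    rewrite linearP mulrDl /= -scalerAl.
  by rewrite linearP mulrDr /= -scalerAr.
exists (tlift (fun a b => f a * h b : F^o)); split=> [//||a' b' Nb'].
  by rewrite E fa hb mul1r.
by rewrite E (hN _ Nb') mulr0.
Qed.

Lemma tens_nontrivial : (1 : A) ⊗ (1 : B) != 0.
Proof.
have [||f [fl f1 _]] := @tens_sep [set 0]%classic 1 1 (oner_neq0 _).
- by split=> // c x y /= -> ->; rewrite scaler0 addr0.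
- by apply/eqP; exact: oner_neq0.
have f0 : f 0 = 0 by have := fl (- 1) 0 0; rewrite scaleN1r oppr0 addr0 scaleN1r addNr.
by apply/eqP => E; move/eqP: f1; rewrite E f0 eq_sym oner_eq0.
Qed.

HB.instance Definition _ := GRing.Zmodule_isNzRing.Build (A ⊗ B)%type
  tmulA tmul1l tmul1r tmulDl tmulDr tens_nontrivial.

Lemma tscaleAl a (x y : A ⊗ B) : a *: (x * y) = a *: x * y.
Proof.
have E : tmul 0 y = 0.
  by have := tmul_linl y (-1) 0 0; rewrite scaleN1r oppr0 addr0 scaleN1r addNr.
by have := tmul_linl y a x 0; rewrite E !addr0.
Qed.
Lemma tscaleAr a (x y : A ⊗ B) : a *: (x * y) = x * (a *: y).
Proof.
have E : tmul x 0 = 0.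
  by have := tmul_linr x (-1) 0 0; rewrite scaleN1r oppr0 addr0 scaleN1r addNr.
by have := tmul_linr x a y 0; rewrite E !addr0.
Qed.
HB.instance Definition _ := GRing.Lmodule_isLalgebra.Build F (A ⊗ B)%type tscaleAl.
HB.instance Definition _ := GRing.Lalgebra_isAlgebra.Build F (A ⊗ B)%type tscaleAr.

Lemma tensM (a a' : A) (b b' : B) : (a ⊗ b) * (a' ⊗ b') = (a * a') ⊗ (b * b').
Proof. exact: tmulE. Qed.

End TensorAlgebra.

(* The last axiom only excludes filtrations with A_{<=k} = A for all k, whose
   completion is the zero ring; it holds as soon as A is separated. *)
Record filtAlg (F : fieldType) := FiltAlg {
  fa_alg :> algType F;
  fil : int -> fa_alg -> Prop;
  fil_sub : forall k, subspace (fil k);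
  fil_mono : forall k l x, k <= l -> fil k x -> fil l x;
  fil_exh : forall x, exists k, fil k x;
  fil_one : fil 0 1;
  fil_mul : forall k l x y, fil k x -> fil l y -> fil (k + l) (x * y);
  fil_proper : exists k, ~ fil k 1 }.

Section FiltTheory.
Variables (F : fieldType) (A : filtAlg F).
Implicit Types (k l : int) (x y : A).

Lemma fil0 k : fil k (0 : A). Proof. by have [] := fil_sub A k. Qed.
Lemma filD k x y : fil k x -> fil k y -> fil k (x + y).
Proof. by move=> xk yk; have := (fil_sub A k).2 1 x y xk yk; rewrite scale1r. Qed.
Lemma filZ k a x : fil k x -> fil k (a *: x).
Proof. by move=> xk; have := (fil_sub A k).2 a x 0 xk (fil0 k); rewrite addr0. Qed.
Lemma filN k x : fil k x -> fil k (- x).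
Proof. by rewrite -scaleN1r; exact: filZ. Qed.
Lemma filB k x y : fil k x -> fil k y -> fil k (x - y).
Proof. by move=> xk yk; apply: filD => //; exact: filN. Qed.
Lemma filBC k x y : fil k (x - y) -> fil k (y - x).
Proof. by move/filN; rewrite opprB. Qed.
Lemma fil_tr k y x z : fil k (x - y) -> fil k (y - z) -> fil k (x - z).
Proof. by move=> h /(filD h); rewrite addrA subrK. Qed.

Definition separated := forall x, (forall k, fil k x) -> x = 0.

(* Surjectivity of A -> lim_k A / A_{<=k}. *)
Definition complete := forall s : int -> A,
  (forall j k, j <= k -> fil k (s j - s k)) -> exists x, forall k, fil k (x - s k).

End FiltTheory.

Definition filtered (F : fieldType) (A B : filtAlg F) (f : A -> B) : Prop :=
  forall k x, fil k x -> fil k (f x).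

Definition filtered_morphism (F : fieldType) (A B : filtAlg F) (f : A -> B) : Prop :=
  [/\ linear f, GRing.monoid_morphism f & filtered f].

Section EnvelopingFiltration.
Variables (F : fieldType) (g : lieAlg F).

Definition uword (w : seq g) : Uenv g := \prod_(x <- w) uinj x.

Definition ufil (k : int) (x : Uenv g) : Prop :=
  exists s : seq (F * seq g), (forall p, p \in s -> (size p.2)%:Z <= k) /\
    x = \sum_(p <- s) p.1 *: uword p.2.

Lemma ufil_sub k : subspace (ufil k).
Proof.
split=> [|a x y [s [sk ->]] [t [tk ->]]]; first by exists [::]; rewrite big_nil.
exists ([seq (a * p.1, p.2) | p <- s] ++ t); split=> [p|].
  by rewrite mem_cat => /orP[/mapP[q qs ->]|/tk //]; exact: (sk q).
rewrite big_cat big_map scaler_sumr; congr (_ + _).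
by apply: eq_bigr => p _; rewrite scalerA.
Qed.

Lemma ufil_mono k l x : k <= l -> ufil k x -> ufil l x.
Proof. by move=> kl [s [sk ->]]; exists s; split=> // p /sk pk; exact: le_trans pk kl. Qed.

Lemma ufil_mul k l x y : ufil k x -> ufil l y -> ufil (k + l) (x * y).
Proof.
move=> [s [sk ->]] [t [tl ->]].
exists [seq (p.1 * q.1, p.2 ++ q.2) | p <- s, q <- t]; split=> [p|].
  move=> /allpairsP[[p1 p2] /= [p1s p2t ->]] /=.
  by rewrite size_cat PoszD; apply: lerD; [exact: sk|exact: tl].
rewrite big_allpairs_dep mulr_suml; apply: eq_bigr => p _.
rewrite mulr_sumr; apply: eq_bigr => q _.
by rewrite /= /uword big_cat /= -scalerAl -scalerAr scalerA.
Qed.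

Lemma ufil_one : ufil 0 1.
Proof.
by exists [:: (1, [::])]; split=> [p|]; rewrite ?inE ?big_seq1 ?scale1r
  /uword ?big_nil // => /eqP ->.
Qed.

Lemma ufil_exh x : exists k, ufil k x.
Proof.
elim/uenv_ind: x => [x||a x y [k xk] [l yl]|x y [k xk] [l yl]].
- exists 1, [:: (1, [:: x])]; rewrite big_seq1 scale1r /uword big_seq1.
  by split=> // p; rewrite inE => /eqP ->.
- by exists 0; exact: ufil_one.
- exists (Num.max k l); apply: (ufil_sub _).2.
    by apply: ufil_mono xk; rewrite le_max lexx.
  by apply: ufil_mono yl; rewrite le_max lexx orbT.
- by exists (k + l); exact: ufil_mul.
Qed.

Lemma ufil_proper : exists k, ~ ufil k 1.
Proof.
exists (- 1) => -[[|p s] [sk]]; first by rewrite big_nil => /eqP; rewrite oner_eq0.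
by have := sk p (mem_head _ _).
Qed.

Definition Ufilt : filtAlg F := FiltAlg ufil_sub ufil_mono ufil_exh ufil_one ufil_mul ufil_proper.

End EnvelopingFiltration.

Section TensorFiltration.
Variables (F : fieldType).

Section Span.
Variables (A B : algType F).

Definition tspan (P : A -> Prop) (Q : B -> Prop) (t : A ⊗ B) : Prop :=
  exists s : seq (A * B), (forall p, p \in s -> P p.1 /\ Q p.2) /\
    t = \sum_(p <- s) p.1 ⊗ p.2.

Lemma tspan_gen (P : A -> Prop) (Q : B -> Prop) a b : P a -> Q b -> tspan P Q (a ⊗ b).
Proof.
move=> Pa Qb; exists [:: (a, b)]; rewrite big_seq1.
by split=> // p; rewrite inE => /eqP ->.
Qed.

Lemma tspan_sub (P : A -> Prop) (Q : B -> Prop) :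
  (forall a x, P x -> P (a *: x)) -> subspace (tspan P Q).
Proof.
move=> PZ; split=> [|a x y [s [sP ->]] [t [tP ->]]].
  by exists [::]; rewrite big_nil.
exists ([seq (a *: p.1, p.2) | p <- s] ++ t); split=> [p|].
  rewrite mem_cat => /orP[/mapP[q /sP [Pq Qq] ->]|/tP //].
  by split=> //; exact: PZ.
rewrite big_cat big_map scaler_sumr; congr (_ + _).
by apply: eq_bigr => p _; rewrite tensZl.
Qed.

Lemma tspan_mono (P P' : A -> Prop) (Q Q' : B -> Prop) t :
  (forall a, P a -> P' a) -> (forall b, Q b -> Q' b) -> tspan P Q t -> tspan P' Q' t.
Proof.
move=> PP QQ [s [sP ->]]; exists s; split=> // p /sP [Pp Qp].
by split; [exact: PP|exact: QQ].
Qed.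

Lemma tspan_mul (P P' P'' : A -> Prop) (Q Q' Q'' : B -> Prop) x y :
  (forall a a', P a -> P' a' -> P'' (a * a')) ->
  (forall b b', Q b -> Q' b' -> Q'' (b * b')) ->
  tspan P Q x -> tspan P' Q' y -> tspan P'' Q'' (x * y).
Proof.
move=> PM QM [s [sP ->]] [t [tP ->]].
exists [seq (p.1 * q.1, p.2 * q.2) | p <- s, q <- t]; split=> [p|].
  move=> /allpairsP[[p1 p2] /= [/sP [? ?] /tP [? ?] ->]] /=.
  by split; [exact: PM|exact: QM].
rewrite big_allpairs_dep mulr_suml; apply: eq_bigr => p _.
by rewrite mulr_sumr; apply: eq_bigr => q _; rewrite tensM.
Qed.

End Span.

Section Right.
Variables (A : algType F) (B : filtAlg F).

Definition rfil (k : int) : A ⊗ B -> Prop := tspan (fun=> True) (fil k).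

Lemma rfil_sub k : subspace (rfil k).
Proof. exact: tspan_sub. Qed.
Lemma rfil_mono k l x : k <= l -> rfil k x -> rfil l x.
Proof. by move=> kl; apply: tspan_mono => // b; exact: fil_mono. Qed.
Lemma rfil_exh x : exists k, rfil k x.
Proof.
elim/tens_ind: x => [a b|c x y [k xk] [l yl]].
  by have [k bk] := fil_exh b; exists k; exact: tspan_gen.
exists (Num.max k l); apply: (rfil_sub _).2.
  by apply: rfil_mono xk; rewrite le_max lexx.
by apply: rfil_mono yl; rewrite le_max lexx orbT.
Qed.
Lemma rfil_one : rfil 0 1.
Proof. by apply: tspan_gen => //; exact: fil_one. Qed.
Lemma rfil_mul k l x y : rfil k x -> rfil l y -> rfil (k + l) (x * y).
Proof. by apply: tspan_mul => // b b'; exact: fil_mul. Qed.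
Lemma rfil_proper : exists k, ~ rfil k 1.
Proof.
have [k k1] := fil_proper B; exists k => -[s [sk]].
have [f [fl f1 fk]] := tens_sep (oner_neq0 A) (fil_sub B k) k1.
have f0 : f 0 = 0 by have := fl (- 1) 0 0; rewrite scaleN1r oppr0 addr0 scaleN1r addNr.
have fD x y : f (x + y) = f x + f y by have := fl 1 x y; rewrite !scale1r.
move=> /(congr1 f); rewrite f1 (big_morph f fD f0) big_seq big1 => [/eqP|p /sk [_ ?]].
  by rewrite oner_eq0.
exact: fk.
Qed.

Definition rtens : filtAlg F := FiltAlg rfil_sub rfil_mono rfil_exh rfil_one rfil_mul rfil_proper.

End Right.

Section Left.
Variables (A : filtAlg F) (B : algType F).

Definition lfil (k : int) : A ⊗ B -> Prop := tspan (fil k) (fun=> True).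

Lemma lfil_sub k : subspace (lfil k).
Proof. by apply: tspan_sub => a x; exact: filZ. Qed.
Lemma lfil_mono k l x : k <= l -> lfil k x -> lfil l x.
Proof. by move=> kl; apply: tspan_mono => // b; exact: fil_mono. Qed.
Lemma lfil_exh x : exists k, lfil k x.
Proof.
elim/tens_ind: x => [a b|c x y [k xk] [l yl]].
  by have [k bk] := fil_exh a; exists k; exact: tspan_gen.
exists (Num.max k l); apply: (lfil_sub _).2.
  by apply: lfil_mono xk; rewrite le_max lexx.
by apply: lfil_mono yl; rewrite le_max lexx orbT.
Qed.
Lemma lfil_one : lfil 0 1.
Proof. by apply: tspan_gen => //; exact: fil_one. Qed.
Lemma lfil_mul k l x y : lfil k x -> lfil l y -> lfil (k + l) (x * y).
Proof. by apply: tspan_mul => // b b'; exact: fil_mul. Qed.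

Lemma tswap_spec : linear (@tswap F A B) /\ forall a b, tswap ((a : A) ⊗ (b : B)) = b ⊗ a.
Proof.
by apply: tlift_spec; split=> w c x y; rewrite ?tensDl ?tensDr ?tensZl ?tensZr.
Qed.

Lemma lfil_proper : exists k, ~ lfil k 1.
Proof.
have [k k1] := rfil_proper B A; exists k => -[s [sk E]]; apply: k1.
have [swl swE] := tswap_spec.
have sw0 : @tswap F A B 0 = 0.
  by have := swl (- 1) 0 0; rewrite scaleN1r oppr0 addr0 scaleN1r addNr.
have swD x y : @tswap F A B (x + y) = tswap x + tswap y.
  by have := swl 1 x y; rewrite !scale1r.
exists [seq (p.2, p.1) | p <- s]; split=> [p /mapP[q /sk [? _] ->] //|].
rewrite big_map -[LHS](swE 1 1) -[1 ⊗ 1]/(1 : A ⊗ B) E (big_morph _ swD sw0).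
by apply: eq_bigr => p _; rewrite swE.
Qed.

Definition ltens : filtAlg F := FiltAlg lfil_sub lfil_mono lfil_exh lfil_one lfil_mul lfil_proper.

End Left.
End TensorFiltration.
Arguments rtens {F} A%_type B.
Arguments ltens {F} A B%_type.

(* The inverse limit of the A / A_{<=k}. For A = rtens V B this is the completed
   tensor product lim_k (V (x) B) / (V (x) B_{<=k}), and for A = ltens B V it is
   lim_k (B (x) V) / (B_{<=k} (x) V). *)
Section Completion.
Variables (F : fieldType) (A : filtAlg F).
Implicit Types (i j k l : int) (x y z : A).

(* A point of lim_k A / A_{<=k}, given by representatives of its components. *)
Record coherent := Coherent {
  coh_val :> int -> A;
  coh_prop : forall j k, j <= k -> fil k (coh_val j - coh_val k) }.
Implicit Types (s t u : coherent).

Definition coheq s t : Prop := forall k, fil k (s k - t k).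

Lemma coheq_refl s : coheq s s.
Proof. by move=> k; rewrite subrr; exact: fil0. Qed.
Lemma coheq_sym s t : coheq s t -> coheq t s.
Proof. by move=> h k; exact/filBC/h. Qed.
Lemma coheq_trans s t u : coheq s t -> coheq t u -> coheq s u.
Proof. by move=> h h' k; exact: fil_tr (h k) (h' k). Qed.

HB.instance Definition _ := gen_eqMixin coherent.
HB.instance Definition _ := gen_choiceMixin coherent.

Definition completion : Type := {eq_quot propb_equiv coheq_refl coheq_sym coheq_trans}.
HB.instance Definition _ := Choice.on completion.
HB.instance Definition _ := Quotient.on completion.

Local Notation cpi := (\pi_completion).

Lemma cpiE s t : cpi s = cpi t <-> coheq s t.
Proof. exact: eq_pi. Qed.
Lemma creprP s : coheq (repr (cpi s)) s.
Proof. by apply/cpiE; rewrite reprK. Qed.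
Lemma complP (P : completion -> Prop) : (forall s, P (cpi s)) -> forall X, P X.
Proof. by move=> h x; rewrite -[x]reprK. Qed.

Lemma cst_coh x : forall j k, j <= k -> fil k (x - x).
Proof. by move=> *; rewrite subrr; exact: fil0. Qed.
Definition ccst x := @Coherent (fun=> x) (cst_coh x).

Lemma add_coh s t j k : j <= k -> fil k (s j + t j - (s k + t k)).
Proof. by move=> jk; rewrite opprD addrACA; apply: filD; exact: coh_prop. Qed.
Definition add_coherent s t := Coherent (@add_coh s t).

Lemma opp_coh s j k : j <= k -> fil k (- s j - - s k).
Proof. by move=> jk; rewrite -opprD; apply: filN; exact: coh_prop. Qed.
Definition opp_coherent s := Coherent (@opp_coh s).

Lemma scale_coh a s j k : j <= k -> fil k (a *: s j - a *: s k).
Proof. by move=> jk; rewrite -scalerBr; apply: filZ; exact: coh_prop. Qed.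
Definition scale_coherent a s := Coherent (@scale_coh a s).

Lemma coh_bound s : exists b : nat, forall i, i <= 0 -> fil b (s i).
Proof.
have [m sm] := fil_exh (s 0); exists `|m|%N => i i0.
rewrite -[s i](subrK (s 0)); apply: filD.
  by apply: fil_mono (coh_prop s i0); rewrite lez_nat.
by apply: fil_mono sm; rewrite lez_abs.
Qed.
Definition cbound s : nat := projT1 (cid (coh_bound s)).
Lemma cboundP s i : i <= 0 -> fil (cbound s) (s i).
Proof. by rewrite /cbound; case: cid => b hb /=; exact: hb. Qed.

(* Coherent families are bounded, so the products s_i t_i are eventually
   constant modulo each A_{<=k} as i tends to -oo; the k-th component of the
   product is this eventual value. *)
Definition midx s t k : int := - (`|k| + cbound s + cbound t)%:Z.

Lemma mul_stable s t k i : i <= midx s t k ->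
  fil k (s i * t i - s (midx s t k) * t (midx s t k)).
Proof.
set m := midx s t k => im.
have m0 : m <= 0 by rewrite /m /midx; lia.
have -> : s i * t i - s m * t m = s i * (t i - t m) + (s i - s m) * t m.
  by rewrite mulrBr mulrBl addrA subrK.
apply: filD.
  have := fil_mul (cboundP s (le_trans im m0)) (coh_prop t im).
  by apply: fil_mono; rewrite /m /midx; lia.
have := fil_mul (coh_prop s im) (cboundP t m0).
by apply: fil_mono; rewrite /m /midx; lia.
Qed.

Lemma mul_coh s t j k : j <= k ->
  fil k (s (midx s t j) * t (midx s t j) - s (midx s t k) * t (midx s t k)).
Proof.
move=> jk; set i := Num.min (midx s t j) (midx s t k).
have ij : i <= midx s t j by rewrite ge_min lexx.
have ik : i <= midx s t k by rewrite ge_min lexx orbT.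
apply: (fil_tr _ (mul_stable ik)).
by apply: (fil_mono jk); apply: filBC; exact: mul_stable.
Qed.
Definition mul_coherent s t := Coherent (@mul_coh s t).

(* The net x : int -> A tends, as its index tends to -oo, to the point s. *)
Definition nlim (x : int -> A) s : Prop :=
  forall k, exists n, forall i, i <= n -> fil k (x i - s i).

Lemma nlim_coheq s t : coheq s t -> nlim s t.
Proof. by move=> st k; exists k => i ik; apply: fil_mono (st i). Qed.

Lemma nlim_unique (x : int -> A) s t : nlim x s -> nlim x t -> coheq s t.
Proof.
move=> hs ht k; have [n hn] := hs k; have [m hm] := ht k.
set i := Num.min k (Num.min n m).
have [ik ni mi] : [/\ i <= k, i <= n & i <= m] by rewrite /i; split; lia.
apply: (fil_tr (filBC (coh_prop s ik))); apply: fil_tr (coh_prop t ik).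
exact: fil_tr (filBC (hn i ni)) (hm i mi).
Qed.

Lemma nlimD (x y : int -> A) s t : nlim x s -> nlim y t ->
  nlim (fun i => x i + y i) (add_coherent s t).
Proof.
move=> hs ht k; have [n hn] := hs k; have [m hm] := ht k.
exists (Num.min n m) => i inm; rewrite opprD addrACA.
by apply: filD; [apply: hn|apply: hm]; lia.
Qed.

Lemma nlimZ a (x : int -> A) s : nlim x s -> nlim (fun i => a *: x i) (scale_coherent a s).
Proof.
by move=> hs k; have [n hn] := hs k; exists n => i /hn; rewrite -scalerBr; exact: filZ.
Qed.

Lemma nlimM (x y : int -> A) s t : nlim x s -> nlim y t ->
  nlim (fun i => x i * y i) (mul_coherent s t).
Proof.
move=> hs ht k.
pose c := - (`|k| + cbound s + cbound t)%:Z : int.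
have [n0 h0] := hs 0; have [n hn] := hs c; have [m hm] := ht c.
exists (Num.min (Num.min 0 (Num.min n0 n)) (Num.min m (Num.min k (midx s t k)))) => i hi.
have [i0 in0 ni mi ik] : [/\ i <= 0, i <= n0, i <= n, i <= m & i <= k] by split; lia.
have im : i <= midx s t k by lia.
have xb : fil (cbound s) (x i).
  rewrite -[x i](subrK (s i)); apply: filD (cboundP s i0).
  by apply: fil_mono (h0 i in0).
have Ek : fil k (s i * t i - mul_coherent s t i).
  apply: (fil_tr (mul_stable im)); apply: filBC.
  exact: (coh_prop (mul_coherent s t)).
apply: (fil_tr _ Ek).
have -> : x i * y i - s i * t i = x i * (y i - t i) + (x i - s i) * t i.
  by rewrite mulrBr mulrBl addrA subrK.
apply: filD.
  by apply: fil_mono (fil_mul xb (hm i mi)); rewrite /c; lia.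
by apply: fil_mono (fil_mul (hn i ni) (cboundP t i0)); rewrite /c; lia.
Qed.

Definition copp (X : completion) : completion := cpi (opp_coherent (repr X)).
Definition cadd (X Y : completion) : completion := cpi (add_coherent (repr X) (repr Y)).
Definition cmul (X Y : completion) : completion := cpi (mul_coherent (repr X) (repr Y)).
Definition cscale a (X : completion) : completion := cpi (scale_coherent a (repr X)).

Lemma coppE s : copp (cpi s) = cpi (opp_coherent s).
Proof. by apply/cpiE => k; rewrite -opprD; apply: filN; exact: creprP. Qed.
Lemma caddE s t : cadd (cpi s) (cpi t) = cpi (add_coherent s t).
Proof. by apply/cpiE => k; rewrite opprD addrACA; apply: filD; exact: creprP. Qed.
Lemma cscaleE a s : cscale a (cpi s) = cpi (scale_coherent a s).
Proof. by apply/cpiE => k; rewrite -scalerBr; apply: filZ; exact: creprP. Qed.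

Lemma cmulE s t : cmul (cpi s) (cpi t) = cpi (mul_coherent s t).
Proof.
apply/cpiE/(@nlim_unique (fun i => repr (cpi s) i * repr (cpi t) i)).
  by apply: nlimM; exact/nlim_coheq/coheq_refl.
by apply: nlimM; exact/nlim_coheq/creprP.
Qed.

Let cE := (coppE, caddE, cscaleE, cmulE).

Lemma caddA : associative cadd.
Proof.
by do 3!elim/complP => ?; rewrite !cE; apply/cpiE => k /=; rewrite addrA subrr; exact: fil0.
Qed.
Lemma caddC : commutative cadd.
Proof.
do 2!elim/complP => ?; rewrite !cE; apply/cpiE => k /=.
by rewrite [X in X - _]addrC subrr; exact: fil0.
Qed.
Lemma cadd0 : left_id (cpi (ccst 0)) cadd.
Proof. by elim/complP => ?; rewrite !cE; apply/cpiE => k /=; rewrite add0r subrr; exact: fil0. Qed.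
Lemma caddN : left_inverse (cpi (ccst 0)) copp cadd.
Proof. by elim/complP => ?; rewrite !cE; apply/cpiE => k /=; rewrite addNr subrr; exact: fil0. Qed.
HB.instance Definition _ := GRing.isZmodule.Build completion caddA caddC cadd0 caddN.

Lemma cscaleA a b X : cscale a (cscale b X) = cscale (a * b) X.
Proof.
by elim/complP: X => ?; rewrite !cE; apply/cpiE => k /=; rewrite scalerA subrr; exact: fil0.
Qed.
Lemma cscale1 : left_id 1 cscale.
Proof. by elim/complP => ?; rewrite !cE; apply/cpiE => k /=; rewrite scale1r subrr; exact: fil0. Qed.
Lemma cscaleDr : right_distributive cscale cadd.
Proof.
move=> a; do 2!elim/complP => ?; rewrite !cE; apply/cpiE => k /=.
by rewrite scalerDr subrr; exact: fil0.
Qed.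
Lemma cscaleDl X : {morph cscale^~ X : a b / a + b >-> cadd a b}.
Proof.
elim/complP: X => ? a b; rewrite !cE; apply/cpiE => k /=.
by rewrite scalerDl subrr; exact: fil0.
Qed.
HB.instance Definition _ :=
  GRing.Zmodule_isLmodule.Build F completion cscaleA cscale1 cscaleDr cscaleDl.

Lemma nlim_id s : nlim s s. Proof. exact/nlim_coheq/coheq_refl. Qed.
Local Hint Resolve nlim_id nlimD nlimZ nlimM : core.

Lemma eq_nlim (x y : int -> A) s : x =1 y -> nlim x s -> nlim y s.
Proof. by move=> /funext ->. Qed.

Lemma cmulA : associative cmul.
Proof.
elim/complP => s; elim/complP => t; elim/complP => u; rewrite !cE; apply/cpiE.
apply: (@nlim_unique (fun i => s i * (t i * u i))); first by auto.
by apply: (@eq_nlim (fun i => s i * t i * u i)) => [i|]; [rewrite mulrA|auto].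
Qed.
Lemma cmul1l : left_id (cpi (ccst 1)) cmul.
Proof.
elim/complP => s; rewrite !cE; apply/cpiE/(@nlim_unique (fun i => ccst 1 i * s i)); first by auto.
by apply: eq_nlim (nlim_id s) => i; rewrite mul1r.
Qed.
Lemma cmul1r : right_id (cpi (ccst 1)) cmul.
Proof.
elim/complP => s; rewrite !cE; apply/cpiE/(@nlim_unique (fun i => s i * ccst 1 i)); first by auto.
by apply: eq_nlim (nlim_id s) => i; rewrite mulr1.
Qed.
Lemma cmulDl : left_distributive cmul cadd.
Proof.
elim/complP => s; elim/complP => t; elim/complP => u; rewrite !cE; apply/cpiE.
apply: (@nlim_unique (fun i => (s i + t i) * u i)); first by auto.
by apply: (@eq_nlim (fun i => s i * u i + t i * u i)) => [i|]; [rewrite mulrDl|auto].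
Qed.
Lemma cmulDr : right_distributive cmul cadd.
Proof.
elim/complP => s; elim/complP => t; elim/complP => u; rewrite !cE; apply/cpiE.
apply: (@nlim_unique (fun i => s i * (t i + u i))); first by auto.
by apply: (@eq_nlim (fun i => s i * t i + s i * u i)) => [i|]; [rewrite mulrDr|auto].
Qed.
Lemma c_nontrivial : cpi (ccst 1) != cpi (ccst 0).
Proof.
have [k k1] := fil_proper A; apply/eqP => /cpiE/(_ k) /=.
by rewrite subr0.
Qed.
HB.instance Definition _ := GRing.Zmodule_isNzRing.Build completion
  cmulA cmul1l cmul1r cmulDl cmulDr c_nontrivial.

Lemma cscaleAl a X Y : cscale a (cmul X Y) = cmul (cscale a X) Y.
Proof.
elim/complP: X Y => s; elim/complP => t; rewrite !cE; apply/cpiE.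
apply: (@nlim_unique (fun i => a *: (s i * t i))); first by auto.
by apply: (@eq_nlim (fun i => (a *: s i) * t i)) => [i|]; [rewrite scalerAl|auto].
Qed.
Lemma cscaleAr a X Y : cscale a (cmul X Y) = cmul X (cscale a Y).
Proof.
elim/complP: X Y => s; elim/complP => t; rewrite !cE; apply/cpiE.
apply: (@nlim_unique (fun i => a *: (s i * t i))); first by auto.
by apply: (@eq_nlim (fun i => s i * (a *: t i))) => [i|]; [rewrite scalerAr|auto].
Qed.
HB.instance Definition _ := GRing.Lmodule_isLalgebra.Build F completion cscaleAl.
HB.instance Definition _ := GRing.Lalgebra_isAlgebra.Build F completion cscaleAr.

Definition cin x : completion := cpi (ccst x).

(* The kernel of lim_j A / A_{<=j} -> A / A_{<=k}. *)
Definition cfil k (X : completion) : Prop := fil k (repr X k).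

Lemma cfilE k s : cfil k (cpi s) <-> fil k (s k).
Proof.
have h := creprP s k; rewrite /cfil; split=> sk.
  by rewrite -[s k]subr0; apply: fil_tr (filBC h) _; rewrite subr0.
by rewrite -[X in fil _ X]subr0; apply: fil_tr h _; rewrite subr0.
Qed.

Lemma cfil_in k x : cfil k (cin x) <-> fil k x.
Proof. exact: cfilE. Qed.

Lemma cinD x y : cin (x + y) = cin x + cin y.
Proof. by rewrite -[RHS]/(cadd _ _) caddE; apply/cpiE/coheq_refl. Qed.
Lemma cinZ a x : cin (a *: x) = a *: cin x.
Proof. by rewrite -[RHS]/(cscale _ _) cscaleE; apply/cpiE/coheq_refl. Qed.
Lemma cinM x y : cin (x * y) = cin x * cin y.
Proof.
rewrite -[RHS]/(cmul _ _) cmulE; apply/cpiE.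
by apply: (@nlim_unique (fun i => ccst x i * ccst y i)) => [|//]; exact: nlim_id (ccst (x * y)).
Qed.
Lemma cinN x : cin (- x) = - cin x.
Proof. by rewrite -[RHS]/(copp _) coppE; apply/cpiE/coheq_refl. Qed.

Lemma cfil_sub k : subspace (cfil k).
Proof.
split=> [|a]; first by apply/cfilE; exact: fil0.
elim/complP => s; elim/complP => t /cfilE sk /cfilE tk.
rewrite -[X in X + _]/(cscale _ _) -[X in cfil _ X]/(cadd _ _) !cE; apply/cfilE => /=.
by apply: filD => //; exact: filZ.
Qed.

Lemma cfil_mono k l X : k <= l -> cfil k X -> cfil l X.
Proof.
elim/complP: X => s kl /cfilE sk; apply/cfilE; rewrite -[s l]subr0.
by apply: (fil_tr (filBC (coh_prop s kl))); rewrite subr0; exact: fil_mono sk.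
Qed.

Lemma cfil_exh X : exists k, cfil k X.
Proof.
elim/complP: X => s; exists (cbound s); apply/cfilE; rewrite -[s _]subr0.
apply: (@fil_tr _ _ _ (s 0)); first by apply: filBC; exact: coh_prop.
by rewrite subr0; exact: cboundP.
Qed.

Lemma cfil_one : cfil 0 1.
Proof. by apply/cfilE; exact: fil_one. Qed.

Lemma cfil_small k s : cfil k (cpi s) <-> exists n, forall i, i <= n -> fil k (s i).
Proof.
split=> [/cfilE sk|[n hn]].
  exists k => i ik; rewrite -[s i]subr0; apply: fil_tr (coh_prop s ik) _.
  by rewrite subr0.
apply/cfilE; pose i := Num.min k n.
have [ik hi] : i <= k /\ i <= n by rewrite /i; lia.
rewrite -[s k]subr0; apply: (fil_tr (filBC (coh_prop s ik))).
by rewrite subr0; exact: hn.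
Qed.

Lemma cfil_mul k l X Y : cfil k X -> cfil l Y -> cfil (k + l) (X * Y).
Proof.
elim/complP: X => s; elim/complP: Y => t /cfil_small[n hn] /cfil_small[m hm].
rewrite -[X in cfil _ X]/(cmul _ _) cmulE; apply/cfilE.
have hs := mul_stable (s := s) (t := t) (k := k + l).
set p := midx s t (k + l) in hs.
pose i := Num.min p (Num.min n m).
have [ip ni mi] : [/\ i <= p, i <= n & i <= m] by rewrite /i; split; lia.
rewrite -[X in fil _ X]subr0; apply: (fil_tr (filBC (hs i ip))).
by rewrite subr0; exact: fil_mul (hn i ni) (hm i mi).
Qed.

Lemma cfil_proper : exists k, ~ cfil k 1.
Proof. by have [k k1] := fil_proper A; exists k => /cfilE. Qed.

Definition compl : filtAlg F :=
  FiltAlg cfil_sub cfil_mono cfil_exh cfil_one cfil_mul cfil_proper.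

Lemma compl_separated : separated compl.
Proof.
elim/complP => s h; apply/cpiE => k; rewrite subr0.
by have /cfilE := h k.
Qed.

Lemma cpiB s t : cpi s - cpi t = cpi (add_coherent s (opp_coherent t)).
Proof. by rewrite -caddE -coppE. Qed.

Lemma repr_near k (X : completion) : cfil k (X - cin (repr X k)).
Proof.
elim/complP: X => s; rewrite cpiB; apply/cfilE => /=.
by apply: filBC; exact: creprP.
Qed.

Lemma compl_complete : complete compl.
Proof.
move=> S hS; pose s k := repr (S k) k.
have sP : forall j k, j <= k -> fil k (s j - s k).
  move=> j k jk; apply/cfil_in; rewrite cinD cinN.
  have h1 : fil k (cin (s j) - S j : compl).
    by apply: filBC; apply: (fil_mono (f := compl) jk); exact: repr_near.
  exact: fil_tr (fil_tr h1 (hS _ _ jk)) (repr_near k (S k)).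
exists (cpi (Coherent sP)) => k; apply: (@fil_tr _ compl _ (cin (s k))).
  by rewrite cpiB; apply/cfilE; rewrite /= subrr; exact: fil0.
by apply: filBC; exact: repr_near.
Qed.

End Completion.

Section Extension.
Variables (F : fieldType) (A B : filtAlg F) (f : A -> B).

(* The value at X of the extension of f by continuity exists and equals y: for
   X = sum_i x_i a convergent series, sum_i f(x_i) converges to y. *)
Definition converges (X : completion A) (y : B) : Prop :=
  forall n, exists k, forall x, cfil k (X - cin x) -> fil n (f x - y).

Definition cext (X : completion A) : B := xget 0 [set y | converges X y]%classic.

Lemma cext_spec X : linear f -> filtered f -> complete B -> separated B ->
  converges X (cext X) /\ forall y, converges X y -> y = cext X.
Proof.
move=> fl ff cB sB.
have fB x y : f (x - y) = f x - f y.
  by have := fl (- 1) y x; rewrite !scaleN1r addrC [- _ + _]addrC => ->.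
have hf j k : j <= k -> fil k (f (repr X j) - f (repr X k)).
  by move=> jk; rewrite -fB; apply: ff; exact: coh_prop.
have [y0 hy0] := cB _ hf.
have cv : converges X y0.
  move=> n; exists n => x hx; apply: fil_tr (filBC (hy0 n)).
  rewrite -fB; apply: ff; apply/cfil_in; rewrite cinD cinN.
  exact: (@fil_tr _ (compl A)) (filBC (A := compl A) hx) (repr_near n X).
have un y : converges X y -> y = y0.
  move=> hy; apply/eqP; rewrite -subr_eq0; apply/eqP; apply: sB => n.
  have [k hk] := hy n; have [l hl] := cv n.
  have h : cfil (Num.min k l) (X - cin (repr X (Num.min k l))) by exact: repr_near.
  apply: (@fil_tr _ _ _ (f (repr X (Num.min k l)))).
    by apply: filBC; apply: hk; apply: cfil_mono h; rewrite ge_min lexx.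
  by apply: hl; apply: cfil_mono h; rewrite ge_min lexx orbT.
have -> : cext X = y0 by exact: xget_unique.
by split.
Qed.

End Extension.

Section ConverseAlgebra.
Variables (F : fieldType) (A : algType F).
HB.instance Definition _ := GRing.Zmodule_isLmodule.Build F A^c%type
  (@scalerA F A) (@scale1r F A) (@scalerDr F A) (fun v a b => scalerDl v a b).
HB.instance Definition _ := GRing.Lmodule_isLalgebra.Build F A^c%type
  (fun a (x y : A) => @scalerAr F A a y x).
HB.instance Definition _ := GRing.Lalgebra_isAlgebra.Build F A^c%type
  (fun a (x y : A) => @scalerAl F A a y x).
End ConverseAlgebra.

Section HopfMaps.
Variables (F : fieldType) (g : lieAlg F).

Definition Ucop : Uenv g -> Uenv g ⊗ Uenv g :=
  ulift (fun x => uinj x ⊗ 1 + 1 ⊗ uinj x).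
Definition Ucounit : Uenv g -> F := @ulift F g F^o (fun=> 0).
Definition Uantipode : Uenv g -> Uenv g := @ulift F g (Uenv g)^c (fun x => - uinj x).

Definition Usub (V : {vspace g}) (hV : lie_closed V) : Uenv (subLie hV) -> Uenv g :=
  @ulift F (subLie hV) (Uenv g) (fun x => uinj (vsval x)).

Lemma Ucop_spec : [/\ linear Ucop, GRing.monoid_morphism Ucop &
  forall x, Ucop (uinj x) = uinj x ⊗ 1 + 1 ⊗ uinj x].
Proof.
apply: ulift_spec => [a x y|x y]; first by
  rewrite uinj_lin tensDl tensDr tensZl tensZr scalerDr addrACA.
rewrite uinj_br tensDl tensDr -!scaleN1r tensZl tensZr !scaleN1r.
rewrite !mulrDl !mulrDr !tensM !mulr1 !mul1r opprD.
set p := (_ * _) ⊗ 1; set q := (_ * _) ⊗ 1; set b := 1 ⊗ _; set d := 1 ⊗ _.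
set m := uinj x ⊗ uinj y; set n := uinj y ⊗ uinj x.
rewrite -opprD [n + b]addrC [p + m + _]addrACA [m + d]addrC [q + n + _]addrACA.
by rewrite (opprD (q + d)) [m + n]addrC [RHS]addrACA subrr addr0 opprD addrACA.
Qed.

Lemma Ucounit_spec : [/\ linear (Ucounit : _ -> F^o), GRing.monoid_morphism Ucounit &
  forall x, Ucounit (uinj x) = 0].
Proof.
apply: (@ulift_spec F g F^o) => [a x y|x y]; first by rewrite scaler0 addr0.
by rewrite mulr0 subr0.
Qed.

Lemma Uantipode_spec : [/\ linear Uantipode, Uantipode 1 = 1,
  forall x y, Uantipode (x * y) = Uantipode y * Uantipode x &
  forall x, Uantipode (uinj x) = - uinj x].
Proof.
have [||l [m1 mM] i] := @ulift_spec F g (Uenv g)^c (fun x => - uinj x).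
- by move=> a x y; rewrite uinj_lin opprD scalerN.
- by move=> x y; rewrite uinj_br opprB -mulrNN -[in RHS]mulrNN !mulrNN.
by split.
Qed.

Lemma Usub_spec (V : {vspace g}) (hV : lie_closed V) :
  [/\ linear (@Usub V hV), GRing.monoid_morphism (@Usub V hV) &
    forall x, @Usub V hV (uinj x) = uinj (vsval x)].
Proof.
apply: ulift_spec => [a x y|x y]; first by rewrite linearP uinj_lin.
by rewrite -uinj_br sub_brE.
Qed.

End HopfMaps.
Arguments Usub {F g V hV}.

Record polarLie (F : fieldType) := PolarLie {
  pol_lie :> lieAlg F;
  pol_l : {vspace pol_lie};
  pol_p : {vspace pol_lie};
  pol_m : {vspace pol_lie};
  pol_sum : (pol_l + pol_p + pol_m)%VS = fullv;
  pol_direct : directv (pol_l + pol_p + pol_m);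
  pol_lC : lie_closed pol_l;
  pol_pC : lie_closed pol_p;
  pol_mC : lie_closed pol_m;
  pol_lp : forall x y, x \in pol_l -> y \in pol_p -> ⁅x, y⁆ \in pol_p;
  pol_lm : forall x y, x \in pol_l -> y \in pol_m -> ⁅x, y⁆ \in pol_m }.

Section Polarized.
Variables (F : fieldType) (g : polarLie F).

Lemma lie_anti (x y : g) : ⁅x, y⁆ = - ⁅y, x⁆.
Proof.
have D : forall z u v : g, ⁅u + v, z⁆ = ⁅u, z⁆ + ⁅v, z⁆.
  by move=> z u v; have := lie_linl z 1 u v; rewrite !scale1r.
have D' : forall z u v : g, ⁅z, u + v⁆ = ⁅z, u⁆ + ⁅z, v⁆.
  by move=> z u v; have := lie_linr z 1 u v; rewrite !scale1r.
have := lie_alt (x + y); rewrite D !D' !lie_alt add0r addr0.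
by move/eqP; rewrite addr_eq0 => /eqP.
Qed.

Lemma closedD (V W : {vspace g}) : lie_closed V -> lie_closed W ->
  (forall x y, x \in V -> y \in W -> ⁅x, y⁆ \in W) -> lie_closed (V + W)%VS.
Proof.
move=> hV hW hVW x y /memv_addP[v Vv [w Ww ->]] /memv_addP[v' Vv' [w' Ww' ->]].
have D : forall z u v : g, ⁅u + v, z⁆ = ⁅u, z⁆ + ⁅v, z⁆.
  by move=> z u u'; have := lie_linl z 1 u u'; rewrite !scale1r.
have D' : forall z u v : g, ⁅z, u + v⁆ = ⁅z, u⁆ + ⁅z, v⁆.
  by move=> z u u'; have := lie_linr z 1 u u'; rewrite !scale1r.
have VW u : u \in V -> u \in (V + W)%VS by apply/subvP; exact: addvSl.
have WW u : u \in W -> u \in (V + W)%VS by apply/subvP; exact: addvSr.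
rewrite D !D' !memvD //; [exact/VW/hV|exact/WW/hVW| |exact/WW/hW].
by rewrite lie_anti memvN; exact/WW/hVW.
Qed.

Lemma pol_lpC : lie_closed (pol_l g + pol_p g)%VS.
Proof. exact: closedD (@pol_lC _ g) (@pol_pC _ g) (@pol_lp _ g). Qed.
Lemma pol_lmC : lie_closed (pol_l g + pol_m g)%VS.
Proof. exact: closedD (@pol_lC _ g) (@pol_mC _ g) (@pol_lm _ g). Qed.

Definition Lie_l := subLie (@pol_lC _ g).
Definition Lie_p := subLie (@pol_pC _ g).
Definition Lie_m := subLie (@pol_mC _ g).
Definition Lie_lp := subLie pol_lpC.
Definition Lie_lm := subLie pol_lmC.

Definition pol_u : {vspace g} := (pol_p g + pol_m g)%VS.

Definition proj_l (z : g) : Lie_l := vsproj (pol_l g) (daddv_pi (pol_l g) pol_u z).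

Definition dim_l := \dim (pol_l g).
Definition basis_l (i : 'I_dim_l) : Lie_l := vsproj (pol_l g) (vbasis (pol_l g))`_i.

(* The inclusion of l in S(l), the polynomial ring on the elements of [basis_l]. *)
Definition sym_inj (x : Lie_l) : {mpoly F[dim_l]} :=
  \sum_(i < dim_l) coord (vbasis (pol_l g)) i (vsval x) *: 'X_i.

(* Genericity is with respect to the Zariski topology of l^*. *)
Definition nondegenerate_pol : Prop :=
  exists P : {mpoly F[dim_l]}, P != 0 /\
    forall lam : {linear Lie_l -> F^o}, P.@[fun i => lam (basis_l i)] != 0 ->
    forall x, x \in pol_u -> (forall y, y \in pol_u -> lam (proj_l ⁅x, y⁆) = 0) -> x = 0.

(* When g is nondegenerate, \dim pol_m = \dim pol_p. *)
Definition dprime := \dim (pol_p g).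
Definition D0' : {mpoly F[dim_l]} := \det (\matrix_(i < dprime, j < dprime)
  sym_inj (proj_l ⁅(vbasis (pol_p g))`_i, (vbasis (pol_m g))`_j⁆)).

(* The field of fractions of S(l), which contains S(l)[1/D0']. *)
Definition Frac : Type := {fraction {mpoly F[dim_l]}}.
HB.instance Definition _ := GRing.Field.on Frac.
Definition to_frac (p : {mpoly F[dim_l]}) : Frac := tofrac p.
Definition frac_scale (a : F) (f : Frac) : Frac := to_frac a%:MP * f.
Lemma frac_scaleA a b f : frac_scale a (frac_scale b f) = frac_scale (a * b) f.
Proof. by rewrite /frac_scale /to_frac mpolyCM rmorphM mulrA. Qed.
Lemma frac_scale1 : left_id 1 frac_scale.
Proof. by move=> f; rewrite /frac_scale /to_frac mpolyC1 rmorph1 mul1r. Qed.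
Lemma frac_scaleDr : right_distributive frac_scale +%R.
Proof. by move=> a x y; rewrite /frac_scale mulrDr. Qed.
Lemma frac_scaleDl f : {morph frac_scale^~ f : a b / a + b}.
Proof. by move=> a b; rewrite /frac_scale /to_frac mpolyCD rmorphD mulrDl. Qed.
HB.instance Definition _ := GRing.Zmodule_isLmodule.Build F Frac
  frac_scaleA frac_scale1 frac_scaleDr frac_scaleDl.

(* The degree n component of S(l)[1/D0'], inside the field of fractions. Up to a
   nonzero scalar D0 = D0'^2, so S(l)[1/D0'] = S(l)[1/D0]. *)
Definition Sloc (n : int) (f : Frac) : Prop := exists (k m : nat) (p : {mpoly F[dim_l]}),
  [/\ m%:Z = n + (k * dprime)%:Z, p \is m.-homog & f = to_frac p / to_frac D0' ^+ k].

(* The matrix of omega in a basis (e_i) of u, and the coefficients of its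
   inverse tensor: u -> u^* maps e_i to sum_j W_ij e_j^*, so its inverse maps
   e_j^* to sum_k (W^-1)_jk e_k, and the tensor sum_ij W_ij e_i^* (x) e_j^* to
   sum_kl ((W^-1)^T W W^-1)_kl e_k (x) e_l. *)
Definition omega_mx : 'M[Frac]_(\dim pol_u) :=
  \matrix_(i, j) to_frac (sym_inj (proj_l ⁅(vbasis pol_u)`_i, (vbasis pol_u)`_j⁆)).
Definition omega_inv_mx : 'M[Frac]_(\dim pol_u) :=
  (invmx omega_mx)^T *m omega_mx *m invmx omega_mx.

(* r_l^g = - omega^-1, in U(g) (x) U(g) (x) Frac S(l). *)
Definition r_matrix : Uenv g ⊗ Uenv g ⊗ Frac :=
  - \sum_(k < \dim pol_u) \sum_(l < \dim pol_u)
      (uinj (vbasis pol_u)`_k ⊗ uinj (vbasis pol_u)`_l) ⊗ omega_inv_mx k l.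

(* The linear map S(l) -> U(l) given by ordered monomials; in degree n it lifts
   the canonical map S^n(l) -> gr_n U(l). *)
Definition pbw (p : {mpoly F[dim_l]}) : Uenv Lie_l :=
  \sum_(m <- msupp p) p@_m *: \prod_(i < dim_l) uinj (basis_l i) ^+ m i.

Definition lift_of_D0' (D : Uenv Lie_l) : Prop :=
  ufil dprime%:Z D /\
  ufil (dprime%:Z - 1) (D - pbw D0').

Section Micro.
Variables (D : Uenv Lie_l) (Uh : filtAlg F) (iota : Uenv Lie_l -> Uh)
  (sigma : int -> Uh -> Frac).

(* [sigma n] is the symbol map Uh_{<=n} -> S(l)[1/D0']_n; it is only specified
   on Uh_{<=n}. The axioms say that the symbol maps induce an isomorphism of
   graded algebras gr Uh = S(l)[1/D0'] extending gr U(l) = S(l). *)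
Record symbol_maps : Prop := SymbolMaps {
  symb_lin : forall n a x y, fil n x -> fil n y ->
    sigma n (a *: x + y) = a *: sigma n x + sigma n y;
  symb_deg : forall n x, fil n x -> Sloc n (sigma n x);
  symb_ker : forall n x, fil n x -> (sigma n x = 0 <-> fil (n - 1) x);
  symb_onto : forall n f, Sloc n f -> exists2 x, fil n x & sigma n x = f;
  symb_one : sigma 0 1 = 1;
  symb_mul : forall m n x y, fil m x -> fil n y ->
    sigma (m + n) (x * y) = sigma m x * sigma n y;
  symb_inj : forall x, sigma 1 (iota (uinj x)) = to_frac (sym_inj x) }.

(* The inverse must have degree <= -d', as 1/D has in Uh: for l of dimension 1 and
   D = x, the inclusion of F[x] in F[x, 1/x], the latter concentrated in degree 0,
   does not extend to a filtered morphism from F((1/x)). *)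
Definition inverts (B : filtAlg F) (f : Uenv Lie_l -> B) : Prop :=
  exists e : B, [/\ fil (- dprime%:Z) e, e * f D = 1 & f D * e = 1].

Record microlocalization : Prop := Microlocalization {
  micro_complete : complete Uh;
  micro_separated : separated Uh;
  micro_lin : linear iota;
  micro_mor : GRing.monoid_morphism iota;
  micro_inj : injective iota;
  micro_fil : forall k x, fil k (iota x) <-> ufil k x;
  micro_inv : inverts iota;
  micro_gr : symbol_maps;
  micro_univ : forall (B : filtAlg F) (f : Ufilt Lie_l -> B),
    complete B -> separated B -> filtered_morphism f -> inverts f ->
    exists! h : Uh -> B, filtered_morphism h /\ forall x, h (iota x) = f x }.

(* The extensions of the coproduct and of the antipode of U(l) to Uh; they exist
   and are unique, by [micro_univ] and density. *)
Definition coproduct_l (Dl : Uh -> compl (rtens (Uenv Lie_l) Uh)) : Prop :=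
  filtered_morphism Dl /\ forall x, Dl (iota x) = cin (tmap id iota (Ucop x) : rtens _ Uh).

Definition coproduct_r (Dr : Uh -> compl (ltens Uh (Uenv Lie_l))) : Prop :=
  filtered_morphism Dr /\ forall x, Dr (iota x) = cin (tmap iota id (Ucop x) : ltens Uh _).

Definition antipode_ext (Sh : Uh -> Uh) : Prop :=
  [/\ linear Sh, Sh 1 = 1, forall x y, Sh (x * y) = Sh y * Sh x, filtered Sh &
    forall x, Sh (iota x) = iota (Uantipode x)].

Definition harish_chandra (H : Uenv g -> Uenv Lie_l) : Prop := linear H /\
  forall (xp : Uenv Lie_p) (x0 : Uenv Lie_l) (xm : Uenv Lie_m),
    H (Usub xp * Usub x0 * Usub xm) = (Ucounit xp * Ucounit xm) *: x0.

Notation TK := (rtens (Uenv Lie_p ⊗ Uenv Lie_m) Uh).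
Notation T2 := (rtens (Uenv g ⊗ Uenv g) Uh).
Notation T3 := (rtens (Uenv g ⊗ Uenv g ⊗ Uenv g) Uh).

Definition tlift3 (U V W M : lmodType F) (f : U -> V -> W -> M) : U ⊗ V ⊗ W -> M :=
  tlift (fun uv w => tlift (fun u v => f u v w) uv).

Definition canonical_element (H : Uenv g -> Uenv Lie_l) (K : compl TK) : Prop :=
  forall (x : Uenv Lie_lm) (y : Uenv Lie_lp),
    @converges F TK Uh
      (tlift3 (fun a b u => iota (H (Usub x * Usub a)) * u * iota (H (Usub b * Usub y))))
      K (iota (H (Usub x * Usub y))).

Section Jelement.
Variables (Sh : Uh -> Uh) (Dr : Uh -> compl (ltens Uh (Uenv Lie_l))).

(* a (x) S(b) S(u2) (x) S(u1), where u1 (x) u2 stands for Dr u. *)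
Definition J_term (a : Uenv Lie_p) (b : Uenv Lie_m) (u : Uh) : compl T2 :=
  @cext F (ltens Uh (Uenv Lie_l)) (compl T2)
    (tlift (fun u1 u2 =>
      cin ((Usub a ⊗ (Usub (Uantipode b) * Usub (Uantipode u2))) ⊗ Sh u1 : T2)))
    (Dr u).

Definition J_elt (K : compl TK) : compl T2 := @cext F TK (compl T2) (tlift3 J_term) K.

End Jelement.

Section Quantization.
Variables (Dl : Uh -> compl (rtens (Uenv Lie_l) Uh)).

Definition cmap_l (V W : algType F) (phi : V -> W) :
    compl (rtens V Uh) -> compl (rtens W Uh) :=
  @cext F (rtens V Uh) (compl (rtens W Uh)) (fun t => cin (tmap phi id t : rtens W Uh)).

Definition J_12_3_4 : compl T2 -> compl T3 := cmap_l (tmap (@Ucop F g) id).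
Definition J_1_23_4 : compl T2 -> compl T3 :=
  cmap_l (tlift (fun a b => tlift (fun b1 b2 => a ⊗ b1 ⊗ b2) (Ucop b))).
Definition J_2_3_4 : compl T2 -> compl T3 := cmap_l (tlift (fun a b => 1 ⊗ a ⊗ b)).
Definition J_1_2_34 : compl T2 -> compl T3 :=
  @cext F T2 (compl T3) (tlift (fun (v : Uenv g ⊗ Uenv g) u =>
    @cext F (rtens (Uenv Lie_l) Uh) (compl T3)
      (tlift (fun u1 u2 => cin ((v ⊗ Usub u1) ⊗ u2 : T3))) (Dl u))).

Definition l_invariant (J : compl T2) : Prop := forall x : Lie_l,
  let X : T2 := (uinj (vsval x) ⊗ 1 + 1 ⊗ uinj (vsval x)) ⊗ 1 + 1 ⊗ iota (uinj x) in
  cin X * J = J * cin X.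

(* j is the class modulo degree <= n - 1 of X, of degree <= n, viewed in
   U(g) (x) U(g) (x) S(l)[1/D0']_n. *)
Definition reduction (n : int) (X : compl T2) (j : Uenv g ⊗ Uenv g ⊗ Frac) : Prop :=
  exists s : seq ((Uenv g ⊗ Uenv g) * Uh),
    [/\ forall p, p \in s -> fil n p.2,
        fil (n - 1) (X - cin (\sum_(p <- s) p.1 ⊗ p.2 : T2)) &
        j = \sum_(p <- s) p.1 ⊗ sigma n p.2].

Definition Alt (j : Uenv g ⊗ Uenv g ⊗ Frac) : Uenv g ⊗ Uenv g ⊗ Frac :=
  j - tmap (@tswap F _ _) id j.

Definition quantization (r : Uenv g ⊗ Uenv g ⊗ Frac) (J : compl T2) : Prop :=
  [/\ l_invariant J,
      fil 0 J,
      J_12_3_4 J * J_1_2_34 J = J_1_23_4 J * J_2_3_4 J,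
      fil (-1) (J - 1) &
      exists2 j, reduction (-1) (J - 1) j & Alt j = r].

End Quantization.
End Micro.
End Polarized.

(* Main.v *)
Require Import Defs.
From HB Require Import structures.
From mathcomp Require Import all_boot all_order all_algebra.
From mathcomp Require Import perm zify ring mpoly complex boolp classical_sets reals.

Set Implicit Arguments.
Unset Strict Implicit.
Unset Printing Implicit Defensive.

Import Order.TTheory GRing.Theory Num.Theory.
Local Open Scope ring_scope.

(* The pairing z, y |-> sum_i H(z a_i) l_i H(b_i y) on (U(u_+) (x) U(u_-)) (x)^ Uh
   is nondegenerate, even degree by degree: on words of equal length the top
   symbol of H(y_{j_1} ... y_{j_m} x_{i_1} ... x_{i_m}) is the permanent of the
   entries [y_j, x_i]_l, and the matrix they form is invertible over gr Uh.
   Hence K is determined by its pairings.  This gives the degree bound and the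
   expansion K = 1 + sum x_i (x) y_j (x) n_ij modulo degree -2, where (n_ij) lifts
   the inverse matrix; the invariance of K under l, since ad_x K pairs to
   H(zxy) - H(zxy) = 0; and the fact that replacing each b_i by the class of b_i a
   modulo u_+ U(g) turns K into (a (x) 1) K.  Both sides of (i) are images
   under v (x) b (x) u |-> v (x) S(b) S(u2) (x) S(u1) of two elements which have
   the same left pairings by that fact, hence are equal.  Finally (iii) reads off
   the inverse of omega in a basis adapted to u_+ and u_-. *)

(** H of a product of words is known only through its leading part, so the matrix of permanents is
    not inverted as a whole. One letter is removed at a time: to leading order a pairing obeys the
    chain rule in one letter, the matrix n inverts that step, and Euler's identity rebuilds the word
    after division by its length, whence characteristic 0. Words are needed on either side of H, so
    the estimates are proved for an abstract triangular algebra and applied both to U(g) and to its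
    opposite, with u_+ and u_- exchanged.

    The coproducts and the antipode of Uh are given only on U(l). Identities about them are phrased
    as equalities of two filtered morphisms, or antimorphisms, out of Uh that agree on l;
    universality of Uh does the rest. To pass from l-invariance of J to commutation with the images
    of all of Uh, conjugation by J is treated as such a morphism: J - 1 has degree -1, so a
    geometric series inverts J.

    In (i) the comparison takes place in U(g) (x) U(g) (x) U(u_-) over Uh: left pairings can read
    the factor from U(u_-) only before the antipode merges it with S(u2). *)

(* Equality in noncommutative rings by expansion into signed words. *)
Section NcRing.

Inductive ncexp := NcVar of nat | NcZero | NcOne | NcOpp of ncexp
  | NcAdd of ncexp & ncexp | NcMul of ncexp & ncexp.

Fixpoint ncnf (e : ncexp) : seq (bool * seq nat) :=
  match e with
  | NcVar n => [:: (false, [:: n])]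
  | NcZero => [::]
  | NcOne => [:: (false, [::])]
  | NcOpp e => [seq (~~ p.1, p.2) | p <- ncnf e]
  | NcAdd e e' => ncnf e ++ ncnf e'
  | NcMul e e' => [seq (p.1 (+) q.1, p.2 ++ q.2) | p <- ncnf e, q <- ncnf e']
  end.

(** All words are moved to one side; the difference vanishes as soon as every word occurs equally
    often with each sign, and words that do not occur satisfy this trivially. *)
Definition nccheck (e e' : ncexp) : bool :=
  let s := ncnf e ++ [seq (~~ p.1, p.2) | p <- ncnf e'] in
  all (fun p => count_mem (true, p.2) s == count_mem (false, p.2) s) s.

Variables (R : pzRingType) (env : seq R).

Fixpoint ncev (e : ncexp) : R :=
  match e with
  | NcVar n => env`_n | NcZero => 0 | NcOne => 1 | NcOpp e => - ncev e
  | NcAdd e e' => ncev e + ncev e' | NcMul e e' => ncev e * ncev e'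
  end.

Let wv (w : seq nat) : R := \prod_(i <- w) env`_i.
Let tv (p : bool * seq nat) : R := (if p.1 then -1 else 1) * wv p.2.

Lemma tvN p : tv (~~ p.1, p.2) = - tv p.
Proof. by case: p => -[] w; rewrite /tv /= !mulN1r !mul1r ?opprK. Qed.

Lemma ncnfE e : ncev e = \sum_(p <- ncnf e) tv p.
Proof.
elim: e => [n||| e IH|e IH e' IH'|e IH e' IH'] /=.
- by rewrite big_seq1 /tv /wv /= big_seq1 mul1r.
- by rewrite big_nil.
- by rewrite big_seq1 /tv /wv /= big_nil mul1r.
- by rewrite IH big_map -sumrN; apply: eq_bigr => p _; rewrite tvN.
- by rewrite big_cat IH IH'.
rewrite IH IH' big_allpairs_dep mulr_suml; apply: eq_bigr => -[b w] _.
rewrite mulr_sumr; apply: eq_bigr => -[b' w'] _.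
rewrite /tv /wv /= big_cat /=.
by case: b b' => [] []; rewrite ?mulN1r ?mul1r ?mulNr ?mulrN ?opprK.
Qed.

Lemma ncsum_count (s : seq (bool * seq nat)) :
  \sum_(p <- s) tv p =
  \sum_(w <- undup [seq p.2 | p <- s])
    wv w *+ count_mem (false, w) s - \sum_(w <- undup [seq p.2 | p <- s])
    wv w *+ count_mem (true, w) s.
Proof.
rewrite -sumrB; transitivity (\sum_(w <- undup [seq p.2 | p <- s])
  \sum_(p <- s | p.2 == w) tv p).
  rewrite (exchange_big_dep predT) //=; apply: eq_big_seq => p ps.
  rewrite -big_filter (_ : [seq i <- _ | _] = [:: p.2]) ?big_seq1 //.
  rewrite (eq_filter (a2 := pred1 p.2)); last by move=> w; rewrite /= eq_sym.
  by rewrite filter_pred1_uniq ?undup_uniq // mem_undup map_f.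
apply: eq_bigr => w _; rewrite (bigID (fun p : bool * seq nat => p.1)) /= addrC.
congr (_ + _).
  rewrite -!sum1_count -sumrMnr big_mkcond [RHS]big_mkcond; apply: eq_bigr => -[b v] _ /=.
  rewrite /= xpair_eqE; case: eqP => [->|]; rewrite ?andbF //.
  by case: b; rewrite //= /tv /= mul1r.
rewrite -!sum1_count -sumrMnr -sumrN big_mkcond [RHS]big_mkcond; apply: eq_bigr => -[b v] _ /=.
rewrite xpair_eqE; case: eqP => [->|]; rewrite ?andbF //.
by case: b; rewrite //= /tv /= mulN1r.
Qed.

Lemma ncringP e e' : nccheck e e' -> ncev e = ncev e'.
Proof.
rewrite /nccheck; set s := _ ++ _ => /allP h.
apply/eqP; rewrite -subr_eq0; apply/eqP.
have -> : ncev e - ncev e' = \sum_(p <- s) tv p.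
  rewrite big_cat big_map !ncnfE -sumrN; congr (_ + _).
  by apply: eq_bigr => p _; rewrite tvN.
rewrite ncsum_count -sumrB big_seq big1 // => w.
rewrite mem_undup => /mapP[p /h/eqP E ->].
by rewrite E subrr.
Qed.

End NcRing.

Ltac nc_mem x l :=
  match l with nil => constr:(false) | cons x _ => constr:(true) | cons _ ?t => nc_mem x t end.
Ltac nc_add x l := let b := nc_mem x l in
  match b with true => l | false => constr:(cons x l) end.
Ltac nc_atoms e l :=
  match e with
  | (?a + ?b)%R => let l := nc_atoms a l in nc_atoms b l
  | (?a * ?b)%R => let l := nc_atoms a l in nc_atoms b l
  | (- ?a)%R => nc_atoms a l
  | 0%R => l
  | 1%R => l
  | _ => nc_add e l
  end.
Ltac nc_index x l :=
  match l with cons x _ => constr:(0%N) | cons _ ?t => let n := nc_index x t in constr:(S n) end.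
Ltac nc_quote e l :=
  match e with
  | (?a + ?b)%R => let a := nc_quote a l in let b := nc_quote b l in constr:(NcAdd a b)
  | (?a * ?b)%R => let a := nc_quote a l in let b := nc_quote b l in constr:(NcMul a b)
  | (- ?a)%R => let a := nc_quote a l in constr:(NcOpp a)
  | 0%R => constr:(NcZero)
  | 1%R => constr:(NcOne)
  | _ => let n := nc_index e l in constr:(NcVar n)
  end.
(** Whatever is not a sum, a product, an opposite, 0 or 1 becomes an atom; scalar multiples and
    powers are opaque to it. *)
Ltac ncring :=
  match goal with
  | |- @eq ?T ?x ?y =>
    let l := nc_atoms x (@nil T) in
    let l := nc_atoms y l in
    let ex := nc_quote x l in
    let ey := nc_quote y l in
    exact: (@ncringP _ l ex ey isT)
  end.


(** * Linear and bilinear maps given as plain functions *)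

Section LinearMaps.
Variables (F : fieldType) (V W : lmodType F) (f : V -> W).
Hypothesis fl : linear f.

Lemma lin0 : f 0 = 0.
Proof. by have := fl (- 1) 0 0; rewrite scaleN1r oppr0 addr0 scaleN1r addNr. Qed.
Lemma linD x y : f (x + y) = f x + f y.
Proof. by have := fl 1 x y; rewrite !scale1r. Qed.
Lemma linZ a x : f (a *: x) = a *: f x.
Proof. by have := fl a x 0; rewrite !addr0 lin0 addr0. Qed.
Lemma linN x : f (- x) = - f x.
Proof. by rewrite -scaleN1r linZ scaleN1r. Qed.
Lemma linB x y : f (x - y) = f x - f y.
Proof. by rewrite linD linN. Qed.
Lemma lin_sum (I : Type) (r : seq I) (P : pred I) (h : I -> V) :
  f (\sum_(i <- r | P i) h i) = \sum_(i <- r | P i) f (h i).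
Proof. exact: (big_morph f linD lin0). Qed.
Lemma linMn x n : f (x *+ n) = f x *+ n.
Proof. by elim: n => [|n IHn]; rewrite ?mulr0n ?lin0 // !mulrS linD IHn. Qed.

End LinearMaps.

Section LinearClosure.
Variables (F : fieldType).

Lemma lin_comp (U V W : lmodType F) (f : V -> W) (h : U -> V) :
  linear f -> linear h -> linear (fun x => f (h x)).
Proof. by move=> fl hl a x y; rewrite hl fl. Qed.
Lemma lin_add (V W : lmodType F) (f h : V -> W) :
  linear f -> linear h -> linear (fun x => f x + h x).
Proof. by move=> fl hl a x y; rewrite hl fl scalerDr addrACA. Qed.
Lemma lin_opp (V W : lmodType F) (f : V -> W) : linear f -> linear (fun x => - f x).
Proof. by move=> fl a x y; rewrite fl opprD scalerN. Qed.
Lemma lin_sub (V W : lmodType F) (f h : V -> W) :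
  linear f -> linear h -> linear (fun x => f x - h x).
Proof. by move=> fl hl; apply: lin_add => //; exact: lin_opp. Qed.
Lemma lin_scale (V W : lmodType F) (f : V -> W) b : linear f -> linear (fun x => b *: f x).
Proof. by move=> fl a x y; rewrite fl scalerDr !scalerA mulrC. Qed.
Lemma lin_id (V : lmodType F) : linear (fun x : V => x).
Proof. by []. Qed.
Lemma lin_mull (V : lmodType F) (A : algType F) (f : V -> A) b :
  linear f -> linear (fun x => b * f x).
Proof. by move=> fl a x y; rewrite fl mulrDr scalerAr. Qed.
Lemma lin_mulr (V : lmodType F) (A : algType F) (f : V -> A) b :
  linear f -> linear (fun x => f x * b).
Proof. by move=> fl a x y; rewrite fl mulrDl scalerAl. Qed.
Lemma lin_tensl (U V W : lmodType F) (f : U -> V) (w : W) :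
  linear f -> linear (fun x => f x ⊗ w).
Proof. by move=> fl a x y; rewrite fl tensDl tensZl. Qed.
Lemma lin_tensr (U V W : lmodType F) (f : U -> W) (v : V) :
  linear f -> linear (fun x => v ⊗ f x).
Proof. by move=> fl a x y; rewrite fl tensDr tensZr. Qed.
End LinearClosure.

Section TensorLift.
Variables (F : fieldType).

Lemma tlift_lin (V W M : lmodType F) (b : V -> W -> M) :
  bilinear_map b -> linear (tlift b).
Proof. by case/tlift_spec. Qed.
Lemma tliftE (V W M : lmodType F) (b : V -> W -> M) v w :
  bilinear_map b -> tlift b (v ⊗ w) = b v w.
Proof. by case/tlift_spec. Qed.


Lemma tlift_comp (V W M N : lmodType F) (b : V -> W -> M) (f : M -> N) x :
  bilinear_map b -> linear f -> f (tlift b x) = tlift (fun v w => f (b v w)) x.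
Proof.
move=> bb fl.
have fb : bilinear_map (fun v w => f (b v w)).
  by split=> [w|v]; apply: (lin_comp fl); [exact: bb.1|exact: bb.2].
elim/tens_ind: x => [v w|a x y Ex Ey]; first by rewrite !tliftE.
by rewrite (tlift_lin bb) (tlift_lin fb) fl Ex Ey.
Qed.

Lemma tlift_linl (U V W M : lmodType F) (b : U -> V -> W -> M) x :
  (forall u, bilinear_map (b u)) -> (forall v w, linear (fun u => b u v w)) ->
  linear (fun u => tlift (b u) x).
Proof.
move=> bb bl; elim/tens_ind: x => [v w|c x y Ex Ey] a u u'.
  by rewrite !tliftE // bl.
rewrite !(tlift_lin (bb _)) Ex Ey !scalerDr !scalerA (mulrC c) !addrA.
by congr (_ + _); rewrite addrAC.
Qed.

Lemma tmap_bilin (V V' W W' : lmodType F) (f : V -> V') (h : W -> W') :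
  linear f -> linear h -> bilinear_map (fun v w => f v ⊗ h w).
Proof. by move=> fl hl; split=> ?; [exact: lin_tensl|exact: lin_tensr]. Qed.
Lemma tmap_lin (V V' W W' : lmodType F) (f : V -> V') (h : W -> W') :
  linear f -> linear h -> linear (tmap f h).
Proof. by move=> fl hl; apply: tlift_lin; exact: tmap_bilin. Qed.
Lemma tmapE (V V' W W' : lmodType F) (f : V -> V') (h : W -> W') v w :
  linear f -> linear h -> tmap f h (v ⊗ w) = f v ⊗ h w.
Proof. by move=> fl hl; apply: tliftE; exact: tmap_bilin. Qed.

Lemma tmap_morph (A A' B B' : algType F) (f : A -> A') (h : B -> B') :
  linear f -> linear h -> GRing.monoid_morphism f -> GRing.monoid_morphism h ->
  GRing.monoid_morphism (tmap f h).
Proof.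
move=> fl hl [f1 fM] [h1 hM]; split; first by rewrite tmapE // f1 h1.
elim/tens_ind => [a b|c x y Ex Ey] z; last first.
  by rewrite mulrDl -scalerAl !(tmap_lin fl hl) Ex Ey mulrDl -scalerAl.
elim/tens_ind: z => [a' b'|c x y Ex Ey]; last first.
  by rewrite mulrDr -scalerAr !(tmap_lin fl hl) Ex Ey mulrDr -scalerAr.
by rewrite tensM !tmapE // fM hM tensM.
Qed.

Lemma tlift_morph (A B C : algType F) (b : A -> B -> C) : bilinear_map b ->
  b 1 1 = 1 -> (forall a a' c c', b (a * a') (c * c') = b a c * b a' c') ->
  GRing.monoid_morphism (tlift b).
Proof.
move=> bb b1 bM; have bl := tlift_lin bb; split; first by rewrite tliftE.
elim/tens_ind => [x y|c x y Ex Ey] z; last first.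
  by rewrite mulrDl -scalerAl !bl Ex Ey mulrDl -scalerAl.
elim/tens_ind: z => [a' b'|c z z' Ex Ey]; last first.
  by rewrite mulrDr -scalerAr !bl Ex Ey mulrDr -scalerAr.
by rewrite tensM !tliftE.
Qed.

End TensorLift.

(** * Maps of bounded degree and their extension to completions *)

Section Bounded.
Variables (F : fieldType).
Implicit Types A B C : filtAlg F.

(* Linear maps shifting degrees by a bounded amount, hence continuous. *)
Definition fshift A B (d : int) (f : A -> B) :=
  linear f /\ forall k x, fil k x -> fil (k + d) (f x).
Definition bdd A B (f : A -> B) := exists d, fshift d f.

Lemma bdd_lin A B (f : A -> B) : bdd f -> linear f.
Proof. by case=> d []. Qed.

Lemma fshift_mono A B (f : A -> B) d e : d <= e -> fshift d f -> fshift e f.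
Proof.
move=> de [fl fs]; split=> // k x kx; apply: fil_mono (fs _ _ kx).
by rewrite lerD2l.
Qed.

Lemma bdd_id A : bdd (fun x : A => x).
Proof. by exists 0; split=> // k x; rewrite addr0. Qed.
Lemma bdd_comp A B C (f : B -> C) (h : A -> B) :
  bdd f -> bdd h -> bdd (fun x => f (h x)).
Proof.
move=> [d [fl fs]] [e [hl hs]]; exists (e + d); split; first exact: lin_comp.
by move=> k x /hs/fs; rewrite addrA.
Qed.
Lemma bdd_add A B (f h : A -> B) : bdd f -> bdd h -> bdd (fun x => f x + h x).
Proof.
move=> [d fs] [e hs]; exists (Num.max d e).
have [[fl fs'] [hl hs']] : fshift (Num.max d e) f /\ fshift (Num.max d e) h.
  by split; [apply: fshift_mono fs|apply: fshift_mono hs]; rewrite le_max lexx ?orbT.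
split; first exact: lin_add.
by move=> k x kx; apply: filD; [exact: fs'|exact: hs'].
Qed.
Lemma bdd_opp A B (f : A -> B) : bdd f -> bdd (fun x => - f x).
Proof.
move=> [d [fl fs]]; exists d; split; first exact: lin_opp.
by move=> k x /fs; exact: filN.
Qed.
Lemma bdd_sub A B (f h : A -> B) : bdd f -> bdd h -> bdd (fun x => f x - h x).
Proof. by move=> fb hb; apply: bdd_add => //; exact: bdd_opp. Qed.
Lemma bdd_mull A B (f : A -> B) b : bdd f -> bdd (fun x => b * f x).
Proof.
move=> [d [fl fs]]; have [e be] := fil_exh b.
exists (e + d); split; first exact: lin_mull.
by move=> k x /fs kx; rewrite addrCA; exact: fil_mul.
Qed.
Lemma bdd_mulr A B (f : A -> B) b : bdd f -> bdd (fun x => f x * b).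
Proof.
move=> [d [fl fs]]; have [e be] := fil_exh b.
exists (d + e); split; first exact: lin_mulr.
by move=> k x /fs kx; rewrite addrA; exact: fil_mul.
Qed.
Lemma bdd_sum A B (I : Type) (r : seq I) (f : I -> A -> B) :
  (forall i, bdd (f i)) -> bdd (fun x => \sum_(i <- r) f i x).
Proof.
move=> fb; elim: r => [|i r [d [lr sr]]].
  by exists 0; split=> [a x y|k x _]; rewrite !big_nil ?scaler0 ?addr0 //; exact: fil0.
have [e se] := bdd_add (fb i) (ex_intro _ d (conj lr sr)).
by exists e; split=> [a x y|k x /(se.2)]; rewrite !big_cons //; exact: se.1.
Qed.

Lemma bdd_cin A : bdd (@cin F A : A -> compl A).
Proof.
exists 0; split=> [a x y|k x kx]; first by rewrite cinD cinZ.
by rewrite addr0; exact/cfil_in.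
Qed.

Lemma fil_tr' A k (x y : A) : fil k (x - y) -> fil k y -> fil k x.
Proof. by move=> h /(filD h); rewrite subrK. Qed.

Lemma sep_eq A (x y : A) : separated A -> (forall k, fil k (x - y)) -> x = y.
Proof. by move=> sA h; apply/eqP; rewrite -subr_eq0; apply/eqP/sA. Qed.

Lemma cin_near A (X : compl A) k : exists x, fil k (X - cin x : compl A).
Proof. by exists (repr X k); exact: repr_near. Qed.

Lemma cin_near_in A (X : compl A) n k : fil n X -> k <= n ->
  exists2 x, fil n x & fil k (X - cin x : compl A).
Proof.
move=> nX kn; have [x xk] := cin_near X k; exists x => //.
apply/cfil_in; rewrite -[cin x](subrK X); apply: (filD (A := compl A)) => //.
by apply: (fil_mono (f := compl A) kn); exact: (filBC (A := compl A)).
Qed.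

Lemma fil_sum A k (I : Type) (r : seq I) (P : pred I) (f : I -> A) :
  (forall i, P i -> fil k (f i)) -> fil k (\sum_(i <- r | P i) f i).
Proof.
by move=> h; apply: (big_ind (fil k)) => [|x y|]; [exact: fil0|exact: filD|].
Qed.
Lemma fil_sum_in A k (I : eqType) (r : seq I) (f : I -> A) :
  (forall i, i \in r -> fil k (f i)) -> fil k (\sum_(i <- r) f i).
Proof. by move=> h; rewrite big_seq; exact: fil_sum. Qed.

Section Ext.
Variables (A B : filtAlg F) (f : A -> B).
Hypotheses (cB : complete B) (sB : separated B).

(** [cext_spec] concerns maps that preserve degrees, whereas pairing with a word raises them by up
    to its length. The degree of the limit is obtained along with its existence. *)
Lemma converges_shift d (X : compl A) : fshift d f -> exists y,
  converges f X y /\ forall k, fil k X -> fil (k + d) y.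
Proof.
move=> [fl fs].
(* Sampling [X] at precision [j - d] compensates the shift and makes the images a coherent
   family. *)
have hf j k : j <= k -> fil k (f (repr X (j - d)) - f (repr X (k - d))).
  move=> jk; rewrite -(linB fl) -[k](subrK d); apply: fs.
  by rewrite subrK; apply: coh_prop; rewrite lerD2r.
have [y hy] := cB hf.
have cv : converges f X y.
  move=> n; exists (n - d) => x hx; apply: fil_tr (filBC (hy n)).
  rewrite -(linB fl) -[n](subrK d); apply: fs; rewrite subrK.
  apply/cfil_in; rewrite cinD cinN.
  exact: (@fil_tr _ (compl A)) (filBC (A := compl A) hx) (repr_near _ X).
exists y; split=> // k kX; have [m hm] := cv (k + d).
have [||x xk] := @cin_near_in A X k (Num.min m k) => //; first by rewrite ge_min lexx orbT.
move=> hx; rewrite -[y]opprK -[- y](addKr (f x)); apply: filN.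
apply: filD; first by apply: filN; exact: fs.
by apply: hm; apply: cfil_mono hx; rewrite ge_min lexx.
Qed.

Lemma converges_unique (X : compl A) y z : converges f X y -> converges f X z -> y = z.
Proof.
move=> hy hz; apply: (sep_eq sB) => n.
have [k hk] := hy n; have [l hl] := hz n.
have [x hx] := cin_near X (Num.min k l).
apply: (@fil_tr _ _ _ (f x)).
  by apply: filBC; apply: hk; apply: cfil_mono hx; rewrite ge_min lexx.
by apply: hl; apply: cfil_mono hx; rewrite ge_min lexx orbT.
Qed.

Lemma converges_cext (X : compl A) y : converges f X y -> cext f X = y.
Proof. by move=> hy; apply: xget_unique => //= z hz; exact: converges_unique hz hy. Qed.

Hypothesis fb : bdd f.

Lemma cext_converges (X : compl A) : converges f X (cext f X).
Proof.
have [d fs] := fb; have [y [hy _]] := converges_shift X fs.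
by rewrite (converges_cext hy).
Qed.

Lemma cext_cin x : cext f (cin x) = f x.
Proof.
apply: converges_cext => n; have [d [fl fs]] := fb.
exists (n - d) => y; rewrite -cinN -cinD => /cfil_in hy.
by apply: filBC; rewrite -(linB fl) -[n](subrK d); exact: fs.
Qed.

Lemma cext_fshift d : fshift d f -> fshift d (cext f : compl A -> B).
Proof.
move=> fs; split=> [a X Y|k X kX]; last first.
  have [y [hy hk]] := converges_shift X fs.
  by rewrite (converges_cext hy); exact: hk.
apply: converges_cext => n.
have [k hk] := cext_converges X n; have [l hl] := cext_converges Y n.
pose m := Num.min k l; have [fl fs'] := fs.
exists (Num.min m (n - d)) => z hz.
have [x hx] := cin_near X (Num.min m (n - d)); have [y hy] := cin_near Y (Num.min m (n - d)).
have mm : Num.min m (n - d) <= k /\ Num.min m (n - d) <= l by rewrite /m; lia.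
apply: (@fil_tr _ _ _ (f (a *: x + y))).
  rewrite -(linB fl) -[n](subrK d); apply: fs'.
  have : fil (Num.min m (n - d)) (cin z - cin (a *: x + y) : compl A).
    apply: (@fil_tr _ (compl A) _ (a *: X + Y)); first exact: (filBC (A := compl A)).
    rewrite cinD cinZ opprD addrACA -scalerBr.
    by apply: (filD (A := compl A)) => //; exact: (filZ (A := compl A)).
  rewrite -cinN -cinD => /cfil_in; apply: fil_mono; lia.
rewrite fl opprD addrACA -scalerBr; apply: filD.
  by apply: filZ; apply: hk; apply: cfil_mono hx; case: mm.
by apply: hl; apply: cfil_mono hy; case: mm.
Qed.

Lemma bdd_cext : bdd (cext f : compl A -> B).
Proof. by have [d fs] := fb; exists d; exact: cext_fshift. Qed.
End Ext.

(** Density of [A] in its completion. Through it every identity between series below is reduced to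
    pure tensors. *)
Lemma bdd_eq A B (f h : compl A -> B) : separated B -> bdd f -> bdd h ->
  (forall x, f (cin x) = h (cin x)) -> f =1 h.
Proof.
move=> sB fb hb fh X; have [d [fl fs]] := bdd_sub fb hb.
apply: (sep_eq sB) => k; have [x hx] := cin_near X (k - d).
have -> : f X - h X = f (X - cin x) - h (X - cin x).
  by rewrite (linB (bdd_lin fb)) (linB (bdd_lin hb)) fh opprB addrA subrK.
by rewrite -[k](subrK d); exact: fs.
Qed.

End Bounded.

Definition antimorphism (A B : pzRingType) (f : A -> B) : Prop :=
  f 1 = 1 /\ forall x y, f (x * y) = f y * f x.

Section TensorAnti.
Variables (F : fieldType).

Lemma tlift_anti (A B C : algType F) (b : A -> B -> C) : bilinear_map b ->
  b 1 1 = 1 -> (forall a a' c c', b (a * a') (c * c') = b a' c' * b a c) ->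
  antimorphism (tlift b).
Proof.
move=> bb b1 bM; have bl := tlift_lin bb; split; first by rewrite tliftE.
elim/tens_ind => [x y|c x y Ex Ey] z; last first.
  by rewrite mulrDl -scalerAl !bl Ex Ey mulrDr -scalerAr.
elim/tens_ind: z => [a' b'|c z z' Ex Ey]; last first.
  by rewrite mulrDr -scalerAr !bl Ex Ey mulrDl -scalerAl.
by rewrite tensM !tliftE.
Qed.
End TensorAnti.

Section ExtMorph.
Variables (F : fieldType) (A B : filtAlg F) (f : A -> B).
Hypotheses (cB : complete B) (sB : separated B) (fb : bdd f).

(** Density is used in one variable at a time: for fixed [Y] both sides are bounded in [X], so [X]
    may be taken in [A], and then likewise [Y]. *)
Lemma cext_morph : GRing.monoid_morphism f ->
  GRing.monoid_morphism (cext f : compl A -> B).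
Proof.
move=> [f1 fM]; split; first by have := cext_cin sB fb 1; rewrite f1.
have eb := bdd_cext cB sB fb.
move=> X Y; apply: (@bdd_eq _ _ _ (fun X : compl A => cext f (X * Y))
  (fun X : compl A => cext f X * cext f Y)) => // [||x].
- by apply: (bdd_comp (f := cext f : compl A -> B)) => //; apply: bdd_mulr; exact: bdd_id.
- exact: bdd_mulr.
apply: (@bdd_eq _ _ _ (fun Y : compl A => cext f ((cin x : compl A) * Y))
  (fun Y : compl A => cext f (cin x) * cext f Y)) => // [||y].
- by apply: (bdd_comp (f := cext f : compl A -> B)) => //; apply: bdd_mull; exact: bdd_id.
- exact: bdd_mull.
by rewrite -cinM !cext_cin.
Qed.

Lemma cext_anti : antimorphism f -> antimorphism (cext f : compl A -> B).
Proof.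
move=> [f1 fM]; split; first by have := cext_cin sB fb 1; rewrite f1.
have eb := bdd_cext cB sB fb.
move=> X Y; apply: (@bdd_eq _ _ _ (fun X : compl A => cext f (X * Y))
  (fun X : compl A => cext f Y * cext f X)) => // [||x].
- by apply: (bdd_comp (f := cext f : compl A -> B)) => //; apply: bdd_mulr; exact: bdd_id.
- exact: bdd_mull.
apply: (@bdd_eq _ _ _ (fun Y : compl A => cext f ((cin x : compl A) * Y))
  (fun Y : compl A => cext f Y * cext f (cin x))) => // [||y].
- by apply: (bdd_comp (f := cext f : compl A -> B)) => //; apply: bdd_mull; exact: bdd_id.
- exact: bdd_mulr.
by rewrite -cinM !cext_cin.
Qed.
End ExtMorph.

Section TensorExt.
Variables (F : fieldType) (V W : algType F) (A B : filtAlg F).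

(** The bound is uniform in the argument from [V]. This is what continuity on [rtens V A] requires,
    where only the factor [A] contributes to the degree. *)
Definition bshift (d : int) (b : V -> A -> B) :=
  bilinear_map b /\ forall k v u, fil k u -> fil (k + d) (b v u).
Definition bshift_l (d : int) (b : A -> V -> B) :=
  bilinear_map b /\ forall k u v, fil k u -> fil (k + d) (b u v).
Definition tshift (d : int) (f : V -> W -> A -> B) :=
  [/\ forall w u, linear (fun v => f v w u), forall v u, linear (fun w => f v w u),
      forall v w, linear (f v w) & forall k v w u, fil k u -> fil (k + d) (f v w u)].

Lemma tlift_fshift d b : bshift d b -> fshift d (tlift b : rtens V A -> B).
Proof.
move=> [bb bs]; split; first exact: tlift_lin.
move=> k x [s [sP ->]]; rewrite (lin_sum (tlift_lin bb)); apply: fil_sum_in => p /sP[_ kp].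
by rewrite tliftE //; exact: bs.
Qed.

Lemma tlift_fshift_l d b : bshift_l d b -> fshift d (tlift b : ltens A V -> B).
Proof.
move=> [bb bs]; split; first exact: tlift_lin.
move=> k x [s [sP ->]]; rewrite (lin_sum (tlift_lin bb)); apply: fil_sum_in => p /sP[kp _].
by rewrite tliftE //; exact: bs.
Qed.

End TensorExt.

Section Tri.
Variables (F : fieldType) (V W : algType F) (A B : filtAlg F).
Implicit Types (f : V -> W -> A -> B).

Lemma tshift_bil f d u : tshift d f -> bilinear_map (fun v w => f v w u).
Proof. by case=> f1 f2 _ _; split=> [w|v]. Qed.

Lemma tshift_bshift f d : tshift d f ->
  bshift d (fun (vw : V ⊗ W) u => tlift (fun v w => f v w u) vw).
Proof.
move=> ft; have [f1 f2 f3 fs] := ft; split.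
  split=> [u|vw]; first exact: tlift_lin (tshift_bil _ ft).
  by apply: tlift_linl => [u|v w]; [exact: tshift_bil ft|exact: f3].
move=> k vw u ku; elim/tens_ind: vw => [v w|a x y Ex Ey].
  by rewrite tliftE; [exact: fs|exact: tshift_bil ft].
by rewrite (tlift_lin (tshift_bil _ ft)); apply: filD => //; exact: filZ.
Qed.

Lemma tlift3_fshift f d : tshift d f -> fshift d (tlift3 f : rtens (V ⊗ W) A -> B).
Proof. by move=> /tshift_bshift/tlift_fshift. Qed.

Lemma tlift3E f d v w u : tshift d f -> tlift3 f (v ⊗ w ⊗ u) = f v w u.
Proof.
move=> ft; rewrite /tlift3 tliftE; last by have [] := tshift_bshift ft.
by rewrite tliftE //; exact: tshift_bil ft.
Qed.

Hypotheses (cB : complete B) (sB : separated B).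

Lemma ext_fshift (b : V -> A -> B) d : bshift d b ->
  fshift d (@cext F (rtens V A) B (tlift b) : compl (rtens V A) -> B).
Proof. by move=> /tlift_fshift fs; apply: cext_fshift => //; exists d. Qed.
Lemma ext_bdd (b : V -> A -> B) d : bshift d b -> bdd (@cext F (rtens V A) B (tlift b) : compl (rtens V A) -> B).
Proof. by move=> /ext_fshift; exists d. Qed.
Lemma extE (b : V -> A -> B) d v u : bshift d b ->
  @cext F (rtens V A) B (tlift b) (cin (v ⊗ u : rtens V A)) = b v u.
Proof.
move=> bs; rewrite cext_cin //; last by exists d; exact: tlift_fshift.
by rewrite tliftE; case: bs.
Qed.

Lemma extl_fshift (b : A -> V -> B) d : bshift_l d b ->
  fshift d (@cext F (ltens A V) B (tlift b) : compl (ltens A V) -> B).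
Proof. by move=> /tlift_fshift_l fs; apply: cext_fshift => //; exists d. Qed.
Lemma extl_bdd (b : A -> V -> B) d : bshift_l d b -> bdd (@cext F (ltens A V) B (tlift b) : compl (ltens A V) -> B).
Proof. by move=> /extl_fshift; exists d. Qed.
Lemma extlE (b : A -> V -> B) d v u : bshift_l d b ->
  @cext F (ltens A V) B (tlift b) (cin (u ⊗ v : ltens A V)) = b u v.
Proof.
move=> bs; rewrite cext_cin //; last by exists d; exact: tlift_fshift_l.
by rewrite tliftE; case: bs.
Qed.

Lemma ext3_fshift f d : tshift d f ->
  fshift d (@cext F (rtens (V ⊗ W) A) B (tlift3 f) : compl (rtens (V ⊗ W) A) -> B).
Proof. by move=> /tlift3_fshift fs; apply: cext_fshift => //; exists d. Qed.
Lemma ext3_bdd f d : tshift d f ->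
  bdd (@cext F (rtens (V ⊗ W) A) B (tlift3 f) : compl (rtens (V ⊗ W) A) -> B).
Proof. by move=> /ext3_fshift; exists d. Qed.
Lemma ext3E f d v w u : tshift d f ->
  @cext F (rtens (V ⊗ W) A) B (tlift3 f) (cin (v ⊗ w ⊗ u : rtens (V ⊗ W) A)) = f v w u.
Proof.
move=> ft; rewrite cext_cin //; last by exists d; exact: tlift3_fshift.
exact: tlift3E ft.
Qed.

Lemma eq_ext (f h : compl (rtens V A) -> B) : bdd f -> bdd h ->
  (forall v u, f (cin (v ⊗ u : rtens V A)) = h (cin (v ⊗ u : rtens V A))) -> f =1 h.
Proof.
move=> fb hb fh; apply: bdd_eq => //.
have cl := bdd_lin (bdd_cin (rtens V A)).
apply: (@eq_tens_lin F V A B (fun x => f (cin (x : rtens V A))) (fun x => h (cin (x : rtens V A)))) => //.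
  exact: lin_comp (bdd_lin fb) cl.
exact: lin_comp (bdd_lin hb) cl.
Qed.

Lemma eq_extl (f h : compl (ltens A V) -> B) : bdd f -> bdd h ->
  (forall v u, f (cin (u ⊗ v : ltens A V)) = h (cin (u ⊗ v : ltens A V))) -> f =1 h.
Proof.
move=> fb hb fh; apply: bdd_eq => //.
have cl := bdd_lin (bdd_cin (ltens A V)).
apply: (@eq_tens_lin F A V B (fun x => f (cin (x : ltens A V))) (fun x => h (cin (x : ltens A V)))) => //.
  exact: lin_comp (bdd_lin fb) cl.
exact: lin_comp (bdd_lin hb) cl.
Qed.

Lemma eq_ext3 (f h : compl (rtens (V ⊗ W) A) -> B) : bdd f -> bdd h ->
  (forall v w u, f (cin (v ⊗ w ⊗ u : rtens (V ⊗ W) A)) = h (cin (v ⊗ w ⊗ u : rtens (V ⊗ W) A))) ->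
  f =1 h.
Proof.
move=> fb hb fh; apply: bdd_eq => //.
have cl := bdd_lin (bdd_cin (rtens (V ⊗ W) A)).
pose f' (x : V ⊗ W ⊗ A) : B := f (cin (x : rtens (V ⊗ W) A)).
pose h' (x : V ⊗ W ⊗ A) : B := h (cin (x : rtens (V ⊗ W) A)).
have fl : linear f' by exact: lin_comp (bdd_lin fb) cl.
have hl : linear h' by exact: lin_comp (bdd_lin hb) cl.
move=> x; apply: (@eq_tens_lin F (V ⊗ W)%type A B f' h') => // vw u.
apply: (@eq_tens_lin F V W B (fun vw => f' (vw ⊗ u)) (fun vw => h' (vw ⊗ u))) => [||v w].
- by apply: (lin_comp fl); exact: lin_tensl.
- by apply: (lin_comp hl); exact: lin_tensl.
exact: fh.
Qed.

End Tri.

Lemma cin1 (F : fieldType) (A : filtAlg F) : (1 : compl A) = cin 1.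
Proof. by []. Qed.
Lemma tens1 (F : fieldType) (A B : algType F) : (1 : A ⊗ B) = 1 ⊗ 1.
Proof. by []. Qed.
Lemma rtens1 (F : fieldType) (A : algType F) (B : filtAlg F) : (1 : rtens A B) = 1 ⊗ 1.
Proof. by []. Qed.

Section Cmap.
Variables (F : fieldType) (Uh : filtAlg F).

Lemma cmap_bshift (V W : algType F) (phi : V -> W) : linear phi ->
  bshift 0 (fun v (u : Uh) => cin (phi v ⊗ u : rtens W Uh) : compl (rtens W Uh)).
Proof.
move=> pl; have cl := bdd_lin (bdd_cin (rtens W Uh)); split.
  by split=> [u|v]; apply: (lin_comp cl); [exact: lin_tensl|exact: lin_tensr].
by move=> k v u ku; rewrite addr0; apply/cfil_in; exact: tspan_gen.
Qed.

Lemma cmap_tlift (V W : algType F) (phi : V -> W) : linear phi ->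
  (fun t : V ⊗ Uh => cin (tmap phi id t : rtens W Uh) : compl (rtens W Uh)) =
  tlift (fun v (u : Uh) => cin (phi v ⊗ u : rtens W Uh) : compl (rtens W Uh)).
Proof.
move=> pl; apply/funext => t; rewrite /tmap (tlift_comp (f := @cin F (rtens W Uh) : _ -> compl (rtens W Uh))) //.
  exact: (tmap_bilin (h := @idfun Uh)).
exact: bdd_lin (bdd_cin _).
Qed.

Lemma cmap_fshift (V W : algType F) (phi : V -> W) : linear phi ->
  fshift 0 (cmap_l (Uh := Uh) phi : compl (rtens V Uh) -> compl (rtens W Uh)).
Proof.
move=> pl; rewrite /cmap_l cmap_tlift //; apply: ext_fshift (cmap_bshift pl).
  exact: compl_complete.
exact: compl_separated.
Qed.

Lemma cmap_bdd (V W : algType F) (phi : V -> W) : linear phi ->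
  bdd (cmap_l (Uh := Uh) phi : compl (rtens V Uh) -> compl (rtens W Uh)).
Proof. by move=> /cmap_fshift; exists 0. Qed.

Lemma cmapE (V W : algType F) (phi : V -> W) v u : linear phi ->
  cmap_l (Uh := Uh) phi (cin (v ⊗ u : rtens V Uh)) = cin (phi v ⊗ u : rtens W Uh).
Proof.
move=> pl; rewrite /cmap_l cmap_tlift //; apply: (extE _ _ _ (cmap_bshift pl)).
exact: compl_separated.
Qed.

Lemma cmap_morph (V W : algType F) (phi : V -> W) : linear phi ->
  GRing.monoid_morphism phi ->
  GRing.monoid_morphism (cmap_l (Uh := Uh) phi : compl (rtens V Uh) -> compl (rtens W Uh)).
Proof.
move=> pl pm; apply: cext_morph; [exact: compl_complete|exact: compl_separated| |].
  rewrite cmap_tlift //; exists 0; exact: tlift_fshift (cmap_bshift pl).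
have [m1 mM] := tmap_morph (h := @idfun Uh) pl (@lin_id _ Uh) pm (conj erefl (fun _ _ => erefl)).
split; first by rewrite m1.
by move=> x y; rewrite mM cinM.
Qed.

End Cmap.

(** * Inversion by the geometric series *)

Section Inverse.
Variables (F : fieldType) (B : filtAlg F).
Hypotheses (cB : complete B) (sB : separated B).

Lemma fil_exp (x : B) n : fil (-1) x -> fil (- n%:Z) (x ^+ n).
Proof.
move=> hx; elim: n => [|n IHn]; first by rewrite expr0 oppr0; exact: fil_one.
by rewrite exprS intS opprD; exact: fil_mul.
Qed.

Lemma fil_unit (x : B) : fil (-1) x ->
  exists y, [/\ fil 0 y, y * (1 - x) = 1 & (1 - x) * y = 1].
Proof.
move=> hx; pose s (n : nat) := \sum_(i < n) x ^+ i.
have s0 n : fil 0 (s n).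
  by apply: fil_sum => i _; apply: fil_mono (fil_exp i hx); lia.
have sm m n : (m <= n)%N -> fil (- m%:Z) (s n - s m).
  move=> mn; rewrite /s -(subnKC mn) big_split_ord /= addrAC subrr add0r.
  by apply: fil_sum => i _; apply: fil_mono (fil_exp (m + i) hx); lia.
(* For k <= 0 the partial sum of index |k| is correct modulo degree k; for k > 0 any partial sum
   serves, since all of them lie in degree 0. *)
have [|y hy] := cB (s := fun k => s `|k|%N).
  move=> j k jk; have [k0|k0] := leP k 0.
    have -> : k = - (`|k|%N)%:Z by lia.
    by rewrite abszN absz_nat; apply: sm; lia.
  by apply: (fil_mono (k := 0)); [lia|apply: filB].
have y0 : fil 0 y by apply: fil_tr' (hy 0) _; exact: s0.
have sx n : s n * (1 - x) = 1 - x ^+ n.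
  rewrite mulr_suml; elim: n => [|n IHn]; first by rewrite big_ord0 expr0 subrr.
  by rewrite big_ord_recr /= IHn mulrBr mulr1 -exprSr addrA subrK.
have xs n : (1 - x) * s n = 1 - x ^+ n.
  rewrite mulr_sumr; elim: n => [|n IHn]; first by rewrite big_ord0 expr0 subrr.
  by rewrite big_ord_recr /= IHn mulrBl mul1r -exprS addrA subrK.
have x0 : fil 0 (1 - x).
  by apply: filB; [exact: fil_one|apply: fil_mono hx].
have yn (n : nat) : fil (- n%:Z) (y - s n).
  by have := hy (- n%:Z); rewrite abszN absz_nat.
have small (z : B) : (forall n : nat, fil (- n%:Z) z) -> z = 0.
  move=> hz; apply: sB => k; have [k0|k0] := leP k 0.
    by have := hz `|k|%N; congr (fil _ _); lia.
  by apply: fil_mono (hz 0%N); lia.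
exists y; split=> //; apply/eqP; rewrite -subr_eq0; apply/eqP/small => n.
  have -> : y * (1 - x) - 1 = (y - s n) * (1 - x) - x ^+ n.
    by rewrite mulrBl sx opprB addrA [RHS]addrAC addrK.
  apply: filB; last exact: fil_exp.
  by have := fil_mul (yn n) x0; rewrite addr0.
have -> : (1 - x) * y - 1 = (1 - x) * (y - s n) - x ^+ n.
  by rewrite mulrBr xs opprB addrA [RHS]addrAC addrK.
apply: filB; last exact: fil_exp.
by have := fil_mul x0 (yn n); rewrite add0r.
Qed.
End Inverse.

(** * Linear spans and deletion of one letter from a word *)

Section Span.
Variables (F : fieldType) (V : lmodType F).

(** Linear combinations built one term at a time: [elim] on membership is the induction used
    throughout, and no coefficients or index types have to be named. *)
Inductive spanp (Q : V -> Prop) : V -> Prop :=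
| span0 : spanp Q 0
| spanS a x y : Q x -> spanp Q y -> spanp Q (a *: x + y).

Implicit Types (Q : V -> Prop).

Lemma span_gen Q x : Q x -> spanp Q x.
Proof. by move=> Qx; rewrite -[x]addr0 -[x]scale1r; apply: spanS => //; exact: span0. Qed.
Lemma spanD Q x y : spanp Q x -> spanp Q y -> spanp Q (x + y).
Proof.
move=> h hy; elim: h => [|a u v Qu _ IH]; first by rewrite add0r.
by rewrite -addrA; exact: spanS.
Qed.
Lemma spanZ Q a x : spanp Q x -> spanp Q (a *: x).
Proof.
elim=> [|b u v Qu _ IH]; first by rewrite scaler0; exact: span0.
by rewrite scalerDr scalerA; exact: spanS.
Qed.
Lemma spanN Q x : spanp Q x -> spanp Q (- x).
Proof. by rewrite -scaleN1r; exact: spanZ. Qed.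
Lemma spanB Q x y : spanp Q x -> spanp Q y -> spanp Q (x - y).
Proof. by move=> hx /spanN; exact: spanD. Qed.
Lemma span_sum Q (I : Type) (r : seq I) (f : I -> V) :
  (forall i, spanp Q (f i)) -> spanp Q (\sum_(i <- r) f i).
Proof.
by move=> h; apply: (big_ind (spanp Q)) => //; [exact: span0|exact: spanD].
Qed.
End Span.

Lemma span_map (F : fieldType) (V W : lmodType F) (Q : V -> Prop) (Q' : W -> Prop)
    (f : V -> W) x : linear f ->
  (forall x, Q x -> spanp Q' (f x)) -> spanp Q x -> spanp Q' (f x).
Proof.
move=> fl fQ; elim=> [|a u v Qu _ IH]; first by rewrite lin0 //; exact: span0.
by rewrite fl; apply: spanD => //; apply: spanZ; exact: fQ.
Qed.

Lemma span_sub (F : fieldType) (V : lmodType F) (Q Q' : V -> Prop) x :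
  (forall x, Q x -> spanp Q' x) -> spanp Q x -> spanp Q' x.
Proof. exact: (span_map (f := id)). Qed.

Lemma span_ind_lin (F : fieldType) (V W : lmodType F) (Q : V -> Prop) (f h : V -> W) x :
  linear f -> linear h -> (forall x, Q x -> f x = h x) -> spanp Q x -> f x = h x.
Proof.
move=> fl hl fh; elim=> [|a u v Qu _ IH]; first by rewrite !lin0.
by rewrite fl hl fh // IH.
Qed.

(** All deletions of one letter, counted by position: a repeated letter gives several entries, as
    the Leibniz rule demands. *)
Fixpoint rems (T : Type) (s : seq T) : seq (T * seq T) :=
  if s is x :: s' then (x, s') :: [seq (p.1, x :: p.2) | p <- rems s'] else [::].

Lemma size_rems (T : Type) (s : seq T) : size (rems s) = size s.
Proof. by elim: s => //= x s IHs; rewrite size_map IHs. Qed.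

Lemma rems_size (T : eqType) (s : seq T) p : p \in rems s -> size s = (size p.2).+1.
Proof.
elim: s p => //= x s IHs p; rewrite inE => /orP[/eqP -> //|/mapP[q /IHs -> ->] //].
Qed.


Lemma rems_map (T T' : Type) (f : T -> T') (s : seq T) :
  rems [seq f x | x <- s] = [seq (f p.1, [seq f x | x <- p.2]) | p <- rems s].
Proof. by elim: s => //= x s ->; rewrite -!map_comp. Qed.

(** * Triangular decomposition in an abstract algebra and leading parts of pairings of words *)

Section Triangular.
Variables (F : fieldType) (A : algType F) (TP TN : eqType) (eP : TP -> A) (eN : TN -> A)
  (L : A -> Prop) (c : TN -> TP -> A).
Hypotheses
  (LP : forall l p, L l -> exists p', l * eP p - eP p * l = eP p')
  (NL : forall n l, L l -> exists n', eN n * l - l * eN n = eN n')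
  (NP : forall n p, L (c n p) /\
    exists p' n', eN n * eP p - eP p * eN n = eP p' + c n p + eN n').

Definition isP x := exists p, x = eP p.
Definition isN x := exists n, x = eN n.

Definition inw (Q : A -> Prop) (w : seq A) := forall x, x \in w -> Q x.

Lemma inw_cons Q x w : inw Q (x :: w) <-> Q x /\ inw Q w.
Proof.
split=> [h|[Qx Qw] y]; last by rewrite inE => /orP[/eqP -> |/Qw].
by split=> [|y yw]; apply: h; rewrite inE ?eqxx ?yw ?orbT.
Qed.
Lemma inw_cat Q v w : inw Q v -> inw Q w -> inw Q (v ++ w).
Proof. by move=> Qv Qw x; rewrite mem_cat => /orP[/Qv|/Qw]. Qed.

Notation pr w := (\prod_(x <- w) x).
Notation prP v := (\prod_(x <- v) eP x).
Notation prN w := (\prod_(x <- w) eN x).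

Definition wd Q (z : A) := exists2 w, inw Q w & z = pr w.
Definition wdle Q e (z : A) := exists w, [/\ inw Q w, (size w <= e)%N & z = pr w].

Lemma wd1 Q : wd Q 1. Proof. by exists [::]; rewrite ?big_nil. Qed.
Lemma wd_cons Q x z : Q x -> wd Q z -> wd Q (x * z).
Proof. by move=> Qx [w Qw ->]; exists (x :: w); rewrite ?big_cons //; exact/inw_cons. Qed.
Lemma wd_mul Q x z : wd Q x -> wd Q z -> wd Q (x * z).
Proof.
by move=> [v Qv ->] [w Qw ->]; exists (v ++ w); [exact: inw_cat|rewrite big_cat].
Qed.
Lemma wdle_cons Q e x z : Q x -> wdle Q e z -> wdle Q e.+1 (x * z).
Proof. by move=> Qx [w [Qw we ->]]; exists (x :: w); rewrite big_cons; split=> //; exact/inw_cons. Qed.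
Lemma wdle_mono Q e e' z : (e <= e')%N -> wdle Q e z -> wdle Q e' z.
Proof. by move=> ee [w [Qw we ->]]; exists w; split=> //; exact: leq_trans ee. Qed.

(** Only the letters from [L] are counted, because the value of H on such a product is governed by
    them alone. *)
Definition tri_gen e (z : A) :=
  exists p l n, [/\ wd isP p, wdle L e l, wd isN n & z = p * l * n].
Definition tri e : A -> Prop := spanp (tri_gen e).

Lemma comLP l p : L l -> wd isP p -> spanp (wd isP) (l * p - p * l).
Proof.
move=> Ll [w Pw ->]; elim: w Pw => [|x w IHw] /= => [_|/inw_cons[Px Pw]].
  by rewrite big_nil mulr1 mul1r subrr; exact: span0.
rewrite big_cons.
have -> : l * (x * pr w) - x * pr w * l = (l * x - x * l) * pr w + x * (l * pr w - pr w * l).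
  by rewrite mulrBl mulrBr !mulrA addrA subrK.
have [q Eq] := Px; have [p' Ep] := LP q Ll.
apply: spanD.
  by apply: span_gen; apply: wd_cons; [exists p'; rewrite Eq Ep|exists w].
apply: (span_map (f := fun z => x * z)) (IHw Pw) => [|z Pz].
  exact: (lin_mull (f := id)).
by apply: span_gen; exact: wd_cons.
Qed.

(** The outcomes of carrying one letter of the N side across a word in P: it is absorbed, becomes a
    single element of [L], or emerges on the right as a single N letter. *)
Definition npgen (z : A) := [\/ wd isP z, exists p l, [/\ wd isP p, L l & z = p * l] |
  exists p n, [/\ wd isP p, isN n & z = p * n]].

Lemma comNP n p : isN n -> wd isP p -> spanp npgen (n * p).
Proof.
move=> + [w Pw ->]; elim: w Pw n => [|x w IHw] /= => [_|/inw_cons[Px Pw]] n Nn.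
  rewrite big_nil mulr1; apply: span_gen; apply: Or33.
  by exists 1, n; rewrite mul1r; split=> //; exact: wd1.
have [a Ea] := Nn; have [b Eb] := Px.
have [Lc [p' [n' E]]] := NP a b; rewrite -Ea -Eb in E.
have Pw' : wd isP (pr w) by exists w.
(* The component [c a b] of the bracket is carried to the far side of the word; the commutator left
   behind is a combination of words in P by [comLP]. *)
have -> : n * pr (x :: w) = x * (n * pr w) + eP p' * pr w + (pr w * c a b +
   (c a b * pr w - pr w * c a b)) + eN n' * pr w.
  transitivity ((n * x - x * n) * pr w + x * (n * pr w)); first by rewrite big_cons; ncring.
  by rewrite E; ncring.
have lx : linear (fun z : A => x * z) by exact: (lin_mull (f := id)).
apply: spanD; last by apply: IHw => //; exists n'.
apply: spanD; first apply: spanD.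
- apply: (span_map lx) (IHw Pw n Nn) => z; case=> [Pz|[q [l [Pq Ll ->]]]|[q [m [Pq Nm ->]]]].
  + by apply: span_gen; apply: Or31; exact: wd_cons.
  + by apply: span_gen; apply: Or32; exists (x * q), l; rewrite mulrA; split=> //; exact: wd_cons.
  + by apply: span_gen; apply: Or33; exists (x * q), m; rewrite mulrA; split=> //; exact: wd_cons.
- by apply: span_gen; apply: Or31; apply: wd_cons => //; exists p'.
apply: spanD; first by apply: span_gen; apply: Or32; exists (pr w), (c a b).
by apply: span_sub (comLP Lc Pw') => z Pz; apply: span_gen; exact: Or31.
Qed.

Lemma comNL n l e : isN n -> wdle L e l ->
  spanp (fun z => exists l' n', [/\ wdle L e l', isN n' & z = l' * n']) (n * l).
Proof.
move=> + [w [Lw we ->]]; elim: w e Lw we n => [|x w IHw] /= e => [_ _|/inw_cons[Lx Lw]] => [n Nn|we n Nn].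
  rewrite big_nil mulr1; apply: span_gen; exists 1, n; rewrite mul1r; split=> //.
  by exists [::]; rewrite big_nil.
case: e we => // e we.
have -> : n * pr (x :: w) = x * (n * pr w) + (n * x - x * n) * pr w.
  by rewrite big_cons mulrBl !mulrA addrC subrK.
have lx : linear (fun z : A => x * z) by exact: (lin_mull (f := id)).
apply: spanD.
  apply: (span_map lx) (IHw e Lw we n Nn) => z [l' [n' [Ll' Nn' ->]]].
  by apply: span_gen; exists (x * l'), n'; rewrite mulrA; split=> //; exact: wdle_cons.
have [a Ea] := Nn; have [n' En] := NL a Lx; rewrite Ea En.
have Nn' : isN (eN n') by exists n'.
apply: span_sub (IHw e Lw we _ Nn') => z [l' [m [Ll' Nm ->]]].
by apply: span_gen; exists l', m; split=> //; apply: wdle_mono Ll'.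
Qed.

Lemma tri_mono e e' z : (e <= e')%N -> tri e z -> tri e' z.
Proof.
move=> ee; apply: span_sub => x [p [l [n [Pp Ll Nn ->]]]].
by apply: span_gen; exists p, l, n; split=> //; exact: wdle_mono Ll.
Qed.

Lemma tri_one : tri 0 1.
Proof.
apply: span_gen; exists 1, 1, 1; rewrite !mulr1; split=> //; try exact: wd1.
by exists [::]; rewrite big_nil.
Qed.

Lemma tri_wdP p e z : wd isP p -> tri e z -> tri e (p * z).
Proof.
move=> Pp; apply: (span_map (f := fun z => p * z)).
  exact: (lin_mull (f := id)).
move=> x [q [l [n [Pq Ll Nn ->]]]].
by apply: span_gen; exists (p * q), l, n; rewrite !mulrA; split=> //; exact: wd_mul.
Qed.

Lemma tri_P p e z : isP p -> tri e z -> tri e (p * z).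
Proof.
by move=> Pp; apply: tri_wdP; exists [:: p]; rewrite ?big_seq1 // => x; rewrite inE => /eqP ->.
Qed.

Lemma tri_L x e z : L x -> tri e z -> tri e.+1 (x * z).
Proof.
move=> Lx; apply: (span_map (f := fun z => x * z)).
  exact: (lin_mull (f := id)).
move=> _ [p [l [n [Pp Ll Nn ->]]]].
have -> : x * (p * l * n) = p * (x * l) * n + (x * p - p * x) * (l * n).
  by rewrite mulrBl !mulrA addrC subrK.
apply: spanD.
  by apply: span_gen; exists p, (x * l), n; split=> //; exact: wdle_cons.
apply: (span_map (f := fun z => z * (l * n))) (comLP Lx Pp).
  exact: (lin_mulr (f := id)).
move=> q Pq; apply: span_gen; exists q, l, n; rewrite mulrA; split=> //.
exact: wdle_mono Ll.
Qed.

(** By [comNP] the letter turns into at most one element of [L]; if it survives as an N letter,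
    [comNL] carries it across the word in [L] without lengthening that word. *)
Lemma tri_N y e z : isN y -> tri e z -> tri e.+1 (y * z).
Proof.
move=> Ny; apply: (span_map (f := fun z => y * z)).
  exact: (lin_mull (f := id)).
move=> _ [p [l [n [Pp Ll Nn ->]]]]; rewrite !mulrA -mulrA.
apply: (span_map (f := fun z => z * (l * n))) (comNP Ny Pp).
  exact: (lin_mulr (f := id)).
move=> q [Pq|[p' [l' [Pp' Ll' ->]]]|[p' [n' [Pp' Nn' ->]]]].
- by apply: span_gen; exists q, l, n; rewrite mulrA; split=> //; exact: wdle_mono Ll.
- by apply: span_gen; exists p', (l' * l), n; rewrite !mulrA; split=> //; exact: wdle_cons.
rewrite -mulrA; apply: tri_wdP => //; rewrite mulrA.
apply: (span_map (f := fun z => z * n)) (comNL Nn' Ll).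
  exact: (lin_mulr (f := id)).
move=> _ [l' [m [Ll' Nm ->]]]; apply: span_gen; exists 1, l', (m * n).
rewrite mul1r mulrA; split=> //; [exact: wd1|exact: wdle_mono Ll'|exact: wd_cons].
Qed.

Lemma wd_prP v : wd isP (prP v).
Proof.
elim: v => [|x v IHv]; first by rewrite big_nil; exact: wd1.
by rewrite big_cons; apply: wd_cons => //; exists x.
Qed.

Lemma tri_wdN w e z : tri e z -> tri (size w + e) (prN w * z).
Proof.
move=> ez; elim: w => [|x w IHw] /=; first by rewrite big_nil mul1r.
by rewrite big_cons -mulrA addSn; apply: tri_N => //; exists x.
Qed.

Lemma tri_NP w p : wd isP p -> tri (size w) (prN w * p).
Proof.
move=> Pp; rewrite -[p]mulr1 -[size w]addn0; apply: tri_wdN.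
by apply: tri_wdP => //; exact: tri_one.
Qed.

Section Pairing.
Variables (B : lmodType F) (filB : int -> B -> Prop) (H : A -> B) (r : A -> B -> B).
Hypotheses (fB_sub : forall k, subspace (filB k))
  (Hl : linear H) (HD : forall e z, tri e z -> filB e%:Z (H z))
  (HL : forall l z, L l -> H (z * l) = r l (H z))
  (r_fil : forall l k b, L l -> filB k b -> filB (k + 1) (r l b))
  (HN : forall n z, H (z * eN n) = 0).

Let fB0 k : filB k 0. Proof. by case: (fB_sub k). Qed.
Let fBD k x y : filB k x -> filB k y -> filB k (x + y).
Proof. by move=> xk yk; have := (fB_sub k).2 1 x y xk yk; rewrite scale1r. Qed.
Let fBZ k a x : filB k x -> filB k (a *: x).
Proof. by move=> xk; have := (fB_sub k).2 a x 0 xk (fB0 k); rewrite addr0. Qed.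

Lemma span_fB (Q : A -> Prop) (f : A -> B) k z : linear f ->
  (forall x, Q x -> filB k (f x)) -> spanp Q z -> filB k (f z).
Proof.
move=> fl fQ; elim=> [|a u v Qu _ IH]; first by rewrite lin0.
by rewrite fl; apply: fBD => //; apply: fBZ; exact: fQ.
Qed.

(** Errors that lower the degree once paired: words in P alone, one element of [L] behind a word
    shorter than [m] by at least two, and products with a final N letter, which H kills. *)
Definition recgen (m : nat) (z : A) := [\/ wd isP z,
  exists u l, [/\ ((size u).+1 < m)%N, L l & z = prP u * l] |
  exists a n, z = a * eN n].

(** Leibniz rule for the bracket with [n] along the word [v]: the [L] components, moved to the right
    end, form the leading sum, and everything else is an error. *)
Lemma comNP_rec n v :
  spanp (recgen (size v)) (eN n * prP v - \sum_(p <- rems v) prP p.2 * c n p.1).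
Proof.
elim: v n => [|x v IHv] /= n.
  by rewrite !big_nil subr0 mulr1; apply: span_gen; apply: Or33; exists 1, n; rewrite mul1r.
have [Lc [p' [n' E]]] := NP n x.
rewrite !big_cons /= big_map /=.
pose S := \sum_(p <- rems v) prP p.2 * c n p.1.
pose S' := \sum_(p <- rems v) prP p.2 * c n' p.1.
have -> : \sum_(p <- rems v) prP (x :: p.2) * c n p.1 = eP x * S.
  by rewrite mulr_sumr; apply: eq_bigr => p _; rewrite big_cons mulrA.
have -> : eN n * (eP x * prP v) - (prP v * c n x + eP x * S) =
   eP x * (eN n * prP v - S) + eP p' * prP v +
   (c n x * prP v - prP v * c n x) + ((eN n' * prP v - S') + S').
  transitivity ((eN n * eP x - eP x * eN n) * prP v + eP x * (eN n * prP v - S) - prP v * c n x).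
    by ncring.
  by rewrite E; ncring.
have lx : linear (fun z : A => eP x * z) by exact: (lin_mull (f := id)).
have Px : isP (eP x) by exists x.
have recP z : wd isP z -> spanp (recgen (size v).+1) z.
  by move=> Pz; apply: span_gen; exact: Or31.
apply: spanD; first apply: spanD; first apply: spanD.
- apply: (span_map lx) (IHv n) => z [Pz|[u [l [us Ll ->]]]|[a [m ->]]].
  + by apply: recP; exact: wd_cons.
  + by apply: span_gen; apply: Or32; exists (x :: u), l; rewrite big_cons mulrA.
  + by apply: span_gen; apply: Or33; exists (eP x * a), m; rewrite mulrA.
- by apply: recP; apply: wd_cons; [exists p'|exact: wd_prP].
- by apply: span_sub (comLP Lc (wd_prP v)).
apply: spanD.
  apply: span_sub (IHv n') => z [Pz|[u [l [us Ll ->]]]|[a [m ->]]].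
  + exact: recP.
  + by apply: span_gen; apply: Or32; exists u, l; split=> //; exact: leq_trans us _.
  + by apply: span_gen; apply: Or33; exists a, m.
(* The leading sum of the new letter [n'] involves words shorter by two than [x :: v], hence is an
   error here. *)
rewrite /S' big_seq; apply: (big_ind (spanp _)) => [||p pv].
- exact: span0.
- exact: spanD.
apply: span_gen; apply: Or32; exists p.2, (c n' p.1).
by split=> //; [rewrite (rems_size pv)|case: (NP n' p.1)].
Qed.

(* By induction on m: the letter y adjacent to v is commuted past
   the letters of v, up to terms of lower degree. *)
Lemma pairing_rec m :
  (forall w v, size w = m -> (size v < m)%N -> filB (m%:Z - 1) (H (prN w * prP v))) /\
  (forall w n v, size w = m -> (size v <= m.+1)%N ->
     filB m%:Z (H (prN w * (eN n * prP v)) -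
       \sum_(p <- rems v) r (c n p.1) (H (prN w * prP p.2)))).
Proof.
(* The second estimate at a given length follows from the first at the same length; the first at
   length [m.+1] follows from both at length [m]. *)
have T2rec k : (forall w v, size w = k -> (size v < k)%N ->
     filB (k%:Z - 1) (H (prN w * prP v))) ->
  forall w n v, size w = k -> (size v <= k.+1)%N ->
     filB k%:Z (H (prN w * (eN n * prP v)) -
       \sum_(p <- rems v) r (c n p.1) (H (prN w * prP p.2))).
  move=> T2 w n v wk vk.
  have -> : \sum_(p <- rems v) r (c n p.1) (H (prN w * prP p.2)) =
      H (prN w * \sum_(p <- rems v) prP p.2 * c n p.1).
    rewrite mulr_sumr (lin_sum Hl); apply: eq_bigr => p _.
    by have [Lc _] := NP n p.1; rewrite mulrA [RHS]HL.
  rewrite -(linB Hl) -mulrBr.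
  apply: (span_fB (f := fun z => H (prN w * z))) (comNP_rec n v).
    by apply: (lin_comp Hl); exact: (lin_mull (f := id)).
  move=> z [Pz|[u [l [us Ll ->]]]|[a [n' ->]]].
  - by rewrite -wk; apply: HD; exact: tri_NP.
  - rewrite mulrA HL // -[k%:Z](subrK 1); apply: r_fil => //; apply: T2 => //.
    by rewrite -ltnS; exact: leq_trans us vk.
  - by rewrite mulrA HN.
elim: m => [|m [IH1 IH2]]; first by split; [|exact: T2rec].
suff T2 : forall w v, size w = m.+1 -> (size v < m.+1)%N ->
     filB (m.+1%:Z - 1) (H (prN w * prP v)) by split=> //; exact: T2rec.
move=> w v; case/lastP: w => // w n; rewrite size_rcons => -[wm] vm.
rewrite big_rcons /= intS addrAC subrr add0r -mulrA.
have h := IH2 w n v wm (leqW vm).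
rewrite -[H _](subrK (\sum_(p <- rems v) r (c n p.1) (H (prN w * prP p.2)))).
apply: fBD => //; rewrite (@big_seq _ _ +%R).
apply: (big_ind (filB m%:Z)) => [||p pv]; [exact: fB0|exact: fBD|].
rewrite -[m%:Z](subrK 1); apply: r_fil; first by have [] := NP n p.1.
by apply: IH1 => //; rewrite -ltnS -(rems_size pv).
Qed.

End Pairing.
End Triangular.

(** * Nondegeneracy of a pairing, one degree and one letter at a time *)

Section TopDegree.
Variables (F : fieldType) (E : algType F) (Uh G : filtAlg F) (d : nat).
Variables (e : 'I_d -> E) (VV : E -> Prop) (T : seq 'I_d -> rtens E Uh -> G)
  (m n : 'I_d -> 'I_d -> G) (back : G -> rtens E Uh).

Definition ew (u : seq 'I_d) : E := \prod_(i <- u) e i.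

Hypotheses (char0 : forall k, k.+1%:R != 0 :> F)
  (VV_span : forall x : E, spanp (fun z => exists v u, VV v /\ z = v * ew u) x)
  (VV_com : forall v i, VV v -> e i * v = v * e i)
  (e_com : forall i j, spanp (fun z => exists k, z = e k) (e i * e j - e j * e i))
  (T_lin : forall w, linear (T w))
  (T_fil : forall w k t, fil k t -> fil (k + (size w)%:Z) (T w t))
  (T_rec : forall v j w u k l, VV v -> fil k l -> (size u <= (size w).+1)%N ->
    fil (k + (size w)%:Z) (T (j :: w) (v * ew u ⊗ l : rtens E Uh) -
      \sum_(p <- rems u) m j p.1 * T w (v * ew p.2 ⊗ l : rtens E Uh)))
  (n_fil : forall i j, fil (-1) (n i j))
  (nm : forall k i, fil (-1) (\sum_j n k j * m j i - (k == i)%:R))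
  (back_lin : linear back) (back_fil : forall k x, fil k x -> fil k (back x))
  (back_T : forall v l, VV v -> back (T [::] (v ⊗ l : rtens E Uh)) = v ⊗ l).

Definition short N k : rtens E Uh -> Prop :=
  spanp (fun z => exists v u l, [/\ VV v, (size u < N)%N, fil k l & z = v * ew u ⊗ l]).

Lemma short0 N k : short N k 0. Proof. exact: span0. Qed.
Lemma shortD N k x y : short N k x -> short N k y -> short N k (x + y).
Proof. exact: spanD. Qed.
Lemma shortZ N k a x : short N k x -> short N k (a *: x).
Proof. exact: spanZ. Qed.
Lemma shortB N k x y : short N k x -> short N k y -> short N k (x - y).
Proof. exact: spanB. Qed.
Lemma short_sum_in N k (I : eqType) (r : seq I) (f : I -> rtens E Uh) :
  (forall i, i \in r -> short N k (f i)) -> short N k (\sum_(i <- r) f i).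
Proof.
move=> h; rewrite big_seq.
by apply: (big_ind (short N k)) => [|x y|//]; [exact: short0|exact: shortD].
Qed.

Lemma short_fil N k t : short N k t -> fil k t.
Proof.
elim=> [|a x y [v [u [l [_ _ kl ->]]]] _ IH]; first exact: fil0.
by apply: filD => //; apply: filZ; exact: tspan_gen.
Qed.

Lemma ew_cons i u : ew (i :: u) = e i * ew u.
Proof. by rewrite /ew big_cons. Qed.

(** Letters commute modulo shorter words, so a deleted letter may be put back in front. *)
Lemma ew_rems u p : p \in rems u ->
  spanp (fun z => exists2 u', (size u' < size u)%N & z = ew u') (ew u - ew (p.1 :: p.2)).
Proof.
elim: u p => //= x u IHu p; rewrite inE => /orP[/eqP -> /=|/mapP[q qu -> /=]].
  by rewrite subrr; exact: span0.
have -> : ew (x :: u) - ew [:: q.1, x & q.2] =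
    e x * (ew u - ew (q.1 :: q.2)) + (e x * e q.1 - e q.1 * e x) * ew q.2.
  by rewrite !ew_cons; ncring.
apply: spanD.
  apply: (span_map (f := fun z => e x * z)) (IHu _ qu) => [|_ [u' us ->]].
    exact: (lin_mull (f := id)).
  by apply: span_gen; exists (x :: u'); rewrite ?ew_cons.
apply: (span_map (f := fun z => z * ew q.2)) (e_com x q.1) => [|_ [i ->]].
  exact: (lin_mulr (f := id)).
by apply: span_gen; exists (i :: q.2); rewrite ?ew_cons //= (rems_size qu).
Qed.

Lemma short_scale v l k N x : VV v -> fil k l ->
  spanp (fun z => exists2 u', (size u' < N)%N & z = ew u') x -> short N k (v * x ⊗ l).
Proof.
move=> Vv kl; apply: (span_map (f := fun x => v * x ⊗ l : rtens E Uh)).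
  by apply: lin_tensl; exact: (lin_mull (f := id)).
by move=> _ [u us ->]; apply: span_gen; exists v, u, l.
Qed.

(** [ti i] plays the part of the partial derivative of [t] in the letter [e i]. The second clause is
    the chain rule for the leading part of the pairing, the third is Euler's identity in length
    [N.+1]. *)
Lemma short_remove N k t : short N.+2 k t -> exists ti : 'I_d -> rtens E Uh,
  [/\ forall i, short N.+1 k (ti i),
      forall w j, (N <= size w)%N ->
        fil (k + (size w)%:Z) (T (j :: w) t - \sum_i m j i * T w (ti i)) &
      short N.+1 k (N.+1%:R *: t - \sum_i (e i ⊗ 1 : rtens E Uh) * ti i)].
Proof.
elim=> [|a x y [v [u [l [Vv us kl ->]]]] _ [yi [yi1 yi2 yi3]]].
  exists (fun=> 0); split=> [i|w j wN|]; first exact: short0.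
    rewrite lin0 // big1 ?subrr => [|i _]; first exact: fil0.
    by rewrite lin0 // mulr0.
  rewrite scaler0 big1 ?subrr => [|i _]; first exact: short0.
  by rewrite mulr0.
pose xi i : rtens E Uh := \sum_(p <- rems u | p.1 == i) (v * ew p.2 ⊗ l : rtens E Uh).
have sumxi (M : lmodType F) (f : 'I_d -> rtens E Uh -> M) : (forall i, linear (f i)) ->
    \sum_i f i (xi i) = \sum_(p <- rems u) f p.1 (v * ew p.2 ⊗ l : rtens E Uh).
  move=> fl; under eq_bigr => i _ do rewrite (lin_sum (fl i)).
  rewrite (exchange_big_dep predT) //=; apply: eq_bigr => p _.
  by rewrite (big_pred1 p.1) // => i; rewrite eq_sym.
have gen u' : (size u' < N.+1)%N -> short N.+1 k (v * ew u' ⊗ l).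
  by move=> us'; apply: span_gen; exists v, u', l.
exists (fun i => a *: xi i + yi i); split=> [i|w j wN|].
- apply: shortD => //; apply: shortZ; rewrite /xi big_mkcond.
  apply: short_sum_in => p pu.
  case: ifP => _; last exact: short0.
  by apply: gen; rewrite -ltnS -(rems_size pu).
- have -> : \sum_i m j i * T w (a *: xi i + yi i) =
      a *: (\sum_i m j i * T w (xi i)) + \sum_i m j i * T w (yi i).
    rewrite scaler_sumr -big_split; apply: eq_bigr => i _ /=.
    by rewrite T_lin mulrDr scalerAr.
  rewrite T_lin opprD addrACA -scalerBr; apply: filD; last exact: yi2.
  apply: filZ; rewrite (sumxi _ (fun i z => m j i * T w z)).
    by apply: T_rec => //; lia.
  by move=> i; exact: lin_mull.
have -> : \sum_i (e i ⊗ 1 : rtens E Uh) * (a *: xi i + yi i) =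
    a *: (\sum_i (e i ⊗ 1 : rtens E Uh) * xi i) + \sum_i (e i ⊗ 1 : rtens E Uh) * yi i.
  rewrite scaler_sumr -big_split; apply: eq_bigr => i _ /=.
  by rewrite mulrDr scalerAr.
rewrite scalerDr scalerA mulrC -scalerA opprD addrACA -scalerBr; apply: shortD => //.
apply: shortZ; rewrite (sumxi _ (fun i z => (e i ⊗ 1 : rtens E Uh) * z)); last first.
  by move=> i; exact: (lin_mull (f := id)).
have eE (p : 'I_d * seq 'I_d) : (e p.1 ⊗ 1 : rtens E Uh) * (v * ew p.2 ⊗ l) = v * ew (p.1 :: p.2) ⊗ l.
  by rewrite [LHS]tensM mul1r mulrA VV_com // ew_cons mulrA.
(* Words below the maximal length are short on both sides. A word of length [N.+1] has [N.+1]
   deletions, each of which gives the word back modulo shorter ones. *)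
have [uN|uN] := ltnP (size u) N.+1.
  apply: shortB; first by apply: shortZ; exact: gen.
  by apply: short_sum_in => p pu; rewrite eE; apply: gen; rewrite /= -(rems_size pu).
have {uN}us' : size u = N.+1 by apply/eqP; rewrite eqn_leq uN andbT -ltnS.
have -> : N.+1%:R *: (v * ew u ⊗ l) = \sum_(p <- rems u) (v * ew u ⊗ l : rtens E Uh).
  by rewrite big_const_seq count_predT size_rems us' iter_addr addr0 scaler_nat.
rewrite -sumrB; apply: short_sum_in => p pu.
rewrite eE -(linB (f := fun z => z ⊗ l : rtens E Uh)) -?mulrBr; last first.
  exact: (lin_tensl (f := id)).
apply: short_scale => //; apply: span_sub (ew_rems pu) => _ [u' u's ->].
by apply: span_gen; exists u'; rewrite // -us'.
Qed.

Lemma short_mul N k i t : short N k t -> short N.+1 k ((e i ⊗ 1 : rtens E Uh) * t).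
Proof.
apply: (span_map (f := fun z => (e i ⊗ 1 : rtens E Uh) * z)).
  exact: (lin_mull (f := id)).
move=> _ [v [u [l [Vv uN kl ->]]]]; apply: span_gen; exists v, (i :: u), l.
by split=> //; rewrite [LHS]tensM mul1r mulrA VV_com // ew_cons mulrA.
Qed.

(** Induction through the derivatives: small pairings of [t] make the sums of [m j i * T w (ti i)]
    small, multiplication by [n] makes each [T w (ti i)] small, and Euler's identity recovers [t]
    after division by the length. *)
Lemma short_step N k t : short N.+1 k t ->
  (forall w, size w = N -> fil (k + N%:Z - 1) (T w t)) ->
  exists2 t', short N k t' & fil (k - 1) (t - t').
Proof.
elim: N k t => [|N IHN] k t st ht.
  exists 0; first exact: short0.
  rewrite subr0 -[t](_ : back (T [::] t) = t); last first.
    apply: (span_ind_lin (f := fun t => back (T [::] t)) (h := id)) st => //.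
      exact: lin_comp.
    move=> _ [v [u [l [Vv u0 _ ->]]]]; have -> : u = [::] by case: u u0.
    by rewrite /ew big_nil mulr1; exact: back_T.
  by apply: back_fil; have := ht [::] erefl; rewrite addr0.
have [ti [ti1 ti2 ti3]] := short_remove st.
have hti i : exists t', short N k t' /\ fil (k - 1) (ti i - t').
  suff [t' ? ?] : exists2 t', short N k t' & fil (k - 1) (ti i - t') by exists t'.
  apply: IHN => // w wN.
  have hj j : fil (k + N%:Z) (\sum_i m j i * T w (ti i)).
    rewrite -[X in fil _ X](subKr (T (j :: w) t)); apply: filB.
      by have := ht (j :: w); rewrite /= wN => /(_ erefl); apply: fil_mono; lia.
    by have := ti2 w j; rewrite wN; apply.
  have hi i' : fil (k + N%:Z) (T w (ti i')).
    by rewrite -wN; apply: T_fil; exact: short_fil (ti1 i').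
  (* The inversion is exact up to the defect of n m from the identity. This defect has degree -1, so
     its product with a pairing gains the one degree that is wanted. *)
  have -> : T w (ti i) = \sum_j n i j * (\sum_i' m j i' * T w (ti i')) -
      \sum_i' (\sum_j n i j * m j i' - (i == i')%:R) * T w (ti i').
    under [X in _ - X]eq_bigr => i' _ do rewrite mulrBl.
    have E1 : \sum_i' (i == i')%:R * T w (ti i') = T w (ti i).
      rewrite (bigD1 i) //= eqxx mul1r big1 ?addr0 // => i' ii'.
      by rewrite eq_sym (negPf ii') mul0r.
    rewrite sumrB E1 opprB addrCA -[LHS]addr0; congr (_ + _); apply/esym/eqP.
    rewrite subr_eq0; apply/eqP.
    under eq_bigr => j _ do rewrite mulr_sumr.
    rewrite exchange_big; apply: eq_bigr => i' _ /=.
    by rewrite mulr_suml; apply: eq_bigr => j _; rewrite mulrA.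
  have -> : k + N%:Z - 1 = -1 + (k + N%:Z) by lia.
  by apply: filB; apply: fil_sum => j _; apply: fil_mul.
have /choice[ti' hti'] := hti.
pose c : F := N.+1%:R.
have c0 : c != 0 by exact: char0.
exists (c^-1 *: (c *: t - \sum_i (e i ⊗ 1 : rtens E Uh) * ti i +
                 \sum_i (e i ⊗ 1 : rtens E Uh) * ti' i)).
  apply: shortZ; apply: shortD => //; apply: short_sum_in => i _.
  by apply: short_mul; case: (hti' i).
have -> : t - c^-1 *: (c *: t - \sum_i (e i ⊗ 1 : rtens E Uh) * ti i +
                 \sum_i (e i ⊗ 1 : rtens E Uh) * ti' i) =
    c^-1 *: (\sum_i (e i ⊗ 1 : rtens E Uh) * (ti i - ti' i)).
  under [in RHS]eq_bigr => i _ do rewrite mulrBr.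
  rewrite sumrB -addrA scalerDr scalerA mulVf // scale1r opprD addrA subrr add0r -scalerN.
  by rewrite opprD opprK.
apply: filZ; apply: fil_sum => i _; case: (hti' i) => _ hi.
rewrite -[k - 1]add0r; apply: fil_mul => //.
by apply: tspan_gen => //; exact: fil_one.
Qed.

Lemma short_exists k t : fil k t -> exists N, short N k t.
Proof.
move=> [s [sk ->]]; elim: s sk => [|p s IHs] sk.
  by exists 0%N; rewrite big_nil; exact: short0.
have [|N sN] := IHs; first by move=> q qs; apply: sk; rewrite inE qs orbT.
have [_ kp] := sk p (mem_head _ _).
have mono M M' x : (M <= M')%N -> short M k x -> short M' k x.
  move=> MM; apply: span_sub => z [v [u [l [Vv uM kl ->]]]].
  by apply: span_gen; exists v, u, l; split=> //; exact: leq_trans MM.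
have [M sM] : exists M, short M k (p.1 ⊗ p.2).
  elim: (VV_span p.1) => [|a x y [v [u [Vv ->]]] _ [M sM]].
    by exists 0%N; rewrite tens0l; exact: short0.
  exists (maxn (size u).+1 M); rewrite tensDl tensZl; apply: shortD.
    by apply: shortZ; apply: span_gen; exists v, u, p.2; split; rewrite // leq_maxl.
  by apply: mono sM; exact: leq_maxr.
exists (maxn M N); rewrite big_cons; apply: shortD.
  by apply: mono sM; exact: leq_maxl.
by apply: mono sN; exact: leq_maxr.
Qed.

(** Each application of [short_step] shortens the words of [t] at the price of a term of degree
    [k - 1], whose pairings are small enough to keep the hypothesis. *)
Lemma top_degree k t : fil k t -> (forall w, fil (k + (size w)%:Z - 1) (T w t)) ->
  fil (k - 1) t.
Proof.
move=> kt; have [N] := short_exists kt; elim: N t {kt} => [|N IHN] t st ht.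
  suff -> : t = 0 by exact: fil0.
  by elim: st => // a x y [v [u [l [_ + _ _]]]]; rewrite ltn0.
have [w wN|t' st' tt'] := short_step st; first by rewrite -wN.
rewrite -[t](subrK t'); apply: filD => //; apply: IHN => // w.
rewrite -[T w t'](subKr (T w t)) -(linB (T_lin w)).
apply: filB => //; rewrite addrAC; exact: T_fil.
Qed.

(** Descent from some degree of [X] down to [k]: at each step [X] is replaced by a finite
    approximation modulo the next degree, to which [top_degree] applies. The values lie in [G],
    which may fail to be complete; [j] embeds it into an algebra where limits exist. *)
Lemma completed_degree (G' : filtAlg F) (j : G -> G') k (X : compl (rtens E Uh)) :
  complete G' -> separated G' -> linear j -> (forall k x, fil k (j x) <-> fil k x) ->
  (forall w, fil (k + (size w)%:Z) (cext (fun t => j (T w t)) X)) -> fil k X.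
Proof.
move=> cG sG jl jf hX; have Ts w : fshift (size w)%:Z (fun t => j (T w t)).
  by split=> [|i x ix]; [exact: lin_comp|apply/jf; exact: T_fil].
have Tb w : bdd (fun t => j (T w t)) by exists (size w)%:Z.
have cb w := bdd_cext cG sG (Tb w).
have [k0 k0X] := fil_exh X.
have [|/ltW k0k] := leP k0 k; first by move=> kk; apply: fil_mono k0X.
have [i Ei] : exists i : nat, k0 = k + i%:Z by exists `|k0 - k|%N; lia.
elim: i k0 {k0k} Ei k0X => [|i IHi] k0 Ei k0X.
  by apply: fil_mono k0X; lia.
apply: (IHi (k0 - 1)); first by lia.
have k1 : k0 - 1 <= k0 by lia.
have [t tk tX] := cin_near_in k0X k1.
apply: (fil_tr' tX); apply/cfil_in; apply: top_degree tk _ => w; apply/jf.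
rewrite -(cext_cin sG (Tb w)) -[X in fil _ X](subKr (cext (fun t => j (T w t)) X)); apply: filB.
  by apply: fil_mono (hX w); lia.
rewrite -(linB (bdd_lin (cb w))).
have := (cext_fshift cG sG (Tb w) (Ts w)).2 _ _ tX.
by rewrite addrAC.
Qed.
End TopDegree.

(** * Polarized Lie algebras, enveloping algebras of subalgebras, Hopf maps *)

Section PolarBasics.
Variables (F : fieldType) (g : polarLie F).

Lemma uinjD (x y : g) : uinj (x + y) = uinj x + uinj y.
Proof. exact: linD (@uinj_lin F g) x y. Qed.
Lemma uinjN (x : g) : uinj (- x) = - uinj x.
Proof. exact: linN (@uinj_lin F g) x. Qed.


Lemma pol_l_u : (pol_l g :&: pol_u g = 0)%VS.
Proof.
have := pol_direct g; rewrite directvE /= -addvA => /eqP E.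
apply/eqP; rewrite -dimv_eq0.
have h1 := dimv_add_leqif (pol_p g) (pol_m g).
have := dimv_sum_cap (pol_l g) (pol_u g); rewrite /pol_u in h1 *.
by rewrite E; case: h1 => h1 _; lia.
Qed.

Lemma polar_split (z : g) : exists (p : Lie_p g) (m : Lie_m g),
  z = vsval (proj_l z) + vsval p + vsval m.
Proof.
have : z \in (pol_l g + pol_u g)%VS by rewrite addvA pol_sum memvf.
move/(daddv_pi_add pol_l_u) => {1}<-.
have /memv_addP[p pp [m mm ->]] : daddv_pi (pol_u g) (pol_l g) z \in pol_u g.
  exact: memv_pi.
exists (vsproj (pol_p g) p), (vsproj (pol_m g) m).
by rewrite /proj_l !vsprojK ?memv_pi // addrA.
Qed.

Lemma proj_l_lin : linear (@proj_l F g).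
Proof. by move=> a x y; rewrite /proj_l !linearP. Qed.

Lemma proj_l_u (z : g) : z \in pol_u g -> proj_l z = 0.
Proof.
move=> zu; rewrite /proj_l; suff -> : daddv_pi (pol_l g) (pol_u g) z = 0 by rewrite linear0.
have zlu : z \in (pol_l g + pol_u g)%VS by rewrite addvA pol_sum memvf.
have := daddv_pi_add pol_l_u zlu; rewrite (daddv_pi_id _ zu); last first.
  by rewrite capvC pol_l_u.
by move=> E; apply: (addIr z); rewrite add0r.
Qed.


Lemma pol_p_u x : x \in pol_p g -> x \in pol_u g.
Proof. by apply/subvP; exact: addvSl. Qed.
Lemma pol_m_u x : x \in pol_m g -> x \in pol_u g.
Proof. by apply/subvP; exact: addvSr. Qed.
End PolarBasics.

Section UsubBasics.
Variables (F : fieldType) (g : lieAlg F) (V : {vspace g}) (hV : lie_closed V).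
Notation us := (@Usub F g V hV).

Lemma Usub_lin : linear us. Proof. by case: (Usub_spec hV). Qed.
Lemma Usub1 : us 1 = 1. Proof. by case: (Usub_spec hV) => _ []. Qed.
Lemma UsubM x y : us (x * y) = us x * us y. Proof. by case: (Usub_spec hV) => _ []. Qed.
Lemma Usub_inj x : us (uinj x) = uinj (vsval x). Proof. by case: (Usub_spec hV). Qed.
End UsubBasics.

Section HopfBasics.
Variables (F : fieldType) (g : lieAlg F).

Lemma Ucounit_lin : linear (@Ucounit F g : Uenv g -> F^o). Proof. by case: (Ucounit_spec g). Qed.
Lemma Ucounit1 : Ucounit (1 : Uenv g) = 1. Proof. by case: (Ucounit_spec g) => _ []. Qed.
Lemma UcounitM (x y : Uenv g) : Ucounit (x * y) = Ucounit x * Ucounit y.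
Proof. by case: (Ucounit_spec g) => _ []. Qed.
Lemma Ucounit_inj (x : g) : Ucounit (uinj x) = 0. Proof. by case: (Ucounit_spec g). Qed.
Lemma Uant_lin : linear (@Uantipode F g). Proof. by case: (Uantipode_spec g). Qed.
Lemma Uant1 : Uantipode (1 : Uenv g) = 1. Proof. by case: (Uantipode_spec g). Qed.
Lemma UantM (x y : Uenv g) : Uantipode (x * y) = Uantipode y * Uantipode x.
Proof. by case: (Uantipode_spec g). Qed.
Lemma Uant_inj (x : g) : Uantipode (uinj x) = - uinj x.
Proof. by case: (Uantipode_spec g). Qed.
Lemma Ucop_lin : linear (@Ucop F g). Proof. by case: (Ucop_spec g). Qed.
Lemma Ucop1 : Ucop (1 : Uenv g) = 1. Proof. by case: (Ucop_spec g) => _ []. Qed.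
Lemma UcopM (x y : Uenv g) : Ucop (x * y) = Ucop x * Ucop y.
Proof. by case: (Ucop_spec g) => _ []. Qed.
Lemma Ucop_inj (x : g) : Ucop (uinj x) = uinj x ⊗ 1 + 1 ⊗ uinj x.
Proof. by case: (Ucop_spec g). Qed.
Lemma ufil_inj (x : g) : ufil 1 (uinj x).
Proof.
exists [:: (1, [:: x])]; rewrite big_seq1 scale1r /uword big_seq1.
by split=> // p; rewrite inE => /eqP ->.
Qed.
End HopfBasics.

Lemma big_converse (R : pzRingType) (T : Type) (f : T -> R) (w : seq T) :
  \prod_(x <- w) (f x : R^c%type) = \prod_(x <- rev w) f x.
Proof.
elim: w => [|x w IHw]; first by rewrite !big_nil.
by rewrite big_cons rev_cons big_rcons /= IHw.
Qed.

Lemma big_rems_rev (M : nmodType) (T : Type) (f : T * seq T -> M) (w : seq T) :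
  \sum_(p <- rems (rev w)) f p = \sum_(p <- rems w) f (p.1, rev p.2).
Proof.
have rems_rcons (x : T) s : rems (rcons s x) =
    rcons [seq (p.1, rcons p.2 x) | p <- rems s] (x, s).
  elim: s => //= y s ->; rewrite map_rcons -!map_comp.
  by congr (_ :: rcons _ _).
elim: w f => [|x w IHw] f; first by rewrite !big_nil.
rewrite rev_cons rems_rcons big_rcons big_map IHw /= big_cons big_map addrC.
by congr (_ + _); apply: eq_bigr => p _; rewrite rev_cons.
Qed.

(** * The Harish-Chandra map: U(l)-linearity and degree estimates *)

Section HarishChandra.
Variables (F : fieldType) (g : polarLie F) (H : Uenv g -> Uenv (Lie_l g)).
Hypothesis H_hc : harish_chandra H.

Notation U := (Uenv g).
Notation ip := (@Usub F g _ (@pol_pC F g)).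
Notation im := (@Usub F g _ (@pol_mC F g)).
Notation il := (@Usub F g _ (@pol_lC F g)).

Let isL (x : U) := exists l : Lie_l g, x = uinj (vsval l).
Let eP (x : Lie_p g) : U := uinj (vsval x).
Let eM (x : Lie_m g) : U := uinj (vsval x).
Let cmp (m : Lie_m g) (p : Lie_p g) : U := uinj (vsval (proj_l ⁅vsval m, vsval p⁆)).

Lemma tri_LP l p : isL l -> exists p', l * eP p - eP p * l = eP p'.
Proof.
move=> [x ->]; exists (vsproj (pol_p g) ⁅vsval x, vsval p⁆).
by rewrite /eP vsprojK ?uinj_br // pol_lp ?subvsP.
Qed.
Lemma tri_LM l p : isL l -> exists p', l * eM p - eM p * l = eM p'.
Proof.
move=> [x ->]; exists (vsproj (pol_m g) ⁅vsval x, vsval p⁆).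
by rewrite /eM vsprojK ?uinj_br // pol_lm ?subvsP.
Qed.
Lemma tri_ML n l : isL l -> exists n', eM n * l - l * eM n = eM n'.
Proof.
move=> /(tri_LM n)[p E]; exists (- p); rewrite -opprB E /eM.
by rewrite linearN uinjN.
Qed.

Lemma tri_MP n p : isL (cmp n p) /\
  exists p' n', eM n * eP p - eP p * eM n = eP p' + cmp n p + eM n'.
Proof.
split; first by exists (proj_l ⁅vsval n, vsval p⁆).
have [p' [n' E]] := polar_split ⁅vsval n, vsval p⁆; exists p', n'.
by rewrite /eM /eP -uinj_br {1}E !uinjD [eP p' + _]addrC.
Qed.

(** [tri2] below is the same decomposition in the opposite algebra with u_+ and u_- exchanged. Read
    in U(g), its products again have the order of [tgen], so a single evaluation of H bounds
    both. *)
Let tri1 := @tri F U (Lie_p g) (Lie_m g) eP eM isL.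
Let tri2 := @tri F (U^c)%type (Lie_m g) (Lie_p g) eM eP isL.
Let cpm (p : Lie_p g) (m : Lie_m g) : (U^c)%type := cmp m p.

Lemma tri2_MP n p : isL (cpm n p) /\ exists p' n',
  (eP n : U^c%type) * (eM p : U^c%type) - (eM p : U^c%type) * (eP n : U^c%type) =
  (eM p' : U^c%type) + cpm n p + (eP n' : U^c%type).
Proof.
have [h [p' [n' E]]] := tri_MP p n; split=> //; exists n', p'.
have E' : eP p' + cmp p n + eM n' = eM n' + cmp p n + eP p' by ncring.
exact: etrans E E'.
Qed.

Lemma tri2_LP l p : isL l -> exists p',
  (l : U^c%type) * (eM p : U^c%type) - (eM p : U^c%type) * (l : U^c%type) = (eM p' : U^c%type).
Proof. exact: tri_ML. Qed.
Lemma tri2_NL n l : isL l -> exists n',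
  (eP n : U^c%type) * (l : U^c%type) - (l : U^c%type) * (eP n : U^c%type) = (eP n' : U^c%type).
Proof. exact: tri_LP. Qed.

Definition tgen (e : nat) (z : U) :=
  exists a l b, ufil e%:Z l /\ z = ip a * il l * im b.

Let il_lin := @Usub_lin F g _ (@pol_lC F g).

Lemma tri1_gen e z : tri1 e z -> spanp (tgen e) z.
Proof.
apply: span_sub => _ [p [l [n [[wp Pp ->] [wl [Ll le ->]] [wn Nn ->] ->]]]].
have img V (hV : lie_closed V) (Q : U -> Prop) w :
    (forall x, Q x -> exists y : subLie hV, x = uinj (vsval y)) -> inw Q w ->
    exists2 a : Uenv (subLie hV), \prod_(x <- w) x = Usub a & ufil (size w)%:Z a.
  move=> hQ; elim: w => [|x w IHw] => [_|/inw_cons[/hQ[y ->] /IHw[a Ea fa]]].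
    by exists 1; rewrite ?big_nil ?Usub1 //; exact: ufil_one.
  exists (uinj y * a); first by rewrite big_cons Ea UsubM Usub_inj.
  by rewrite /= intS; apply: ufil_mul => //; exact: ufil_inj.
have [|a -> _] := img _ (@pol_pC F g) (isP eP) wp _ Pp; first by move=> x [y ->]; exists y.
have [|b -> _] := img _ (@pol_mC F g) (isN eM) wn _ Nn; first by move=> x [y ->]; exists y.
have [|k -> fk] := img _ (@pol_lC F g) isL wl _ Ll; first by [].
apply: span_gen; exists a, k, b; split=> //.
by apply: ufil_mono fk; rewrite lez_nat.
Qed.

Lemma tri2_gen e z : tri2 e z -> spanp (tgen e) z.
Proof.
apply: (@span_sub F U) => _ [p [l [n [[wp Pp ->] [wl [Ll le ->]] [wn Nn ->] ->]]]].
have img V (hV : lie_closed V) (Q : U -> Prop) w :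
    (forall x, Q x -> exists y : subLie hV, x = uinj (vsval y)) -> inw (A := (U^c)%type) Q w ->
    exists2 a : Uenv (subLie hV), \prod_(x <- w) (x : U^c%type) = Usub a & ufil (size w)%:Z a.
  move=> hQ; elim: w => [|x w IHw] => [_|/inw_cons[/hQ[y ->] /IHw[a Ea fa]]].
    by exists 1; rewrite ?big_nil ?Usub1 //; exact: ufil_one.
  exists (a * uinj y); first by rewrite big_cons Ea UsubM Usub_inj.
  by rewrite /= -addn1 PoszD; apply: ufil_mul => //; exact: ufil_inj.
have [|b -> _] := img _ (@pol_mC F g) (isP (A := (U^c)%type) eM) wp _ Pp; first by move=> x [y ->]; exists y.
have [|a -> _] := img _ (@pol_pC F g) (isN (A := (U^c)%type) eP) wn _ Nn; first by move=> x [y ->]; exists y.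
have [|k -> fk] := img _ (@pol_lC F g) isL wl _ Ll; first by [].
apply: span_gen; exists a, k, b; split; last by rewrite -mulrA.
by apply: ufil_mono fk; rewrite lez_nat.
Qed.

(** The increase depends on [x] alone and not on the other factor; this is the source of the
    continuity of the pairings. *)
Lemma tri1_word x : exists d, forall e z, tri1 e z -> tri1 (d + e) (x * z).
Proof.
elim/uenv_ind: x => [x||a x y [d hd] [d' hd']|x y [d hd] [d' hd']].
- have [p [m ->]] := polar_split x; exists 1%N => e z ez.
  rewrite !uinjD !mulrDl; apply: spanD; first apply: spanD.
  + by apply: tri_L => //; [exact: tri_LP|exists (proj_l x)].
  + by apply: tri_mono (leqnSn e) _; apply: tri_P => //; exists p.
  + apply: tri_N => //; [exact: tri_LP|exact: tri_ML|exact: tri_MP|by exists m].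
- by exists 0%N => e z; rewrite mul1r.
- exists (d + d')%N => e z ez; rewrite mulrDl -scalerAl; apply: spanD.
    by apply: spanZ; apply: tri_mono (hd _ _ ez); lia.
  by apply: tri_mono (hd' _ _ ez); lia.
exists (d + d')%N => e z ez; rewrite -mulrA -addnA; apply: hd; exact: hd'.
Qed.

Lemma tri2_word (x : U) : exists d, forall e (z : U^c%type), tri2 e z ->
  tri2 (d + e) ((x : U^c%type) * z).
Proof.
elim/uenv_ind: x => [x||a x y [d hd] [d' hd']|x y [d hd] [d' hd']].
- have [p [m E]] := polar_split x; exists 1%N => e z ez.
  have -> : (uinj x : U^c%type) = (uinj (vsval (proj_l x)) : U^c%type) + eP p + eM m.
    by rewrite {1}E !uinjD.
  rewrite !mulrDl; apply: spanD; first apply: spanD.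
  + by apply: tri_L => //; [exact: tri2_LP|exists (proj_l x)].
  + apply: tri_N => //; [exact: tri2_LP|exact: tri2_NL|exact: tri2_MP|by exists p].
  + by apply: tri_mono (leqnSn e) _; apply: tri_P => //; exists m.
- by exists 0%N => e z ez; rewrite mul1r.
- exists (d + d')%N => e z ez; rewrite mulrDl -scalerAl; apply: spanD.
    by apply: spanZ; apply: tri_mono (hd _ _ ez); lia.
  by apply: tri_mono (hd' _ _ ez); lia.
exists (d' + d)%N => e z ez.
have -> : ((x * y : U) : U^c%type) * z = (y : U^c%type) * ((x : U^c%type) * z).
  by rewrite mulrA.
by rewrite -addnA; apply: hd'; exact: hd.
Qed.

Lemma tri1_all z : exists e, tri1 e z.
Proof.
have [e he] := tri1_word z; exists e.
by rewrite -[z]mulr1 -[e]addn0; apply: he; exact: tri_one.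
Qed.

Lemma U_span z : spanp (fun z => exists a l b, z = ip a * il l * im b) z.
Proof.
have [e /tri1_gen] := tri1_all z; apply: span_sub => _ [a [l [b [_ ->]]]].
by apply: span_gen; exists a, l, b.
Qed.

Let Hl : linear H. Proof. by case: H_hc. Qed.
Let HE a l b : H (ip a * il l * im b) = (Ucounit a * Ucounit b) *: l.
Proof. by case: H_hc. Qed.

Lemma hc_P a z : H (ip a * z) = Ucounit a *: H z.
Proof.
apply: (span_ind_lin (f := fun z => H (ip a * z)) (h := fun z => Ucounit a *: H z)) (U_span z).
- by apply: (lin_comp Hl); exact: (lin_mull (f := id)).
- exact: lin_scale.
move=> _ [a' [l [b ->]]]; rewrite !mulrA -UsubM !HE UcounitM scalerA.
by rewrite mulrA.
Qed.

Lemma hc_M b z : H (z * im b) = Ucounit b *: H z.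
Proof.
apply: (span_ind_lin (f := fun z => H (z * im b)) (h := fun z => Ucounit b *: H z)) (U_span z).
- by apply: (lin_comp Hl); exact: (lin_mulr (f := id)).
- exact: lin_scale.
move=> _ [a' [l [b' ->]]] /=; rewrite -[_ * im b' * im b]mulrA -UsubM !HE UcounitM scalerA.
by congr (_ *: _); rewrite mulrA mulrC.
Qed.

Lemma hc_il l : H (il l) = l.
Proof. by have := HE 1 l 1; rewrite !Usub1 mul1r mulr1 !Ucounit1 mulr1 scale1r. Qed.

(** An element of l crosses a factor from u_- at the cost of a term that again ends in u_-, and H
    kills both. For [hc_ll] the same happens with u_+ on the left. *)
Lemma hc_lr l z : H (z * il l) = H z * l.
Proof.
elim/uenv_ind: l z => [x||a x y Ex Ey|x y Ex Ey] z.
- have Q b z' : H (z' * im b * il (uinj x)) = Ucounit b *: H (z' * il (uinj x)).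
    elim/uenv_ind: b z' => [n||a b b' Eb Eb'|b b' Eb Eb'] z'.
    + have [n' En] := tri_ML n (ex_intro _ x erefl).
      have -> : z' * im (uinj n) * il (uinj x) = z' * il (uinj x) * im (uinj n) + z' * im (uinj n').
        by rewrite !Usub_inj -[uinj (vsval n')]En /eM; ncring.
      by rewrite (linD Hl) !hc_M !Ucounit_inj !scale0r addr0.
    + by rewrite Usub1 mulr1 Ucounit1 scale1r.
    + rewrite (Usub_lin a b b') mulrDr mulrDl -scalerAr -scalerAl Hl Eb Eb'.
      by rewrite scalerA -scalerDl (Ucounit_lin a b b').
    + by rewrite UsubM mulrA Eb' Eb UcounitM scalerA mulrC.
  apply: (span_ind_lin (f := fun z => H (z * il (uinj x))) (h := fun z => H z * uinj x)) (U_span z).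
  + by apply: (lin_comp Hl); exact: (lin_mulr (f := id)).
  + exact: lin_mulr.
  move=> _ [a' [l [b ->]]] /=; rewrite Q -mulrA -UsubM hc_P hc_il HE.
  by rewrite -!scalerAl scalerA mulrC.
- by rewrite Usub1 !mulr1.
- by rewrite (Usub_lin a x y) !mulrDr -!scalerAr Hl Ex Ey.
by rewrite UsubM mulrA Ey Ex mulrA.
Qed.

Lemma hc_ll l z : H (il l * z) = l * H z.
Proof.
elim/uenv_ind: l z => [x||a x y Ex Ey|x y Ex Ey] z.
- have Q b z' : H (il (uinj x) * (ip b * z')) = Ucounit b *: H (il (uinj x) * z').
    elim/uenv_ind: b z' => [n||a b b' Eb Eb'|b b' Eb Eb'] z'.
    + have [n' En] := tri_LP n (ex_intro _ x erefl).
      have -> : il (uinj x) * (ip (uinj n) * z') = ip (uinj n) * (il (uinj x) * z') + ip (uinj n') * z'.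
        by rewrite !Usub_inj -[uinj (vsval n')]En /eP; ncring.
      by rewrite (linD Hl) !hc_P !Ucounit_inj !scale0r addr0.
    + by rewrite Usub1 mul1r Ucounit1 scale1r.
    + rewrite (Usub_lin a b b') mulrDl mulrDr -scalerAl -scalerAr Hl Eb Eb'.
      by rewrite scalerA -scalerDl (Ucounit_lin a b b').
    + by rewrite UsubM -[ip b * ip b' * z']mulrA Eb Eb' UcounitM scalerA.
  apply: (span_ind_lin (f := fun z => H (il (uinj x) * z)) (h := fun z => uinj x * H z)) (U_span z).
  + by apply: (lin_comp Hl); exact: (lin_mull (f := id)).
  + exact: lin_mull.
  move=> _ [a' [l [b ->]]] /=; rewrite -!mulrA Q !mulrA -UsubM hc_M hc_il HE.
  by rewrite -!scalerAr scalerA.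
- by rewrite Usub1 !mul1r.
- by rewrite (Usub_lin a x y) !mulrDl -!scalerAl Hl Ex Ey.
by rewrite UsubM -mulrA Ex Ey mulrA.
Qed.

Lemma hc_tgen e z : spanp (tgen e) z -> ufil e%:Z (H z).
Proof.
elim=> [|a x y [p [l [m [el ->]]]] _ IH]; first by rewrite lin0 //; case: (ufil_sub (Lie_l g) e%:Z).
rewrite Hl HE; apply: (ufil_sub _ _).2 => //.
have [z0 zl] := ufil_sub (Lie_l g) e%:Z.
by have := zl (Ucounit p * Ucounit m) l 0 el z0; rewrite addr0.
Qed.

Section Values.
Variables (Uh : filtAlg F) (iota : Uenv (Lie_l g) -> Uh).
Hypotheses (iota_lin : linear iota) (iota_mor : GRing.monoid_morphism iota)
  (iota_fil : forall k x, ufil k x -> fil k (iota x)).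

Definition hI (z : U) : Uh := iota (H z).

Lemma hI_lin : linear hI. Proof. exact: lin_comp. Qed.
Lemma hI_P a z : hI (ip a * z) = Ucounit a *: hI z.
Proof. by rewrite /hI hc_P linZ. Qed.
Lemma hI_M b z : hI (z * im b) = Ucounit b *: hI z.
Proof. by rewrite /hI hc_M linZ. Qed.
Lemma hI_lr l z : hI (z * il l) = hI z * iota l.
Proof. by rewrite /hI hc_lr iota_mor.2. Qed.
Lemma hI_ll l z : hI (il l * z) = iota l * hI z.
Proof. by rewrite /hI hc_ll iota_mor.2. Qed.
Lemma hI1 : hI 1 = 1.
Proof. by rewrite /hI -[1](@Usub1 _ _ _ (@pol_lC F g)) hc_il iota_mor.1. Qed.
Lemma hI_fil1 e z : tri1 e z -> fil e%:Z (hI z).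
Proof. by move=> /tri1_gen/hc_tgen; exact: iota_fil. Qed.
Lemma hI_fil2 e z : tri2 e z -> fil e%:Z (hI z).
Proof. by move=> /tri2_gen/hc_tgen; exact: iota_fil. Qed.

Definition wP (v : seq (Lie_p g)) : U := \prod_(x <- v) uinj (vsval x).
Definition wM (v : seq (Lie_m g)) : U := \prod_(x <- v) uinj (vsval x).
Definition mpair (y : Lie_m g) (x : Lie_p g) : Uh := iota (uinj (proj_l ⁅vsval y, vsval x⁆)).


Lemma ip_wd (w : seq (Lie_p g)) : ip (\prod_(x <- w) uinj x) = wP w.
Proof.
rewrite /wP; elim: w => [|x w IHw]; first by rewrite !big_nil Usub1.
by rewrite !big_cons UsubM Usub_inj IHw.
Qed.
Lemma im_wd (w : seq (Lie_m g)) : im (\prod_(x <- w) uinj x) = wM w.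
Proof.
rewrite /wM; elim: w => [|x w IHw]; first by rewrite !big_nil Usub1.
by rewrite !big_cons UsubM Usub_inj IHw.
Qed.

Lemma Up_wd a : spanp (wd (isP eP)) (ip a).
Proof.
have [s [_ ->]] : exists s : seq (F * seq (Lie_p g)), (forall p, p \in s -> true) /\
    a = \sum_(p <- s) p.1 *: uword p.2.
  by have [k [s [_ sE]]] := ufil_exh a; exists s.
rewrite (lin_sum (@Usub_lin _ _ _ _)); apply: span_sum => p; rewrite (linZ (@Usub_lin _ _ _ _)).
by apply: spanZ; apply: span_gen; rewrite ip_wd; exact: wd_prP.
Qed.
Lemma Um_wd b : spanp (wd (A := U^c%type) (isP (A := U^c%type) eM)) (im b).
Proof.
have [s [_ ->]] : exists s : seq (F * seq (Lie_m g)), (forall p, p \in s -> true) /\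
    b = \sum_(p <- s) p.1 *: uword p.2.
  by have [k [s [_ sE]]] := ufil_exh b; exists s.
rewrite (lin_sum (@Usub_lin _ _ _ _)); apply: (@span_sum F U) => p.
rewrite (linZ (@Usub_lin _ _ _ _)); apply: (@spanZ F U); apply: (@span_gen F U).
rewrite im_wd /wM -[p.2]revK -big_converse; exact: wd_prP.
Qed.

(** In the opposite algebra [a] multiplies words in u_- from the left, so the number of letters of l
    created is bounded in terms of [a] alone. *)
Lemma tgen_ipim a : exists e, forall b, spanp (tgen e) (im b * ip a).
Proof.
have [e he] := tri2_word (ip a); exists e => b; apply: tri2_gen.
elim: (Um_wd b) => [|c x y Px _ IH]; first by rewrite mul0r; exact: span0.
rewrite mulrDl -scalerAl; apply: (@spanD F U) => //; apply: (@spanZ F U).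
have := @tri_wdP F (U^c)%type _ _ eM eP isL _ _ _ Px (@tri_one F (U^c)%type _ _ eM eP isL).
by rewrite mulr1 => /he; rewrite addn0.
Qed.

Lemma hI_shift1 x : exists d : nat, forall a, fil d%:Z (hI (x * ip a)).
Proof.
have [d hd] := tri1_word x; exists d => a; apply: hI_fil1.
elim: (Up_wd a) => [|c y z Py _ IH]; first by rewrite mulr0; exact: span0.
rewrite mulrDr -scalerAr; apply: spanD => //; apply: spanZ.
rewrite -[d]addn0; apply: hd; rewrite -[y]mulr1.
by apply: tri_wdP => //; exact: tri_one.
Qed.

Lemma hI_shift2 y : exists d : nat, forall b, fil d%:Z (hI (im b * y)).
Proof.
have [d hd] := tri2_word y; exists d => a; apply: hI_fil2.
elim: (Um_wd a) => [|c x z Px _ IH]; first by rewrite mul0r; exact: span0.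
rewrite mulrDl -scalerAl; apply: (@spanD F U) => //; apply: (@spanZ F U).
have := @tri_wdP F (U^c)%type _ _ eM eP isL _ _ _ Px (@tri_one F (U^c)%type _ _ eM eP isL).
by rewrite mulr1 => /hd; rewrite addn0.
Qed.

Lemma hI_wM w a : fil (size w)%:Z (hI (wM w * ip a)).
Proof.
apply: hI_fil1; elim: (Up_wd a) => [|c y z Py _ IH]; first by rewrite mulr0; exact: span0.
rewrite mulrDr -scalerAr; apply: spanD => //; apply: spanZ.
by apply: tri_NP => //; [exact: tri_LP|exact: tri_ML|exact: tri_MP].
Qed.

Lemma hI_wP w b : fil (size w)%:Z (hI (im b * wP w)).
Proof.
apply: hI_fil2; elim: (Um_wd b) => [|c y z Py _ IH]; first by rewrite mul0r; exact: span0.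
rewrite mulrDl -scalerAl; apply: (@spanD F U) => //; apply: (@spanZ F U).
have := @tri_NP F (U^c)%type _ _ eM eP isL cpm tri2_LP tri2_NL tri2_MP (rev w) _ Py.
by rewrite big_converse revK size_rev.
Qed.

(** The abstract recursion in U(g): right U(l)-linearity of H makes an element of l act on values by
    right multiplication. *)
Lemma hI_recM w n v : (size v <= (size w).+1)%N ->
  fil (size w)%:Z (hI (wM w * (uinj (vsval n) * wP v)) -
    \sum_(p <- rems v) hI (wM w * wP p.2) * mpair n p.1).
Proof.
move=> vw.
have h1 l z : isL l -> hI (z * l) = hI z * hI l.
  by move=> [x ->]; rewrite -Usub_inj hI_lr /hI hc_il.
have h2 l k b : isL l -> fil k b -> fil (k + 1) (b * hI l).
  move=> [x ->] kb; apply: fil_mul => //.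
  by rewrite -Usub_inj /hI hc_il; apply: iota_fil; exact: ufil_inj.
have h3 m z : hI (z * eM m) = 0 by rewrite /eM -Usub_inj hI_M Ucounit_inj scale0r.
have [_ h] := @pairing_rec F U _ _ eP eM isL cmp tri_LP tri_ML tri_MP
  Uh (@fil F Uh) hI (fun l b => b * hI l) (@fil_sub F Uh) hI_lin hI_fil1 h1 h2 h3 (size w).
have := h w n v erefl vw; congr (fil _ (_ - _)); apply: eq_bigr => p _.
by rewrite /mpair /cmp -Usub_inj /hI hc_il.
Qed.

(** The abstract recursion in the opposite algebra: products there reverse words, whence the
    occurrences of [rev], and left U(l)-linearity of H is the one that enters. *)
Lemma hI_recP w n v : (size v <= (size w).+1)%N ->
  fil (size w)%:Z (hI (wM v * (uinj (vsval n) * wP w)) -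
    \sum_(p <- rems v) mpair p.1 n * hI (wM p.2 * wP w)).
Proof.
move=> vw.
have h1 (l z : U^c%type) : isL l -> hI (z * l) = hI l * hI z.
  move=> [x ->]; transitivity (hI (uinj (vsval x) * (z : U))) => //.
  by rewrite -Usub_inj hI_ll /hI hc_il.
have h2 l k b : isL l -> fil k b -> fil (k + 1) (hI l * b).
  move=> [x ->] kb; rewrite addrC; apply: fil_mul => //.
  by rewrite -Usub_inj /hI hc_il; apply: iota_fil; exact: ufil_inj.
have h3 m (z : U^c%type) : hI (z * (eP m : U^c%type)) = 0.
  transitivity (hI (eP m * (z : U))) => //.
  by rewrite /eP -Usub_inj hI_P Ucounit_inj scale0r.
have [_ h] := @pairing_rec F (U^c)%type _ _ eM eP isL cpm tri2_LP tri2_NL tri2_MP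
  Uh (@fil F Uh) hI (fun l b => hI l * b) (@fil_sub F Uh) hI_lin hI_fil2 h1 h2 h3 (size w).
have := h (rev w) n (rev v); rewrite !size_rev => /(_ erefl vw).
rewrite !big_converse !revK big_rems_rev.
congr (fil _ (_ - _)); first by congr hI; rewrite mulrA.
apply: eq_bigr => p _ /=.
rewrite !big_converse !revK /mpair /cpm /cmp; congr (_ * _).
by rewrite -Usub_inj /hI hc_il.
Qed.
End Values.

End HarishChandra.

(** * Change of the uncompleted factor, constants and embeddings *)

Lemma cmap_comp (F : fieldType) (Uh : filtAlg F) (V W X : algType F) (f : W -> X) (h : V -> W)
    (Z : compl (rtens V Uh)) : linear f -> linear h ->
  cmap_l f (cmap_l h Z) = cmap_l (fun v => f (h v)) Z.
Proof.
move=> fl hl; have fhl : linear (fun v => f (h v)) by exact: lin_comp.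
apply: (@eq_ext F V Uh (compl (rtens X Uh)) _
  (fun Z => cmap_l f (cmap_l h Z)) (fun Z => cmap_l (fun v => f (h v)) Z)).
- exact: compl_separated.
- by apply: (bdd_comp (cmap_bdd _ fl)); exact: cmap_bdd.
- exact: cmap_bdd.
by move=> v u; rewrite !cmapE.
Qed.

Lemma cmap_id (F : fieldType) (Uh : filtAlg F) (V : algType F) (Z : compl (rtens V Uh)) :
  cmap_l (fun v : V => v) Z = Z.
Proof.
apply: (@eq_ext F V Uh (compl (rtens V Uh)) _ (cmap_l (fun v : V => v)) (fun Z => Z)).
- exact: compl_separated.
- exact: cmap_bdd.
- exact: bdd_id.
by move=> v u; rewrite cmapE.
Qed.

Lemma Usub_incl (F : fieldType) (g : lieAlg F) (V W : {vspace g}) (hV : lie_closed V)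
    (hW : lie_closed W) (x : Uenv (subLie hV)) : (V <= W)%VS ->
  exists w : Uenv (subLie hW), Usub w = Usub x.
Proof.
move=> /subvP VW; elim/uenv_ind: x => [x||a x y [v Ev] [w Ew]|x y [v Ev] [w Ew]].
- exists (uinj (vsproj W (vsval x) : subLie hW)); rewrite !Usub_inj vsprojK //.
  by apply: VW; exact: subvsP.
- by exists 1; rewrite !Usub1.
- by exists (a *: v + w); rewrite !(@Usub_lin _ _ _ _ a) Ev Ew.
by exists (v * w); rewrite !UsubM Ev Ew.
Qed.


Lemma cinMt (F : fieldType) (Uh : filtAlg F) (V : algType F) (v v' : V) (u u' : Uh) :
  (cin (v ⊗ u : rtens V Uh) : compl (rtens V Uh)) * cin (v' ⊗ u' : rtens V Uh) = cin ((v * v') ⊗ (u * u') : rtens V Uh).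
Proof. by rewrite -[LHS]cinM [X in cin X = _]tensM. Qed.

Section Alpha.
Variables (F : fieldType) (A B C : algType F).
Definition alpha (a : A) (t : B ⊗ C) : A ⊗ B ⊗ C := tlift (fun b c => a ⊗ b ⊗ c) t.
Lemma alpha_bil a : @bilinear_map F B C (A ⊗ B ⊗ C)%type (fun b c => a ⊗ b ⊗ c).
Proof.
split=> [c|b]; last exact: (lin_tensr (f := id)).
by apply: lin_tensl; exact: (lin_tensr (f := id)).
Qed.
Lemma alphaE a b c : alpha a (b ⊗ c) = a ⊗ b ⊗ c.
Proof. by apply: tliftE; exact: alpha_bil. Qed.
Lemma alpha_lin a : linear (alpha a).
Proof. exact: (tlift_lin (alpha_bil a)). Qed.
Lemma alpha_linl t : linear (alpha^~ t).
Proof.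
apply: (@tlift_linl F A B C (A ⊗ B ⊗ C)%type (fun a b c => a ⊗ b ⊗ c)) => [a|b c]; first exact: alpha_bil.
by apply: lin_tensl; exact: (lin_tensl (f := id)).
Qed.
Lemma alphaM a a' s t : alpha a s * alpha a' t = alpha (a * a') (s * t).
Proof.
elim/tens_ind: s => [b c|k x y Ex Ey]; last first.
  by rewrite alpha_lin !mulrDl -!scalerAl Ex Ey alpha_lin.
elim/tens_ind: t => [b' c'|k x y Ex Ey]; last first.
  by rewrite alpha_lin !mulrDr -!scalerAr Ex Ey alpha_lin.
by rewrite tensM !alphaE !tensM.
Qed.
Lemma tmap_alpha t : tmap (fun w : B => (1 : A) ⊗ w) (@id C) t = alpha 1 t.
Proof.
have tl : linear (tmap (fun w : B => (1 : A) ⊗ w) (@id C)).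
  by apply: tmap_lin => //; exact: (lin_tensr (f := id)).
elim/tens_ind: t => [b c|k x y Ex Ey]; last by rewrite tl Ex Ey alpha_lin.
by rewrite alphaE tmapE //; exact: (lin_tensr (f := id)).
Qed.
End Alpha.

Section Constants.
Variables (F : fieldType) (Uh : filtAlg F).
Notation C V := (compl (rtens V Uh)).

Definition cc (V : algType F) (v : V) : C V := cin (v ⊗ 1 : rtens V Uh).
Definition cu (V : algType F) (u : Uh) : C V := cin (1 ⊗ u : rtens V Uh).
Definition embr (V W : algType F) (Y : C W) : C (V ⊗ W) := cmap_l (fun w : W => (1 : V) ⊗ w) Y.

Section One.
Variable V : algType F.

Lemma cc_lin : linear (@cc V).
Proof. by apply: (lin_comp (bdd_lin (bdd_cin _))); exact: (lin_tensl (f := id)). Qed.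
Lemma cu_lin : linear (@cu V).
Proof. by apply: (lin_comp (bdd_lin (bdd_cin _))); exact: (lin_tensr (f := id)). Qed.
Lemma cc1 : cc (1 : V) = 1. Proof. by []. Qed.
Lemma cu1 : cu V 1 = 1. Proof. by []. Qed.
Lemma ccM (v w : V) : cc (v * w) = cc v * cc w.
Proof. by rewrite /cc cinMt mulr1. Qed.
Lemma cuM u v : cu V (u * v) = cu V u * cu V v.
Proof. by rewrite /cu cinMt mulr1. Qed.
Lemma cc_cu (v : V) u : cc v * cu V u = cin (v ⊗ u : rtens V Uh).
Proof. by rewrite /cc /cu cinMt mulr1 mul1r. Qed.
Lemma cu_cc (v : V) u : cu V u * cc v = cin (v ⊗ u : rtens V Uh).
Proof. by rewrite /cc /cu cinMt mulr1 mul1r. Qed.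
Lemma cc_fil (v : V) : fil 0 (cc v).
Proof. by apply/cfil_in; apply: tspan_gen => //; exact: fil_one. Qed.
Lemma cu_fil k u : fil k u -> fil k (cu V u).
Proof. by move=> ku; apply/cfil_in; exact: tspan_gen. Qed.
End One.

Lemma cmap_cc (V W : algType F) (f : V -> W) v : linear f -> cmap_l f (cc v) = cc (f v).
Proof. by move=> fl; rewrite /cc cmapE. Qed.
Lemma cmap_cu (V W : algType F) (f : V -> W) u : linear f -> f 1 = 1 ->
  cmap_l f (cu V u) = cu W u.
Proof. by move=> fl f1; rewrite /cu cmapE // f1. Qed.

Section Two.
Variables V W : algType F.

Lemma tensr_lin (v : V) : linear (fun w : W => v ⊗ w).
Proof. exact: (lin_tensr (f := id)). Qed.
Lemma tensl_lin (w : W) : linear (fun v : V => v ⊗ w).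
Proof. exact: (lin_tensl (f := id)). Qed.
Lemma tensr_mor : GRing.monoid_morphism (fun w : W => (1 : V) ⊗ w).
Proof. by split=> // x y; rewrite tensM mul1r. Qed.
Lemma tensl_mor : GRing.monoid_morphism (fun v : V => v ⊗ (1 : W)).
Proof. by split=> // x y; rewrite tensM mul1r. Qed.

Lemma embr_bdd : bdd (@embr V W : C W -> C (V ⊗ W)).
Proof. by apply: cmap_bdd; exact: tensr_lin. Qed.
Lemma embr_lin : linear (@embr V W : C W -> C (V ⊗ W)).
Proof. exact: bdd_lin embr_bdd. Qed.
Lemma embr_fil k Y : fil k Y -> fil k (@embr V W Y : C (V ⊗ W)).
Proof. by have [_ h] := cmap_fshift Uh (@tensr_lin 1); move=> /h; rewrite addr0. Qed.
Lemma embr_mor : GRing.monoid_morphism (@embr V W : C W -> C (V ⊗ W)).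
Proof. by apply: cmap_morph; [exact: tensr_lin|exact: tensr_mor]. Qed.
Lemma embrM X Y : @embr V W (X * Y) = embr V X * embr V Y.
Proof. by case: embr_mor. Qed.
Lemma embr1 : @embr V W 1 = 1. Proof. by case: embr_mor. Qed.
Lemma embrE w u : @embr V W (cin (w ⊗ u : rtens W Uh)) = cin (1 ⊗ w ⊗ u : rtens (V ⊗ W) Uh).
Proof. by apply: cmapE; exact: tensr_lin. Qed.
Lemma embr_cc w : @embr V W (cc w) = cc (1 ⊗ w).
Proof. exact: embrE. Qed.
Lemma embr_cu u : @embr V W (cu W u) = cu _ u.
Proof. exact: embrE. Qed.

Lemma embr_com v Y : cc (v ⊗ 1) * @embr V W Y = embr V Y * cc (v ⊗ 1).
Proof.
apply: (@eq_ext F W Uh (C (V ⊗ W)) _ (fun Y => cc (v ⊗ 1) * embr V Y) (fun Y => embr V Y * cc (v ⊗ 1))).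
- exact: compl_separated.
- by apply: bdd_mull; exact: embr_bdd.
- by apply: bdd_mulr; exact: embr_bdd.
by move=> w u; rewrite embrE /cc !cinMt !tensM !mulr1 !mul1r.
Qed.
End Two.
Section Three.
Variables V W X : algType F.

(** Inserts 1 in front while keeping the brackets to the left; [embr V] would land in V (x) (W (x)
    X). *)
Definition embm (Y : C (W ⊗ X)) : C (V ⊗ W ⊗ X) :=
  cmap_l (tmap (fun w : W => (1 : V) ⊗ w) (@id X)) Y.

Let phi_lin : linear (tmap (fun w : W => (1 : V) ⊗ w) (@id X)).
Proof. by apply: tmap_lin => //; exact: tensr_lin. Qed.
Let phi_mor : GRing.monoid_morphism (tmap (fun w : W => (1 : V) ⊗ w) (@id X)).
Proof. by apply: tmap_morph => //; [exact: tensr_lin|exact: tensr_mor]. Qed.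
Let phiE w x : tmap (fun w : W => (1 : V) ⊗ w) (@id X) (w ⊗ x) = 1 ⊗ w ⊗ x.
Proof. by apply: tmapE => //; exact: tensr_lin. Qed.

Lemma embm_bdd : bdd embm. Proof. exact: cmap_bdd. Qed.
Lemma embm_lin : linear embm. Proof. exact: bdd_lin embm_bdd. Qed.
Lemma embm_mor : GRing.monoid_morphism embm. Proof. exact: cmap_morph. Qed.
Lemma embmM Y Z : embm (Y * Z) = embm Y * embm Z. Proof. by case: embm_mor. Qed.
Lemma embm_fil k Y : fil k Y -> fil k (embm Y).
Proof. by have [_ h] := cmap_fshift Uh phi_lin; move=> /h; rewrite addr0. Qed.
Lemma embmE w x u : embm (cin (w ⊗ x ⊗ u : rtens (W ⊗ X) Uh)) = cin (1 ⊗ w ⊗ x ⊗ u : rtens (V ⊗ W ⊗ X) Uh).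
Proof. by rewrite /embm cmapE // phiE. Qed.
Lemma embm_t t u : embm (cin (t ⊗ u : rtens (W ⊗ X) Uh)) = cin (alpha 1 t ⊗ u : rtens (V ⊗ W ⊗ X) Uh).
Proof. by rewrite /embm cmapE // tmap_alpha. Qed.
Lemma embm_cc w x : embm (cc (w ⊗ x)) = cc (1 ⊗ w ⊗ x).
Proof. exact: embmE. Qed.

Lemma embm_embr Y : embm (embr W Y) = embr (V ⊗ W)%type Y.
Proof.
rewrite /embm /embr cmap_comp //; last exact: tensr_lin.
by congr (cmap_l _ Y); apply/funext => x; rewrite phiE.
Qed.
End Three.
End Constants.
Arguments embm {F Uh} V {W X} Y.
Arguments cu {F Uh} V u.
Arguments embr {F Uh} V {W} Y.


Section UsubHopf.
Variables (F : fieldType) (g : lieAlg F) (V : {vspace g}) (hV : lie_closed V).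
Notation us := (@Usub F g V hV).

Lemma Usub_ant x : Uantipode (us x) = us (Uantipode x).
Proof.
elim/uenv_ind: x => [x||a x y Ex Ey|x y Ex Ey].
- by rewrite Usub_inj !Uant_inj (linN (@Usub_lin _ _ _ _)) Usub_inj.
- by rewrite !(Usub1, Uant1).
- by rewrite (@Usub_lin _ _ _ _ a) !(@Uant_lin _ _ a) (@Usub_lin _ _ _ _ a) Ex Ey.
by rewrite !(UsubM, UantM) Ex Ey.
Qed.
Lemma Usub_cop x : Ucop (us x) = tmap us us (Ucop x).
Proof.
have ul := @Usub_lin F g V hV; have tl := tmap_lin ul ul.
have um : GRing.monoid_morphism us by split; [exact: Usub1|exact: UsubM].
have [t1 tM] := tmap_morph ul ul um um.
elim/uenv_ind: x => [x||a x y Ex Ey|x y Ex Ey].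
- by rewrite Usub_inj !Ucop_inj (linD tl) !tmapE // Usub_inj Usub1.
- by rewrite Usub1 !Ucop1 t1.
- by rewrite ul !Ucop_lin tl Ex Ey.
by rewrite UsubM !UcopM tM Ex Ey.
Qed.
End UsubHopf.

Lemma Ucop_ant (F : fieldType) (g : lieAlg F) (x : Uenv g) :
  Ucop (Uantipode x) = tlift (fun b1 b2 => Uantipode b2 ⊗ Uantipode b1) (Ucop x).
Proof.
have Sl := @Uant_lin F g.
have bb : @bilinear_map F (Uenv g) (Uenv g) (Uenv g ⊗ Uenv g)%type
    (fun b1 b2 => Uantipode b2 ⊗ Uantipode b1).
  by split=> b; [exact: lin_tensr|exact: lin_tensl].
have tl := tlift_lin bb.
have [t1 tM] : antimorphism (tlift (fun b1 b2 : Uenv g => Uantipode b2 ⊗ Uantipode b1)).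
  apply: tlift_anti => [||a a' c c']; [exact: bb|by rewrite Uant1|].
  by rewrite !UantM tensM.
elim/uenv_ind: x => [x||a x y Ex Ey|x y Ex Ey].
- rewrite Uant_inj (linN (@Ucop_lin F g)) !Ucop_inj (linD tl) !tliftE // Uant1 Uant_inj.
  rewrite (linN (@tensr_lin F (Uenv g) (Uenv g) 1)) (linN (@tensl_lin F (Uenv g) (Uenv g) 1)).
  by rewrite -opprD addrC.
- by rewrite Uant1 !Ucop1 t1.
- by rewrite Sl !Ucop_lin tl Ex Ey.
by rewrite UantM !UcopM tM Ex Ey.
Qed.

Section Generic.
Variables (F : fieldType) (Uh : filtAlg F).
Notation C V := (compl (rtens V Uh)).

(** A functional nonzero on [v - w], tensored with one that separates 1 from a degree not containing
    it, detects the difference even after completion. *)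
Lemma cc_inj (V : algType F) : injective (@cc F Uh V).
Proof.
move=> v w /eqP; rewrite -subr_eq0 -(linB (@cc_lin F Uh V)) => /eqP E; apply/eqP.
rewrite -subr_eq0; apply: contraT => vw; have [k k1] := fil_proper Uh.
have [f [fl f1 fk]] := tens_sep vw (fil_sub Uh k) k1.
have : fil k (cin ((v - w) ⊗ 1 : rtens V Uh) : C V) by rewrite -/(cc _ _) E; exact: fil0.
move=> /cfil_in [s [sk Es]]; move/eqP: f1.
rewrite Es (lin_sum fl) big_seq big1 => [|p /sk [_ pk]]; last exact: fk.
by rewrite eq_sym oner_eq0.
Qed.

Definition embl (V W : algType F) (X : C V) : C (V ⊗ W) := cmap_l (fun v : V => v ⊗ (1 : W)) X.

Section EmbL.
Variables V W : algType F.
Let el := @tensl_lin F V W 1.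
Lemma embl_bdd : bdd (@embl V W : C V -> C (V ⊗ W)). Proof. exact: cmap_bdd. Qed.
Lemma embl_lin : linear (@embl V W : C V -> C (V ⊗ W)). Proof. exact: bdd_lin embl_bdd. Qed.
Lemma emblM X Y : @embl V W (X * Y) = embl W X * embl W Y.
Proof. by have [_ h] := cmap_morph Uh el (@tensl_mor F V W); exact: h. Qed.
Lemma emblE v u : @embl V W (cin (v ⊗ u : rtens V Uh)) = cin (v ⊗ 1 ⊗ u : rtens (V ⊗ W) Uh).
Proof. exact: cmapE. Qed.
Lemma embl_cc v : @embl V W (cc Uh v) = cc Uh (v ⊗ 1).
Proof. exact: emblE. Qed.
Lemma embl_cu u : @embl V W (cu V u) = cu _ u.
Proof. exact: emblE. Qed.
Lemma embl_fil k Y : fil k Y -> fil k (@embl V W Y : C (V ⊗ W)).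
Proof. by have [_ h] := cmap_fshift Uh el; move=> /h; rewrite addr0. Qed.
End EmbL.
End Generic.
Arguments embl {F Uh V} W X.

Lemma ltens1 (F : fieldType) (A : filtAlg F) (B : algType F) : (1 : ltens A B) = 1 ⊗ 1.
Proof. by []. Qed.


Lemma span_word (F : fieldType) (g : lieAlg F) (d : nat) (xs : 'I_d -> g) :
  (forall x, exists c : 'I_d -> F, x = \sum_i c i *: xs i) ->
  forall a : Uenv g, spanp (fun z => exists u, z = ew (fun i => uinj (xs i)) u) a.
Proof.
move=> xs_span; have inj x : spanp (fun z => exists i, z = uinj (xs i)) (uinj x).
  have [c ->] := xs_span x; rewrite (lin_sum (@uinj_lin F g)); apply: span_sum => i.
  by rewrite (linZ (@uinj_lin F g)); apply: spanZ; apply: span_gen; exists i.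
elim/uenv_ind => [x||a x y Px Py|x y Px Py].
- apply: span_sub (inj x) => _ [i ->]; apply: span_gen; exists [:: i].
  by rewrite /ew big_seq1.
- by apply: span_gen; exists [::]; rewrite /ew big_nil.
- by apply: spanD => //; exact: spanZ.
apply: (span_map (f := fun z => z * y)) Px => [|_ [u ->]].
  exact: (lin_mulr (f := id)).
apply: (span_map (f := fun z => ew _ u * z)) Py => [|_ [v ->]].
  exact: (lin_mull (f := id)).
by apply: span_gen; exists (u ++ v); rewrite /ew big_cat.
Qed.

Lemma span_inj (F : fieldType) (g : lieAlg F) (d : nat) (xs : 'I_d -> g) :
  (forall x, exists c : 'I_d -> F, x = \sum_i c i *: xs i) ->
  forall x, spanp (fun z => exists i, z = uinj (xs i)) (uinj x).
Proof.
move=> xs_span x; have [c ->] := xs_span x; rewrite (lin_sum (@uinj_lin F g)).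
apply: span_sum => i; rewrite (linZ (@uinj_lin F g)).
by apply: spanZ; apply: span_gen; exists i.
Qed.


Lemma comm_lin (F : fieldType) (A : algType F) (x : A) : linear (fun y => x * y - y * x).
Proof. by apply: lin_sub; [exact: (lin_mull (f := id))|exact: (lin_mulr (f := id))]. Qed.
Lemma commM (F : fieldType) (A : algType F) (x y z : A) :
  x * (y * z) - y * z * x = (x * y - y * x) * z + y * (x * z - z * x).
Proof. ncring. Qed.


Section SwapMap.
Variables (F : fieldType) (A C' : algType F) (f : A -> C').
Hypothesis fl : linear f.
Definition swapt (t : A ⊗ A) : C' ⊗ C' := tlift (fun b1 b2 => f b2 ⊗ f b1) t.
Let bb : @bilinear_map F A A (C' ⊗ C')%type (fun b1 b2 => f b2 ⊗ f b1).
Proof. by split=> b; [apply: lin_tensr|apply: lin_tensl]. Qed.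
Lemma swapt_lin : linear swapt. Proof. exact: tlift_lin bb. Qed.
Lemma swaptE b1 b2 : swapt (b1 ⊗ b2) = f b2 ⊗ f b1.
Proof. by apply: tliftE; exact: bb. Qed.
End SwapMap.

Lemma swapt_map (F : fieldType) (A B C' : algType F) (f : B -> C') (h : A -> B) t : linear f -> linear h ->
  swapt f (tmap h h t) = swapt (fun x => f (h x)) t.
Proof.
move=> fl hl; have fhl : linear (fun x => f (h x)) by exact: lin_comp.
apply: (@eq_tens_lin F A A _ (fun t => swapt f (tmap h h t)) (swapt (fun x => f (h x)))).
- by apply: (lin_comp (swapt_lin fl)); exact: tmap_lin.
- exact: swapt_lin.
by move=> a b; rewrite tmapE // !swaptE.
Qed.


(** * Pairings of the canonical element and their nondegeneracy *)

Section Quantization.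
Variables (F : fieldType) (g : polarLie F) (H : Uenv g -> Uenv (Lie_l g)).
Variables (Uh : filtAlg F) (iota : Uenv (Lie_l g) -> Uh).
Notation U := (Uenv g).
Notation Up := (Uenv (Lie_p g)).
Notation Um := (Uenv (Lie_m g)).
Notation Ul := (Uenv (Lie_l g)).
Notation ip := (@Usub F g _ (@pol_pC F g)).
Notation im := (@Usub F g _ (@pol_mC F g)).
Notation il := (@Usub F g _ (@pol_lC F g)).
Notation C V := (compl (rtens V Uh)).
Notation TK := (rtens (Up ⊗ Um) Uh).
Hypotheses (H_hc : harish_chandra H)
  (iota_lin : linear iota) (iota_mor : GRing.monoid_morphism iota)
  (iota_fil : forall k x, ufil k x -> fil k (iota x))
  (Uh_complete : complete Uh) (Uh_separated : separated Uh)
  (Uh_comm : forall a b (x y : Uh), fil a x -> fil b y -> fil (a + b - 1) (x * y - y * x))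
  (Uh_uniq : forall (B : filtAlg F) (h h' : Uh -> B), complete B -> separated B ->
    filtered_morphism h -> filtered_morphism h' ->
    (forall x, h (iota x) = h' (iota x)) -> h =1 h').
Variables (Dl : Uh -> C Ul) (Dr : Uh -> compl (ltens Uh Ul)) (Sh : Uh -> Uh).
Hypotheses (Dl_ext : coproduct_l iota Dl) (Dr_ext : coproduct_r iota Dr)
  (Sh_ext : antipode_ext iota Sh).
Notation hI := (hI H iota).
Notation mpair := (mpair iota).
Variables (dr : nat) (xs : 'I_dr -> Lie_p g) (ys : 'I_dr -> Lie_m g) (n : 'I_dr -> 'I_dr -> Uh).
Hypotheses (char0 : forall k, k.+1%:R != 0 :> F)
  (xs_span : forall x, exists c : 'I_dr -> F, x = \sum_i c i *: xs i)
  (ys_span : forall y, exists c : 'I_dr -> F, y = \sum_i c i *: ys i)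
  (n_fil : forall i j, fil (-1) (n i j))
  (nm : forall i k, fil (-1) (\sum_j n i j * mpair (ys j) (xs k) - (i == k)%:R))
  (mn : forall j k, fil (-1) (\sum_i mpair (ys j) (xs i) * n i k - (j == k)%:R)).
Variable K : C (Up ⊗ Um).
Hypothesis K_canonical : canonical_element iota H K.

Let hIl : linear hI := hI_lin H_hc iota_lin.

Let m_fil y x : fil 1 (mpair y x).
Proof. by apply: iota_fil; exact: ufil_inj. Qed.

Lemma ip_ew u : ip (ew (fun i => uinj (xs i)) u) = wP [seq xs i | i <- u].
Proof. by rewrite -ip_wd big_map. Qed.
Lemma im_ew u : im (ew (fun i => uinj (ys i)) u) = wM [seq ys i | i <- u].
Proof. by rewrite -im_wd big_map. Qed.

(* a (x) u |-> H(x a) u *)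
Definition rpair_fun (x : U) (a : Up) (u : Uh) : Uh := hI (x * ip a) * u.
Definition rpair (x : U) : compl (rtens Up Uh) -> Uh :=
  @cext F (rtens Up Uh) Uh (tlift (rpair_fun x)).

Lemma rpair_bil x : bilinear_map (rpair_fun x).
Proof.
split=> [u|a].
  apply: lin_mulr; apply: (lin_comp hIl); apply: lin_mull; exact: Usub_lin.
exact: (lin_mull (f := id)).
Qed.
Lemma rpair_bshift x : exists e, bshift e (rpair_fun x).
Proof.
have [e he] := hI_shift1 H_hc iota_fil x; exists e%:Z.
split; first exact: rpair_bil.
by move=> k a u ku; rewrite addrC; apply: fil_mul.
Qed.
Lemma rpair_bdd x : bdd (rpair x).
Proof. by have [e he] := rpair_bshift x; exact: ext_bdd he. Qed.
Lemma rpairE x a u : rpair x (cin (a ⊗ u : rtens Up Uh)) = hI (x * ip a) * u.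
Proof. by have [e he] := rpair_bshift x; exact: extE he. Qed.

(* (v (x) b) (x) u |-> v (x) u H(b y) *)
Definition lpair_fun (V : algType F) (y : U) (v : V) (b : Um) (u : Uh) : rtens V Uh :=
  v ⊗ (u * hI (im b * y)).
Definition lpair (V : algType F) (y : U) : compl (rtens (V ⊗ Um) Uh) -> compl (rtens V Uh) :=
  @cext F (rtens (V ⊗ Um) Uh) (compl (rtens V Uh))
    (fun t => cin (tlift3 (lpair_fun y) t : rtens V Uh)).

Lemma lpair_tshift (V : algType F) y : exists e, tshift e (@lpair_fun V y).
Proof.
have [e he] := hI_shift2 H_hc iota_fil y; exists e%:Z; split.
- by move=> b u; exact: (lin_tensl (f := id)).
- move=> v u; apply: lin_tensr; apply: lin_mull; apply: (lin_comp hIl).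
  apply: lin_mulr; exact: Usub_lin.
- by move=> v b; apply: lin_tensr; exact: (lin_mulr (f := id)).
by move=> k v b u ku; apply: tspan_gen => //; apply: fil_mul.
Qed.
Lemma lpair_bdd0 (V : algType F) y :
  bdd (fun t : rtens (V ⊗ Um) Uh => cin (tlift3 (@lpair_fun V y) t : rtens V Uh) : compl (rtens V Uh)).
Proof.
have [e he] := lpair_tshift V y; apply: (bdd_comp (bdd_cin _)).
by exists e; exact: tlift3_fshift.
Qed.
Lemma lpair_bdd (V : algType F) y : bdd (@lpair V y).
Proof.
apply: bdd_cext; [exact: compl_complete|exact: compl_separated|exact: lpair_bdd0].
Qed.
Lemma lpairE (V : algType F) y v b u :
  @lpair V y (cin (v ⊗ b ⊗ u : rtens (V ⊗ Um) Uh)) = cin (v ⊗ (u * hI (im b * y)) : rtens V Uh).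
Proof.
rewrite /lpair cext_cin; [|exact: compl_separated|exact: lpair_bdd0].
by have [e he] := lpair_tshift V y; rewrite (tlift3E _ _ _ he).
Qed.

(** Instance of [completed_degree] for U(u_+) with 1 as the only coefficient; [hI_recM] supplies the
    recursion. *)
Lemma rpair_nondeg k (X : compl (rtens Up Uh)) :
  (forall w : seq 'I_dr, fil (k + (size w)%:Z) (rpair (wM [seq ys j | j <- w]) X)) -> fil k X.
Proof.
move=> hX.
(* The letter that meets [a] is the last one of the word, whereas the recursion consumes words from
   the head. *)
pose T (w : seq 'I_dr) : rtens Up Uh -> Uh := tlift (rpair_fun (wM [seq ys j | j <- rev w])).
have T_lin w : linear (T w) by apply: tlift_lin; exact: rpair_bil.
have TE w a u : T w (a ⊗ u) = hI (wM [seq ys j | j <- rev w] * ip a) * u.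
  by rewrite /T tliftE //; exact: rpair_bil.
apply: (@completed_degree F Up Uh Uh dr (fun i => uinj (xs i)) (fun v => v = 1) T
  (fun j i => mpair (ys j) (xs i)) n (fun u => 1 ⊗ u)
  char0 _ _ _ T_lin _ _ n_fil nm _ _ _ Uh id) => //.
- move=> a; apply: span_sub (span_word xs_span a) => _ [u ->].
  by apply: span_gen; exists 1, u; rewrite mul1r.
- by move=> v i ->; rewrite mul1r mulr1.
- move=> i j; rewrite -uinj_br.
  exact: span_inj.
- move=> w l t; have h : bshift (size w)%:Z (rpair_fun (wM [seq ys j | j <- rev w])).
    split; first exact: rpair_bil.
    move=> e a u eu; rewrite addrC; apply: fil_mul => //.
    have := hI_wM H_hc iota_fil [seq ys j | j <- rev w] a.
    by rewrite size_map size_rev.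
  exact: (tlift_fshift h).2.
- move=> v j w u l q -> lq uw; rewrite mul1r TE.
  under eq_bigr => p _ do rewrite mul1r TE ip_ew.
  rewrite ip_ew rev_cons map_rcons.
  set W := [seq ys j | j <- rev w].
  have sW : size W = size w by rewrite size_map size_rev.
  have := @hI_recM F g H H_hc Uh iota iota_lin iota_mor iota_fil W (ys j) [seq xs i | i <- u].
  rewrite size_map sW => /(_ uw); rewrite rems_map big_map /= => h.
  have -> : wM (rcons W (ys j)) = wM W * uinj (vsval (ys j)) by rewrite /wM big_rcons.
  rewrite -[_ * _ * wP _]mulrA.
  set A := hI _ in h *.
  (* [hI_recM] has [mpair] to the right of H, the recursion wants it to the left; the commutator has
     one degree less. *)
  have -> : A * q - \sum_(p <- rems u) mpair (ys j) (xs p.1) * (hI (wM W * wP [seq xs i | i <- p.2]) * q) =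
     (A - \sum_(p <- rems u) hI (wM W * wP [seq xs i | i <- p.2]) * mpair (ys j) (xs p.1)) * q +
     \sum_(p <- rems u) (hI (wM W * wP [seq xs i | i <- p.2]) * mpair (ys j) (xs p.1) -
        mpair (ys j) (xs p.1) * hI (wM W * wP [seq xs i | i <- p.2])) * q.
    rewrite mulrBl mulr_suml -addrA; congr (_ + _); rewrite -sumrN -sumrN -big_split.
    by apply: eq_bigr => p _ /=; ncring.
  apply: filD; first by rewrite addrC; apply: fil_mul.
  apply: fil_sum => p _; rewrite addrC; apply: fil_mul => //.
  have -> : (size w)%:Z = (size w)%:Z + 1 - 1 by rewrite addrK.
  apply: Uh_comm => //; rewrite -sW.
  have := hI_wM H_hc iota_fil W (ew (fun i => uinj (xs i)) p.2).
  by rewrite ip_ew.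
- exact: (lin_tensr (f := id)).
- by move=> l u lu; exact: tspan_gen.
- by move=> v l ->; rewrite TE /= /wM big_nil Usub1 mulr1 hI1 // mul1r.
move=> w; have := hX (rev w); rewrite size_rev; congr (fil _ _).
Qed.


Lemma ew_tensr (V : algType F) u :
  ew (E := (V ⊗ Um)%type) (fun i => 1 ⊗ uinj (ys i)) u = 1 ⊗ ew (fun i => uinj (ys i)) u.
Proof.
elim: u => [|i u IHu]; first by rewrite /ew !big_nil.
by rewrite !ew_cons IHu tensM mul1r.
Qed.

(** The factor [V] is carried along unpaired and supplies the coefficients [v ⊗ 1]. The cocycle
    identity needs it for V = U(g) (x) U(g). *)
Lemma lpair_nondeg (V : algType F) k (Z : compl (rtens (V ⊗ Um) Uh)) :
  (forall w : seq 'I_dr, fil (k + (size w)%:Z) (lpair (wP [seq xs i | i <- w]) Z)) -> fil k Z.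
Proof.
move=> hZ.
pose T (w : seq 'I_dr) : rtens (V ⊗ Um) Uh -> rtens V Uh :=
  tlift3 (@lpair_fun V (wP [seq xs i | i <- w])).
have T_shift w : tshift (size w)%:Z (@lpair_fun V (wP [seq xs i | i <- w])).
  have [e [h1 h2 h3 _]] := lpair_tshift V (wP [seq xs i | i <- w]).
  split=> // j v b u ju; apply: tspan_gen => //; apply: fil_mul => //.
  by have := hI_wP H_hc iota_fil [seq xs i | i <- w] b; rewrite size_map.
have TE w v b u : T w (v ⊗ b ⊗ u) = v ⊗ (u * hI (im b * wP [seq xs i | i <- w])).
  exact: tlift3E (T_shift w).
have T_lin w : linear (T w) by exact: (tlift3_fshift (T_shift w)).1.
pose lift1 (u : Uh) : rtens V Uh := 1 ⊗ u.
have lift1_lin : linear lift1 by exact: (lin_tensr (f := id)).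
have lift1M x y : lift1 x * lift1 y = lift1 (x * y) by rewrite /lift1 [LHS]tensM mul1r.
have lift1_fil e x : fil e x -> fil e (lift1 x) by move=> ex; exact: tspan_gen.
pose back : rtens V Uh -> rtens (V ⊗ Um) Uh := tmap (fun v : V => v ⊗ (1 : Um)) (@id Uh).
have bl : linear back by apply: tmap_lin => //; exact: (lin_tensl (f := id)).
have backE v u : back (v ⊗ u) = v ⊗ 1 ⊗ u.
  by apply: tmapE => //; exact: (lin_tensl (f := id)).
apply: (@completed_degree F (V ⊗ Um)%type Uh (rtens V Uh) dr (fun i => 1 ⊗ uinj (ys i))
  (fun v => exists v0, v = v0 ⊗ 1) T
  (fun j i => lift1 (mpair (ys i) (xs j))) (fun i j => lift1 (n j i)) back
  char0 _ _ _ T_lin _ _ _ _ bl _ _ (compl (rtens V Uh)) (@cin F _)) => //.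
- elim/tens_ind => [v b|a x y Px Py]; last by apply: spanD => //; exact: spanZ.
  apply: (span_map (f := fun b => v ⊗ b)) (span_word ys_span b) => [|_ [u ->]].
    exact: (lin_tensr (f := id)).
  by apply: span_gen; exists (v ⊗ 1), u; rewrite ew_tensr tensM mulr1 mul1r; split=> //; exists v.
- by move=> _ i [v ->]; rewrite !tensM !mul1r !mulr1.
- move=> i j; rewrite !tensM !mul1r -(linB (f := fun z : Um => (1 : V) ⊗ z)); last first.
    exact: (lin_tensr (f := id)).
  rewrite -uinj_br; apply: (span_map (f := fun b => (1 : V) ⊗ b)) (span_inj ys_span _) => [|_ [l ->]].
    exact: (lin_tensr (f := id)).
  by apply: span_gen; exists l.
- by move=> w e t; exact: (tlift3_fshift (T_shift w)).2.
- move=> _ j w u e q [v ->] eq uw.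
  rewrite ew_tensr tensM mul1r mulr1 TE.
  under eq_bigr => p _ do rewrite ew_tensr tensM mul1r mulr1 TE im_ew.
  rewrite im_ew /= {1}/wP big_cons -/(wP _).
  have := @hI_recP F g H H_hc Uh iota iota_lin iota_mor iota_fil [seq xs i | i <- w] (xs j) [seq ys i | i <- u].
  rewrite !size_map => /(_ uw); rewrite rems_map big_map /= => h.
  set W := [seq xs i | i <- w] in h *.
  set A := hI _ in h *.
  have -> : (v ⊗ (q * A) : rtens V Uh) -
      \sum_(p <- rems u) lift1 (mpair (ys p.1) (xs j)) * (v ⊗ (q * hI (wM [seq ys i | i <- p.2] * wP W))) =
    v ⊗ (q * (A - \sum_(p <- rems u) mpair (ys p.1) (xs j) * hI (wM [seq ys i | i <- p.2] * wP W)) +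
      \sum_(p <- rems u) (q * mpair (ys p.1) (xs j) - mpair (ys p.1) (xs j) * q) *
        hI (wM [seq ys i | i <- p.2] * wP W)).
    have vl : linear (fun z : Uh => v ⊗ z : rtens V Uh) by exact: (lin_tensr (f := id)).
    under eq_bigr => p _ do rewrite [_ * _]tensM mul1r.
    rewrite -(lin_sum vl) -(linB vl); congr (v ⊗ _).
    rewrite mulrBr mulr_sumr -addrA; congr (_ + _); rewrite -sumrN -sumrN -big_split.
    by apply: eq_bigr => p _ /=; ncring.
  apply: tspan_gen => //; apply: filD; first exact: fil_mul.
  apply: fil_sum => p _; have -> : e + (size w)%:Z = e + 1 - 1 + (size w)%:Z by rewrite addrK.
  apply: fil_mul; first exact: Uh_comm.
  have := hI_wP H_hc iota_fil W (ew (fun i => uinj (ys i)) p.2).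
  by rewrite im_ew size_map.
- by move=> i j; exact: lift1_fil.
- move=> k' i.
  (* Rows and columns are exchanged on this side, so [mn] applies, once n and m have been commuted
     modulo degree -1. *)
  have -> : \sum_j lift1 (n j k') * lift1 (mpair (ys i) (xs j)) - (k' == i)%:R =
    lift1 (\sum_j (mpair (ys i) (xs j) * n j k') - (i == k')%:R +
      \sum_j (n j k' * mpair (ys i) (xs j) - mpair (ys i) (xs j) * n j k')).
    rewrite (linD lift1_lin) (linB lift1_lin) (linMn lift1_lin) !(lin_sum lift1_lin).
    under [X in _ = _ + X]eq_bigr => j _ do rewrite (linB lift1_lin) -!lift1M.
    rewrite sumrB; under [X in _ = X - _ + _]eq_bigr => j _ do rewrite -lift1M.
    have -> : lift1 1 = 1 by [].
    by rewrite [i == k']eq_sym [RHS]addrC addrA subrK.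
  apply: lift1_fil; apply: filD => //; apply: fil_sum => j _.
  exact: (Uh_comm (n_fil j k') (m_fil (ys i) (xs j))).
- move=> e t [s [sP ->]]; rewrite (lin_sum bl); apply: fil_sum_in => p /sP[_ ep].
  by rewrite backE; exact: tspan_gen.
- move=> _ l [v ->]; rewrite TE backE /= /wP big_nil mulr1.
  by rewrite Usub1 hI1 // mulr1.
- exact: compl_complete.
- exact: compl_separated.
- exact: bdd_lin (bdd_cin _).
- by move=> e x; exact: cfil_in.
Qed.


Let rpair_b x : bdd (rpair x) := rpair_bdd x.
Let lpair_b (V : algType F) y : bdd (@lpair V y) := lpair_bdd V y.

Definition pair_fun (x y : U) (a : Up) (b : Um) (u : Uh) : Uh := hI (x * ip a) * u * hI (im b * y).
Definition pair (x y : U) : C (Up ⊗ Um) -> Uh := @cext F TK Uh (tlift3 (pair_fun x y)).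

Lemma pair_tshift x y : exists e, tshift e (pair_fun x y).
Proof.
have [e he] := hI_shift1 H_hc iota_fil x; have [e' he'] := hI_shift2 H_hc iota_fil y.
exists (e%:Z + e'%:Z); split.
- move=> b u; apply: lin_mulr; apply: lin_mulr; apply: (lin_comp hIl).
  by apply: lin_mull; exact: Usub_lin.
- by move=> a u; apply: lin_mull; apply: (lin_comp hIl); apply: lin_mulr; exact: Usub_lin.
- by move=> a b; apply: lin_mulr; exact: (lin_mull (f := id)).
move=> k a b u ku; rewrite addrA; apply: fil_mul => //.
by rewrite addrC; exact: fil_mul.
Qed.
Lemma pair_bdd x y : bdd (pair x y).
Proof. by have [e he] := pair_tshift x y; exact: ext3_bdd he. Qed.
Lemma pairE x y a b u : pair x y (cin (a ⊗ b ⊗ u : TK)) = hI (x * ip a) * u * hI (im b * y).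
Proof. by have [e he] := pair_tshift x y; exact: ext3E he. Qed.

Lemma rpair_lpair x y Z : rpair x (lpair y Z) = pair x y Z.
Proof.
apply: (@eq_ext3 F Up Um Uh Uh _ (fun Z => rpair x (lpair y Z)) (pair x y)) => //.
- by apply: (bdd_comp (rpair_b x)); exact: lpair_b.
- exact: pair_bdd.
by move=> a b u; rewrite lpairE rpairE pairE mulrA.
Qed.

Lemma pair_linl y Z : linear (fun x => pair x y Z).
Proof.
move=> c x x'; apply: (@eq_ext3 F Up Um Uh Uh _ (pair (c *: x + x') y)
  (fun Z => c *: pair x y Z + pair x' y Z)) => //.
- exact: pair_bdd.
- apply: bdd_add; last exact: pair_bdd.
  by apply: (bdd_comp (f := fun x : Uh => c *: x)) (pair_bdd _ _); exists 0; split=> [|k z kz];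
    [exact: (lin_scale (f := id))|rewrite addr0; exact: filZ].
by move=> a b u; rewrite !pairE mulrDl -scalerAl hIl !mulrDl -!scalerAl.
Qed.
Lemma pair_linr x Z : linear (fun y => pair x y Z).
Proof.
move=> c y y'; apply: (@eq_ext3 F Up Um Uh Uh _ (pair x (c *: y + y'))
  (fun Z => c *: pair x y Z + pair x y' Z)) => //.
- exact: pair_bdd.
- apply: bdd_add; last exact: pair_bdd.
  by apply: (bdd_comp (f := fun x : Uh => c *: x)) (pair_bdd _ _); exists 0; split=> [|k z kz];
    [exact: (lin_scale (f := id))|rewrite addr0; exact: filZ].
move=> a b u; rewrite !pairE mulrDr -scalerAr hIl mulrDr.
by rewrite -scalerAr.
Qed.
Lemma pair_P a x y Z : pair (ip a * x) y Z = Ucounit a *: pair x y Z.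
Proof.
apply: (@eq_ext3 F Up Um Uh Uh _ (pair (ip a * x) y) (fun Z => Ucounit a *: pair x y Z)) => //.
- exact: pair_bdd.
- by apply: (bdd_comp (f := fun x : Uh => Ucounit a *: x)) (pair_bdd _ _); exists 0; split=> [|k z kz];
    [exact: (lin_scale (f := id))|rewrite addr0; exact: filZ].
by move=> a' b u; rewrite !pairE -[ip a * x * _]mulrA hI_P // -!scalerAl.
Qed.
Lemma pair_M b x y Z : pair x (y * im b) Z = Ucounit b *: pair x y Z.
Proof.
apply: (@eq_ext3 F Up Um Uh Uh _ (pair x (y * im b)) (fun Z => Ucounit b *: pair x y Z)) => //.
- exact: pair_bdd.
- by apply: (bdd_comp (f := fun x : Uh => Ucounit b *: x)) (pair_bdd _ _); exists 0; split=> [|k z kz];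
    [exact: (lin_scale (f := id))|rewrite addr0; exact: filZ].
by move=> a' b' u; rewrite !pairE [_ * (y * _)]mulrA hI_M // -!scalerAr.
Qed.

Lemma pair_nondeg k (Z : C (Up ⊗ Um)) :
  (forall w w' : seq 'I_dr, fil (k + (size w)%:Z + (size w')%:Z)
     (pair (wM [seq ys j | j <- w]) (wP [seq xs i | i <- w']) Z)) -> fil k Z.
Proof.
move=> hZ; apply: (lpair_nondeg).
move=> w'; apply: (rpair_nondeg) => w.
by rewrite rpair_lpair addrAC; exact: hZ.
Qed.

Lemma pair_ext (Z Z' : C (Up ⊗ Um)) : (forall x y, pair x y Z = pair x y Z') -> Z = Z'.
Proof.
move=> h; apply: sep_eq => [|k]; first exact: compl_separated.
apply: pair_nondeg => w w'.
by rewrite (linB (bdd_lin (pair_bdd _ _))) h subrr; exact: fil0.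
Qed.

Lemma rpair_ext (X X' : C Up) : (forall x, rpair x X = rpair x X') -> X = X'.
Proof.
move=> h; apply: sep_eq => [|k]; first exact: compl_separated.
apply: (rpair_nondeg) => w.
by rewrite (linB (bdd_lin (rpair_b _))) h subrr; exact: fil0.
Qed.

Lemma lpair_ext (V : algType F) (Z Z' : C (V ⊗ Um)) :
  (forall a, lpair (ip a) Z = lpair (ip a) Z') -> Z = Z'.
Proof.
move=> h; apply: sep_eq => [|k]; first exact: compl_separated.
apply: (lpair_nondeg) => w.
by rewrite (linB (bdd_lin (lpair_b _ _))) -ip_wd h subrr; exact: fil0.
Qed.


(** The defining property of K covers x in U(l + u_-) and y in U(l + u_+). A factor from U(u_+) on
    the left of x, or from U(u_-) on the right of y, leaves both sides through the counit, and U(g)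
    is spanned by products a l b. *)
Lemma pair_K x y : pair x y K = hI (x * y).
Proof.
have lmK (x' : Uenv (Lie_lm g)) (y' : Uenv (Lie_lp g)) :
    pair (Usub x') (Usub y') K = hI (Usub x' * Usub y').
  by apply: converges_cext => //; exact: K_canonical.
have lp_sub : (pol_l g <= pol_l g + pol_p g)%VS by exact: addvSl.
have pp_sub : (pol_p g <= pol_l g + pol_p g)%VS by exact: addvSr.
have lm_sub : (pol_l g <= pol_l g + pol_m g)%VS by exact: addvSl.
have mm_sub : (pol_m g <= pol_l g + pol_m g)%VS by exact: addvSr.
apply: (span_ind_lin (f := fun x => pair x y K) (h := fun x => hI (x * y))) (U_span x).
- exact: pair_linl.
- by apply: (lin_comp hIl); exact: (lin_mulr (f := id)).
move=> _ [a [l [b ->]]]; rewrite -!mulrA pair_P hI_P //; congr (_ *: _); rewrite mulrA.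
apply: (span_ind_lin (f := fun y => pair (il l * im b) y K)
  (h := fun y => hI (il l * im b * y))) (U_span y).
- exact: pair_linr.
- by apply: (lin_comp hIl); exact: (lin_mull (f := id)).
move=> _ [a' [l' [b' ->]]]; rewrite pair_M mulrA hI_M //; congr (_ *: _).
have [v1 E1] := Usub_incl (@pol_lmC F g) l lm_sub.
have [v2 E2] := Usub_incl (@pol_lmC F g) b mm_sub.
have [w1 E1'] := Usub_incl (@pol_lpC F g) a' pp_sub.
have [w2 E2'] := Usub_incl (@pol_lpC F g) l' lp_sub.
by rewrite -E1 -E2 -E1' -E2' -!UsubM lmK.
Qed.

Lemma hI_yx (y : Lie_m g) (x : Lie_p g) : hI (uinj (vsval y) * uinj (vsval x)) = mpair y x.
Proof.
have [p [m E]] := polar_split ⁅vsval y, vsval x⁆.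
have -> : uinj (vsval y) * uinj (vsval x) = ip (uinj x) * im (uinj y) +
    (il (uinj (proj_l ⁅vsval y, vsval x⁆)) + ip (uinj p) + im (uinj m)).
  by rewrite !Usub_inj -!uinjD -E uinj_br addrC subrK.
have z1 : hI (ip (uinj p)) = 0 by rewrite -[ip _]mulr1 hI_P // Ucounit_inj scale0r.
have z2 : hI (im (uinj m)) = 0 by rewrite -[im _]mul1r hI_M // Ucounit_inj scale0r.
rewrite !(linD hIl) hI_P // Ucounit_inj scale0r add0r z1 z2 !addr0.
by rewrite -[il _]mul1r hI_lr // hI1 // mul1r.
Qed.

Lemma hI_wM_eps w : hI (wM w) = (w == [::])%:R.
Proof.
rewrite -im_wd -[im _]mul1r hI_M // hI1 //; case: w => [|i s].
  by rewrite big_nil Ucounit1 scale1r.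
by rewrite big_cons UcounitM Ucounit_inj mul0r scale0r.
Qed.
Lemma hI_wP_eps w : hI (wP w) = (w == [::])%:R.
Proof.
rewrite -ip_wd -[ip _]mulr1 hI_P // hI1 //; case: w => [|i s].
  by rewrite big_nil Ucounit1 scale1r.
by rewrite big_cons UcounitM Ucounit_inj mul0r scale0r.
Qed.

(** Pairings with words of lengths p and q must be bounded by degree p + q - 2. H(xy) has degree at
    most min(p, q), which suffices unless p, q <= 1. In those cases the subtracted terms cancel it:
    exactly if p or q is 0, and up to degree 0 if p = q = 1, because n inverts m. *)
Lemma K_top : fil (-2) (K - 1 - \sum_i \sum_j cin (uinj (xs i) ⊗ uinj (ys j) ⊗ n i j : TK) : C (Up ⊗ Um)).
Proof.
apply: pair_nondeg => w w'.
set x := wM _; set y := wP _.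
have pl := bdd_lin (pair_bdd x y).
have E1 : pair x y 1 = hI x * hI y.
  by rewrite cin1 rtens1 tens1 pairE !Usub1 !mulr1 !mul1r.
have E2 : pair x y (\sum_i \sum_j cin (uinj (xs i) ⊗ uinj (ys j) ⊗ n i j : TK)) =
    \sum_i \sum_j hI (x * uinj (vsval (xs i))) * n i j * hI (uinj (vsval (ys j)) * y).
  rewrite (lin_sum pl); apply: eq_bigr => i _; rewrite (lin_sum pl).
  by apply: eq_bigr => j _; rewrite pairE !Usub_inj.
rewrite (linB pl) (linB pl) pair_K E1 E2 {E1 E2 pl} /x /y {x y}.
have x0 i : hI (uinj (vsval (xs i))) = 0.
  by have := hI_wP_eps [:: xs i]; rewrite /wP big_seq1.
have y0 j : hI (uinj (vsval (ys j))) = 0.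
  by have := hI_wM_eps [:: ys j]; rewrite /wM big_seq1.
case: w => [|j [|j2 w]] /=.
- rewrite /wM big_nil hI1 // !mul1r subrr sub0r big1 ?oppr0; first exact: fil0.
  by move=> i _; rewrite big1 // => j _; rewrite mul1r x0 !mul0r.
- case: w' => [|i w'] /=.
    rewrite /wP big_nil hI1 // !mulr1 subrr sub0r big1 ?oppr0; first exact: fil0.
    by move=> i _; rewrite big1 // => j' _; rewrite mulr1 y0 mulr0.
  case: w' => [|i2 w'] /=.
    rewrite /wM /wP !big_seq1 x0 mulr0 subr0 hI_yx.
    under eq_bigr => k _ do under eq_bigr => l _ do rewrite !hI_yx.
    rewrite exchange_big /=; under eq_bigr => l _ do rewrite -mulr_suml.
    have -> : mpair (ys j) (xs i) - \sum_l (\sum_k mpair (ys j) (xs k) * n k l) * mpair (ys l) (xs i) =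
        - \sum_l (\sum_k mpair (ys j) (xs k) * n k l - (j == l)%:R) * mpair (ys l) (xs i).
      have e1 : \sum_l (j == l)%:R * mpair (ys l) (xs i) = mpair (ys j) (xs i).
        rewrite (bigD1 j) //= eqxx mul1r big1 ?addr0 // => l lj.
        by rewrite eq_sym (negPf lj) mul0r.
      under [X in _ = - X]eq_bigr => l _ do rewrite mulrBl.
      by rewrite sumrB e1 opprB.
    apply: filN; apply: fil_sum => l _.
    by apply: (fil_mul (mn j l)); apply: iota_fil; exact: ufil_inj.
  set w1 := [:: xs i, xs i2 & [seq xs k | k <- w']].
  have -> : hI (wP w1) = 0 by rewrite hI_wP_eps.
  rewrite mulr0 subr0; apply: filB.
    have := hI_wM H_hc iota_fil [:: ys j] (\prod_(x <- w1) uinj x).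
    by rewrite ip_wd; apply: fil_mono => /=; lia.
  apply: fil_sum => k _; apply: fil_sum => l _.
  have f1 := hI_wM H_hc iota_fil [:: ys j] (uinj (xs k)).
  have f2 := hI_wM H_hc iota_fil [:: ys l] (\prod_(x <- w1) uinj x).
  rewrite ip_wd {1}/wM big_seq1 /= in f2; rewrite Usub_inj /= in f1.
  by apply: fil_mono (fil_mul (fil_mul f1 (n_fil k l)) f2); lia.
set w2 := [:: ys j, ys j2 & [seq ys k | k <- w]].
have -> : hI (wM w2) = 0 by rewrite hI_wM_eps.
rewrite mul0r subr0.
case: w' => [|i w'] /=.
  rewrite /wP big_nil mulr1 hI_wM_eps /= sub0r big1 ?oppr0; first exact: fil0.
  by move=> i _; rewrite big1 // => j' _; rewrite mulr1 y0 mulr0.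
set w3 := xs i :: [seq xs k | k <- w'].
apply: filB.
  have := hI_wP H_hc iota_fil w3 (\prod_(x <- w2) uinj x).
  by rewrite im_wd; apply: fil_mono; rewrite /= size_map; lia.
apply: fil_sum => k _; apply: fil_sum => l _.
have f2 := hI_wM H_hc iota_fil [:: ys l] (\prod_(x <- w3) uinj x).
have f1 := hI_wP H_hc iota_fil [:: xs k] (\prod_(x <- w2) uinj x).
rewrite ip_wd {1}/wM big_seq1 /= in f2; rewrite im_wd /wP big_seq1 /= in f1.
by apply: fil_mono (fil_mul (fil_mul f1 (n_fil k l)) f2); lia.
Qed.



(** * Classes modulo U(g) u_- and modulo u_+ U(g), expressed through K *)

Lemma rpair_mull x a X : rpair x (cc Uh a * X) = rpair (x * ip a) X.
Proof.
apply: (@eq_ext F Up Uh Uh _ (fun X : C Up => rpair x (cc Uh a * X))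
  (rpair (x * ip a))) => //.
  by apply: (bdd_comp (rpair_b x)); apply: bdd_mull; exact: bdd_id.
by move=> a' u; rewrite /cc cinMt mul1r !rpairE UsubM mulrA.
Qed.

Lemma rpair_mulr x u X : rpair x (X * cu Up u) = rpair x X * u.
Proof.
apply: (@eq_ext F Up Uh Uh _ (fun X : C Up => rpair x (X * cu Up u))
  (fun X => rpair x X * u)) => //.
- by apply: (bdd_comp (rpair_b x)); apply: bdd_mulr; exact: bdd_id.
- exact: bdd_mulr.
by move=> a' u'; rewrite /cu cinMt !rpairE mulr1 mulrA.
Qed.

(** The class of [z] modulo U(g) u_-, with coefficients in Uh: by [rho_P], [rho_lr] and [rho_M] a
    product a l b goes to a (x) l times the counit of b. *)
Definition rho (z : U) : C Up := lpair z K.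

Lemma rpair_rho x z : rpair x (rho z) = hI (x * z).
Proof. by rewrite /rho rpair_lpair pair_K. Qed.

Lemma rho_lin : linear rho.
Proof.
move=> c z z'; apply: rpair_ext => x.
by rewrite (bdd_lin (rpair_b x)) !rpair_rho mulrDr -scalerAr hIl.
Qed.
Lemma rho_ip a : rho (ip a) = cc Uh a.
Proof. by apply: rpair_ext => x; rewrite rpair_rho /cc rpairE mulr1. Qed.
Lemma rho_P a z : rho (ip a * z) = cc Uh a * rho z.
Proof. by apply: rpair_ext => x; rewrite rpair_mull !rpair_rho mulrA. Qed.
Lemma rho_lr l z : rho (z * il l) = rho z * cu Up (iota l).
Proof. by apply: rpair_ext => x; rewrite rpair_mulr !rpair_rho mulrA hI_lr. Qed.
Lemma rho_M b z : rho (z * im b) = Ucounit b *: rho z.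
Proof.
by apply: rpair_ext => x; rewrite (linZ (bdd_lin (rpair_b x))) !rpair_rho mulrA hI_M.
Qed.

(* b (x) u |-> u H(b y) *)
Definition qpair (y : U) : C Um -> Uh :=
  @cext F (rtens Um Uh) Uh (tlift (fun b u => u * hI (im b * y))).
Lemma qpair_bshift y : exists e, bshift e (fun b (u : Uh) => u * hI (im b * y)).
Proof.
have [e he] := hI_shift2 H_hc iota_fil y; exists e%:Z; split; first split.
- move=> u; apply: lin_mull; apply: (lin_comp hIl); apply: lin_mulr; exact: Usub_lin.
- by move=> b; exact: (lin_mulr (f := id)).
by move=> k b u ku; apply: fil_mul.
Qed.
Lemma qpair_bdd y : bdd (qpair y).
Proof. by have [e he] := qpair_bshift y; exact: ext_bdd he. Qed.
Lemma qpairE y b u : qpair y (cin (b ⊗ u : rtens Um Uh)) = u * hI (im b * y).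
Proof. by have [e he] := qpair_bshift y; exact: extE he. Qed.

Definition right2 (X : C Um) : C (Up ⊗ Um) := cmap_l (fun b : Um => (1 : Up) ⊗ b) X.
Let right_lin : linear (fun b : Um => (1 : Up) ⊗ b).
Proof. exact: (lin_tensr (f := id)). Qed.

Lemma right2_bdd : bdd right2.
Proof. exact: cmap_bdd. Qed.
Lemma right2E b u : right2 (cin (b ⊗ u : rtens Um Uh)) = cin (1 ⊗ b ⊗ u : TK).
Proof. exact: cmapE. Qed.

(** Deduced from [lpair_ext] by inserting 1 in U(u_+); the counit, in [r], removes it again. *)
Lemma qpair_ext (X X' : C Um) : (forall y, qpair y X = qpair y X') -> X = X'.
Proof.
move=> h; pose r : Up ⊗ Um -> Um := tlift (fun a b => Ucounit a *: b).
have rb : bilinear_map (fun (a : Up) (b : Um) => Ucounit a *: b).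
  split=> [b c x y|a]; last exact: (lin_scale (f := id)).
  by rewrite (Ucounit_lin c x y) scalerDl scalerA.
have rl : linear r by exact: tlift_lin.
have rK Y : cmap_l r (right2 Y) = Y.
  rewrite /right2 cmap_comp // -[RHS]cmap_id; congr (cmap_l _ Y); apply/funext => b.
  by rewrite /r tliftE // Ucounit1 scale1r.
have lp y Y : lpair y (right2 Y) = cin (1 ⊗ qpair y Y : rtens Up Uh).
  apply: (@eq_ext F Um Uh (C Up) _ (fun Y => lpair y (right2 Y))
    (fun Y => cin (1 ⊗ qpair y Y : rtens Up Uh))).
  - exact: compl_separated.
  - by apply: (bdd_comp (lpair_b _ y)); exact: right2_bdd.
  - apply: (bdd_comp (bdd_cin _)); apply: (bdd_comp (f := fun u : Uh => 1 ⊗ u : rtens Up Uh)) (qpair_bdd y).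
    exists 0; split=> [|k u ku]; first exact: (lin_tensr (f := id)).
    by rewrite addr0; exact: tspan_gen.
  by move=> b u; rewrite right2E lpairE qpairE.
rewrite -[X]rK -[X']rK; congr (cmap_l r _).
by apply: lpair_ext => a; rewrite !lp h.
Qed.

(* sum_k H(z a_k) l_k (x) b_k, the class of z modulo u_+ U(g) *)
Definition uproj_fun (z : U) (a : Up) (b : Um) (u : Uh) : C Um :=
  cin (b ⊗ (hI (z * ip a) * u) : rtens Um Uh).
Definition uproj (z : U) : C Um := @cext F TK (C Um) (tlift3 (uproj_fun z)) K.

Lemma uproj_tshift z : exists e, tshift e (uproj_fun z).
Proof.
have cl := bdd_lin (bdd_cin (rtens Um Uh)).
have [e he] := hI_shift1 H_hc iota_fil z; exists e%:Z; split.
- move=> b u; apply: (lin_comp cl); apply: lin_tensr; apply: lin_mulr; apply: (lin_comp hIl).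
  by apply: lin_mull; exact: Usub_lin.
- by move=> a u; apply: (lin_comp cl); exact: (lin_tensl (f := id)).
- by move=> a b; apply: (lin_comp cl); apply: lin_tensr; exact: (lin_mull (f := id)).
move=> k a b u ku; apply/cfil_in; apply: tspan_gen => //.
by rewrite addrC; exact: fil_mul.
Qed.

Lemma qpair_uproj z y : qpair y (uproj z) = hI (z * y).
Proof.
have [e he] := uproj_tshift z; rewrite -pair_K /uproj.
apply: (@eq_ext3 F Up Um Uh Uh _ (fun Z => qpair y (@cext F TK (C Um) (tlift3 (uproj_fun z)) Z))
  (pair z y)) => //.
- apply: (bdd_comp (qpair_bdd y)); apply: (ext3_bdd _ _ he).
    exact: compl_complete.
  exact: compl_separated.
- exact: pair_bdd.
move=> a b u; rewrite (ext3E _ _ _ _ he) ?qpairE ?pairE //.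
exact: compl_separated.
Qed.

Lemma uproj_lin : linear uproj.
Proof.
move=> c z z'; apply: qpair_ext => y.
by rewrite (bdd_lin (qpair_bdd y)) !qpair_uproj mulrDl -scalerAl hIl.
Qed.
Lemma uproj_gen a l b : uproj (ip a * il l * im b) = Ucounit a *: cin (b ⊗ iota l : rtens Um Uh).
Proof.
apply: qpair_ext => y; rewrite (linZ (bdd_lin (qpair_bdd y))) qpair_uproj qpairE.
by rewrite -!mulrA hI_P // hI_ll.
Qed.

(** Uniformity in [b] is what allows the substitution of b a for b to be performed on infinite
    series. *)
Lemma uproj_shift a : exists e : nat, forall b, fil e%:Z (uproj (im b * ip a)).
Proof.
have [e he] := tgen_ipim a; exists e => b.
elim: (he b) => [|c x y [p [l [m [fl ->]]]] _ IH]; first by rewrite lin0; [exact: fil0|exact: uproj_lin].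
rewrite uproj_lin uproj_gen; apply: filD => //; apply: filZ; apply: filZ.
by apply/cfil_in; apply: tspan_gen => //; exact: iota_fil.
Qed.

Definition shift_fun (a : Up) (a' : Up) (b : Um) (u : Uh) : C (Up ⊗ Um) :=
  (cin (a' ⊗ 1 ⊗ u : TK) : C (Up ⊗ Um)) * right2 (uproj (im b * ip a)).

Lemma shift_tshift a : exists e, tshift e (shift_fun a).
Proof.
have cl := bdd_lin (bdd_cin TK); have [e he] := uproj_shift a; exists e%:Z; split.
- move=> b u; apply: lin_mulr; apply: (lin_comp cl); apply: lin_tensl.
  exact: (lin_tensl (f := id)).
- move=> a' u; apply: lin_mull; apply: (lin_comp (bdd_lin right2_bdd)).
  by apply: (lin_comp uproj_lin); apply: lin_mulr; exact: Usub_lin.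
- by move=> a' b; apply: lin_mulr; apply: (lin_comp cl); exact: (lin_tensr (f := id)).
move=> k a' b u ku; apply: fil_mul; first by apply/cfil_in; exact: tspan_gen.
by have := (cmap_fshift Uh right_lin).2 _ _ (he b); rewrite addr0.
Qed.

(* Replacing each b_i by the class of b_i a modulo u_+ U(g) turns K into
   (a (x) 1) K. *)
Lemma K_shift a : @cext F TK (C (Up ⊗ Um)) (tlift3 (shift_fun a)) K =
  cc Uh (a ⊗ 1) * K.
Proof.
have [e he] := shift_tshift a.
have pm x y a' u Y : pair x y ((cin (a' ⊗ 1 ⊗ u : TK) : C (Up ⊗ Um)) * right2 Y) =
    hI (x * ip a') * u * qpair y Y.
  apply: (@eq_ext F Um Uh Uh _
    (fun Y => pair x y ((cin (a' ⊗ 1 ⊗ u : TK) : C (Up ⊗ Um)) * right2 Y))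
    (fun Y => hI (x * ip a') * u * qpair y Y)) => //.
  - by apply: (bdd_comp (pair_bdd x y)); apply: bdd_mull; exact: right2_bdd.
  - by apply: bdd_mull; exact: qpair_bdd.
  move=> b v; rewrite right2E cinMt tensM mulr1 mul1r pairE qpairE.
  by rewrite !mulrA.
(* Substituting the class of b a for b turns the pairing with (x, y) into the one with (x, a y). On
   K this is H(x a y), which is also the pairing with (x a, y). *)
apply: pair_ext => x y; transitivity (pair x (ip a * y) K).
  apply: (@eq_ext3 F Up Um Uh Uh _
    (fun Z => pair x y (@cext F TK (C (Up ⊗ Um)) (tlift3 (shift_fun a)) Z)) (pair x (ip a * y))) => //.
  - apply: (bdd_comp (pair_bdd x y)); apply: (ext3_bdd _ _ he).
      exact: compl_complete.
    exact: compl_separated.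
  - exact: pair_bdd.
  move=> a' b u; rewrite (ext3E _ _ _ _ he); last exact: compl_separated.
  by rewrite /shift_fun pm qpair_uproj pairE mulrA.
transitivity (pair (x * ip a) y K); first by rewrite !pair_K mulrA.
apply/esym; apply: (@eq_ext3 F Up Um Uh Uh _
    (fun Z => pair x y (cc Uh (a ⊗ 1) * Z)) (pair (x * ip a) y)) => //.
- by apply: (bdd_comp (pair_bdd x y)); apply: bdd_mull; exact: bdd_id.
- exact: pair_bdd.
by move=> a' b u; rewrite /cc cinMt tensM !mul1r !pairE UsubM mulrA.
Qed.


(** * Antipode and coproducts on Uh *)

Let Sl (x : Ul) : U := il (Uantipode x).
Let Sm (x : Um) : U := im (Uantipode x).

Lemma Sl_lin : linear Sl.
Proof. by apply: lin_comp; [exact: Usub_lin|exact: Uant_lin]. Qed.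
Lemma Sm_lin : linear Sm.
Proof. by apply: lin_comp; [exact: Usub_lin|exact: Uant_lin]. Qed.
Lemma Sl1 : Sl 1 = 1. Proof. by rewrite /Sl Uant1 Usub1. Qed.
Lemma Sm1 : Sm 1 = 1. Proof. by rewrite /Sm Uant1 Usub1. Qed.
Lemma SlM x y : Sl (x * y) = Sl y * Sl x. Proof. by rewrite /Sl UantM UsubM. Qed.
Lemma SmM x y : Sm (x * y) = Sm y * Sm x. Proof. by rewrite /Sm UantM UsubM. Qed.
Lemma Sl_inj x : Sl (uinj x) = - uinj (vsval x).
Proof. by rewrite /Sl Uant_inj (linN (@Usub_lin _ _ _ _)) Usub_inj. Qed.
Lemma Sm_inj x : Sm (uinj x) = - uinj (vsval x).
Proof. by rewrite /Sm Uant_inj (linN (@Usub_lin _ _ _ _)) Usub_inj. Qed.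

Lemma uniq_inj (B : filtAlg F) (h h' : Uh -> B) : complete B -> separated B ->
  filtered_morphism h -> filtered_morphism h' ->
  (forall x, h (iota (uinj x)) = h' (iota (uinj x))) -> h =1 h'.
Proof.
move=> cB sB hf hf' hh; apply: Uh_uniq => //.
have [hl [h1 hM] _] := hf; have [hl' [h1' hM'] _] := hf'.
elim/uenv_ind => [//||a x y Ex Ey|x y Ex Ey].
- by rewrite iota_mor.1 h1 h1'.
- by rewrite iota_lin hl hl' Ex Ey.
by rewrite iota_mor.2 hM hM' Ex Ey.
Qed.

Let Sh_lin : linear Sh. Proof. by case: Sh_ext. Qed.
Let Sh_anti : antimorphism Sh. Proof. by case: Sh_ext => ? ? ?; split. Qed.
Let Sh_fil k u : fil k u -> fil k (Sh u).
Proof. by case: Sh_ext => _ _ _ h _; exact: h. Qed.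
Lemma Sh_inj x : Sh (iota (uinj x)) = - iota (uinj x).
Proof. by case: Sh_ext => _ _ _ _ ->; rewrite Uant_inj linN. Qed.

(** The square of the antipode is a filtered morphism that fixes l. *)
Lemma ShK u : Sh (Sh u) = u.
Proof.
apply: (@uniq_inj Uh (fun u => Sh (Sh u)) id) => //.
- split; first by exact: lin_comp.
    by split=> [|x y]; rewrite ?Sh_anti.1 ?Sh_anti.2 //.
  by move=> k x kx; do 2!apply: Sh_fil.
- by split.
by move=> x; rewrite Sh_inj linN // Sh_inj opprK.
Qed.

(** Composition with the involution [Sh] turns antimorphisms into morphisms, to which universality
    applies. *)
Lemma anti_uniq (B : filtAlg F) (h h' : Uh -> B) : complete B -> separated B ->
  [/\ linear h, antimorphism h & filtered h] ->
  [/\ linear h', antimorphism h' & filtered h'] ->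
  (forall x, h (iota (uinj x)) = h' (iota (uinj x))) -> h =1 h'.
Proof.
move=> cB sB [hl [h1 hM] hf] [hl' [h1' hM'] hf'] hh u; rewrite -[u]ShK.
apply: (@uniq_inj B (fun u => h (Sh u)) (fun u => h' (Sh u))) => //.
- split; first by exact: lin_comp.
    by split=> [|x y]; rewrite ?Sh_anti.1 ?Sh_anti.2 ?hM.
  by move=> k x kx; apply: hf; exact: Sh_fil.
- split; first by exact: lin_comp.
    by split=> [|x y]; rewrite ?Sh_anti.1 ?Sh_anti.2 ?hM'.
  by move=> k x kx; apply: hf'; exact: Sh_fil.
by move=> x; rewrite Sh_inj (linN hl) (linN hl') hh.
Qed.

Let Dr_lin : linear Dr. Proof. by case: Dr_ext => -[]. Qed.
Let Dr1 : Dr 1 = 1. Proof. by case: Dr_ext => -[_ []]. Qed.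
Let DrM x y : Dr (x * y) = Dr x * Dr y. Proof. by case: Dr_ext => -[_ [_ h] _] _; exact: h. Qed.
Let Dr_fil : filtered Dr. Proof. by case: Dr_ext => -[_ _ h] _; exact: h. Qed.

Lemma Dr_inj x : Dr (iota (uinj x)) =
  (cin (iota (uinj x) ⊗ 1 : ltens Uh Ul) : compl (ltens Uh Ul)) + cin (1 ⊗ uinj x : ltens Uh Ul).
Proof.
case: Dr_ext => _ ->; rewrite Ucop_inj.
have tl : linear (tmap iota (@id Ul)) by exact: tmap_lin.
by rewrite (linD tl) !tmapE // iota_mor.1 -cinD.
Qed.

(* S(u2) (x) Sh(u1), where u1 (x) u2 stands for Dr u. *)
Definition sg_fun (u1 : Uh) (u2 : Ul) : C U := cin (Sl u2 ⊗ Sh u1 : rtens U Uh).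

(* S(u2) (x) u1 *)
Definition sg'_fun (u1 : Uh) (u2 : Ul) : C U := cin (Sl u2 ⊗ u1 : rtens U Uh).

Lemma sg_bshift : bshift_l 0 sg_fun.
Proof.
have cl := bdd_lin (bdd_cin (rtens U Uh)); split; first split.
- by move=> u; apply: (lin_comp cl); exact: lin_tensr.
- by move=> u; apply: (lin_comp cl); apply: lin_tensl; exact: Sl_lin.
by move=> k u v ku; rewrite addr0; apply/cfil_in; apply: tspan_gen => //; exact: Sh_fil.
Qed.
Lemma sg'_bshift : bshift_l 0 sg'_fun.
Proof.
have cl := bdd_lin (bdd_cin (rtens U Uh)); split; first split.
- by move=> u; apply: (lin_comp cl); exact: (lin_tensr (f := id)).
- by move=> u; apply: (lin_comp cl); apply: lin_tensl; exact: Sl_lin.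
by move=> k u v ku; rewrite addr0; apply/cfil_in; exact: tspan_gen.
Qed.

(* Maps out of Uh given on u1 (x) u2 = Dr u. *)
Section OnDr.
Variables (B : filtAlg F).
Hypotheses (cB : complete B) (sB : separated B).
Definition onDr (b : Uh -> Ul -> B) (u : Uh) : B := @cext F (ltens Uh Ul) B (tlift b) (Dr u).

Lemma onDr_fshift d b : bshift_l d b -> fshift d (onDr b).
Proof.
move=> bs; have [l h] := extl_fshift cB sB bs; split; first by exact: (lin_comp l).
by move=> k u ku; apply: h; exact: Dr_fil.
Qed.
Lemma onDr_lin d b : bshift_l d b -> linear (onDr b).
Proof. by case/onDr_fshift. Qed.
Lemma onDr_fil b : bshift_l 0 b -> filtered (onDr b).
Proof. by move=> bs k u /(onDr_fshift bs).2; rewrite addr0. Qed.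
Lemma onDr_inj d b (bs : bshift_l d b) x :
  onDr b (iota (uinj x)) = b (iota (uinj x)) 1 + b 1 (uinj x).
Proof.
have [l h] := extl_fshift cB sB bs.
by rewrite /onDr Dr_inj (linD l) !(extlE _ _ _ bs).
Qed.
Lemma onDr_anti d b : bshift_l d b -> b 1 1 = 1 ->
  (forall a a' c c', b (a * a') (c * c') = b a' c' * b a c) -> antimorphism (onDr b).
Proof.
move=> bs b1 bM.
have [e1 eM] : antimorphism (@cext F (ltens Uh Ul) B (tlift b) : compl (ltens Uh Ul) -> B).
  apply: cext_anti => //; first by exists d; exact: tlift_fshift_l.
  exact: tlift_anti bs.1 b1 bM.
by split=> [|x y]; rewrite /onDr ?Dr1 // DrM eM.
Qed.
Lemma onDr_linb d d' c b b' u : bshift_l d b -> bshift_l d' b' ->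
  onDr (fun u1 u2 => c *: b u1 u2 + b' u1 u2) u = c *: onDr b u + onDr b' u.
Proof.
move=> bs bs'.
have bs2 : bshift_l (Num.max d d') (fun u1 u2 => c *: b u1 u2 + b' u1 u2).
  split; first split.
  - by move=> w a x y; rewrite bs.1.1 bs'.1.1 !scalerDr !scalerA mulrC addrACA.
  - by move=> w a x y; rewrite bs.1.2 bs'.1.2 !scalerDr !scalerA mulrC addrACA.
  move=> k v w kv; apply: filD; last by apply: fil_mono (bs'.2 _ _ _ kv); lia.
  by apply: filZ; apply: fil_mono (bs.2 _ _ _ kv); lia.
rewrite /onDr; move: (Dr u); apply: (@eq_extl F Ul Uh B sB
  (@cext F (ltens Uh Ul) B (tlift (fun u1 u2 => c *: b u1 u2 + b' u1 u2)))
  (fun T => c *: @cext F (ltens Uh Ul) B (tlift b) T + @cext F (ltens Uh Ul) B (tlift b') T)).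
- exact: extl_bdd bs2.
- apply: bdd_add; last exact: extl_bdd bs'.
  by apply: (bdd_comp (f := fun x : B => c *: x)) (extl_bdd _ _ bs) => //; exists 0;
    split=> [|k z kz]; [exact: (lin_scale (f := id))|rewrite addr0; exact: filZ].
by move=> v w; rewrite (extlE _ _ _ bs2) ?(extlE _ _ _ bs) ?(extlE _ _ _ bs').
Qed.
End OnDr.

Lemma onDr_map (B B' : filtAlg F) (f : B -> B') d (b : Uh -> Ul -> B) u :
  complete B -> separated B -> complete B' -> separated B' -> bdd f -> bshift_l d b ->
  f (onDr b u) = onDr (fun u1 u2 => f (b u1 u2)) u.
Proof.
move=> cB sB cB' sB' fb bs; have [e [fl fe]] := fb.
have bs' : bshift_l (d + e) (fun u1 u2 => f (b u1 u2)).
  split; first by split=> w; apply: (lin_comp fl); [exact: bs.1.1|exact: bs.1.2].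
  by move=> k v w kv; rewrite addrA; apply: fe; exact: bs.2.
rewrite /onDr; move: (Dr u); apply: (@eq_extl F Ul Uh B' sB'
  (fun T => f (@cext F (ltens Uh Ul) B (tlift b) T))
  (@cext F (ltens Uh Ul) B' (tlift (fun u1 u2 => f (b u1 u2))))).
- by apply: (bdd_comp fb); exact: extl_bdd bs.
- exact: extl_bdd bs'.
by move=> v w; rewrite (extlE _ _ _ bs) ?(extlE _ _ _ bs').
Qed.

Lemma eq_onDr (B : filtAlg F) (b b' : Uh -> Ul -> B) u :
  (forall u1 u2, b u1 u2 = b' u1 u2) -> onDr b u = onDr b' u.
Proof.
by move=> bb; congr onDr; apply/funext => u1; apply/funext => u2.
Qed.

Let cC V : complete (C V) := @compl_complete F (rtens V Uh).
Let sC V : separated (C V) := @compl_separated F (rtens V Uh).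

Definition sg : Uh -> C U := onDr sg_fun.
Definition sg' : Uh -> C U := onDr sg'_fun.
Lemma sg_lin : linear sg. Proof. exact: (onDr_lin (@cC U) (@sC U) sg_bshift). Qed.
Lemma sg_fil : filtered sg. Proof. exact: (onDr_fil (@cC U) (@sC U) sg_bshift). Qed.
Lemma sg_anti : antimorphism sg.
Proof.
apply: (onDr_anti (@cC _) (@sC _) sg_bshift) => [|a a' c c'].
  by rewrite /sg_fun Sl1 Sh_anti.1 -rtens1 -cin1.
by rewrite /sg_fun cinMt SlM Sh_anti.2.
Qed.
Lemma sg_inj x : sg (iota (uinj x)) = - (cc Uh (uinj (vsval x)) + cu U (iota (uinj x))).
Proof.
rewrite /sg (onDr_inj (@cC _) (@sC _) sg_bshift) /sg_fun Sl1 Sl_inj Sh_inj Sh_anti.1.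
have cl := @cc_lin F Uh U; have ul := @cu_lin F Uh U.
by rewrite -/(cu U _) (linN ul) -/(cc _ _) (linN cl) opprD addrC.
Qed.
Lemma sg'_lin : linear sg'. Proof. exact: (onDr_lin (@cC U) (@sC U) sg'_bshift). Qed.
Lemma sg'_fil : filtered sg'. Proof. exact: (onDr_fil (@cC U) (@sC U) sg'_bshift). Qed.

(** S(u3) (x) S(u2) (x) S(u1) in iterated Sweedler notation, with the last leg in Uh. *)
Definition sg3 (u : Uh) : C (U ⊗ U) := cmap_l (@Ucop F g) (sg u).

Lemma Ucop_mor : GRing.monoid_morphism (@Ucop F g).
Proof. by case: (Ucop_spec g). Qed.

Lemma sg3_lin : linear sg3.
Proof. exact: (lin_comp (bdd_lin (cmap_bdd Uh (@Ucop_lin F g)))) sg_lin. Qed.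
Lemma sg3_fil : filtered sg3.
Proof.
by move=> k u /sg_fil; have [_ h] := cmap_fshift Uh (@Ucop_lin F g); move=> /h; rewrite addr0.
Qed.
Lemma sg3_anti : antimorphism sg3.
Proof.
have [m1 mM] := cmap_morph Uh (@Ucop_lin F g) Ucop_mor.
by split=> [|x y]; rewrite /sg3 ?sg_anti.1 ?m1 // sg_anti.2 mM.
Qed.

Definition Xl (x : Lie_l g) : C (U ⊗ U) :=
  cc Uh (uinj (vsval x) ⊗ 1 + 1 ⊗ uinj (vsval x)) + cu _ (iota (uinj x)).

Lemma sg3_inj x : sg3 (iota (uinj x)) = - Xl x.
Proof.
have cl := bdd_lin (cmap_bdd Uh (@Ucop_lin F g)).
rewrite /sg3 sg_inj (linN cl) (linD cl) cmap_cc ?cmap_cu ?Ucop1 ?Ucop_inj //; exact: Ucop_lin.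
Qed.

(** A form of coassociativity. Both sides are antimorphisms in [u], so their values on l decide. *)
Lemma sg3_onDr u : onDr (fun u1 u2 => cc Uh (Sl u2 ⊗ 1) * embr U (sg u1)) u = sg3 u.
Proof.
have bs : bshift_l 0 (fun u1 u2 => cc Uh (Sl u2 ⊗ (1 : U)) * embr U (sg u1)).
  split; first split.
  - by move=> u2; apply: lin_mull; apply: lin_comp sg_lin; exact: embr_lin.
  - move=> u1; apply: lin_mulr; apply: (lin_comp (@cc_lin F Uh _)).
    by apply: lin_tensl; exact: Sl_lin.
  move=> k u1 u2 ku; rewrite addr0 -[k]add0r; apply: fil_mul; first exact: cc_fil.
  by apply: embr_fil; exact: sg_fil.
move: u; apply: anti_uniq; [exact: cC|exact: sC| | |].
- split; [exact: (onDr_lin (@cC _) (@sC _) bs)| |exact: (onDr_fil (@cC _) (@sC _) bs)].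
  apply: (onDr_anti (@cC _) (@sC _) bs) => [|a a' c c'].
    by rewrite Sl1 sg_anti.1 embr1 mulr1 -tens1 cc1.
  rewrite SlM sg_anti.2 embrM (_ : (Sl c' * Sl c) ⊗ (1 : U) = (Sl c' ⊗ 1) * (Sl c ⊗ 1)).
    by rewrite ccM -!mulrA; congr (_ * _); rewrite !mulrA embr_com.
  by rewrite tensM mulr1.
- by split; [exact: sg3_lin|exact: sg3_anti|exact: sg3_fil].
move=> x; rewrite (onDr_inj (@cC _) (@sC _) bs) sg3_inj Sl1 Sl_inj sg_anti.1 embr1 mulr1.
rewrite -tens1 cc1 mul1r sg_inj.
rewrite (linN (@embr_lin F Uh _ _)) (linD (@embr_lin F Uh _ _)) embr_cc embr_cu.
rewrite (linN (@tensl_lin F U U 1)) (linN (@cc_lin F Uh _)) /Xl (linD (@cc_lin F Uh _)).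
rewrite -opprD; congr (- _); rewrite addrC addrA; congr (_ + _); exact: addrC.
Qed.

Let Dl_lin : linear Dl. Proof. by case: Dl_ext => -[]. Qed.
Let Dl_mor : GRing.monoid_morphism Dl. Proof. by case: Dl_ext => -[]. Qed.
Let Dl_fil : filtered Dl. Proof. by case: Dl_ext => -[_ _ h] _; exact: h. Qed.
Let il_lin : linear il := @Usub_lin _ _ _ _.
Let il_mor : GRing.monoid_morphism il. Proof. by case: (Usub_spec (@pol_lC F g)). Qed.

Definition dl (u : Uh) : C U := cmap_l il (Dl u).

Lemma dl_lin : linear dl.
Proof. exact: lin_comp (bdd_lin (cmap_bdd Uh il_lin)) Dl_lin. Qed.
Lemma dl_mor : GRing.monoid_morphism dl.
Proof.
have [h1 hM] := cmap_morph Uh il_lin il_mor; have [e1 eM] := Dl_mor.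
by split=> [|x y]; rewrite /dl ?e1 ?h1 // eM hM.
Qed.
Lemma dl_fil : filtered dl.
Proof. by move=> k u /Dl_fil; have [_ h] := cmap_fshift Uh il_lin; move=> /h; rewrite addr0. Qed.
Lemma dl_inj x : dl (iota (uinj x)) = cc Uh (uinj (vsval x)) + cu U (iota (uinj x)).
Proof.
rewrite /dl; case: Dl_ext => _ ->; rewrite Ucop_inj.
have tl : linear (tmap (@id Ul) iota) by exact: tmap_lin.
have ml := bdd_lin (cmap_bdd Uh il_lin).
rewrite (linD tl) !tmapE // iota_mor.1 (linD (bdd_lin (bdd_cin _))) (linD ml) !cmapE //.
by rewrite Usub_inj Usub1.
Qed.

(* v (x) u |-> v (x) u1 (x) u2 *)
Section Delta.
Variable V : algType F.
Definition dl_fun (v : V) (u : Uh) : C (V ⊗ U) := cc Uh (v ⊗ 1) * embr V (dl u).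
Definition delta : C V -> C (V ⊗ U) := @cext F (rtens V Uh) (C (V ⊗ U)) (tlift dl_fun).

Lemma dl_fun_bshift : bshift 0 dl_fun.
Proof.
split; first split.
- move=> u; apply: lin_mulr; apply: (lin_comp (@cc_lin F Uh _)).
  exact: (lin_tensl (f := id)).
- by move=> v; apply: lin_mull; apply: lin_comp dl_lin; exact: embr_lin.
move=> k v u ku; rewrite addr0 -[k]add0r; apply: fil_mul; first exact: cc_fil.
by apply: embr_fil; exact: dl_fil.
Qed.
Lemma delta_bdd : bdd delta.
Proof. by apply: (ext_bdd _ _ dl_fun_bshift); [exact: cC|exact: sC]. Qed.
Lemma deltaE v u : delta (cin (v ⊗ u : rtens V Uh)) = cc Uh (v ⊗ 1) * embr V (dl u).
Proof. by apply: (extE _ _ _ dl_fun_bshift); exact: sC. Qed.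
Lemma delta_fil : filtered delta.
Proof.
move=> k X kX; rewrite -[k]addr0.
exact: (ext_fshift (@cC _) (@sC _) dl_fun_bshift).2 _ _ kX.
Qed.
Lemma delta_mor : GRing.monoid_morphism delta.
Proof.
have [b1 b2] := dl_fun_bshift; have [d1 dM] := dl_mor.
apply: cext_morph; [exact: cC|exact: sC|by exists 0; exact: tlift_fshift dl_fun_bshift|].
apply: tlift_morph => // [|a a' c c'].
  by rewrite /dl_fun d1 embr1 mulr1 -tens1 cc1.
rewrite /dl_fun dM embrM (_ : (a * a') ⊗ (1 : U) = (a ⊗ 1) * (a' ⊗ 1)); last first.
  by rewrite tensM mulr1.
by rewrite ccM -!mulrA; congr (_ * _); rewrite !mulrA embr_com.
Qed.
Lemma deltaM X Y : delta (X * Y) = delta X * delta Y.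
Proof. by case: delta_mor. Qed.
Lemma delta_cc v : delta (cc Uh v) = cc Uh (v ⊗ 1).
Proof. by rewrite /cc deltaE dl_mor.1 embr1 mulr1. Qed.
Lemma delta_cu u : delta (cu V u) = embr V (dl u).
Proof. by rewrite /cu deltaE -tens1 cc1 mul1r. Qed.
End Delta.

(** Coassociativity again, with the coproduct now applied to the leg in Uh; the comparison is made
    on l. *)
Lemma delta_sg u : delta (sg u) = sg3 u.
Proof.
have dlin := bdd_lin (@delta_bdd U); have [d1 dM] := @delta_mor U.
move: u; apply: anti_uniq; [exact: cC|exact: sC| | |].
- split; first exact: (lin_comp dlin sg_lin).
    by split=> [|x y]; rewrite ?sg_anti.1 // sg_anti.2 dM.
  by move=> k u ku; apply: delta_fil; exact: sg_fil.
- by split; [exact: sg3_lin|exact: sg3_anti|exact: sg3_fil].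
move=> x; rewrite sg3_inj sg_inj (linN dlin) (linD dlin) delta_cc delta_cu dl_inj.
rewrite (linD (@embr_lin F Uh _ _)) embr_cc embr_cu /Xl (linD (@cc_lin F Uh _)).
by rewrite addrA.
Qed.

(** * The map from K to J, its coproducts and auxiliary antipode maps *)

Lemma J_1_2_34_delta (X : C (U ⊗ U)) : J_1_2_34 Dl X = delta X.
Proof.
rewrite /J_1_2_34 /delta; congr (cext _ X); congr tlift.
apply/funext => v; apply/funext => u; rewrite /dl_fun /dl.
have bs : bshift 0 (fun (u1 : Ul) (u2 : Uh) => cin ((v ⊗ il u1) ⊗ u2 : rtens (U ⊗ U ⊗ U) Uh)
    : C (U ⊗ U ⊗ U)).
  have cl := bdd_lin (bdd_cin (rtens (U ⊗ U ⊗ U) Uh)); split; first split.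
  - by move=> u2; apply: (lin_comp cl); apply: lin_tensl; exact: lin_tensr.
  - by move=> u1; apply: (lin_comp cl); exact: (lin_tensr (f := id)).
  by move=> k a b kb; rewrite addr0; apply/cfil_in; exact: tspan_gen.
move: (Dl u); apply: (@eq_ext F Ul Uh (C (U ⊗ U ⊗ U)) _ _
  (fun Y => cc Uh (v ⊗ 1) * embr (U ⊗ U)%type (cmap_l il Y))).
- exact: sC.
- by apply: (ext_bdd _ _ bs); [exact: cC|exact: sC].
- by apply: bdd_mull; apply: (bdd_comp (@embr_bdd F Uh _ _)); exact: cmap_bdd.
move=> u1 u2; rewrite (extE _ _ _ bs); last exact: sC.
by rewrite cmapE // embrE /cc cinMt tensM mulr1 !mul1r.
Qed.

Lemma delta_embr (V W : algType F) (Y : C W) : delta (embr V Y) = embm V (delta Y).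
Proof.
move: Y; apply: (@eq_ext F W Uh (C (V ⊗ W ⊗ U)) (@sC _) (fun Y => delta (embr V Y))
  (fun Y => embm V (delta Y))).
- by apply: (bdd_comp (@delta_bdd _)); exact: embr_bdd.
- by apply: (bdd_comp (@embm_bdd F Uh _ _ _)); exact: delta_bdd.
by move=> v u; rewrite embrE !deltaE embmM embm_cc embm_embr.
Qed.

Lemma delta_embm (V W : algType F) (t : V ⊗ W) (Y : C W) :
  delta (cc Uh t * embr V Y) = cc Uh (t ⊗ 1) * embm V (delta Y).
Proof. by rewrite deltaM delta_cc delta_embr. Qed.

Definition J_fun (a : Up) (b : Um) (u : Uh) : C (U ⊗ U) := cc Uh (ip a ⊗ Sm b) * embr U (sg u).

(** The general term splits as (a (x) S(b)) (1 (x) sg(u)); the constant and the part coming from Uh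
    can then be moved separately. *)
Lemma J_termE a b u : J_term Sh Dr a b u = J_fun a b u.
Proof.
have bs : bshift_l 0 (fun (u1 : Uh) (u2 : Ul) => cin ((ip a ⊗ (Sm b * Sl u2)) ⊗ Sh u1 : rtens (U ⊗ U) Uh)
    : C (U ⊗ U)).
  have cl := bdd_lin (bdd_cin (rtens (U ⊗ U) Uh)); split; first split.
  - by move=> u2; apply: (lin_comp cl); exact: lin_tensr.
  - move=> u1; apply: (lin_comp cl); apply: lin_tensl; apply: lin_tensr; apply: lin_mull.
    exact: Sl_lin.
  by move=> k u1 u2 ku; rewrite addr0; apply/cfil_in; apply: tspan_gen => //; exact: Sh_fil.
rewrite /J_fun /sg /onDr /J_term; move: (Dr u).
apply: (@eq_extl F Ul Uh (C (U ⊗ U)) (@sC _)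
  (@cext F (ltens Uh Ul) (C (U ⊗ U)) (tlift (fun u1 u2 =>
    cin ((ip a ⊗ (Sm b * Sl u2)) ⊗ Sh u1 : rtens (U ⊗ U) Uh) : C (U ⊗ U))))
  (fun Y => cc Uh (ip a ⊗ Sm b) * embr U (@cext F (ltens Uh Ul) (C U) (tlift sg_fun) Y))).
- by apply: (extl_bdd _ _ bs); [exact: cC|exact: sC].
- apply: bdd_mull; apply: (bdd_comp (@embr_bdd F Uh _ _)).
  by apply: (extl_bdd _ _ sg_bshift); [exact: cC|exact: sC].
move=> u2 u1; rewrite (extlE _ _ _ bs) ?(extlE _ _ _ sg_bshift); try exact: sC.
by rewrite /sg_fun embrE /cc cinMt tensM mulr1 mul1r.
Qed.

Lemma J_fun_tshift : tshift 0 J_fun.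
Proof.
split.
- move=> b u; apply: lin_mulr; apply: (lin_comp (@cc_lin F Uh _)).
  by apply: lin_tensl; exact: Usub_lin.
- move=> a u; apply: lin_mulr; apply: (lin_comp (@cc_lin F Uh _)).
  by apply: lin_tensr; exact: Sm_lin.
- by move=> a b; apply: lin_mull; apply: lin_comp sg_lin; exact: embr_lin.
move=> k a b u ku; rewrite addr0 -[k]add0r; apply: fil_mul; first exact: cc_fil.
by apply: embr_fil; exact: sg_fil.
Qed.

Definition J_ext : C (Up ⊗ Um) -> C (U ⊗ U) :=
  @cext F (rtens (Up ⊗ Um) Uh) (C (U ⊗ U)) (tlift3 J_fun).

Lemma J_eltE Z : J_elt Sh Dr Z = J_ext Z.
Proof.
rewrite /J_elt /J_ext; congr (cext _ Z); congr tlift3.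
by apply/funext => a; apply/funext => b; apply/funext => u; exact: J_termE.
Qed.
Lemma J_ext_fil k Z : fil k Z -> fil k (J_ext Z).
Proof.
move=> kZ; rewrite -[k]addr0.
exact: (ext3_fshift (@cC _) (@sC _) J_fun_tshift).2 _ _ kZ.
Qed.
Lemma J_ext_bdd : bdd J_ext.
Proof. by apply: (ext3_bdd _ _ J_fun_tshift); [exact: cC|exact: sC]. Qed.
Lemma J_extE a b u : J_ext (cin (a ⊗ b ⊗ u : rtens (Up ⊗ Um) Uh)) = J_fun a b u.
Proof. by apply: (ext3E _ _ _ _ J_fun_tshift); exact: sC. Qed.

Lemma J_12_3_4E a b (Y : C U) : J_12_3_4 (cc Uh (a ⊗ b) * embr U Y) = cc Uh (Ucop a ⊗ b) * embr (U ⊗ U)%type Y.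
Proof.
have tl : linear (tmap (@Ucop F g) (@id U)) by apply: tmap_lin => //; exact: Ucop_lin.
have tm : GRing.monoid_morphism (tmap (@Ucop F g) (@id U)).
  by apply: tmap_morph => //; [exact: Ucop_lin|exact: Ucop_mor].
have [_ M] := cmap_morph Uh tl tm; rewrite /J_12_3_4 M cmap_cc // tmapE //; last exact: Ucop_lin.
congr (_ * _); rewrite /embr cmap_comp //; last exact: tensr_lin.
congr (cmap_l _ Y); apply/funext => w; rewrite tmapE ?Ucop1 //; exact: Ucop_lin.
Qed.

Let phi1_bil : @bilinear_map F U U (U ⊗ U ⊗ U)%type (fun a b => alpha a (Ucop b)).
Proof.
split=> [b|a]; last exact: (lin_comp (@alpha_lin F U U U a) (@Ucop_lin F g)).
exact: alpha_linl.
Qed.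

Lemma J_1_23_4E a b (Y : C U) : J_1_23_4 (cc Uh (a ⊗ b) * embr U Y) =
  cc Uh (alpha a (Ucop b)) * embm U (cmap_l (@Ucop F g) Y).
Proof.
have pl := tlift_lin phi1_bil.
move: Y; apply: (@eq_ext F U Uh (C (U ⊗ U ⊗ U)) _ (fun Y => J_1_23_4 (cc Uh (a ⊗ b) * embr U Y))
  (fun Y => cc Uh (alpha a (Ucop b)) * embm U (cmap_l (@Ucop F g) Y))).
- exact: sC.
- by apply: (bdd_comp (cmap_bdd Uh pl)); apply: bdd_mull; exact: embr_bdd.
- apply: bdd_mull; apply: (bdd_comp (@embm_bdd F Uh _ _ _)); apply: cmap_bdd.
  exact: Ucop_lin.
move=> v u; rewrite embrE /cc cinMt tensM mulr1 mul1r cmapE; last exact: Ucop_lin.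
rewrite /J_1_23_4 cmapE // tliftE // UcopM embm_t cinMt mul1r.
by rewrite alphaM mulr1.
Qed.

Lemma J_2_3_4E (X : C (U ⊗ U)) : J_2_3_4 X = embm U X.
Proof. by []. Qed.


(* v (x) b (x) u |-> v (x) S(b) S(u2) (x) S(u1) *)
Section Psi.
Variable V : algType F.
Definition psi_fun (v : V) (b : Um) (u : Uh) : C (V ⊗ U) := cc Uh (v ⊗ Sm b) * embr V (sg u).
Lemma psi_tshift : tshift 0 psi_fun.
Proof.
split.
- move=> b u; apply: lin_mulr; apply: (lin_comp (@cc_lin F Uh _)).
  exact: (lin_tensl (f := id)).
- move=> a u; apply: lin_mulr; apply: (lin_comp (@cc_lin F Uh _)).
  by apply: lin_tensr; exact: Sm_lin.
- by move=> a b; apply: lin_mull; apply: lin_comp sg_lin; exact: embr_lin.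
move=> k a b u ku; rewrite addr0 -[k]add0r; apply: fil_mul; first exact: cc_fil.
by apply: embr_fil; exact: sg_fil.
Qed.
Definition psi : C (V ⊗ Um) -> C (V ⊗ U) :=
  @cext F (rtens (V ⊗ Um) Uh) (C (V ⊗ U)) (tlift3 psi_fun).
Lemma psi_bdd : bdd psi.
Proof. by apply: (ext3_bdd _ _ psi_tshift); [exact: cC|exact: sC]. Qed.
Lemma psiE v b u : psi (cin (v ⊗ b ⊗ u : rtens (V ⊗ Um) Uh)) = psi_fun v b u.
Proof. by apply: (ext3E _ _ _ _ psi_tshift); exact: sC. Qed.

(** S reverses products: a right factor b of the leg in U(u_-) comes out as S(b) on the left. *)
Lemma psi_cc v b Z : psi (cc Uh (v ⊗ 1) * Z * cc Uh (1 ⊗ b)) = cc Uh (v ⊗ Sm b) * psi Z.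
Proof.
move: Z; apply: (@eq_ext3 F V Um Uh (C (V ⊗ U)) (@sC _)
  (fun Z => psi (cc Uh (v ⊗ 1) * Z * cc Uh (1 ⊗ b))) (fun Z => cc Uh (v ⊗ Sm b) * psi Z)).
- by apply: (bdd_comp psi_bdd); apply: bdd_mulr; apply: bdd_mull; exact: bdd_id.
- by apply: bdd_mull; exact: psi_bdd.
move=> v' b' u; rewrite /cc !cinMt !tensM !mul1r !mulr1 !psiE /psi_fun SmM.
by rewrite mulrA -ccM tensM.
Qed.

Lemma psi_cu u Z : psi (cu _ u * Z) = psi Z * embr V (sg u).
Proof.
move: Z; apply: (@eq_ext3 F V Um Uh (C (V ⊗ U)) (@sC _)
  (fun Z => psi (cu _ u * Z)) (fun Z => psi Z * embr V (sg u))).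
- by apply: (bdd_comp psi_bdd); apply: bdd_mull; exact: bdd_id.
- by apply: bdd_mulr; exact: psi_bdd.
move=> v' b' u'; rewrite /cu cinMt mul1r !psiE /psi_fun.
by rewrite sg_anti.2 embrM mulrA.
Qed.

Lemma psi_ccr v Z : psi (Z * cc Uh (v ⊗ 1)) = psi Z * cc Uh (v ⊗ 1).
Proof.
move: Z; apply: (@eq_ext3 F V Um Uh (C (V ⊗ U)) (@sC _)
  (fun Z => psi (Z * cc Uh (v ⊗ 1))) (fun Z => psi Z * cc Uh (v ⊗ 1))).
- by apply: (bdd_comp psi_bdd); apply: bdd_mulr; exact: bdd_id.
- by apply: bdd_mulr; exact: psi_bdd.
move=> v' b' u'; rewrite {1}/cc cinMt tensM !mulr1 !psiE /psi_fun.
by rewrite -[RHS]mulrA -embr_com [RHS]mulrA -ccM tensM mulr1.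
Qed.
End Psi.

Lemma psi_embm (V W : algType F) (Z : C (W ⊗ Um)) : psi (embm V Z) = embm V (psi Z).
Proof.
move: Z; apply: (@eq_ext3 F W Um Uh (C (V ⊗ W ⊗ U)) (@sC _)
  (fun Z => psi (embm V Z)) (fun Z => embm V (psi Z))).
- by apply: (bdd_comp (@psi_bdd _)); exact: embm_bdd.
- by apply: (bdd_comp (@embm_bdd F Uh _ _ _)); exact: psi_bdd.
by move=> v b u; rewrite embmE !psiE /psi_fun embmM embm_cc embm_embr.
Qed.

(** v (x) u goes to v (x) S(u2) (x) S(u1). *)
Definition chi (V : algType F) (X : C V) : C (V ⊗ U) := psi (embl Um X).

Lemma chi_bdd (V : algType F) : bdd (@chi V).
Proof. by apply: (bdd_comp (@psi_bdd _)); exact: embl_bdd. Qed.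
Lemma chiE (V : algType F) (v : V) u : chi (cin (v ⊗ u : rtens V Uh)) = cc Uh (v ⊗ 1) * embr V (sg u).
Proof. by rewrite /chi emblE psiE /psi_fun Sm1. Qed.
Lemma chi_cc (V : algType F) (v : V) X : chi (cc Uh v * X) = cc Uh (v ⊗ 1) * chi X.
Proof.
have := psi_cc v 1 (embl Um X).
by rewrite -tens1 cc1 mulr1 Sm1 /chi emblM embl_cc.
Qed.
Lemma chi_embr (V W : algType F) (Y : C W) : chi (embr V Y) = embm V (chi Y).
Proof.
move: Y; apply: (@eq_ext F W Uh (C (V ⊗ W ⊗ U)) (@sC _) (fun Y => chi (embr V Y))
  (fun Y => embm V (chi Y))).
- by apply: (bdd_comp (@chi_bdd _)); exact: embr_bdd.
- by apply: (bdd_comp (@embm_bdd F Uh _ _ _)); exact: chi_bdd.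
by move=> v u; rewrite embrE !chiE embmM embm_cc embm_embr.
Qed.

Lemma psi_embl (V : algType F) (X : C V) u : psi (embl Um X * cu _ u) = embr V (sg u) * chi X.
Proof.
move: X; apply: (@eq_ext F V Uh (C (V ⊗ U)) (@sC _) (fun X => psi (embl Um X * cu _ u))
  (fun X => embr V (sg u) * chi X)).
- by apply: (bdd_comp (@psi_bdd _)); apply: bdd_mulr; exact: embl_bdd.
- by apply: bdd_mull; exact: chi_bdd.
move=> v u'; rewrite emblE chiE /cu cinMt mulr1 psiE /psi_fun Sm1 sg_anti.2 embrM.
by rewrite !mulrA embr_com.
Qed.


(* u1 W S(u2), where u1 (x) u2 stands for Dr u. *)
Section Twist.
Variables (V : algType F) (e : U -> V).
Hypothesis el : linear e.

Definition tw_fun (W : C V) (u1 : Uh) (u2 : Ul) : C V := cu V u1 * W * cc Uh (e (Sl u2)).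
Definition tw (W : C V) (u : Uh) : C V := onDr (tw_fun W) u.

Lemma tw_bshift d W : fil d W -> bshift_l d (tw_fun W).
Proof.
move=> dW; split; first split.
- by move=> u2; apply: lin_mulr; apply: lin_mulr; exact: cu_lin.
- move=> u1; apply: lin_mull; apply: (lin_comp (@cc_lin F Uh V)).
  by apply: (lin_comp el); exact: Sl_lin.
move=> k u1 u2 ku; rewrite -[k + d]addr0; apply: fil_mul; last exact: cc_fil.
by apply: fil_mul => //; exact: cu_fil.
Qed.
Lemma tw_linu W : linear (tw W).
Proof. by have [d /tw_bshift h] := fil_exh W; apply: (onDr_lin _ _ h); [exact: cC|exact: sC]. Qed.
Lemma tw_fil k d W u : fil d W -> fil k u -> fil (k + d) (tw W u).
Proof.
move=> /tw_bshift h ku.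
exact: (onDr_fshift (@cC _) (@sC _) h).2.
Qed.
Lemma tw_lin u : linear (tw^~ u).
Proof.
move=> a W W'; have [d /tw_bshift h] := fil_exh W; have [d' /tw_bshift h'] := fil_exh W'.
rewrite /tw -(onDr_linb (@cC _) (@sC _) _ _ h h'); apply: eq_onDr => u1 u2.
by rewrite /tw_fun mulrDr mulrDl -scalerAr -scalerAl.
Qed.
Lemma tw_bdd u : bdd (tw^~ u).
Proof.
have [k ku] := fil_exh u; exists k; split; first exact: tw_lin.
by move=> d W dW; rewrite addrC; exact: tw_fil.
Qed.
Lemma tw_cc v W u : tw (cc Uh v * W) u = cc Uh v * tw W u.
Proof.
have [d /tw_bshift h] := fil_exh W.
rewrite /tw (onDr_map (f := fun X => cc Uh v * X) u (@cC _) (@sC _) (@cC _) (@sC _) _ h).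
  by apply: eq_onDr => u1 u2; rewrite /tw_fun !mulrA cc_cu cu_cc.
by apply: bdd_mull; exact: bdd_id.
Qed.
End Twist.

(** The left factor u1 becomes a right factor sg(u1), while S(u2) stays on the right of the first
    leg; [sg3_onDr] joins the two. *)
Lemma psi_tw (V : algType F) (W : C (U ⊗ Um)) u :
  psi (tw (fun z : U => z ⊗ (1 : Um)) W u) = psi W * sg3 u.
Proof.
have el := @tensl_lin F U Um 1.
have [d /(tw_bshift el) h] := fil_exh W.
rewrite /tw (onDr_map u (@cC _) (@sC _) (@cC _) (@sC _) (@psi_bdd U) h).
rewrite -sg3_onDr; have bs : bshift_l 0 (fun u1 u2 => cc Uh (Sl u2 ⊗ (1 : U)) * embr U (sg u1)).
  split; first split.
  - by move=> u2; apply: lin_mull; apply: lin_comp sg_lin; exact: embr_lin.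
  - move=> u1; apply: lin_mulr; apply: (lin_comp (@cc_lin F Uh _)).
    by apply: lin_tensl; exact: Sl_lin.
  move=> k u1 u2 ku; rewrite addr0 -[k]add0r; apply: fil_mul; first exact: cc_fil.
  by apply: embr_fil; exact: sg_fil.
rewrite (onDr_map (f := fun X => psi W * X) u (@cC _) (@sC _) (@cC _) (@sC _) _ bs).
  apply: eq_onDr => u1 u2; rewrite /tw_fun psi_ccr psi_cu -!mulrA; congr (_ * _).
  by rewrite embr_com.
by apply: bdd_mull; exact: bdd_id.
Qed.

Let idl : linear (fun z : U => z). Proof. by []. Qed.

(** The origin of [tw]: of the two legs of [sg'] one preserves the order of products and the other
    reverses it, so u1 multiplies from the left and S(u2) from the right. *)
Lemma sg'_mul u m : sg' (u * m) = tw id (sg' m) u.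
Proof.
have [dm /(tw_bshift idl) h] := fil_exh (sg' m).
rewrite /tw /sg' /onDr DrM; move: (Dr u).
apply: (@eq_extl F Ul Uh (C U) (@sC _)
  (fun T => @cext F (ltens Uh Ul) (C U) (tlift sg'_fun) (T * Dr m))
  (@cext F (ltens Uh Ul) (C U) (tlift (tw_fun id (sg' m))))).
- apply: (bdd_comp (extl_bdd (@cC _) (@sC _) sg'_bshift)).
  by apply: bdd_mulr; exact: bdd_id.
- exact: (extl_bdd (@cC _) (@sC _) h).
move=> u2 u1; rewrite (extlE (@sC _) _ _ h) /tw_fun /sg' /onDr; move: (Dr m).
apply: (@eq_extl F Ul Uh (C U) (@sC _)
  (fun T => @cext F (ltens Uh Ul) (C U) (tlift sg'_fun) (cin (u1 ⊗ u2 : ltens Uh Ul) * T))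
  (fun T => cu U u1 * @cext F (ltens Uh Ul) (C U) (tlift sg'_fun) T * cc Uh (Sl u2))).
- apply: (bdd_comp (extl_bdd (@cC _) (@sC _) sg'_bshift)).
  by apply: bdd_mull; exact: bdd_id.
- by apply: bdd_mulr; apply: bdd_mull; exact: (extl_bdd (@cC _) (@sC _) sg'_bshift).
move=> m2 m1; rewrite -cinM [X in cin X]tensM !(extlE (@sC _) _ _ sg'_bshift).
by rewrite /sg'_fun -/(Sl _) SlM /cu /cc !cinMt mul1r mulr1.
Qed.

Lemma sg'_inj x : sg' (iota (uinj x)) = cu U (iota (uinj x)) - cc Uh (uinj (vsval x)).
Proof.
rewrite /sg' (onDr_inj (@cC _) (@sC _) sg'_bshift).
by rewrite /sg'_fun -!/(Sl _) Sl1 Sl_inj -/(cu U _) -/(cc _ _) (linN (@cc_lin F Uh U)).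
Qed.

Lemma sg'_mulr w x : sg' (w * iota (uinj x)) =
  sg' w * cu U (iota (uinj x)) - cc Uh (uinj (vsval x)) * sg' w.
Proof.
rewrite sg'_mul sg'_inj /sg'; set f := fun Y : C U => Y * cu U (iota (uinj x)) - cc Uh (uinj (vsval x)) * Y.
have fb : bdd f.
  by apply: bdd_sub; [apply: bdd_mulr|apply: bdd_mull]; exact: bdd_id.
rewrite -[RHS]/(f _) (onDr_map w (@cC _) (@sC _) (@cC _) (@sC _) fb sg'_bshift).
apply: eq_onDr => u1 u2; rewrite /tw_fun /f /sg'_fun -/(Sl _).
rewrite mulrBr mulrBl; congr (_ - _).
  by rewrite -cuM cu_cc {1}/cu cinMt mulr1.
by rewrite cu_cc /cc !cinMt mulr1 mul1r.
Qed.

Lemma sg'_one : sg' 1 = 1.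
Proof.
rewrite /sg' /onDr Dr1 cin1 ltens1 (extlE (@sC _) _ _ sg'_bshift).
by rewrite /sg'_fun -/(Sl _) Sl1.
Qed.


(** * Degree and invariance of J *)

Notation J := (J_ext K).
Let J_ext_b : bdd J_ext := J_ext_bdd.

Lemma K_fil1 : fil (-1) (K - 1).
Proof.
apply: fil_tr' (fil_mono _ (K_top)) _; first by lia.
apply: fil_sum => i _; apply: fil_sum => j _.
by apply/cfil_in; apply: tspan_gen.
Qed.
Lemma K_fil : fil 0 K.
Proof.
by rewrite -[K](subrK 1); apply: filD; [apply: fil_mono K_fil1|exact: fil_one].
Qed.

(** [rho] recovers [a] from its image in U(g): faithfulness of U(u_+) in U(g) is read off K, and
    that of U(u_-) likewise through [uproj]. *)
Lemma ip_inj : injective ip.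
Proof. by move=> a a' E; apply: (@cc_inj F Uh); rewrite -!rho_ip E. Qed.
Lemma im_inj : injective im.
Proof.
have pm b : uproj (im b) = cc Uh b.
  by have := uproj_gen 1 1 b; rewrite !Usub1 !mul1r Ucounit1 scale1r iota_mor.1.
by move=> b b' E; apply: (@cc_inj F Uh); rewrite -!pm E.
Qed.

Lemma adp_ex (x : Lie_l g) a : exists a', ip a' = uinj (vsval x) * ip a - ip a * uinj (vsval x).
Proof.
elim/uenv_ind: a => [y||a y z [y' Ey] [z' Ez]|y z [y' Ey] [z' Ez]].
- exists (uinj (vsproj (pol_p g) ⁅vsval x, vsval y⁆ : Lie_p g)).
  by rewrite !Usub_inj vsprojK ?uinj_br // pol_lp ?subvsP.
- by exists 0; rewrite (lin0 (@Usub_lin _ _ _ _)) Usub1 mulr1 mul1r subrr.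
- exists (a *: y' + z'); rewrite !(@Usub_lin _ _ _ _ a) Ey Ez.
  exact/esym/comm_lin.
exists (y' * z + y * z'); rewrite (linD (@Usub_lin _ _ _ _)) !UsubM Ey Ez.
by rewrite commM.
Qed.
Lemma adm_ex (x : Lie_l g) b : exists b',
  im b' = uinj (vsval x) * im b - im b * uinj (vsval x) /\
  Sm b' = uinj (vsval x) * Sm b - Sm b * uinj (vsval x).
Proof.
elim/uenv_ind: b => [y||a y z [y' [Ey Fy]] [z' [Ez Fz]]|y z [y' [Ey Fy]] [z' [Ez Fz]]].
- exists (uinj (vsproj (pol_m g) ⁅vsval x, vsval y⁆ : Lie_m g)).
  rewrite !Usub_inj !Sm_inj vsprojK ?uinj_br; last by rewrite pol_lm ?subvsP.
  by split=> //; rewrite mulrN mulNr opprK opprB addrC.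
- by exists 0; rewrite (lin0 (@Usub_lin _ _ _ _)) (lin0 Sm_lin) Usub1 Sm1 mulr1 mul1r subrr.
- exists (a *: y' + z'); rewrite !(@Usub_lin _ _ _ _ a) !Sm_lin Ey Ez Fy Fz.
  by split; exact/esym/comm_lin.
exists (y' * z + y * z'); rewrite (linD (@Usub_lin _ _ _ _)) (linD Sm_lin) !UsubM !SmM Ey Ez Fy Fz.
by split; rewrite commM // addrC.
Qed.

Section Invariance.
Variable x : Lie_l g.
Let X : U := uinj (vsval x).
Let ix : Uh := iota (uinj x).
(** The adjoint action of l on U(u_+), chosen as a preimage in U(u_+) of a commutator in U(g).
    [ip_inj] makes the choice canonical and hence linear. *)
Definition adp a : Up := projT1 (cid (adp_ex x a)).
Definition adm b : Um := projT1 (cid (adm_ex x b)).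
Lemma adpE a : ip (adp a) = X * ip a - ip a * X.
Proof. by rewrite /adp; case: cid. Qed.
Lemma admE b : im (adm b) = X * im b - im b * X.
Proof. by rewrite /adm; case: cid => ? []. Qed.
Lemma Sm_adm b : Sm (adm b) = X * Sm b - Sm b * X.
Proof. by rewrite /adm; case: cid => ? []. Qed.
Lemma adp_lin : linear adp.
Proof.
move=> a y z; apply: ip_inj; rewrite (@Usub_lin _ _ _ _ a) !adpE (@Usub_lin _ _ _ _ a).
exact: comm_lin.
Qed.
Lemma adm_lin : linear adm.
Proof.
move=> a y z; apply: im_inj; rewrite (@Usub_lin _ _ _ _ a) !admE (@Usub_lin _ _ _ _ a).
exact: comm_lin.
Qed.

Definition ad_fun a b u : C (Up ⊗ Um) := cin (adp a ⊗ b ⊗ u : TK) + cin (a ⊗ adm b ⊗ u : TK) +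
  cin (a ⊗ b ⊗ (ix * u - u * ix) : TK).
Lemma ad_tshift : tshift 1 ad_fun.
Proof.
have cl := bdd_lin (bdd_cin TK).
have ix1 : fil 1 ix by apply: iota_fil; exact: ufil_inj.
split.
- move=> b u; apply: lin_add; first apply: lin_add; apply: (lin_comp cl); apply: lin_tensl.
  + by apply: lin_tensl; exact: adp_lin.
  + exact: (lin_tensl (f := id)).
  exact: (lin_tensl (f := id)).
- move=> a u; apply: lin_add; first apply: lin_add; apply: (lin_comp cl); apply: lin_tensl.
  + exact: (lin_tensr (f := id)).
  + by apply: lin_tensr; exact: adm_lin.
  exact: (lin_tensr (f := id)).
- move=> a b; apply: lin_add; first apply: lin_add; apply: (lin_comp cl).
  + exact: (lin_tensr (f := id)).
  + exact: (lin_tensr (f := id)).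
  by apply: lin_tensr; apply: lin_sub; [exact: (lin_mull (f := id))|exact: (lin_mulr (f := id))].
move=> k a b u ku; have ku1 : fil (k + 1) u by apply: fil_mono ku; lia.
apply: filD; first apply: filD; apply/cfil_in; apply: tspan_gen => //.
by apply: filB; [rewrite addrC; exact: fil_mul|exact: fil_mul].
Qed.
Definition ad : C (Up ⊗ Um) -> C (Up ⊗ Um) := @cext F TK (C (Up ⊗ Um)) (tlift3 ad_fun).
Lemma ad_bdd : bdd ad.
Proof. exact: (ext3_bdd (@cC _) (@sC _) ad_tshift). Qed.
Lemma adE a b u : ad (cin (a ⊗ b ⊗ u : TK)) = ad_fun a b u.
Proof. exact: (ext3E (@sC _) _ _ _ ad_tshift). Qed.

(** U(l)-linearity of H moves the inner copies of x next to u, where they cancel against the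
    commutator of x with u. *)
Lemma pair_ad z y Z : pair z y (ad Z) = pair (z * X) y Z - pair z (X * y) Z.
Proof.
have XE : X = il (uinj x) by rewrite Usub_inj.
move: Z; apply: (@eq_ext3 F Up Um Uh Uh Uh_separated (fun Z => pair z y (ad Z))
  (fun Z => pair (z * X) y Z - pair z (X * y) Z)).
- by apply: (bdd_comp (pair_bdd z y)); exact: ad_bdd.
- by apply: bdd_sub; exact: pair_bdd.
move=> a b u; rewrite adE /ad_fun !(linD (bdd_lin (pair_bdd z y))) !pairE adpE admE.
have h1 : hI (z * (X * ip a - ip a * X)) = hI (z * X * ip a) - hI (z * ip a) * ix.
  by rewrite mulrBr (linB hIl) !mulrA [in X in _ - X]XE hI_lr.
have h2 : hI ((X * im b - im b * X) * y) = ix * hI (im b * y) - hI (im b * (X * y)).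
  by rewrite mulrBl (linB hIl) -!mulrA [in X in X - _]XE hI_ll.
rewrite h1 h2; ncring.
Qed.

Lemma ad_K : ad K = 0.
Proof.
apply: pair_ext => z y.
by rewrite pair_ad !pair_K mulrA subrr (lin0 (bdd_lin (pair_bdd z y))).
Qed.

Lemma Xl_embr : Xl x = cc Uh (X ⊗ 1) + embr U (- sg ix).
Proof.
have el := @embr_lin F Uh U U.
rewrite sg_inj opprK (linD el) embr_cc embr_cu /Xl (linD (@cc_lin F Uh _)).
by rewrite addrA.
Qed.
Lemma Xl_embr_com u : Xl x * embr U (sg u) - embr U (sg u) * Xl x =
  embr U (sg (ix * u - u * ix)).
Proof.
have el := @embr_lin F Uh U U.
rewrite Xl_embr mulrDl mulrDr embr_com opprD addrACA subrr add0r.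
rewrite -!embrM -(linB el); congr (embr U _).
by rewrite (linB sg_lin) !sg_anti.2 mulNr mulrN opprK addrC.
Qed.
Lemma Xl_cc_com z t : Xl x * cc Uh (z ⊗ t) - cc Uh (z ⊗ t) * Xl x =
  cc Uh ((X * z - z * X) ⊗ t) + cc Uh (z ⊗ (X * t - t * X)).
Proof.
rewrite /Xl mulrDl mulrDr cu_cc cc_cu opprD addrACA subrr addr0 -!ccM -(linB (@cc_lin F Uh _)).
rewrite -(linD (@cc_lin F Uh _)); congr (cc Uh _).
rewrite mulrDl mulrDr !tensM !mul1r !mulr1 (linB (@tensl_lin F U U t)).
by rewrite (linB (@tensr_lin F U U z)) opprD addrACA.
Qed.

(** The antipode commutes with the adjoint action of l on U(u_-), and [sg], being an antimorphism,
    carries the bracket with x on Uh to the commutator with the total action. *)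
Lemma J_ad Z : J_ext (ad Z) = Xl x * J_ext Z - J_ext Z * Xl x.
Proof.
have Jl := bdd_lin J_ext_bdd.
move: Z; apply: (@eq_ext3 F Up Um Uh (C (U ⊗ U)) (@sC _) (fun Z => J_ext (ad Z))
  (fun Z => Xl x * J_ext Z - J_ext Z * Xl x)).
- by apply: (bdd_comp J_ext_bdd); exact: ad_bdd.
- by apply: bdd_sub; [apply: bdd_mull|apply: bdd_mulr].
move=> a b u; rewrite adE /ad_fun !(linD Jl) !J_extE /J_fun -!/(Sm _) adpE Sm_adm.
by rewrite commM Xl_cc_com Xl_embr_com mulrDl.
Qed.

Lemma J_com : Xl x * J = J * Xl x.
Proof.
by apply/eqP; rewrite -subr_eq0 -J_ad ad_K (lin0 (bdd_lin J_ext_bdd)).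
Qed.
End Invariance.

Lemma J_fil1 : fil (-1) (J - 1).
Proof.
have J1 : J_ext 1 = 1.
  rewrite cin1 rtens1 [X in X ⊗ _]tens1 J_extE /J_fun Usub1 -/(Sm _) Sm1 -tens1 cc1 mul1r.
  by rewrite sg_anti.1 embr1.
by rewrite -[X in _ - X]J1 -(linB (bdd_lin J_ext_bdd)); apply: J_ext_fil; exact: K_fil1.
Qed.

(** After composition with [Sh], [sg3] and its conjugate by J are two filtered morphisms out of Uh;
    invariance makes them agree on l, hence everywhere. *)
Lemma sg3_com u : sg3 u * J = J * sg3 u.
Proof.
have [Ji [Ji0 JiJ JJi]] := fil_unit (@cC _) (@sC _) (filN J_fil1).
have JE : 1 - - (J - 1) = J by rewrite opprK addrC subrK.
rewrite JE in JiJ JJi.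
have J0 : fil 0 J by apply: J_ext_fil; exact: K_fil.
have [Shl Sh1 ShM Shf _] := Sh_ext.
have e : (fun u => sg3 (Sh u)) =1 (fun u => Ji * sg3 (Sh u) * J).
  apply: (uniq_inj (@cC _) (@sC _)).
  - split; first exact: (lin_comp sg3_lin).
      by split=> [|x y]; rewrite ?Sh1 ?sg3_anti.1 // ShM sg3_anti.2.
    by move=> k x kx; apply: sg3_fil; exact: Shf.
  - split; first by apply: lin_mulr; apply: lin_mull; exact: (lin_comp sg3_lin).
      split=> [|x y]; first by rewrite Sh1 sg3_anti.1 mulr1.
      rewrite ShM sg3_anti.2 !mulrA; congr (_ * _); rewrite -!mulrA; congr (_ * (_ * _)).
      by rewrite mulrA JJi mul1r.
    move=> k x kx; rewrite -[k]addr0; apply: fil_mul => //; rewrite -[k]add0r.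
    by apply: fil_mul => //; apply: sg3_fil; exact: Shf.
  move=> x; rewrite Sh_inj (linN sg3_lin) sg3_inj opprK.
  by rewrite -mulrA J_com mulrA JiJ mul1r.
by have := e (Sh u); rewrite ShK => E; rewrite [in RHS]E !mulrA JJi mul1r.
Qed.

(** * The cocycle identity by comparison of left pairings *)

Section LeftPairing.
Variables (V : algType F) (y : U).
Let lb := @lpair_b V y.

Lemma lpair_embl (X : C V) Z : lpair y (embl Um X * Z) = X * lpair y Z.
Proof.
move: X; apply: (@eq_ext F V Uh (C V) (@sC _) (fun X => lpair y (embl Um X * Z))
  (fun X => X * lpair y Z)).
- by apply: (bdd_comp lb); apply: bdd_mulr; exact: embl_bdd.
- by apply: bdd_mulr; exact: bdd_id.
move=> v u; move: Z; apply: (@eq_ext3 F V Um Uh (C V) (@sC _)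
  (fun Z => lpair y (embl Um (cin (v ⊗ u : rtens V Uh)) * Z))
  (fun Z => (cin (v ⊗ u : rtens V Uh) : C V) * lpair y Z)).
- by apply: (bdd_comp lb); apply: bdd_mull; exact: bdd_id.
- exact: bdd_mull.
by move=> v' b u'; rewrite emblE cinMt tensM mul1r !lpairE cinMt mulrA.
Qed.
Lemma lpair_ccr (v : V) (Z : C (V ⊗ Um)) : lpair y (Z * cc Uh (v ⊗ 1)) = lpair y Z * cc Uh v.
Proof.
move: Z; apply: (@eq_ext3 F V Um Uh (C V) (@sC _)
  (fun Z => lpair y (Z * cc Uh (v ⊗ 1))) (fun Z => lpair y Z * cc Uh v)).
- by apply: (bdd_comp lb); apply: bdd_mulr; exact: bdd_id.
- exact: bdd_mulr.
by move=> v' b u'; rewrite /cc cinMt tensM !mulr1 !lpairE cinMt mulr1.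
Qed.
Lemma lpair_ccb b (Z : C (V ⊗ Um)) : lpair y (Z * cc Uh ((1 : V) ⊗ b)) = lpair (im b * y) Z.
Proof.
move: Z; apply: (@eq_ext3 F V Um Uh (C V) (@sC _)
  (fun Z => lpair y (Z * cc Uh ((1 : V) ⊗ b))) (fun Z => lpair (im b * y) Z)).
- by apply: (bdd_comp lb); apply: bdd_mulr; exact: bdd_id.
- exact: lpair_b.
by move=> v' b' u'; rewrite /cc cinMt tensM !mulr1 !lpairE UsubM mulrA.
Qed.
End LeftPairing.

Lemma lpair_embm (V W : algType F) y (Z : C (W ⊗ Um)) :
  lpair y (embm V Z) = embr V (lpair y Z).
Proof.
move: Z; apply: (@eq_ext3 F W Um Uh (C (V ⊗ W)) (@sC _)
  (fun Z => lpair y (embm V Z)) (fun Z => embr V (lpair y Z))).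
- by apply: (bdd_comp (@lpair_b _ _)); exact: embm_bdd.
- by apply: (bdd_comp (@embr_bdd F Uh _ _)); exact: lpair_b.
by move=> v b u; rewrite embmE !lpairE embrE.
Qed.

Section MapLeft.
Variables (V W : algType F) (f : V -> W).
Hypothesis fl : linear f.
Definition mapl (Z : C (V ⊗ Um)) : C (W ⊗ Um) := cmap_l (tmap f (@id Um)) Z.
Lemma mapl_bdd : bdd mapl.
Proof. by apply: cmap_bdd; exact: tmap_lin. Qed.
Lemma maplE v b u : mapl (cin (v ⊗ b ⊗ u : rtens (V ⊗ Um) Uh)) = cin (f v ⊗ b ⊗ u : rtens (W ⊗ Um) Uh).
Proof. by rewrite /mapl cmapE ?tmapE //; exact: tmap_lin. Qed.
Lemma mapl_fil k Z : fil k Z -> fil k (mapl Z).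
Proof.
have tl : linear (tmap f (@id Um)) by exact: tmap_lin.
by have [_ h] := cmap_fshift Uh tl; move=> /h; rewrite addr0.
Qed.
Lemma lpair_mapl y Z : lpair y (mapl Z) = cmap_l f (lpair y Z).
Proof.
move: Z; apply: (@eq_ext3 F V Um Uh (C W) (@sC _)
  (fun Z => lpair y (mapl Z)) (fun Z => cmap_l f (lpair y Z))).
- by apply: (bdd_comp (@lpair_b _ _)); exact: mapl_bdd.
- by apply: (bdd_comp (cmap_bdd Uh fl)); exact: lpair_b.
by move=> v b u; rewrite maplE !lpairE cmapE.
Qed.
End MapLeft.

Let ip_lin : linear ip := @Usub_lin _ _ _ _.
Let im_lin : linear im := @Usub_lin _ _ _ _.

Let Sg_lin : linear (@Uantipode F g) := @Uant_lin F g.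

Definition Kip : C (U ⊗ Um) := mapl ip K.

Lemma psi_Kip : psi Kip = J.
Proof.
rewrite /Kip; move: K; apply: (@eq_ext3 F Up Um Uh (C (U ⊗ U)) (@sC _)
  (fun Z => psi (mapl ip Z)) J_ext).
- by apply: (bdd_comp (@psi_bdd _)); exact: mapl_bdd.
- exact: J_ext_bdd.
move=> a b u; rewrite maplE // J_extE; exact: psiE.
Qed.

(* S(b2) a_i (x) b_i b1 (x) l_i *)
Definition conjK (t : Um ⊗ Um) : C (U ⊗ Um) :=
  tlift (fun b1 b2 => cc Uh (Sm b2 ⊗ 1) * Kip * cc Uh (1 ⊗ b1)) t.
Let conjK_bil : bilinear_map (fun b1 b2 : Um => cc Uh (Sm b2 ⊗ 1) * Kip * cc Uh (1 ⊗ b1)).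
Proof.
split=> [b2|b1].
  by apply: lin_mull; apply: (lin_comp (@cc_lin F Uh _)); exact: tensr_lin.
apply: lin_mulr; apply: lin_mulr; apply: (lin_comp (@cc_lin F Uh _)).
by apply: lin_tensl; exact: Sm_lin.
Qed.
Lemma conjK_lin : linear conjK. Proof. exact: tlift_lin conjK_bil. Qed.
Lemma conjKE b1 b2 : conjK (b1 ⊗ b2) = cc Uh (Sm b2 ⊗ 1) * Kip * cc Uh (1 ⊗ b1).
Proof. exact: tliftE conjK_bil. Qed.
Lemma conjK_fil t : fil 0 (conjK t).
Proof.
elim/tens_ind: t => [b1 b2|c x y Ex Ey]; last first.
  by rewrite conjK_lin; apply: filD => //; exact: filZ.
rewrite conjKE -[0]addr0; apply: fil_mul; last exact: cc_fil.
rewrite -[0]addr0; apply: fil_mul; first exact: cc_fil.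
by apply: mapl_fil; [exact: ip_lin|exact: K_fil].
Qed.
Definition conjKc (b : Um) := conjK (Ucop b).
Lemma conjKc_lin : linear conjKc.
Proof. exact: lin_comp conjK_lin (@Ucop_lin F _). Qed.

Lemma psi_conjK t : psi (conjK t) = cc Uh (swapt Sm t) * J.
Proof.
move: t; apply: (@eq_tens_lin F Um Um _ (fun t => psi (conjK t)) (fun t => cc Uh (swapt Sm t) * J)).
- exact: (lin_comp (bdd_lin (@psi_bdd _)) conjK_lin).
- by apply: lin_mulr; apply: (lin_comp (@cc_lin F Uh _)); exact: (swapt_lin Sm_lin).
move=> b1 b2; rewrite conjKE (swaptE Sm_lin) -psi_Kip; exact: psi_cc.
Qed.
(** The factors S(b2) and b1 placed around K come out as S(b2) (x) S(b1), which is the coproduct of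
    S(b). *)
Lemma psi_conjKc b : psi (conjKc b) = cc Uh (Ucop (Sm b)) * J.
Proof.
rewrite /conjKc psi_conjK; congr (cc Uh _ * J).
rewrite /Sm -[in RHS]Usub_ant Ucop_ant -/(swapt _ _) Usub_cop swapt_map //.
by congr (swapt _ _); apply/funext => z; rewrite Usub_ant.
Qed.
(* S(z2) rho(z1 a) *)
Definition Theta (t : U ⊗ U) (a : U) : C U :=
  tlift (fun z1 z2 => cc Uh (Uantipode z2) * cmap_l ip (rho (z1 * a))) t.
Let cil : linear (cmap_l (Uh := Uh) ip) := bdd_lin (cmap_bdd Uh ip_lin).
Let cim : GRing.monoid_morphism (cmap_l (Uh := Uh) ip).
Proof. by apply: cmap_morph; [exact: ip_lin|case: (Usub_spec (@pol_pC F g))]. Qed.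
Let Th_bil a : bilinear_map (fun z1 z2 : U => cc Uh (Uantipode z2) * cmap_l ip (rho (z1 * a))).
Proof.
split=> z.
  apply: lin_mull; apply: (lin_comp cil); apply: (lin_comp rho_lin).
  exact: (lin_mulr (f := id)).
by apply: lin_mulr; apply: (lin_comp (@cc_lin F Uh _)).
Qed.
Lemma Theta_lin a : linear (Theta^~ a). Proof. exact: tlift_lin (Th_bil a). Qed.
Lemma ThetaE z1 z2 a : Theta (z1 ⊗ z2) a = cc Uh (Uantipode z2) * cmap_l ip (rho (z1 * a)).
Proof. exact: tliftE (Th_bil a). Qed.
Lemma Theta_linr t : linear (Theta t).
Proof.
apply: (tlift_linl (b := fun a (z1 z2 : U) => cc Uh (Uantipode z2) * cmap_l ip (rho (z1 * a)))) => //.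
move=> z1 z2; apply: lin_mull; apply: (lin_comp cil); apply: (lin_comp rho_lin).
exact: (lin_mull (f := id)).
Qed.

Lemma eq_Theta (f h : U ⊗ U -> C U) t : linear f -> linear h ->
  (forall z1 z2, f (z1 ⊗ z2) = h (z1 ⊗ z2)) -> f t = h t.
Proof. by move=> fl hl fh; apply: (@eq_tens_lin F U U _ f h). Qed.

Lemma ccNM (V : algType F) (x y : V) : cc Uh (- x * y) = - (cc Uh x * cc Uh y).
Proof. by rewrite mulNr (linN (@cc_lin F Uh V)) ccM. Qed.
Lemma ccMN (V : algType F) (x y : V) : cc Uh (x * - y) = - (cc Uh x * cc Uh y).
Proof. by rewrite mulrN (linN (@cc_lin F Uh V)) ccM. Qed.
Let aux1 (A : pzRingType) (s r x r' : A) : s * r + - (x * s) * r' = s * r - x * (s * r').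
Proof. by rewrite mulNr mulrA. Qed.
Let aux2 (A : pzRingType) (s r x : A) : s * (x * r) + - (s * x) * r = 0.
Proof. by rewrite mulNr mulrA subrr. Qed.

Lemma Theta_mulr t (x : g) a : Theta (t * (uinj x ⊗ 1 + 1 ⊗ uinj x)) a =
  Theta t (uinj x * a) - cc Uh (uinj x) * Theta t a.
Proof.
apply: (eq_Theta (f := fun t => Theta (t * (uinj x ⊗ 1 + 1 ⊗ uinj x)) a)
  (h := fun t => Theta t (uinj x * a) - cc Uh (uinj x) * Theta t a)).
- by apply: (lin_comp (@Theta_lin a)); exact: (lin_mulr (f := id)).
- by apply: lin_sub; [exact: Theta_lin|apply: lin_mull; exact: Theta_lin].
move=> z1 z2; rewrite mulrDr !tensM !mulr1 (linD (@Theta_lin a)) !ThetaE UantM Uant_inj.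
by rewrite ccNM -[z1 * _ * a]mulrA; exact: aux1.
Qed.
(** From z1 the letter x leaves [rho] on the left as x; from z2 it gives S(x z2) = - S(z2) x, ending
    at the same place with the opposite sign. *)
Lemma Theta_P t (x : Lie_p g) a :
  Theta ((uinj (vsval x) ⊗ 1 + 1 ⊗ uinj (vsval x)) * t) a = 0.
Proof.
apply: (eq_Theta (f := fun t => Theta ((uinj (vsval x) ⊗ 1 + 1 ⊗ uinj (vsval x)) * t) a)
  (h := fun=> 0)).
- by apply: (lin_comp (@Theta_lin a)); exact: (lin_mull (f := id)).
- by move=> k y z; rewrite scaler0 addr0.
move=> z1 z2; rewrite mulrDl !tensM !mul1r (linD (@Theta_lin a)) !ThetaE UantM Uant_inj.
have -> : rho (uinj (vsval x) * z1 * a) = cc Uh (uinj x) * rho (z1 * a).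
  by rewrite -rho_P Usub_inj mulrA.
by rewrite cim.2 cmap_cc // Usub_inj ccMN; exact: aux2.
Qed.
Lemma Theta_M t (x : Lie_m g) a : Theta t (a * uinj (vsval x)) = 0.
Proof.
apply: (eq_Theta (f := fun t => Theta t (a * uinj (vsval x))) (h := fun=> 0)).
- exact: Theta_lin.
- by move=> k y z; rewrite scaler0 addr0.
move=> z1 z2; rewrite ThetaE -Usub_inj mulrA rho_M Ucounit_inj scale0r.
by rewrite (lin0 cil) mulr0.
Qed.
Lemma Theta_L t l a : Theta t (a * il l) = Theta t a * cu U (iota l).
Proof.
apply: (eq_Theta (f := fun t => Theta t (a * il l)) (h := fun t => Theta t a * cu U (iota l))).
- exact: Theta_lin.
- by apply: lin_mulr; exact: Theta_lin.
move=> z1 z2; rewrite !ThetaE mulrA rho_lr cim.2 cmap_cu ?mulrA //.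
exact: Usub1.
Qed.

(** [Theta_mulr], read from right to left, moves one letter from the second argument partly into z
    and partly outside; iterated, it splits [a] by its coproduct. One decomposition [s] serves all
    [z] and [a']. *)
Lemma Theta_shuffle (a : Up) : exists s : seq (Up * Up), Ucop a = \sum_(p <- s) p.1 ⊗ p.2 /\
  forall z a', Theta (Ucop z) (ip a * a') =
    \sum_(p <- s) cc Uh (ip p.2) * Theta (Ucop (z * ip p.1)) a'.
Proof.
elim/uenv_ind: a => [x||c a b [s [Es Hs]] [s' [Es' Hs']]|a b [s [Es Hs]] [s' [Es' Hs']]].
- exists [:: (uinj x, 1); (1, uinj x)].
  split=> [|z a']; first by rewrite big_cons big_seq1 Ucop_inj.
  rewrite big_cons big_seq1 /= Usub1 cc1 mul1r mulr1 !Usub_inj UcopM Ucop_inj Theta_mulr.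
  by rewrite subrK.
- exists [:: (1, 1)]; split=> [|z a']; first by rewrite big_seq1 Ucop1 -tens1.
  by rewrite big_seq1 /= !Usub1 cc1 !mul1r mulr1.
- exists ([seq (c *: p.1, p.2) | p <- s] ++ s'); split=> [|z a'].
    rewrite big_cat big_map Ucop_lin Es Es' scaler_sumr; congr (_ + _).
    by apply: eq_bigr => p _; rewrite tensZl.
  rewrite big_cat big_map ip_lin mulrDl -scalerAl Theta_linr Hs Hs' scaler_sumr; congr (_ + _).
  apply: eq_bigr => p _ /=; rewrite scalerAr; congr (_ * _).
  rewrite (linZ ip_lin) -scalerAr (linZ (@Ucop_lin F _)).
  by rewrite (linZ (@Theta_lin a')).
exists [seq (p.1 * q.1, p.2 * q.2) | p <- s, q <- s']; split=> [|z a'].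
  rewrite UcopM Es Es' big_allpairs_dep mulr_suml; apply: eq_bigr => p _.
  by rewrite mulr_sumr; apply: eq_bigr => q _; rewrite tensM.
rewrite UsubM -mulrA Hs big_allpairs_dep; apply: eq_bigr => p _.
rewrite Hs' mulr_sumr; apply: eq_bigr => q _ /=.
by rewrite !UsubM ccM !mulrA.
Qed.

Definition Theta1 (z : U) : C U := Theta (Ucop z) 1.
Lemma Theta1_lin : linear Theta1.
Proof. exact: lin_comp (@Theta_lin 1) (@Ucop_lin F g). Qed.
Lemma Theta1_P a z : Theta1 (ip a * z) = Ucounit a *: Theta1 z.
Proof.
elim/uenv_ind: a z => [x||c a b Ea Eb|a b Ea Eb] z.
- by rewrite Usub_inj Ucounit_inj scale0r /Theta1 UcopM Ucop_inj Theta_P.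
- by rewrite Usub1 mul1r Ucounit1 scale1r.
- rewrite ip_lin mulrDl -scalerAl Theta1_lin Ea Eb (Ucounit_lin c a b) scalerDl scalerA.
  by [].
by rewrite UsubM -mulrA Ea Eb scalerA UcounitM.
Qed.
Lemma Theta1_M b z : Theta1 (z * im b) = cc Uh (Sm b) * Theta1 z.
Proof.
elim/uenv_ind: b z => [x||c a b Ea Eb|a b Ea Eb] z.
- rewrite Usub_inj Sm_inj /Theta1 UcopM Ucop_inj Theta_mulr mulr1.
  rewrite -[uinj (vsval x)]mul1r Theta_M mul1r sub0r.
  rewrite (linN (@cc_lin F Uh U)); exact/esym/mulNr.
- by rewrite Usub1 mulr1 Sm1 cc1 mul1r.
- rewrite im_lin mulrDr -scalerAr Theta1_lin Ea Eb Sm_lin (@cc_lin F Uh U c) mulrDl.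
  by rewrite -scalerAl.
by rewrite UsubM mulrA Eb Ea SmM ccM mulrA.
Qed.
Lemma Theta1_L l : Theta1 (il l) = sg' (iota l).
Proof.
(* Stated for arbitrary [z] and [w] so that a product is appended one factor at a time. *)
have h : forall z w, Theta1 z = sg' w -> Theta1 (z * il l) = sg' (w * iota l).
  elim/uenv_ind: l => [x||c a b Ea Eb|a b Ea Eb] z w zw.
  - rewrite Usub_inj (sg'_mulr) -zw /Theta1 UcopM Ucop_inj Theta_mulr mulr1.
    rewrite -[X in Theta _ X - _]mul1r -Usub_inj Theta_L.
    by rewrite Usub_inj.
  - by rewrite Usub1 iota_mor.1 !mulr1.
  - rewrite il_lin iota_lin !mulrDr -!scalerAr Theta1_lin sg'_lin.
    by rewrite (Ea _ _ zw) (Eb _ _ zw).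
  by rewrite UsubM iota_mor.2 !mulrA; apply: Eb; exact: Ea.
have q1 : Theta1 1 = sg' 1.
  have r1 : rho (1 * 1) = 1.
    by rewrite mulr1 -[X in rho X](Usub1 (@pol_pC F g)) rho_ip cc1.
  by rewrite (sg'_one) /Theta1 Ucop1 tens1 ThetaE Uant1 cc1 r1 cim.1 mulr1.
by have := h _ _ q1; rewrite !mul1r.
Qed.

(* b (x) u |-> S(b) S(u2) (x) u1 *)
Definition qt_fun (b : Um) (u : Uh) : C U := cc Uh (Sm b) * sg' u.
Lemma qt_bshift : bshift 0 qt_fun.
Proof.
split; first split.
- by move=> u; apply: lin_mulr; exact: (lin_comp (@cc_lin F Uh _) Sm_lin).
- by move=> b; apply: lin_mull; exact: sg'_lin.
move=> k b u ku; rewrite addr0 -[k]add0r; apply: fil_mul; first exact: cc_fil.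
exact: sg'_fil.
Qed.
Definition qt : C Um -> C U := @cext F (rtens Um Uh) (C U) (tlift qt_fun).
Lemma qt_bdd : bdd qt.
Proof. exact: (ext_bdd (@cC _) (@sC _) qt_bshift). Qed.
Lemma qtE b u : qt (cin (b ⊗ u : rtens Um Uh)) = cc Uh (Sm b) * sg' u.
Proof. exact: (extE (@sC _) _ _ qt_bshift). Qed.

(** S(z2) rho(z1) depends only on the class of z modulo u_+ U(g), which [uproj] represents; the
    comparison is made on products a l b. *)
Lemma Theta1_uproj z : Theta1 z = qt (uproj z).
Proof.
apply: (span_ind_lin (f := Theta1) (h := fun z => qt (uproj z))) (U_span z).
- exact: Theta1_lin.
- exact: (lin_comp (bdd_lin qt_bdd) uproj_lin).
move=> _ [a [l [b ->]]]; rewrite Theta1_M Theta1_P Theta1_L uproj_gen (linZ (bdd_lin qt_bdd)) qtE.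
by rewrite scalerAr.
Qed.

Lemma tw_sg' s m u : tw (fun z : U => z) (cc Uh s * sg' m) u = cc Uh s * sg' (u * m).
Proof.
by rewrite (sg'_mul); apply: tw_cc.
Qed.
Lemma tw_qt X u : tw (fun z : U => z) (qt X) u = qt (cu Um u * X).
Proof.
move: X; apply: (@eq_ext F Um Uh (C U) (@sC _) (fun X => tw (fun z : U => z) (qt X) u)
  (fun X => qt (cu Um u * X))).
- by apply: (bdd_comp (f := fun W => tw (fun z : U => z) W u)) qt_bdd; exact: tw_bdd.
- by apply: (bdd_comp qt_bdd); apply: bdd_mull; exact: bdd_id.
by move=> b m; rewrite /cu cinMt mul1r !qtE tw_sg'.
Qed.

(* a (x) b (x) u |-> a (x) S(b) S(u2) (x) u1 *)
Definition Phi_fun (a : Up) (b : Um) (u : Uh) : C (U ⊗ U) := cc Uh (ip a ⊗ 1) * embr U (cc Uh (Sm b) * sg' u).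
Lemma Phi_tshift : tshift 0 Phi_fun.
Proof.
have el := @embr_lin F Uh U U; split.
- move=> b u; apply: lin_mulr; apply: (lin_comp (@cc_lin F Uh _)).
  by apply: lin_tensl; exact: ip_lin.
- move=> a u; apply: lin_mull; apply: (lin_comp el); apply: lin_mulr.
  exact: (lin_comp (@cc_lin F Uh _) Sm_lin).
- by move=> a b; apply: lin_mull; apply: (lin_comp el); apply: lin_mull; exact: sg'_lin.
move=> k a b u ku; rewrite addr0 -[k]add0r; apply: fil_mul; first exact: cc_fil.
apply: embr_fil; rewrite -[k]add0r; apply: fil_mul; first exact: cc_fil.
exact: sg'_fil.
Qed.
Definition Phi : C (Up ⊗ Um) -> C (U ⊗ U) := @cext F TK (C (U ⊗ U)) (tlift3 Phi_fun).
Lemma Phi_bdd : bdd Phi.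
Proof. exact: (ext3_bdd (@cC _) (@sC _) Phi_tshift). Qed.
Lemma PhiE a b u : Phi (cin (a ⊗ b ⊗ u : TK)) = Phi_fun a b u.
Proof. exact: (ext3E (@sC _) _ _ _ Phi_tshift). Qed.
(** Stands for J^{1,2,34} before its last coproduct and antipode, which [chi] supplies. In this form
    it can enter elements whose left pairings are computable. *)
Definition J' := Phi K.

Lemma Phi_cc a Z : Phi (cc Uh (a ⊗ 1) * Z) = cc Uh (ip a ⊗ 1) * Phi Z.
Proof.
move: Z; apply: (@eq_ext3 F Up Um Uh (C (U ⊗ U)) (@sC _)
  (fun Z => Phi (cc Uh (a ⊗ 1) * Z)) (fun Z => cc Uh (ip a ⊗ 1) * Phi Z)).
- by apply: (bdd_comp Phi_bdd); apply: bdd_mull; exact: bdd_id.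
- by apply: bdd_mull; exact: Phi_bdd.
move=> a' b u; rewrite /cc cinMt tensM !mul1r !PhiE /Phi_fun UsubM mulrA -ccM.
by rewrite tensM mulr1.
Qed.
Lemma Phi_right a u X : Phi ((cin (a ⊗ 1 ⊗ u : TK) : C (Up ⊗ Um)) * right2 X) =
  cc Uh (ip a ⊗ 1) * embr U (qt (cu Um u * X)).
Proof.
move: X; apply: (@eq_ext F Um Uh (C (U ⊗ U)) (@sC _)
  (fun X => Phi ((cin (a ⊗ 1 ⊗ u : TK) : C (Up ⊗ Um)) * right2 X))
  (fun X => cc Uh (ip a ⊗ 1) * embr U (qt (cu Um u * X)))).
- by apply: (bdd_comp Phi_bdd); apply: bdd_mull; exact: right2_bdd.
- apply: bdd_mull; apply: (bdd_comp (@embr_bdd F Uh _ _)); apply: (bdd_comp qt_bdd).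
  by apply: bdd_mull; exact: bdd_id.
by move=> b m; rewrite right2E cinMt tensM mul1r mulr1 /cu cinMt mul1r PhiE qtE.
Qed.

Lemma chi_sg' u : chi (sg' u) = sg3 u.
Proof.
have bs := sg'_bshift.
rewrite [sg' u]/(onDr _ _) (onDr_map u (@cC _) (@sC _) (@cC _) (@sC _) (chi_bdd U) bs).
rewrite -(sg3_onDr).
by apply: eq_onDr => u1 u2; rewrite /sg'_fun (chiE).
Qed.
(** Both sides have the general term (a (x) S(b) (x) 1) (1 (x) sg3(u)), by [chi_sg'] and
    [delta_sg]. *)
Lemma chi_Phi Z : chi (Phi Z) = delta (J_ext Z).
Proof.
have dsg := delta_sg.
move: Z; apply: (@eq_ext3 F Up Um Uh (C (U ⊗ U ⊗ U)) (@sC _)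
  (fun Z => chi (Phi Z)) (fun Z => delta (J_ext Z))).
- by apply: (bdd_comp (chi_bdd _)); exact: Phi_bdd.
- by apply: (bdd_comp (delta_bdd _)).
move=> a b u; rewrite PhiE J_extE (chi_cc) (chi_embr).
rewrite (delta_embm) dsg (chi_cc) chi_sg' embmM embm_cc.
by rewrite mulrA -ccM tensM tensM !mulr1 mul1r.
Qed.

(* Delta(a) J' (x) b (x) l *)
Definition zl_fun (a : Up) (b : Um) (u : Uh) : C (U ⊗ U ⊗ Um) :=
  embl Um (cc Uh (Ucop (ip a)) * J') * cin (1 ⊗ b ⊗ u : rtens (U ⊗ U ⊗ Um) Uh).
Lemma zl_tshift : exists e, tshift e zl_fun.
Proof.
have [e he] := fil_exh J'; exists e; have cl := bdd_lin (bdd_cin (rtens (U ⊗ U ⊗ Um) Uh)); split.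
- move=> b u; apply: lin_mulr; apply: (lin_comp (@embl_lin F Uh _ _)); apply: lin_mulr.
  apply: (lin_comp (@cc_lin F Uh _)); exact: (lin_comp (@Ucop_lin F g) ip_lin).
- move=> a u; apply: lin_mull; apply: (lin_comp cl); apply: lin_tensl.
  exact: tensr_lin.
- by move=> a b; apply: lin_mull; apply: (lin_comp cl); exact: tensr_lin.
move=> k a b u ku; rewrite addrC; apply: fil_mul; last by apply/cfil_in; exact: tspan_gen.
by apply: embl_fil; rewrite -[e]add0r; apply: fil_mul; first exact: cc_fil.
Qed.
Definition ZL : C (Up ⊗ Um) -> C (U ⊗ U ⊗ Um) := @cext F TK (C (U ⊗ U ⊗ Um)) (tlift3 zl_fun).
Lemma ZL_bdd : bdd ZL.
Proof. by have [e he] := zl_tshift; exact: (ext3_bdd (@cC _) (@sC _) he). Qed.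
Lemma ZLE a b u : ZL (cin (a ⊗ b ⊗ u : TK)) = zl_fun a b u.
Proof. by have [e he] := zl_tshift; exact: (ext3E (@sC _) _ _ _ he). Qed.

Lemma cin_split (V W : algType F) (b : W) u :
  cin (1 ⊗ b ⊗ u : rtens (V ⊗ W) Uh) = cu (V ⊗ W)%type u * cc Uh (1 ⊗ b).
Proof. by rewrite cu_cc. Qed.

Lemma J_12_3_4_bdd : bdd (@J_12_3_4 F g Uh).
Proof. by apply: cmap_bdd; apply: tmap_lin => //; exact: Ucop_lin. Qed.

Lemma psi_ZL Z : psi (ZL Z) = J_12_3_4 (J_ext Z) * chi J'.
Proof.
move: Z; apply: (@eq_ext3 F Up Um Uh (C (U ⊗ U ⊗ U)) (@sC _)
  (fun Z => psi (ZL Z)) (fun Z => J_12_3_4 (J_ext Z) * chi J')).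
- by apply: (bdd_comp (psi_bdd _)); exact: ZL_bdd.
- by apply: bdd_mulr; apply: (bdd_comp J_12_3_4_bdd).
move=> a b u; rewrite ZLE J_extE /J_fun J_12_3_4E /zl_fun emblM embl_cc cin_split.
have -> (A : pzRingType) (x y z t : A) : x * y * (z * t) = x * (y * z) * t by rewrite !mulrA.
rewrite (psi_cc) (psi_embl) mulrA.
by [].
Qed.

(* a (x) S(b2) a_i S(u2) (x) b_i b1 (x) u1 l_i *)
Notation tww := (tw (fun z : U => z ⊗ (1 : Um))).
Definition zr_fun (a : Up) (b : Um) (u : Uh) : C (U ⊗ U ⊗ Um) :=
  cc Uh (ip a ⊗ 1 ⊗ 1) * embm U (tww (conjKc b) u).
Let ell := @tensl_lin F U Um 1.
Lemma zr_tshift : tshift 0 zr_fun.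
Proof.
have el := @embm_lin F Uh U U Um; split.
- move=> b u; apply: lin_mulr; apply: (lin_comp (@cc_lin F Uh _)); apply: lin_tensl.
  by apply: lin_tensl; exact: ip_lin.
- move=> a u; apply: lin_mull; apply: (lin_comp el).
  exact: (lin_comp (tw_lin ell u) conjKc_lin).
- move=> a b; apply: lin_mull; apply: (lin_comp el).
  exact: (tw_linu ell).
move=> k a b u ku; rewrite addr0 -[k]add0r; apply: fil_mul; first exact: cc_fil.
apply: embm_fil; rewrite -[k]addr0; apply: (tw_fil ell) => //.
exact: conjK_fil.
Qed.
Definition ZR : C (Up ⊗ Um) -> C (U ⊗ U ⊗ Um) := @cext F TK (C (U ⊗ U ⊗ Um)) (tlift3 zr_fun).
Lemma ZR_bdd : bdd ZR.
Proof. exact: (ext3_bdd (@cC _) (@sC _) zr_tshift). Qed.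
Lemma ZRE a b u : ZR (cin (a ⊗ b ⊗ u : TK)) = zr_fun a b u.
Proof. exact: (ext3E (@sC _) _ _ _ zr_tshift). Qed.

Lemma psi_ccl (V : algType F) (v : V) Z : psi (cc Uh (v ⊗ 1) * Z) = cc Uh (v ⊗ 1) * psi Z.
Proof.
have := psi_cc v 1 Z.
by rewrite -tens1 cc1 mulr1 -/(Sm _) Sm1.
Qed.

Lemma J_1_23_4_bdd : bdd (@J_1_23_4 F g Uh).
Proof.
apply: cmap_bdd; apply: tlift_lin; split=> [b|a]; first exact: alpha_linl.
exact: (lin_comp (@alpha_lin F U U U a) (@Ucop_lin F g)).
Qed.

(** The twist leaves sg3(u) to the right of J, whereas J^{1,23,4} has it to the left; [sg3_com]
    exchanges them. This is where invariance enters the cocycle identity. *)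
Lemma psi_ZR Z : psi (ZR Z) = J_1_23_4 (J_ext Z) * embm U J.
Proof.
have ptw := psi_tw U.
move: Z; apply: (@eq_ext3 F Up Um Uh (C (U ⊗ U ⊗ U)) (@sC _)
  (fun Z => psi (ZR Z)) (fun Z => J_1_23_4 (J_ext Z) * embm U J)).
- by apply: (bdd_comp (psi_bdd _)); exact: ZR_bdd.
- by apply: bdd_mulr; apply: (bdd_comp J_1_23_4_bdd).
move=> a b u; rewrite ZRE J_extE /J_fun J_1_23_4E /zr_fun psi_ccl (psi_embm) ptw psi_conjKc.
rewrite -/(sg3 _) -[RHS]mulrA -embmM sg3_com -mulrA embmM mulrA; congr (_ * _).
rewrite /cc embm_t cinMt mul1r; congr (cin (_ ⊗ _ : rtens _ Uh)).
by rewrite -alphaE -tens1 alphaM mulr1 mul1r.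
Qed.

(** Pairing b_i b1 with a evaluates K to rho(b1 a), and S(b2) stays in front. *)
Lemma lpair_conjKc b a : lpair (ip a) (conjKc b) = Theta (Ucop (im b)) (ip a).
Proof.
rewrite Usub_cop /conjKc; move: (Ucop b); apply: (@eq_tens_lin F Um Um _
  (fun t => lpair (ip a) (conjK t)) (fun t => Theta (tmap im im t) (ip a))).
- exact: (lin_comp (bdd_lin (lpair_b _ _)) conjK_lin).
- by apply: (lin_comp (@Theta_lin (ip a))); exact: tmap_lin.
move=> b1 b2; rewrite conjKE tmapE // ThetaE lpair_ccb -embl_cc lpair_embl lpair_mapl //.
by rewrite Usub_ant.
Qed.

Lemma lpair_tww y W u : lpair y (tww W u) = tw (fun z : U => z) (lpair y W) u.
Proof.
have [e /(tw_bshift ell) h] := fil_exh W.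
rewrite [tww W u]/(onDr _ _) (onDr_map u (@cC _) (@sC _) (@cC _) (@sC _) (lpair_b _ y) h).
by apply: eq_onDr => u1 u2; rewrite /tw_fun lpair_ccr -(@embl_cu F Uh U Um) lpair_embl.
Qed.

Definition shift (a : Up) : C (Up ⊗ Um) -> C (Up ⊗ Um) :=
  @cext F TK (C (Up ⊗ Um)) (tlift3 (shift_fun a)).
Let shift_bdd a : bdd (shift a).
Proof. by have [e he] := shift_tshift a; exact: (ext3_bdd (@cC _) (@sC _) he). Qed.
Let shiftE a a' b u : shift a (cin (a' ⊗ b ⊗ u : TK)) = shift_fun a a' b u.
Proof. by have [e he] := shift_tshift a; exact: (ext3E (@sC _) _ _ _ he). Qed.

(** [Theta_shuffle] splits a into a1 and a2; [Theta1_uproj] then replaces b a1 by its class modulo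
    u_+ U(g), the substitution performed by [shift]. *)
Lemma lpair_ZR_terms a : exists s : seq (Up * Up), Ucop a = \sum_(p <- s) p.1 ⊗ p.2 /\
  forall Z, lpair (ip a) (ZR Z) = \sum_(p <- s) cc Uh (1 ⊗ ip p.2) * Phi (shift p.1 Z).
Proof.
have [s [Es Hs]] := Theta_shuffle a; exists s; split=> //.
apply: (@eq_ext3 F Up Um Uh (C (U ⊗ U)) (@sC _) (fun Z => lpair (ip a) (ZR Z))
  (fun Z => \sum_(p <- s) cc Uh (1 ⊗ ip p.2) * Phi (shift p.1 Z))).
- by apply: (bdd_comp (lpair_b _ _)); exact: ZR_bdd.
- apply: bdd_sum => p; apply: bdd_mull; apply: (bdd_comp Phi_bdd); exact: shift_bdd.
move=> a' b u; rewrite ZRE /zr_fun -embl_cc lpair_embl lpair_embm lpair_tww lpair_conjKc.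
rewrite -[ip a]mulr1 Hs (lin_sum (tw_lin (fun c x y => erefl) u)).
rewrite (lin_sum (@embr_lin F Uh U U)) mulr_sumr; apply: eq_bigr => p _.
rewrite -/(Theta1 _) Theta1_uproj tw_cc // tw_qt shiftE /shift_fun Phi_right embrM embr_cc.
by rewrite !mulrA -!ccM !tensM !mul1r !mulr1.
Qed.

(** By [K_shift] each term contributes a1 on the first leg and a2 on the second; together they form
    the coproduct of a in front of [J']. *)
Lemma lpair_ZR a : lpair (ip a) (ZR K) = cc Uh (Ucop (ip a)) * J'.
Proof.
have [s [Es ->]] := lpair_ZR_terms a.
have tl := tmap_lin ip_lin ip_lin.
rewrite Usub_cop Es (lin_sum tl) (lin_sum (@cc_lin F Uh _)) mulr_suml.
apply: eq_bigr => p _; rewrite /shift K_shift Phi_cc tmapE // mulrA -ccM tensM mulr1 mul1r.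
by [].
Qed.

Definition zl_map : C Up -> C (U ⊗ U) :=
  @cext F (rtens Up Uh) (C (U ⊗ U)) (tlift (fun a w => cc Uh (Ucop (ip a)) * J' * cu _ w)).
Let zl_bshift : exists e, bshift e (fun a w => cc Uh (Ucop (ip a)) * J' * cu (U ⊗ U)%type w).
Proof.
have [e he] := fil_exh J'; exists e; split; first split.
- move=> w; apply: lin_mulr; apply: lin_mulr; apply: (lin_comp (@cc_lin F Uh _)).
  exact: (lin_comp (@Ucop_lin F g) ip_lin).
- by move=> a; apply: lin_mull; exact: cu_lin.
move=> k a w kw; rewrite addrC; apply: fil_mul; last exact: cu_fil.
by rewrite -[e]add0r; apply: fil_mul; first exact: cc_fil.
Qed.

Lemma zl_mapE a w : zl_map (cin (a ⊗ w : rtens Up Uh)) = cc Uh (Ucop (ip a)) * J' * cu _ w.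
Proof. by have [e he] := zl_bshift; exact: (extE (@sC _) _ _ he). Qed.

(** The pairing leaves the outer factor untouched and turns K into rho(a), which is a (x) 1. *)
Lemma lpair_ZL a : lpair (ip a) (ZL K) = cc Uh (Ucop (ip a)) * J'.
Proof.
have [e he] := zl_bshift.
have -> : lpair (ip a) (ZL K) = zl_map (rho (ip a)).
  rewrite [rho _]/(lpair _ _); move: K; apply: (@eq_ext3 F Up Um Uh (C (U ⊗ U)) (@sC _)
    (fun Z => lpair (ip a) (ZL Z)) (fun Z => zl_map (lpair (ip a) Z))).
  - by apply: (bdd_comp (lpair_b _ _)); exact: ZL_bdd.
  - by apply: (bdd_comp (ext_bdd (@cC _) (@sC _) he)); exact: lpair_b.
  move=> a' b u; rewrite ZLE /zl_fun lpair_embl !lpairE.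
  by rewrite zl_mapE.
by rewrite rho_ip [cc Uh a]/(cin _) zl_mapE cu1 mulr1.
Qed.

Lemma ZL_ZR : ZL K = ZR K.
Proof. by apply: lpair_ext => a; rewrite lpair_ZL lpair_ZR. Qed.

Lemma cocycle : J_12_3_4 J * J_1_2_34 Dl J = J_1_23_4 J * J_2_3_4 J.
Proof.
have e1 := J_1_2_34_delta J.
have e2 : delta J = chi J' := esym (chi_Phi K).
have e3 := psi_ZL K.
have e4 := psi_ZR K.
rewrite ZL_ZR in e3.
rewrite e4 in e3.
rewrite e1.
rewrite e2.
rewrite J_2_3_4E.
exact: esym e3.
Qed.

(** * The term of degree -1 of J *)

Let m j k : Uh := mpair (ys j) (xs k).
Let mjk_fil j k : fil 1 (m j k). Proof. by apply: iota_fil; exact: ufil_inj. Qed.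
(** The defect of the rule that the antipode acts by -1 in degree -1; the aim is to show that it has
    degree -2. *)
Let G i j : C U := sg (n i j) + cu U (n i j).
Let nU_fil i j : fil (-1) (cu U (n i j)). Proof. exact: cu_fil. Qed.
Let G_fil i j : fil (-1) (G i j).
Proof. by apply: filD => //; exact: sg_fil. Qed.
Let cul : linear (@cu F Uh U) := @cu_lin F Uh U.

(** On the generators m, [sg] is minus the identity up to a constant. Since it reverses products,
    the sum of m sg(n) is therefore minus the sum of m n modulo degree -1. *)
Let mG i k : fil (-1) (\sum_j cu U (m j k) * G i j).
Proof.
have e1 : fil (-1) (\sum_j cu U (m j k) * cu U (n i j) - (i == k)%:R).
  have -> : \sum_j cu U (m j k) * cu U (n i j) - (i == k)%:R =
      cu U (\sum_j n i j * m j k - (i == k)%:R) + \sum_j cu U (m j k * n i j - n i j * m j k).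
    rewrite (linB cul) (lin_sum cul) (linMn cul) cu1 addrAC -big_split; congr (_ - _).
    by apply: eq_bigr => j _ /=; rewrite (linB cul) addrC subrK cuM.
  apply: filD; first exact: cu_fil (nm i k).
  by apply: fil_sum => j _; apply: cu_fil; have := Uh_comm (mjk_fil j k) (n_fil i j).
have e2 : fil (-1) (\sum_j cu U (m j k) * sg (n i j) + (i == k)%:R).
  have h : fil (-1) (\sum_j sg (m j k) * sg (n i j) - (i == k)%:R).
    have := sg_fil (nm i k); rewrite (linB sg_lin) (lin_sum sg_lin) (linMn sg_lin) sg_anti.1.
    by congr (fil _ (_ - _)); apply: eq_bigr => j _; rewrite sg_anti.2.
  rewrite -[X in fil _ X]opprK opprD -sumrN.
  have -> : \sum_j - (cu U (m j k) * sg (n i j)) - (i == k)%:R =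
     (\sum_j sg (m j k) * sg (n i j) - (i == k)%:R) +
     \sum_j cc Uh (uinj (vsval (proj_l ⁅vsval (ys j), vsval (xs k)⁆))) * sg (n i j).
    rewrite addrAC -big_split; congr (_ - _); apply: eq_bigr => j _ /=.
    have -> : m j k = iota (uinj (proj_l ⁅vsval (ys j), vsval (xs k)⁆)) by [].
    rewrite sg_inj -mulrDl -mulNr; congr (_ * _).
    by rewrite opprD addrAC addNr add0r.
  apply: filN; apply: filD => //; apply: fil_sum => j _; rewrite -[-1]add0r.
  by apply: fil_mul; [exact: cc_fil|exact: sg_fil].
have := filD e1 e2; rewrite addrACA addNr addr0 -big_split.
by congr (fil _ _); apply: eq_bigr => j _ /=; rewrite /G mulrDr addrC.
Qed.

(** Multiplication of [mG] by n on the left removes m; the defect of n m from the identity has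
    degree -1, as has G. *)
Let G_fil2 i l : fil (-2) (G i l).
Proof.
have h : fil (-2) (\sum_k cu U (n k l) * \sum_j cu U (m j k) * G i j).
  by apply: fil_sum => k _; apply: (fil_mul (nU_fil k l) (mG i k)).
have e j : fil (-1) (\sum_k n k l * m j k - (j == l)%:R).
  have -> : \sum_k n k l * m j k - (j == l)%:R =
      (\sum_k m j k * n k l - (j == l)%:R) + \sum_k (n k l * m j k - m j k * n k l).
    rewrite addrAC -big_split; congr (_ - _).
    by apply: eq_bigr => k _; rewrite /= addrC subrK.
  apply: filD; first exact: mn; apply: fil_sum => k _.
  by have := Uh_comm (n_fil k l) (mjk_fil j k).
have h2 : fil (-2) (\sum_j cu U (\sum_k n k l * m j k - (j == l)%:R) * G i j).
  by apply: fil_sum => j _; apply: (fil_mul (cu_fil _ (e j)) (G_fil i j)).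
have := filB h h2; congr (fil _ _).
under eq_bigr => k _ do rewrite mulr_sumr.
rewrite exchange_big /= -sumrB.
have T j : \sum_k cu U (n k l) * (cu U (m j k) * G i j) = cu U (\sum_k n k l * m j k) * G i j.
  by rewrite (lin_sum cul) mulr_suml; apply: eq_bigr => k _; rewrite cuM mulrA.
have T' j : \sum_k cu U (n k l) * (cu U (m j k) * G i j) -
    cu U (\sum_k n k l * m j k - (j == l)%:R) * G i j = G i j *+ (j == l).
  by rewrite T (linB cul) (linMn cul) cu1 mulrBl opprB addrC subrK mulr_natl.
under eq_bigr => j _ do rewrite T'.
rewrite (bigD1 l) //= eqxx big1 ?addr0 // => j jl.
by rewrite (negPf jl) mulr0n.
Qed.

(** Two signs cancel: S(y_j) = - y_j, and sg(n_ij) is - n_ij modulo degree -2. *)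
Lemma J_top : fil (-2) (J - 1 - cin (\sum_i \sum_j
  (uinj (vsval (xs i)) ⊗ uinj (vsval (ys j))) ⊗ n i j : rtens (U ⊗ U) Uh) : C (U ⊗ U)).
Proof.
have Kt : fil (-2) (K - 1 - \sum_i \sum_j cin (uinj (xs i) ⊗ uinj (ys j) ⊗ n i j : TK) : C (Up ⊗ Um)).
  exact: K_top.
have Jl := bdd_lin J_ext_bdd.
have J1 : J_ext 1 = 1.
  rewrite cin1 rtens1 [X in X ⊗ _]tens1 J_extE /J_fun Usub1 -/(Sm _) Sm1 -tens1 cc1 mul1r.
  by rewrite sg_anti.1 embr1.
have := J_ext_fil Kt; rewrite (linB Jl) (linB Jl) J1 (lin_sum Jl) => h.
set S := (X in J - 1 - X); apply: (fil_tr h).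
rewrite /S (lin_sum (bdd_lin (bdd_cin _))) -sumrB; apply: fil_sum => i _.
rewrite (lin_sum Jl) (lin_sum (bdd_lin (bdd_cin _))) -sumrB; apply: fil_sum => j _.
rewrite J_extE /J_fun Usub_inj -/(Sm _) Sm_inj.
set t := uinj _; set t' := uinj _.
have -> : cin (t ⊗ t' ⊗ n i j : rtens (U ⊗ U) Uh) = cc Uh (t ⊗ t') * embr U (cu U (n i j)).
  by rewrite embr_cu cc_cu.
rewrite (linN (@tensr_lin F U U t)) (linN (@cc_lin F Uh _)) mulNr -opprD -mulrDr.
rewrite -(linD (@embr_lin F Uh U U)); apply: filN; rewrite -[-2]add0r.
by apply: fil_mul; [exact: cc_fil|apply: embr_fil; exact: G_fil2].
Qed.

End Quantization.

(** * Points off a hypersurface and the dimension of u_- *)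

Lemma digits_inj (N n : nat) (a b : 'I_n -> nat) :
  (forall i, a i < N)%N -> (forall i, b i < N)%N ->
  (\sum_(i < n) a i * N ^ i)%N = (\sum_(i < n) b i * N ^ i)%N -> a =1 b.
Proof.
elim: n a b => [|n IHn] a b aN bN E i; first by case: i.
have S c : (\sum_(i < n.+1) c i * N ^ i = c ord0 + (\sum_(i < n) c (lift ord0 i) * N ^ i) * N)%N.
  rewrite big_ord_recl /= muln1 big_distrl /=; congr addn; apply: eq_bigr => j _.
  by rewrite /bump /= add1n expnSr mulnA.
move: E; rewrite !S => E.
have N0 : (0 < N)%N by exact: leq_ltn_trans (aN ord0).
have E0 : a ord0 = b ord0.
  by have := congr1 (modn^~ N) E; rewrite !(addnC _ (_ * N)) !modnMDl !modn_small.
have E1 : (\sum_(i < n) a (lift ord0 i) * N ^ i = \sum_(i < n) b (lift ord0 i) * N ^ i)%N.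
  by move/eqP: E; rewrite E0 eqn_add2l eqn_pmul2r // => /eqP.
case: (unliftP ord0 i) => [i' ->|->] //.
by apply: (IHn (fun i => a (lift ord0 i)) (fun i => b (lift ord0 i))).
Qed.

(** In characteristic 0 the integers 0, ..., size p - 1 are distinct, more than a nonzero polynomial
    has roots. *)
Lemma nonroot (F : fieldType) (p : {poly F}) : (forall k, k.+1%:R != 0 :> F) -> p != 0 ->
  exists t, ~~ root p t.
Proof.
move=> char0 p0; apply: contrapT => nr.
have all_root t : root p t by apply: contraT => h; case: nr; exists t.
have inj m k : (m < k)%N -> m%:R != k%:R :> F.
  move=> mk; rewrite eq_sym -subr_eq0 -natrB ?(ltnW mk) //.
  by rewrite -(prednK (n := k - m)) ?subn_gt0.
have u : uniq [seq k%:R : F | k <- iota 0 (size p)].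
  rewrite map_inj_uniq ?iota_uniq // => m k E.
  by case: (ltngtP m k) => // /inj; rewrite E eqxx.
have := max_poly_roots p0 _ u; rewrite size_map size_iota ltnn => h.
by have/h : all (root p) [seq k%:R : F | k <- iota 0 (size p)] by apply/allP.
Qed.

(* Kronecker substitution X_i := t ^ (N ^ i). *)
Lemma mpoly_point (F : fieldType) n (P : {mpoly F[n]}) : (forall k, k.+1%:R != 0 :> F) ->
  P != 0 -> exists v, P.@[v] != 0.
Proof.
move=> char0 P0; pose N := (\sum_(m <- msupp P) mdeg m).+1.
have mN (m : 'X_{1..n}) i : m \in msupp P -> (m i < N)%N.
  move=> mP; rewrite ltnS; apply: (@leq_trans (mdeg m)).
    by rewrite mdegE (bigD1 i) //= leq_addr.
  by rewrite (big_rem m mP) /= leq_addr.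
pose k (m : 'X_{1..n}) := (\sum_(i < n) m i * N ^ i)%N.
pose q : {poly F} := \sum_(m <- msupp P) P@_m *: 'X^(k m).
have qE t : q.[t] = P.@[fun i => t ^+ (N ^ i)].
  rewrite mevalE /q horner_sum; apply: eq_bigr => m _.
  rewrite hornerZ hornerXn; congr (_ * _); rewrite /k.
  rewrite expr_sum; apply: eq_bigr => i _.
  by rewrite -exprM mulnC.
have q0 : q != 0.
  have [m mP] : exists m, m \in msupp P.
    move: P0; rewrite -msupp_eq0; case: (msupp P) => // m s _.
    by exists m; rewrite mem_head.
  apply/eqP => /(congr1 (fun p : {poly F} => p`_(k m))).
  rewrite coef0 /q coef_sum (big_rem m mP) /= coefZ coefXn eqxx mulr1 big_seq big1 ?addr0.
    by move/eqP; rewrite mcoeff_eq0 mP.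
  move=> m'; rewrite mem_rem_uniq ?msupp_uniq // inE => /andP[mm' mP'].
  rewrite coefZ coefXn; case: eqP => [E|]; last by rewrite mulr0.
  case/eqP: mm'; apply/mnmP => i; apply/esym.
  by apply: (@digits_inj N n m m' _ _ E) => j; exact: mN.
have [t tq] := nonroot char0 q0; exists (fun i => t ^+ (N ^ i)).
by rewrite -qE.
Qed.

Section Form.
Variables (F : fieldType) (g : polarLie F).

Lemma sym_inj_lin : linear (@sym_inj F g).
Proof.
move=> a x y; rewrite /sym_inj scaler_sumr -big_split; apply: eq_bigr => i _.
by rewrite [vsval _]linearP linearP /= scalerDl scalerA.
Qed.

Definition sbr (x y : g) : {mpoly F[dim_l g]} := sym_inj (proj_l ⁅x, y⁆).
Lemma sbr_linl y : linear (sbr^~ y).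
Proof. by move=> a x x'; rewrite /sbr lie_linl proj_l_lin sym_inj_lin. Qed.
Lemma sbr_linr x : linear (sbr x).
Proof. by move=> a y y'; rewrite /sbr lie_linr proj_l_lin sym_inj_lin. Qed.
Lemma sbr_anti x y : sbr x y = - sbr y x.
Proof.
rewrite /sbr [in LHS]lie_anti (linN (@proj_l_lin F g)).
exact: linN sym_inj_lin _.
Qed.
Lemma sbr_pp x y : x \in pol_p g -> y \in pol_p g -> sbr x y = 0.
Proof.
move=> xp yp; rewrite /sbr proj_l_u ?(lin0 sym_inj_lin) //.
by apply: pol_p_u; exact: pol_pC.
Qed.
Lemma sbr_mm x y : x \in pol_m g -> y \in pol_m g -> sbr x y = 0.
Proof.
move=> xp yp; rewrite /sbr proj_l_u ?(lin0 sym_inj_lin) //.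
by apply: pol_m_u; exact: pol_mC.
Qed.
Lemma sym_inj_homog (x : Lie_l g) : sym_inj x \is 1.-homog.
Proof.
by apply: rpred_sum => i _; apply: rpredZ; rewrite dhomogX /= mdeg1.
Qed.

(** If u_- were smaller, some column of the matrix would use an index past the end of its basis,
    where the default value 0 is returned. *)
Lemma dprime_le_dim_m : D0' g != 0 -> (dprime g <= \dim (pol_m g))%N.
Proof.
apply: contraNT; rewrite -ltnNge => h; apply/eqP.
rewrite /D0' (expand_det_col _ (Ordinal h)) big1 // => i _.
rewrite mxE [(vbasis (pol_m g))`__]nth_default ?size_tuple //=.
by rewrite [sym_inj _](lin0 (@sbr_linr (vbasis (pol_p g))`_i)) mul0r.
Qed.

Definition evl (v : 'I_(dim_l g) -> F) (x : Lie_l g) : F^o :=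
  \sum_i coord (vbasis (pol_l g)) i (vsval x) * v i.
Lemma evl_lin v : linear (evl v).
Proof.
move=> a x y; rewrite /evl scaler_sumr -big_split; apply: eq_bigr => i _.
by rewrite [vsval _]linearP linearP /= mulrDl -mulrA.
Qed.
Lemma evl_basis v i : evl v (basis_l i) = v i.
Proof.
have fr := basis_free (vbasisP (pol_l g)).
rewrite /evl (bigD1 i) //= big1 => [|j ji]; rewrite /basis_l vsprojK ?vbasis_mem ?mem_nth ?size_tuple //.
  by rewrite coord_free // eqxx mul1r addr0.
by rewrite coord_free // eq_sym (negPf ji) mul0r.
Qed.

(** Otherwise the rectangular matrix of the form at a generic point has a kernel: a nonzero element
    of u_- orthogonal to u_+, and to u_- as well because u_- is a subalgebra. *)
Lemma dim_m_le_dprime : (forall k, k.+1%:R != 0 :> F) -> nondegenerate_pol g ->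
  (\dim (pol_m g) <= dprime g)%N.
Proof.
move=> char0 [P [P0 nd]]; have [v Pv] := mpoly_point char0 P0.
pose flin := GRing.isLinear.Build F (Lie_l g) F^o *%R (evl v) (evl_lin v).
pose lam := HB.pack_for {linear Lie_l g -> F^o} (evl v) flin.
have lamP : P.@[fun i => lam (basis_l i)] != 0.
  by rewrite (_ : (fun i => lam (basis_l i)) = v) //; apply/funext => i; exact: evl_basis.
pose B : 'M[F]_(\dim (pol_m g), dprime g) := \matrix_(j, i)
  (lam (proj_l ⁅(vbasis (pol_m g))`_j, (vbasis (pol_p g))`_i⁆) : F).
rewrite leqNgt; apply/negP => h.
have : kermx B != 0.
  rewrite kermx_eq0 /row_free; apply: contraTN h => /eqP <-; rewrite -leqNgt.
  exact: rank_leq_col.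
case/rowV0Pn => c /sub_kermxP cB /eqP; apply.
pose y := \sum_j c 0 j *: (vbasis (pol_m g))`_j.
have ym : y \in pol_m g.
  by apply: rpred_sum => j _; apply: rpredZ; rewrite vbasis_mem ?mem_nth ?size_tuple.
have ll (z : g) : linear (fun y => lam (proj_l ⁅z, y⁆) : F^o).
  by move=> a u u'; rewrite lie_linr proj_l_lin linearP.
have ll' (z : g) : linear (fun y => lam (proj_l ⁅y, z⁆) : F^o).
  by move=> a u u'; rewrite lie_linl proj_l_lin linearP.
have y0 : y = 0.
  apply: (nd lam lamP); first exact: pol_m_u.
  move=> _ /memv_addP[p pp [m mm ->]]; rewrite (linD (ll y)) [X in _ + X](_ : _ = 0) ?addr0; last first.
    by rewrite proj_l_u ?linear0 //; apply: pol_m_u; exact: pol_mC.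
  rewrite (coord_vbasis pp) (lin_sum (ll y)) big1 // => i _; rewrite (linZ (ll y)) /y.
  rewrite (lin_sum (ll' _)) (_ : \sum_(j < _) _ = (c *m B) 0 i); first by rewrite cB mxE scaler0.
  by rewrite mxE; apply: eq_bigr => j _; rewrite (linZ (ll' _)) mxE.
have /freeP fr := basis_free (vbasisP (pol_m g)).
by apply/rowP => j; rewrite mxE; apply: (fr (fun j => c 0 j)).
Qed.

End Form.

(** * The inverse of omega in terms of bases of u_+ and u_- *)

Section RMatrix.
Variables (F : fieldType) (g : polarLie F).
Hypotheses (D0_neq0 : D0' g != 0) (dimm : \dim (pol_m g) = dprime g).
Notation d := (dprime g).
Notation Fr := (Frac g).
Notation tf := (@to_frac F g).

Definition xb (i : 'I_d) : g := (vbasis (pol_p g))`_i.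
Definition yb (j : 'I_d) : g := (vbasis (pol_m g))`_j.
Lemma xb_mem i : xb i \in pol_p g.
Proof. by rewrite vbasis_mem ?mem_nth ?size_tuple. Qed.
Lemma yb_mem j : yb j \in pol_m g.
Proof. by rewrite vbasis_mem ?mem_nth ?size_tuple // dimm. Qed.
Lemma xb_span x : x \in pol_p g -> exists c : 'I_d -> F, x = \sum_i c i *: xb i.
Proof. by move=> xp; exists (fun i => coord (vbasis (pol_p g)) i x); exact: coord_vbasis. Qed.
Lemma yb_span y : y \in pol_m g -> exists c : 'I_d -> F, y = \sum_i c i *: yb i.
Proof.
move=> ym; exists (fun i => coord (vbasis (pol_m g)) (cast_ord (esym dimm) i) y).
rewrite {1}(coord_vbasis ym) (reindex (cast_ord (esym dimm))) //=.
by apply: onW_bij; exists (cast_ord dimm) => k; exact: val_inj.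
Qed.
Definition xs i : Lie_p g := vsproj (pol_p g) (xb i).
Definition ys j : Lie_m g := vsproj (pol_m g) (yb j).
Lemma xsE i : vsval (xs i) = xb i. Proof. by rewrite vsprojK ?xb_mem. Qed.
Lemma ysE j : vsval (ys j) = yb j. Proof. by rewrite vsprojK ?yb_mem. Qed.
Lemma xs_span x : exists c : 'I_d -> F, x = \sum_i c i *: xs i.
Proof.
have [c E] := xb_span (subvsP x); exists c; apply: val_inj; rewrite /= E linear_sum.
by apply: eq_bigr => i _; rewrite linearZ /= xsE.
Qed.
Lemma ys_span y : exists c : 'I_d -> F, y = \sum_i c i *: ys i.
Proof.
have [c E] := yb_span (subvsP y); exists c; apply: val_inj; rewrite /= E linear_sum.
by apply: eq_bigr => i _; rewrite linearZ /= ysE.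
Qed.

Definition Amx : 'M[{mpoly F[dim_l g]}]_d := \matrix_(i, j) sbr (xb i) (yb j).
Definition Bmx : 'M[Fr]_d := map_mx tf Amx.
(** The inverse of [Mmx], the matrix of the brackets [y_j, x_i]; the sign reflects [y, x] = -
    [x, y], the transpose the exchange of rows and columns. *)
Definition Nmx : 'M[Fr]_d := - (invmx Bmx)^T.
Definition Mmx : 'M[Fr]_d := \matrix_(j, i) tf (sbr (yb j) (xb i)).

Lemma tf_lin : linear tf.
Proof. by move=> a p q; rewrite /to_frac rmorphD -mul_mpolyC rmorphM. Qed.
Lemma tfM p q : tf (p * q) = tf p * tf q. Proof. exact: rmorphM. Qed.
Lemma tf_neq0 p : p != 0 -> tf p != 0.
Proof. by rewrite /to_frac tofrac_eq0. Qed.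

Lemma detB : \det Bmx = tf (D0' g).
Proof. exact: det_map_mx. Qed.
Lemma B_unit : Bmx \in unitmx.
Proof. by rewrite unitmxE detB unitfE tf_neq0. Qed.
Lemma MmxE : Mmx = - Bmx^T.
Proof.
by apply/matrixP => j i; rewrite !mxE sbr_anti (linN tf_lin).
Qed.
Lemma NM : Nmx *m Mmx = 1%:M.
Proof. by rewrite MmxE mulNmx mulmxN opprK -trmx_mul mulmxV ?B_unit // trmx1. Qed.
Lemma MN : Mmx *m Nmx = 1%:M.
Proof. by rewrite MmxE mulNmx mulmxN opprK -trmx_mul mulVmx ?B_unit // trmx1. Qed.

Lemma NM_sum i k : \sum_j Nmx i j * Mmx j k = (i == k)%:R.
Proof. by have := congr1 (fun A : 'M_d => A i k) NM; rewrite [(_ *m _) i k]mxE [1%:M _ _]mxE. Qed.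
Lemma MN_sum i k : \sum_j Mmx i j * Nmx j k = (i == k)%:R.
Proof. by have := congr1 (fun A : 'M_d => A i k) MN; rewrite [(_ *m _) i k]mxE [1%:M _ _]mxE. Qed.
Lemma Mmx_br j k : Mmx j k = tf (sym_inj (proj_l ⁅vsval (ys j), vsval (xs k)⁆)).
Proof. by rewrite [LHS]mxE ysE xsE. Qed.

Lemma det_homog m (A : 'M[{mpoly F[dim_l g]}]_m) :
  (forall i j, A i j \is 1.-homog) -> \det A \is m.-homog.
Proof.
move=> hA; apply: rpred_sum => s _; rewrite rpredMsign.
have : \prod_(i < m) A i (s i) \is (\sum_(i < m) 1)%N.-homog.
  elim/big_rec2: _ => [|i e p _ hp]; first exact: dhomog1.
  exact: dhomogM.
by rewrite sum1_card card_ord.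
Qed.

(** Cramer's rule: cofactors are homogeneous of degree d' - 1, and the determinant is D0', of degree
    d'. *)
Lemma N_Sloc i j : Sloc (-1) (Nmx i j).
Proof.
have d0 : (0 < d)%N by exact: leq_ltn_trans (ltn_ord i).
exists 1%N, d.-1, (- cofactor Amx i j); split.
- by clear dimm; lia.
- rewrite rpredN rpredMsign; apply: det_homog => k l.
  by rewrite !mxE; exact: sym_inj_homog.
rewrite !mxE /invmx B_unit !mxE detB expr1 mulrC -mulNr.
rewrite (linN tf_lin); congr (- _ / _).
exact: (cofactor_map_mx (@tofrac _)).
Qed.

Notation E k := ((vbasis (pol_u g))`_k).
Definition cst (c : F) : Fr := tf c%:MP.
Lemma frac_scaleE c (f : Fr) : c *: f = cst c * f. Proof. by []. Qed.
Lemma cst_lin : linear (cst : F^o -> Fr).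
Proof.
by move=> a x y; rewrite /cst mpolyCD (linD tf_lin) mpolyCM tfM.
Qed.
Lemma cst1 : cst 1 = 1. Proof. by rewrite /cst mpolyC1; exact: rmorph1. Qed.
Let co (z : g) (k : 'I_(\dim (pol_u g))) : Fr := cst (coord (vbasis (pol_u g)) k z).
Let co_lin k : linear (co^~ k).
Proof. by move=> a x y; rewrite /co linearP; exact: cst_lin. Qed.
Let u_expand z : z \in pol_u g -> z = \sum_k coord (vbasis (pol_u g)) k z *: E k.
Proof. exact: coord_vbasis. Qed.
Let co_E (k l : 'I_(\dim (pol_u g))) : co (E k) l = (k == l)%:R.
Proof.
rewrite /co (coord_free k l (basis_free (vbasisP (pol_u g)))).
by case: eqP => _; rewrite ?cst1 //; exact: lin0 cst_lin.
Qed.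

(** The tensor sum of N_ij (x_i (x) y_j - y_j (x) x_i) in coordinates on u: [r_matrix] is written in
    a basis of u that need not be adapted to u_+ and u_-. *)
Let Q : 'M[Fr]_(\dim (pol_u g)) := \matrix_(k, l) \sum_i \sum_j
  Nmx i j * (co (xb i) k * co (yb j) l - co (yb j) k * co (xb i) l).
Let Q_anti k l : Q l k = - Q k l.
Proof.
rewrite !mxE -sumrN; apply: eq_bigr => i _; rewrite -sumrN; apply: eq_bigr => j _.
ring.
Qed.

(** Contraction of z with that tensor through the bracket. [RzE] says that it returns z, which
    characterizes the inverse of omega. *)
Let Rz (z : g) l := \sum_i \sum_j
  Nmx i j * (tf (sbr z (xb i)) * co (yb j) l - tf (sbr z (yb j)) * co (xb i) l).
Let Rz_lin l : linear (Rz^~ l).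
Proof.
have tl y : linear (fun z => tf (sbr z y)) by exact: lin_comp tf_lin (@sbr_linl F g y).
rewrite /Rz => a z z'; rewrite scaler_sumr -big_split; apply: eq_bigr => i _ /=.
rewrite scaler_sumr -big_split; apply: eq_bigr => j _ /=.
by rewrite !tl !frac_scaleE; ring.
Qed.
Let Rz_x i l : Rz (xb i) l = co (xb i) l.
Proof.
rewrite /Rz; transitivity (\sum_k (Nmx *m Mmx) k i * co (xb k) l).
  apply: eq_bigr => k _; rewrite [(Nmx *m Mmx) k i]mxE mulr_suml; apply: eq_bigr => j _.
  rewrite sbr_pp ?xb_mem // (lin0 tf_lin) mul0r sub0r [Mmx j i]mxE [sbr (yb j) _]sbr_anti.
  by rewrite (linN tf_lin); ring.
rewrite NM (bigD1 i) //= big1 => [|k ki]; rewrite mxE ?eqxx ?mul1r ?addr0 //.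
by rewrite (negPf ki) mul0r.
Qed.
Let Rz_y j l : Rz (yb j) l = co (yb j) l.
Proof.
rewrite /Rz exchange_big; transitivity (\sum_k (Mmx *m Nmx) j k * co (yb k) l).
  apply: eq_bigr => k _; rewrite [(Mmx *m Nmx) j k]mxE mulr_suml; apply: eq_bigr => i _.
  rewrite [sbr (yb j) (yb k)]sbr_mm ?yb_mem // (lin0 tf_lin) mul0r subr0 [Mmx j i]mxE.
  by rewrite mulrCA mulrA.
rewrite MN (bigD1 j) //= big1 => [|k ki]; rewrite mxE ?eqxx ?mul1r ?addr0 //.
by rewrite eq_sym (negPf ki) mul0r.
Qed.
Let RzE z l : z \in pol_u g -> Rz z l = co z l.
Proof.
move=> /memv_addP[x xp [y ym ->]]; have [c ->] := xb_span xp; have [c' ->] := yb_span ym.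
rewrite (linD (Rz_lin l)) (linD (co_lin l)) !(lin_sum (Rz_lin l)) !(lin_sum (co_lin l)).
congr (_ + _); apply: eq_bigr => i _; rewrite (linZ (Rz_lin l)) (linZ (co_lin l)).
  by rewrite Rz_x.
by rewrite Rz_y.
Qed.

Let W_expand k z : z \in pol_u g ->
  \sum_m omega_mx g k m * co z m = tf (sbr (E k) z).
Proof.
move=> zu; rewrite [in RHS](u_expand zu) (lin_sum (@sbr_linr F g _)) (lin_sum tf_lin).
apply: eq_bigr => m _; rewrite (linZ (@sbr_linr F g _)) (linZ tf_lin) frac_scaleE mulrC mxE.
by [].
Qed.
(** Row k is the contraction of the k-th basis vector of u, after expansion of x_i and y_j in that
    basis. *)
Let WQ : omega_mx g *m Q = 1%:M.
Proof.
apply/matrixP => k l; rewrite mxE [RHS]mxE -co_E -RzE; last first.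
  by rewrite vbasis_mem ?mem_nth ?size_tuple.
under eq_bigr => m _ do rewrite [Q _ _]mxE mulr_sumr.
rewrite exchange_big; apply: eq_bigr => i _ /=.
under eq_bigr => m _ do rewrite mulr_sumr.
rewrite exchange_big; apply: eq_bigr => j _ /=.
rewrite -(W_expand _ (pol_p_u (xb_mem i))) -(W_expand _ (pol_m_u (yb_mem j))).
rewrite !mulr_suml -sumrB mulr_sumr; apply: eq_bigr => m _; ring.
Qed.
(** By antisymmetry this is - Q, so the sign in [r_matrix] leaves Q itself. *)
Let omega_invE : omega_inv_mx g = Q^T.
Proof.
have [Wu _] := mulmx1_unit WQ.
have Qi := mulKmx Wu Q; rewrite WQ mulmx1 in Qi.
by rewrite /omega_inv_mx Qi -mulmxA WQ mulmx1.
Qed.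

Definition j_class : Uenv g ⊗ Uenv g ⊗ Fr :=
  \sum_i \sum_j (uinj (xb i) ⊗ uinj (yb j)) ⊗ Nmx i j.

Let tens_expand x y (f : Fr) : x \in pol_u g -> y \in pol_u g ->
  (uinj x ⊗ uinj y) ⊗ f =
    \sum_(k < \dim (pol_u g)) \sum_(l < \dim (pol_u g)) (uinj (E k) ⊗ uinj (E l)) ⊗ (co x k * co y l * f).
Proof.
move=> xu yu; rewrite [in LHS](u_expand xu) [in LHS](u_expand yu).
rewrite !(lin_sum (@uinj_lin F g)).
have tl (V : lmodType F) (W : lmodType F) (w : W) : linear (fun v : V => v ⊗ w).
  exact: (lin_tensl (f := id)).
have tr (V : lmodType F) (W : lmodType F) (v : V) : linear (fun w : W => v ⊗ w).
  exact: (lin_tensr (f := id)).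
rewrite (lin_sum (tl _ _ _)) (lin_sum (tl _ _ _)); apply: eq_bigr => k _.
rewrite (lin_sum (tr _ _ _)) (lin_sum (tl _ _ _)); apply: eq_bigr => l _.
rewrite !(linZ (@uinj_lin F g)) tensZl tensZr !tensZl -!tensZr !frac_scaleE mulrA.
by [].
Qed.

Lemma Alt_j_class : Alt j_class = r_matrix g.
Proof.
have tr (V : lmodType F) (W : lmodType F) (v : V) : linear (fun w : W => v ⊗ w).
  exact: (lin_tensr (f := id)).
have sb : @bilinear_map F (Uenv g) (Uenv g) (Uenv g ⊗ Uenv g)%type (fun v w => w ⊗ v).
  by split=> w; [exact: tr|exact: (lin_tensl (f := id))].
have al : linear (tmap (@tswap F (Uenv g) (Uenv g)) (@id Fr)).
  by apply: tmap_lin => //; exact: (tlift_lin sb).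
have -> : Alt j_class = \sum_i \sum_j ((uinj (xb i) ⊗ uinj (yb j)) ⊗ Nmx i j
    - (uinj (yb j) ⊗ uinj (xb i)) ⊗ Nmx i j).
  rewrite /Alt /j_class (lin_sum al) -sumrB; apply: eq_bigr => i _.
  rewrite (lin_sum al) -sumrB; apply: eq_bigr => j _.
  rewrite tmapE //; last exact: (tlift_lin sb).
  by rewrite /tswap tliftE.
have -> : r_matrix g = \sum_(k < \dim (pol_u g)) \sum_(l < \dim (pol_u g))
    (uinj (E k) ⊗ uinj (E l)) ⊗ Q k l.
  rewrite /r_matrix omega_invE -sumrN; apply: eq_bigr => k _; rewrite -sumrN.
  apply: eq_bigr => l _; rewrite [Q^T k l]mxE Q_anti.
  by rewrite (linN (tr _ _ _)) opprK.
transitivity (\sum_i \sum_j \sum_(k < \dim (pol_u g)) \sum_(l < \dim (pol_u g))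
    (uinj (E k) ⊗ uinj (E l)) ⊗
    (Nmx i j * (co (xb i) k * co (yb j) l - co (yb j) k * co (xb i) l))).
  apply: eq_bigr => i _; apply: eq_bigr => j _.
  have xu := pol_p_u (xb_mem i); have yu := pol_m_u (yb_mem j).
  rewrite (tens_expand _ xu yu) (tens_expand _ yu xu) -sumrB; apply: eq_bigr => k _.
  rewrite -sumrB; apply: eq_bigr => l _; rewrite -(linB (tr _ _ _)); congr (_ ⊗ _).
  ring.
under eq_bigr => i _ do rewrite exchange_big.
rewrite exchange_big; apply: eq_bigr => k _ /=.
under eq_bigr => i _ do rewrite exchange_big.
rewrite exchange_big; apply: eq_bigr => l _ /=.
rewrite [Q k l]mxE (lin_sum (tr _ _ _)); apply: eq_bigr => i _.
by rewrite (lin_sum (tr _ _ _)).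
Qed.
End RMatrix.

(** * Consequences of the symbol maps and of universality *)

Section Symbols.
Variables (F : fieldType) (g : polarLie F) (D : Uenv (Lie_l g)) (Uh : filtAlg F)
  (iota : Uenv (Lie_l g) -> Uh) (sigma : int -> Uh -> Frac g).
Hypotheses (D_lift : lift_of_D0' D) (Uh_micro : microlocalization D iota sigma).

Let sym : symbol_maps iota sigma. Proof. by case: Uh_micro. Qed.

Lemma symb0 k : sigma k 0 = 0.
Proof. by apply/(symb_ker sym); exact: fil0. Qed.
Lemma symbD k x y : fil k x -> fil k y -> sigma k (x + y) = sigma k x + sigma k y.
Proof. by move=> kx ky; have := symb_lin sym 1 kx ky; rewrite !scale1r. Qed.
Lemma symbN k x : fil k x -> sigma k (- x) = - sigma k x.
Proof.
move=> kx; have := symb_lin sym (-1) kx (fil0 Uh k).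
by rewrite symb0 !addr0 !scaleN1r.
Qed.
Lemma symb_sum k (I : Type) (r : seq I) (f : I -> Uh) : (forall i, fil k (f i)) ->
  sigma k (\sum_(i <- r) f i) = \sum_(i <- r) sigma k (f i).
Proof.
move=> kf; elim: r => [|i r IHr]; first by rewrite !big_nil symb0.
by rewrite !big_cons symbD ?IHr //; exact: fil_sum.
Qed.

(** In degree 0 equality of symbols is congruence modulo degree -1; thus matrices inverse over the
    fraction field lift to approximate inverses over Uh. *)
Lemma symb_sum_mul a b m (f h : 'I_m -> Uh) (e : bool) : (forall j, fil a (f j)) ->
  (forall j, fil b (h j)) -> a + b = 0 ->
  \sum_j sigma a (f j) * sigma b (h j) = e%:R -> fil (-1) (\sum_j f j * h j - e%:R).
Proof.
move=> fa hb ab E; have fh j : fil 0 (f j * h j) by rewrite -ab; exact: fil_mul.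
have e0 : fil 0 (e%:R : Uh) by case: (e); [exact: fil_one|exact: fil0].
have eE : sigma 0 e%:R = e%:R by case: (e); [exact: (symb_one sym)|exact: symb0].
have s0 : fil 0 (\sum_j f j * h j) by exact: fil_sum.
rewrite -[-1]sub0r; apply/(symb_ker sym); first exact: filB.
rewrite symbD ?symbN ?symb_sum ?eE //; last exact: filN.
rewrite -E -sumrB big1 // => j _; rewrite -ab (symb_mul sym (fa j) (hb j)).
exact: subrr.
Qed.

(** Symbols multiply in a commutative field, so the symbol of a commutator in degree [a + b]
    vanishes. *)
Lemma micro_comm a b (x y : Uh) : fil a x -> fil b y -> fil (a + b - 1) (x * y - y * x).
Proof.
move=> ax bY; have xy := fil_mul ax bY; have := fil_mul bY ax; rewrite addrC => yx.
apply/(symb_ker sym); first exact: filB.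
rewrite symbD ?symbN ?(symb_mul sym ax bY) //; last exact: filN.
by have := symb_mul sym bY ax; rewrite (addrC b a) => ->; rewrite mulrC addrN.
Qed.

(** The uniqueness half of universality for the restriction of [h] to U(l); [h] maps the inverse of
    D to the inverse that is required. *)
Lemma micro_uniq (B : filtAlg F) (h h' : Uh -> B) : complete B -> separated B ->
  filtered_morphism h -> filtered_morphism h' ->
  (forall x, h (iota x) = h' (iota x)) -> h =1 h'.
Proof.
case: Uh_micro => _ _ il im _ ifil [e [fe eD De]] _ univ cB sB hh hh' hE.
have [hl [h1 hM] hf] := hh.
have [//|//|||h0 [_ u]] := univ B (fun x => h (iota x)).
- split; first exact: lin_comp.
    by split=> [|x y]; rewrite ?im.1 ?im.2.
  by move=> k x kx; apply: hf; apply/ifil.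
- by exists (h e); split; [exact: hf|rewrite -hM eD|rewrite -hM De].
have E : h0 = h by apply: u.
have E' : h0 = h' by apply: u; split=> // x; rewrite hE.
by rewrite -E E'.
Qed.

(** Otherwise D would have degree d' - 1; its inverse has degree -d', so 1 would have degree -1 and
    symbol 0. *)
Lemma D0'_neq0 : D0' g != 0.
Proof.
case: Uh_micro => _ _ _ _ _ ifil [e [fe eD _]] _ _.
apply/eqP => D0; case: D_lift => _; rewrite D0 /pbw msupp0 big_nil subr0 => /ifil Df.
have := fil_mul fe Df; rewrite eD addrA addNr sub0r => h.
have /(symb_ker sym (fil_one Uh)) : fil (0 - 1) (1 : Uh) by rewrite sub0r.
by rewrite (symb_one sym) => /eqP; rewrite oner_eq0.
Qed.
End Symbols.

Theorem corollary2p6 (R : realType) (g : polarLie R[i])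
  (g_nondeg : nondegenerate_pol g)
  (D : Uenv (Lie_l g)) (D_lift : lift_of_D0' D)
  (Uh : filtAlg R[i]) (iota : Uenv (Lie_l g) -> Uh) (sigma : int -> Uh -> Frac g)
  (Uh_micro : microlocalization D iota sigma)
  (Dl : Uh -> compl (rtens (Uenv (Lie_l g)) Uh)) (Dl_ext : coproduct_l iota Dl)
  (Dr : Uh -> compl (ltens Uh (Uenv (Lie_l g)))) (Dr_ext : coproduct_r iota Dr)
  (Sh : Uh -> Uh) (Sh_ext : antipode_ext iota Sh)
  (H : Uenv g -> Uenv (Lie_l g)) (H_hc : harish_chandra H)
  (K : compl (rtens (Uenv (Lie_p g) ⊗ Uenv (Lie_m g)) Uh))
  (K_canonical : canonical_element iota H K) :
  quantization iota sigma Dl (r_matrix g) (J_elt Sh Dr K).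
Proof.
have char0 k : k.+1%:R != 0 :> R[i] by rewrite pnatr_eq0.
have D0 := D0'_neq0 D_lift Uh_micro.
have dimm : \dim (pol_m g) = dprime g.
  by apply/eqP; rewrite eqn_leq dim_m_le_dprime // dprime_le_dim_m.
have Uh_comm := micro_comm Uh_micro; have Uh_uniq := micro_uniq Uh_micro.
have [Uh_complete Uh_separated iota_lin iota_mor _ ifil _ sym _] := Uh_micro.
have iota_fil k x : ufil k x -> fil k (iota x) by move=> /ifil.
(* Any lifts of the entries of the inverse matrix will do: only their degrees and symbols are
   used. *)
have nP i j := symb_onto sym (N_Sloc D0 i j).
pose n i j := s2val (cid2 (nP i j)).
have n_fil i j : fil (-1) (n i j) by rewrite /n; case: cid2.
have nE i j : sigma (-1) (n i j) = Nmx g i j by rewrite /n; case: cid2.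
have m_fil j k : fil 1 (mpair iota (ys j) (xs k)) by apply: iota_fil; exact: ufil_inj.
have mE j k : sigma 1 (mpair iota (ys j) (xs k)) = Mmx g j k.
  by rewrite (Mmx_br dimm); exact: (symb_inj sym).
have nm i k : fil (-1) (\sum_j n i j * mpair iota (ys j) (xs k) - (i == k)%:R).
  apply: (symb_sum_mul Uh_micro (n_fil i) (fun j => m_fil j k)); first by rewrite addNr.
  by rewrite -(NM_sum D0); apply: eq_bigr => j _; rewrite nE mE.
have mn j k : fil (-1) (\sum_i mpair iota (ys j) (xs i) * n i k - (j == k)%:R).
  apply: (symb_sum_mul Uh_micro (m_fil j) (fun i => n_fil i k)); first by rewrite addrN.
  by rewrite -(MN_sum D0); apply: eq_bigr => i _; rewrite nE mE.
have xsp := @xs_span _ g; have ysp := ys_span dimm.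
have -> : J_elt Sh Dr K = J_ext Dr Sh K by eapply J_eltE; eassumption.
have Jt : fil (-2) (J_ext Dr Sh K - 1 - cin (\sum_i \sum_j
    (uinj (vsval (xs i)) ⊗ uinj (vsval (ys j))) ⊗ n i j : rtens (Uenv g ⊗ Uenv g) Uh) :
    compl (rtens (Uenv g ⊗ Uenv g) Uh)).
  eapply J_top; eassumption.
have Jc : J_12_3_4 (J_ext Dr Sh K) * J_1_2_34 Dl (J_ext Dr Sh K) =
    J_1_23_4 (J_ext Dr Sh K) * J_2_3_4 (J_ext Dr Sh K).
  eapply cocycle; eassumption.
have J1 : fil (-1) (J_ext Dr Sh K - 1) by eapply J_fil1; eassumption.
have J0 : fil 0 (J_ext Dr Sh K).
  by rewrite -[J_ext _ _ _](subrK 1); apply: filD; [apply: fil_mono J1|exact: fil_one].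
have Jcom x : Xl iota x * J_ext Dr Sh K = J_ext Dr Sh K * Xl iota x.
  eapply J_com; eassumption.
split=> //.
- move=> x X; have -> : cin X = Xl iota x by rewrite /X cinD.
  exact: Jcom.
exists (j_class g); last exact: Alt_j_class.
pose s := [seq ((uinj (xb p.1) ⊗ uinj (yb p.2)), n p.1 p.2)
  | p <- enum ({: 'I_(dprime g) * 'I_(dprime g)})].
exists s; split; first by move=> _ /mapP[p _ ->]; exact: n_fil.
- rewrite (_ : \sum_(p <- s) p.1 ⊗ p.2 = \sum_i \sum_j
    (uinj (vsval (xs i)) ⊗ uinj (vsval (ys j))) ⊗ n i j); first exact: Jt.
  rewrite big_map big_enum -(pair_bigA _ (fun i j => (uinj (xb i) ⊗ uinj (yb j)) ⊗ n i j)) /=.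
  by apply: eq_bigr => i _; apply: eq_bigr => j _; rewrite xsE ysE.
rewrite big_map big_enum /j_class (pair_bigA _ (fun i j => (uinj (xb i) ⊗ uinj (yb j)) ⊗ Nmx g i j)) /=.
by apply: eq_bigr => p _; rewrite nE.
Qed.
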